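(* Let $(X_t)_{t\ge 0}$ be a regular jump Lévy process in $\mathbf{R}^d$ and let $V$ be a confining $X$-Kato class potential with Feynman--Kac semigroup $\{T_t: t\ge0\}$ (all terms as defined in the context). (1) If $\displaystyle\lim_{|x|\to\infty}\frac{V(x)}{|\log\nu(x)|}=\infty$, then $\{T_t: t\ge0\}$ is GSD. (2) If $\{T_t: t\ge0\}$ is GSD, then for every $\varepsilon\in(0,1]$, $$\lim_{|x|\to\infty}\frac{\sup_{y\in B(x,\varepsilon)}V(y)}{|\log\nu(x)|}=\infty.$$
   Context: Conventions. $(X_t)_{t\ge0}$ is a Lévy process in $\mathbf{R}^d$, $d\ge1$; $\mathbf{P}^x,\mathbf{E}^x$ refer to the process started at $x$. $B(x,r)$ is the open ball; $\mathbf{1}$ is the function identically $1$. $C, C_i$ denote positive constants; $C(X,a,\dots)$ depends only on the process (and the dimension $d$) and on the listed parameters. $f\asymp Cg$ means $C^{-1}g\le f\le Cg$. Regular jump Lévy process: a Lévy process satisfying (A1)--(A3). (A1) $(X_t)$ is symmetric, its Lévy measure is absolutely continuous with a strictly positive density $\nu$, and: (1) for every $0<r\le 1/2$ there is $C_1=C_1(X,r)\ge1$ with $\nu(x)\asymp C_1\nu(y)$ for $r\le|y|\le|x|\le|y|+1$; (2) there is $C_2=C_2(X)\ge1$ with $\nu(x)\le C_2\nu(y)$ for $1/2\le|y|\le|x|$; (3) there is $C_3=C_3(X)\ge1$ with $\int_{|z-x|>1/2,\,|z-y|>1/2}\nu(x-z)\nu(z-y)\,dz\le C_3\nu(x-y)$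 for $|y-x|\ge1$. (A2) $(X_t)$ is strong Feller, equivalently it has transition densities $p(t,x,y)=p(t,y-x)$ for $t>0$; moreover there are $t_b>0$ and a constant $C(X,t_b)$ with $0<p(t_b,x)\le C(X,t_b)$ for all $x\in\mathbf{R}^d$. (A3) For all $0<p<q<R\le1$, $\sup_{x\in B(0,p)}\sup_{y\in B(0,q)^c}G_{B(0,R)}(x,y)<\infty$, where for a bounded open set $D$, $G_D(x,y)=\int_0^\infty p_D(t,x,y)\,dt$ for $x,y\in D$ (and $0$ otherwise), and $p_D$ is the transition density of the process killed upon exiting $D$. Potentials. A Borel function $V:\mathbf{R}^d\to\mathbf{R}$ belongs to $\mathcal{K}^X$ if $\lim_{t\to0}\sup_x\mathbf{E}^x[\int_0^t|V(X_s)|ds]=0$, and to $\mathcal{K}^X_{\mathrm{loc}}$ if $V\mathbf{1}_B\in\mathcal{K}^X$ for every ball $B$. $V$ is an $X$-Kato class potential if $V_-\in\mathcal{K}^X$ and $V_+\in\mathcal{K}^X_{\mathrm{loc}}$. It is confining if also $V(x)\to\infty$ as $|x|\to\infty$. Feynman--Kac semigroup: $T_tf(x)=\mathbf{E}^x[e^{-\int_0^tV(X_s)ds}f(X_t)]$, $t>0$. Whenever $(X_t)$ is a regular jump Lévy process and $V$ is a confining $X$-Kato class potential, $\{T_t\}$ is a strongly continuous semigroup of symmetric compact operators on $L^2(\mathbf{R}^d)$; there is an orthonormal basis $\{\varphi_n\}_{n\ge0}$ of $L^2(\mathbf{R}^d)$ with $T_t\varphi_n=e^{-\lambda_nt}\varphi_n$,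 where $\lambda_0<\lambda_1\le\lambda_2\le\cdots\to\infty$; each $\varphi_n$ is bounded and continuous, and the ground state $\varphi_0$ is chosen strictly positive. GSD (ground state domination): for every $t>0$ there is a constant $C_{12}=C_{12}(X,V,t)$ with $T_t\mathbf{1}(x)\le C_{12}\varphi_0(x)$ for all $x\in\mathbf{R}^d$. *)

(* Defs.v *)
From HB Require Import structures.
From mathcomp Require Import all_boot all_order all_algebra.
From mathcomp Require Import all_classical all_reals all_analysis measurable_realfun.

Set Implicit Arguments.
Unset Strict Implicit.
Unset Printing Implicit Defensive.
Import Order.TTheory GRing.Theory Num.Theory.
Import numFieldNormedType.Exports.

Local Open Scope classical_set_scope.
Local Open Scope ring_scope.

(** R^d is ['rV[R]_d].  The library norm on row vectors is the maximum norm; it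
    induces the usual topology, but [|x|] and [B(x,r)] below are Euclidean. *)

Definition dotv (R : realType) (d : nat) (x y : 'rV[R]_d) : R :=
  \sum_(i < d) x 0 i * y 0 i.

Definition enorm (R : realType) (d : nat) (x : 'rV[R]_d) : R :=
  Num.sqrt (dotv x x).

Definition eball (R : realType) (d : nat) (c : 'rV[R]_d) (r : R) : set 'rV[R]_d :=
  [set y | enorm (y - c) < r].

Definition at_infinity (R : realType) (d : nat) : set_system 'rV[R]_d :=
  filter_from [set: R] (fun r => [set x | r < enorm x]).
Arguments at_infinity : clear implicits.

Global Instance at_infinity_filter (R : realType) (d : nat) :
  Filter (at_infinity R d).
Proof.
apply: filter_from_filter; first by exists 0.
move=> r s _ _; exists (Num.max r s) => // x /=.
by rewrite gt_max => /andP[].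
Qed.

Definition rV_display : measure_display.
Proof. exact: default_measure_display. Qed.

Section rV_borel.
Variables (R : realType) (d : nat).

Let borel : set (set 'rV[R]_d) := <<s [set U : set 'rV[R]_d | open U] >>.

Let borel0 : borel set0. Proof. exact: sigma_algebra0. Qed.
Let borelC A : borel A -> borel (~` A). Proof. exact: sigma_algebraC. Qed.
Let borel_bigcup (F : (set 'rV[R]_d)^nat) :
  (forall i, borel (F i)) -> borel (\bigcup_i F i).
Proof. exact: sigma_algebra_bigcup. Qed.

HB.instance Definition _ := @isMeasurable.Build rV_display
  'rV[R]_d borel borel0 borelC borel_bigcup.

End rV_borel.

Lemma measurable_fun_rV d (T : measurableType d) (R : realType) n
    (f : T -> 'rV[R]_n) :
  (forall i, measurable_fun setT (fun x => f x 0 i)) -> measurable_fun setT f.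
Proof.
move=> mf; apply: (measurability [set U : set 'rV[R]_n | open U]) => //.
move=> _ [U oU <-]; rewrite setTI.
pose F (q : 'rV[rat]_n * nat) : set T :=
  if `[< ball (map_mx ratr q.1 : 'rV[R]_n) (q.2.+1%:R^-1) `<=` U >]
  then \bigcap_(i in [set: 'I_n])
     ((fun x => f x 0 i) @^-1` ball (ratr (q.1 0 i) : R) (q.2.+1%:R^-1))
  else set0.
have -> : f @^-1` U = \bigcup_q F q.
  apply/seteqP; split => [x Ux|x [q _]]; last first.
    rewrite /F; case: asboolP => // qU qx; apply: qU.
    by split => // i j; rewrite mxE ord1; exact: qx.
  have /nbhs_ballP[e /= e0 xU] : nbhs (f x) U by exact: open_nbhs_nbhs.
  have [k ke] : exists k, (k.+1%:R^-1 : R) < e / 2.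
    have e20 : 0 < e / 2 by rewrite divr_gt0.
    have := near_infty_natSinv_lt (PosNum e20).
    by case=> k _ /(_ k (leqnn k)) /= h; exists k.
  have k0 : (0 : R) < k.+1%:R^-1 by rewrite invr_gt0.
  have /choice[q qx] : forall i, exists q : rat,
      ball (ratr q : R) (k.+1%:R^-1) (f x 0 i).
    move=> i; have /rat_in_itvoo[q qi] :
      f x 0 i - k.+1%:R^-1 < f x 0 i + k.+1%:R^-1.
      by rewrite ltrD2l gtrN.
    exists q; apply: ball_sym; rewrite /ball /=.
    by move: qi; rewrite in_itv /= => /andP[a b]; rewrite ltr_distlC a b.
  exists (\row_i q i, k) => //; rewrite /F; case: asboolP => [_ i _|].
    by rewrite /= mxE; exact: qx.
  case=> y [_ qy]; apply: xU; split => // i j.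
  have := qy i j; rewrite !mxE ord1 => /= qyj.
  rewrite (splitr e); apply: (@ball_triangle _ _ (ratr (q j) : R)).
    by apply: (le_ball (ltW ke)); apply: ball_sym; exact: qx.
  exact: (le_ball (ltW ke)).
apply: countable_bigcupT_measurable => // -[q k]; rewrite /F /=.
case: asboolP => // _; rewrite -[X in measurable X]setCK setC_bigcap.
apply: measurableC; apply: countable_bigcupT_measurable => // i.
apply: measurableC; rewrite -[X in measurable X]setTI; apply: mf => //.
exact: measurable_ball.
Qed.

Lemma measurable_coord (R : realType) n (i : 'I_n) :
  measurable_fun setT (fun x : 'rV[R]_n => x 0 i).
Proof.
apply: (measurability _ (RGenOInfty.measurableE R)).
move=> _ [_ [r ->] <-]; rewrite setTI; apply: sub_sigma_algebra => /=.
rewrite openE => x /=; rewrite in_itv /= andbT => rx.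
apply/nbhs_ballP; exists (x 0 i - r) => /=; first by rewrite subr_gt0.
move=> y [_ /(_ 0 i)]; rewrite /ball /= in_itv /= andbT.
by rewrite ltr_distlC => /andP[]; rewrite subKr.
Qed.

Section lebesgue_rV.
Variable R : realType.

Definition rV_cons (n : nat) (z : measurableTypeR R * 'rV[R]_n) : 'rV[R]_n.+1 :=
  \row_i oapp (z.2 0) z.1 (unlift ord0 i).

Definition rV_uncons (n : nat) (v : 'rV[R]_n.+1) : measurableTypeR R * 'rV[R]_n :=
  (v 0 ord0, \row_i v 0 (lift ord0 i)).

Lemma rV_unconsK n : cancel (@rV_uncons n) (@rV_cons n).
Proof.
move=> v; apply/rowP => i; rewrite !mxE.
by case: unliftP => [j|] -> //=; rewrite mxE.
Qed.

Lemma rV_consK n : cancel (@rV_cons n) (@rV_uncons n).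
Proof.
case=> x v; rewrite /rV_uncons mxE unlift_none /=; congr pair.
by apply/rowP => i; rewrite !mxE liftK.
Qed.

Lemma measurable_rV_cons n : measurable_fun setT (@rV_cons n).
Proof.
apply: measurable_fun_rV => i; case: (unliftP ord0 i) => [j ij|i0].
  have -> : (fun z => rV_cons z 0 i) = (fun x : 'rV[R]_n => x 0 j) \o snd.
    by apply/funext => z; rewrite mxE ij liftK.
  by apply: measurableT_comp => //; exact: measurable_coord.
have -> : (fun z => rV_cons z 0 i) = fst :> (measurableTypeR R * 'rV[R]_n -> R).
  by apply/funext => z; rewrite mxE i0 unlift_none.
exact: measurable_fst.
Qed.

Lemma measurable_rV_uncons n : measurable_fun setT (@rV_uncons n).
Proof.
apply/measurable_fun_pairP; split => /=; first exact: measurable_coord.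
apply: measurable_fun_rV => i.
under eq_fun do rewrite /= mxE.
exact: measurable_coord.
Qed.

Section step.
Variables (n : nat) (mu : {sigma_finite_measure set 'rV[R]_n -> \bar R}).

Let prod : {measure set (measurableTypeR R * 'rV[R]_n)%type -> \bar R} :=
  (lebesgue_measure \x mu)%E.

Definition lebesgue_step : set 'rV[R]_n.+1 -> \bar R :=
  pushforward (lebesgue_measure \x mu)%E (@rV_cons n).

Let prod_sigma_finite : sigma_finite setT prod.
Proof.
have /sigma_finiteP[F [TF ndF Foo]] := sigma_finiteT (@lebesgue_measure R).
have /sigma_finiteP[G [TG ndG Goo]] := sigma_finiteT mu.
exists (fun k => F k `*` G k).
  rewrite -setXTT TF TG predeqE => -[x y]; split.
    move=> [/= [k _ Fkx] [l _ Gly]]; exists (maxn k l) => //; split.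
      by move: x Fkx; exact/subsetPset/ndF/leq_maxl.
    by move: y Gly; exact/subsetPset/ndG/leq_maxr.
  by move=> [k _ []/= ? ?]; split; exists k.
move=> k; have [? ?] := Foo k; have [? ?] := Goo k.
split; first exact: measurableX.
by rewrite /prod/= product_measure1E// lte_mul_pinfty// ge0_fin_numE.
Qed.

Let push : {measure set 'rV[R]_n.+1 -> \bar R} :=
  measure_function_pushforward__canonical__measure_function_Measure prod
    (@measurable_rV_cons n).

Let step0 : lebesgue_step set0 = 0%E. Proof. exact: (measure0 push). Qed.
Let step_ge0 A : (0 <= lebesgue_step A)%E. Proof. exact: (measure_ge0 push). Qed.
Let step_sigma : semi_sigma_additive lebesgue_step.
Proof. exact: (@measure_semi_sigma_additive _ _ _ push). Qed.

HB.instance Definition _ :=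
  isMeasure.Build _ _ _ lebesgue_step step0 step_ge0 step_sigma.

Lemma lebesgue_step_sigma_finite : sigma_finite setT lebesgue_step.
Proof.
have [F FT Foo] := prod_sigma_finite.
exists (fun k => @rV_uncons n @^-1` F k).
  by rewrite -preimage_bigcup -FT.
move=> k; have [mF Fk] := Foo k; split.
  by rewrite -[X in measurable X]setTI; exact: measurable_rV_uncons.
rewrite /lebesgue_step /pushforward -comp_preimage.
rewrite (_ : _ @^-1` F k = F k)//.
by apply/seteqP; split=> z /=; rewrite rV_consK.
Qed.

HB.instance Definition _ :=
  Measure_isSigmaFinite.Build _ _ _ lebesgue_step lebesgue_step_sigma_finite.

End step.

Fixpoint lebesgue_rV (d : nat) : {sigma_finite_measure set 'rV[R]_d -> \bar R} :=
  match d with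
  | 0 => dirac (0 : 'rV[R]_0)
  | n.+1 => lebesgue_step (lebesgue_rV n)
  end.

End lebesgue_rV.
Arguments lebesgue_rV : clear implicits.

Lemma measurable_rV_box (R : realType) (d : nat) (A : 'I_d -> set R) :
  (forall i, measurable (A i)) ->
  measurable [set x : 'rV[R]_d | forall i, A i (x 0 i)].
Proof.
move=> mA; rewrite (_ : [set _ | _] =
  ~` \bigcup_(i in [set: 'I_d]) ~` ((fun x : 'rV[R]_d => x 0 i) @^-1` A i)).
  apply: measurableC; apply: countable_bigcupT_measurable => // i.
  apply: measurableC; rewrite -[X in measurable X]setTI.
  exact: measurable_coord.
rewrite setC_bigcup; apply/seteqP; split => x /= Ax i; last first.
  by have := Ax i I; rewrite setCK.
by move=> _; rewrite setCK; exact: Ax.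
Qed.

Lemma lebesgue_rV_box (R : realType) (d : nat) (A : 'I_d -> set R) :
  (forall i, measurable (A i)) ->
  lebesgue_rV R d [set x | forall i, A i (x 0 i)] =
  (\prod_(i < d) lebesgue_measure (A i))%E.
Proof.
elim: d A => [|d IHd] A mA.
  by rewrite big_ord0 /= diracE mem_set// => -[].
have mB := @measurable_rV_box R d (A \o lift ord0) (fun i => mA (lift ord0 i)).
rewrite big_ord_recl -IHd//=.
rewrite /lebesgue_step /pushforward (_ : _ @^-1` _ =
  A ord0 `*` [set x : 'rV[R]_d | forall i, A (lift ord0 i) (x 0 i)]).
  by rewrite product_measure1E; [|exact: mA|exact: mB].
apply/seteqP; split => -[x v] /=.
  move=> xA; split; first by have := xA ord0; rewrite mxE unlift_none.
  by move=> i; have := xA (lift ord0 i); rewrite mxE liftK.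
move=> [Ax Av] i; rewrite mxE.
by case: unliftP => [j|] ->.
Qed.

(** A process is a map [X : R -> Omega -> 'rV[R]_d], of which only the times
    [t >= 0] matter.  It starts at the origin under [P]; the process started at
    [x] is [x + X], so that [E^x[F(X)]] is [E[F(x + X)]]. *)

Section levy.
Variables (R : realType) (d : nat).
Local Notation E := 'rV[R]_d.
Local Notation leb := (lebesgue_rV R d).

Section process.
Variables (dOmega : measure_display) (Omega : measurableType dOmega).
Variables (P : probability Omega R) (X : R -> Omega -> E).

Record levy_process : Prop := LevyProcess {
  levy_measurable : forall t, 0 <= t -> measurable_fun setT (X t) ;
  levy_start : {ae P, forall w, X 0 w = 0} ;
  levy_independent_increments :
    forall (n : nat) (t : nat -> R) (A : nat -> set E),
      0 <= t 0%N -> (forall i, t i <= t i.+1) -> (forall i, measurable (A i)) ->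
      P (\bigcap_(i in `I_n) [set w | A i (X (t i.+1) w - X (t i) w)]) =
      (\prod_(i < n) P [set w | A i (X (t i.+1) w - X (t i) w)%R])%E ;
  levy_stationary_increments :
    forall (s t : R) (A : set E), 0 <= s -> 0 <= t -> measurable A ->
      P [set w | A (X (s + t) w - X s w)] = P [set w | A (X t w)] ;
  levy_cadlag : {ae P, forall w, forall t, 0 <= t ->
    X s w @[s --> t^'+] --> X t w /\ (0 < t -> cvg (X s w @[s --> t^'-]))} }.

Definition symmetric_process : Prop :=
  forall t (A : set E), 0 <= t -> measurable A ->
    P [set w | A (X t w)] = P [set w | A (- X t w)].

(** [N] is the Lévy measure of [X]: the Lévy-Khintchine formula
      E[exp(i xi.X_t)] = exp(- t (a(xi) - i c(xi))),
      a(xi) = xi.Q xi / 2 + int (1 - cos(xi.y)) N(dy),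
      c(xi) = b.xi + int (sin(xi.y) - xi.y 1_{|y| <= 1}) N(dy),
    holds for some drift [b] and Gaussian covariance [Q]; it is split into its
    real and imaginary parts. *)
Definition levy_khintchine (b : E) (Q : 'M[R]_d) (N : {measure set E -> \bar R})
    : Prop :=
  forall (t : R) (xi : E), 0 <= t ->
    let a := dotv xi (xi *m Q) / 2 +
             (\int[N]_y (1 - cos (dotv xi y)))%R in
    let c := dotv b xi +
      (\int[N]_y (sin (dotv xi y) - dotv xi y * \1_[set u | enorm u <= 1] y))%R in
    (\int[P]_w (cos (dotv xi (X t w))))%R = expR (- (t * a)) * cos (t * c) /\
    (\int[P]_w (sin (dotv xi (X t w))))%R = expR (- (t * a)) * sin (t * c).

Definition levy_measure (N : {measure set E -> \bar R}) : Prop :=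
  [/\ N [set 0] = 0%E,
      (\int[N]_y (Num.min 1 (enorm y ^+ 2))%:E < +oo)%E &
      exists (b : E) (Q : 'M[R]_d),
        [/\ Q^T = Q, (forall xi : E, 0 <= dotv xi (xi *m Q)) &
            levy_khintchine b Q N]].

Definition strong_feller : Prop :=
  forall (t : R) (f : E -> R), 0 < t ->
    measurable_fun setT f -> bounded_fun (f : E -> R^o) ->
    continuous (fun x : E => (\int[P]_w f (x + X t w))%R).

(** p(t, x, y) = p(t, y - x) *)
Definition transition_density (p : R -> E -> R) : Prop :=
  forall t, 0 < t ->
    [/\ (forall y, 0 <= p t y), measurable_fun setT (p t) &
        forall A : set E, measurable A ->
          P [set w | A (X t w)] = (\int[leb]_(y in A) (p t y)%:E)%E].

Definition exit_time (D : set E) (path : R -> E) : \bar R :=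
  ereal_inf [set s%:E | s in [set s : R | 0 <= s /\ ~ D (path s)]].

(** The event [t < exit_time] need only be measurable for the completion of [P]
    (it is a projection), hence the integral of its indicator, which is insensitive
    to this, and not its value under [P].  Joint measurability makes the Green
    function below meaningful. *)
Definition killed_density (D : set E) (q : R -> E -> E -> R) : Prop :=
  [/\ (forall t x y, 0 <= q t x y),
      measurable_fun setT (fun z : R * E * E => q z.1.1 z.1.2 z.2) &
      forall (t : R) (x : E) (A : set E), 0 < t -> D x ->
        measurable A -> A `<=` D ->
        (\int[P]_w (\1_[set w | (t%:E < exit_time D (fun s => x + X s w)%R)%E /\
                               A (x + X t w)%R] w)%:E =
         \int[leb]_(y in A) (q t x y)%:E)%E].

Definition green (D : set E) (q : R -> E -> E -> R) (x y : E) : \bar R :=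
  if (x \in D) && (y \in D)
  then (\int[lebesgue_measure]_(t in `]0%R, +oo[) (q t x y)%:E)%E else 0%E.

(** [nu] is a density on R^d minus the origin: its value at 0 is irrelevant. *)
Record regular_A1 (nu : E -> R) : Prop := RegularA1 {
  A1_symmetric : symmetric_process ;
  A1_measurable : measurable_fun setT nu ;
  A1_positive : forall x, x != 0 -> 0 < nu x ;
  A1_density : exists2 N : {measure set E -> \bar R}, levy_measure N &
    forall A : set E, measurable A -> N A = (\int[leb]_(y in A) (nu y)%:E)%E ;
  A1_1 : forall r : R, 0 < r <= 1 / 2 -> exists2 C : R, 1 <= C &
    forall x y, r <= enorm y -> enorm y <= enorm x -> enorm x <= enorm y + 1 ->
      C^-1 * nu y <= nu x <= C * nu y ;
  A1_2 : exists2 C : R, 1 <= C &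
    forall x y, 1 / 2 <= enorm y -> enorm y <= enorm x -> nu x <= C * nu y ;
  A1_3 : exists2 C : R, 1 <= C &
    forall x y, 1 <= enorm (y - x) ->
      (\int[leb]_(z in [set z | (1 / 2 < enorm (z - x))%R /\
                                (1 / 2 < enorm (z - y))%R])
         (nu (x - z)%R * nu (z - y)%R)%:E <= (C * nu (x - y)%R)%:E)%E }.

Definition regular_A2 : Prop :=
  strong_feller /\
  exists2 p, transition_density p &
    exists tb C : R, [/\ 0 < tb, 0 < C & forall x, 0 < p tb x <= C].

(** A killed density is determined up to null sets only, so the pointwise bound is
    required of some version. *)
Definition regular_A3 : Prop :=
  exists2 q : set E -> R -> E -> E -> R,
    (forall D, open D -> bounded_set D -> killed_density D (q D)) &
    forall p1 p2 r : R, 0 < p1 -> p1 < p2 -> p2 < r -> r <= 1 ->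
      (ereal_sup [set green (eball 0 r) (q (eball 0 r)) x y |
                  x in eball 0 p1 & y in ~` eball 0 p2] < +oo)%E.

Definition regular_jump_levy (nu : E -> R) : Prop :=
  [/\ levy_process, regular_A1 nu, regular_A2 & regular_A3].

Definition kato (V : E -> R) : Prop :=
  measurable_fun setT V /\
  ereal_sup (range (fun x : E =>
    \int[P]_w \int[lebesgue_measure]_(s in `[0%R, t]) `|(V (x + X s w)%R)%:E|))%E
  @[t --> 0^'+] --> 0%E.

Definition kato_loc (V : E -> R) : Prop :=
  forall c r, 0 < r -> kato (fun x : E => V x * \1_(eball c r) x).

Definition kato_potential (V : E -> R) : Prop :=
  [/\ measurable_fun setT V, kato (V^\-) & kato_loc (V^\+)].

Definition confining_potential (V : E -> R) : Prop :=
  kato_potential V /\ V x @[x --> at_infinity R d] --> +oo.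

Definition feynman_kac (V : E -> R) (t : R) (f : E -> R) (x : E) : \bar R :=
  (\int[P]_w (expeR (- \int[lebesgue_measure]_(s in `[0%R, t])
                         (V (x + X s w)%R)%:E) * (f (x + X t w)%R)%:E))%E.

Definition l2dot (f g : E -> R) : R := (\int[leb]_x (f x * g x))%R.

Definition l2_orthonormal_basis (phi : nat -> E -> R) : Prop :=
  [/\ (forall n, phi n \in Lfun leb 2%:E),
      (forall m n, l2dot (phi m) (phi n) = (m == n)%:R) &
      forall f, f \in Lfun leb 2%:E ->
        ('N[leb]_(2%:E)[(fun x =>
          (f x - \sum_(k < n) l2dot f (phi k) * phi k x)%:E)])%E @[n --> \oo] --> 0%E].

(** The eigenvalue equation is an identity in L^2, hence almost everywhere. *)
Record feynman_kac_eigenbasis (V : E -> R) (phi : nat -> E -> R) (lam : nat -> R)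
    : Prop := FeynmanKacEigenbasis {
  eigen_basis : l2_orthonormal_basis phi ;
  eigen_eq : forall n t, 0 < t ->
    {ae leb, forall x,
      feynman_kac V t (phi n) x = (expR (- (lam n * t)) * phi n x)%:E} ;
  eigen_gap : lam 0%N < lam 1%N ;
  eigen_mono : forall n, lam n.+1 <= lam n.+2 ;
  eigen_oo : lam n @[n --> \oo] --> +oo ;
  eigen_bounded : forall n, bounded_fun (phi n : E -> R^o) ;
  eigen_continuous : forall n, continuous (phi n) ;
  ground_state_gt0 : forall x, 0 < phi 0%N x }.

Definition GSD (V phi0 : E -> R) : Prop :=
  forall t, 0 < t -> exists2 C : R, 0 < C &
    forall x, (feynman_kac V t (cst 1%R) x <= (C * phi0 x)%:E)%E.

End process.
End levy.

(* Main.v *)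
(** Let [T] be the Feynman-Kac semigroup, [T+] the semigroup killed at rate [V+] only, [P] the
    free one, and [g] a bounded positive function comparable to [nu] at infinity.  An infimal
    convolution of [nu] with hyperbolic cosines gives a [g] with a multiplicative bound on its
    second differences; with (A1)(3) for the large jumps and a Gronwall argument this yields
    [P_t g <= exp (C t) g].

    A function that is excessive for a killed semigroup and bounded below near a ball
    dominates, up to a constant, the potential of every charge supported in that ball with
    bounded potential: such a charge is only collected after the ball has been hit.

    (1) If [V] grows faster than [|log nu|], then [exp (- s V+) <= C g], so Jensen's inequality
    gives [T+_s 1 <= C g].  A bump function [rho] on the unit ball satisfies
    [P_h rho >= c h g] far away for small [h], because a single jump reaches the ball.  Comparing
    [P_h rho] with [T+_h rho] by Duhamel's formula and letting [h -> 0] bounds the potential of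
    [g] under [T+] by the ground state: killing inside the ball is handled by the hitting
    principle and killing outside it costs [O(h)].  Hence [T+_t 1 <= C phi0], and creation by
    [V-], whose support is bounded, is again handled by the hitting principle.

    (2) Since [V >= lambda + 1] outside a ball, [phi0 <= C (exp (- t) + exp (Gamma t) g)] for
    all [t > 0], which optimizes to [phi0 <= C nu ^ theta].  If [V <= A |log nu(x)|] on
    [B(x, eps)], then [T_t 1 (x) >= nu(x) ^ (t A) / 2] for small [t]; when [t A < theta] this is
    incompatible with [T_t 1 <= C phi0] far away. *)
Require Import Defs.
From HB Require Import structures.
From mathcomp Require Import all_boot all_order all_algebra.
From mathcomp Require Import all_classical all_reals all_analysis measurable_realfun.
From mathcomp Require Import ring lra.

Set Implicit Arguments.
Unset Strict Implicit.
Unset Printing Implicit Defensive.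
Import Order.TTheory GRing.Theory Num.Theory.
Import numFieldNormedType.Exports.

Local Open Scope classical_set_scope.
Local Open Scope ring_scope.

(** * Independence on path space *)

(** The hypotheses control [X] time by time: measurability holds for each fixed time and path
    regularity only almost surely. Time integrals of [V] along paths are therefore taken on a
    version rebuilt from dyadic increments, and the first hitting of a ball is replaced by visits at
    the times of a finite grid, with an error that vanishes with the mesh. The Levy measure is tied
    to [X] only by the Levy-Khintchine formula, so every statement on jumps is extracted from
    characteristic functions: the rate [n P(X_(1/n) in cube)] is tested with tent functions, which
    are superpositions of cosines. Since [nu] need not be differentiable, the generator cannot be
    applied to it; a bound on symmetric second differences replaces two derivatives, the symmetry of
    [X] cancelling the first-order term. Killing and creation are kept apart throughout because [V+]
    is only locally in the Kato class and its time integral has no uniform bound. The eigenvalue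
    equation holds almost everywhere only; it is upgraded to an inequality at every point, the
    excessivity that the hitting principle needs. *)

Definition path_display : measure_display.
Proof. exact: default_measure_display. Qed.

Definition paths (R : realType) (d : nat) (I : Type) := I -> 'rV[R]_d.

Section paths.
Variables (R : realType) (d : nat) (I : Type).
Local Notation S := (paths R d I).

HB.instance Definition _ := gen_eqMixin S.
HB.instance Definition _ := gen_choiceMixin S.
HB.instance Definition _ := isPointed.Build S (fun=> 0).

Definition cyl1 : set (set S) :=
  [set C | exists i (A : set 'rV[R]_d), measurable A /\ C = [set z | A (z i)]].

Let cyl0 : <<s cyl1 >> set0. Proof. exact: sigma_algebra0. Qed.
Let cylC A : <<s cyl1 >> A -> <<s cyl1 >> (~` A).
Proof. exact: sigma_algebraC. Qed.
Let cyl_bigcup (F : (set S)^nat) :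
  (forall i, <<s cyl1 >> (F i)) -> <<s cyl1 >> (\bigcup_i F i).
Proof. exact: sigma_algebra_bigcup. Qed.

HB.instance Definition _ := @isMeasurable.Build path_display
  S <<s cyl1 >> cyl0 cylC cyl_bigcup.

Lemma measurable_path_coord (i : I) : measurable_fun setT (fun z : S => z i).
Proof.
move=> _ A mA; rewrite setTI; apply: sub_sigma_algebra.
by exists i, A.
Qed.

Lemma measurable_fun_paths dT (T : measurableType dT) (f : T -> S) :
  (forall i, measurable_fun setT (fun x => f x i)) -> measurable_fun setT f.
Proof.
move=> mf; apply: (measurability cyl1) => // _ [_ [i [A [mA ->]]] <-].
exact: mf.
Qed.

End paths.

Section independence.
Variables (R : realType) (dO d1 d2 : measure_display) (O : measurableType dO)
  (T1 : measurableType d1) (T2 : measurableType d2) (P : probability O R).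
Variables (x : O -> T1) (y y' : O -> T2).
Hypotheses (mx : measurable_fun setT x) (my : measurable_fun setT y)
  (my' : measurable_fun setT y').
Variables (G1 : set (set T1)) (G2 : set (set T2)).
Hypotheses (G1I : setI_closed G1) (G2I : setI_closed G2).
Hypotheses (G1E : measurable = <<s G1 >>) (G2E : measurable = <<s G2 >>).
Hypotheses (G1T : G1 setT) (G2T : G2 setT).
Hypothesis indepG : forall A B, G1 A -> G2 B ->
  P (x @^-1` A `&` y @^-1` B) = (P (x @^-1` A) * P (y' @^-1` B))%E.

Let mG2 A : G2 A -> measurable A. Proof. by rewrite G2E; exact: sub_sigma_algebra. Qed.

(** The map [y'] carries the law that [y] should have, so one identity states both independence of
    [x] and [y] and equality of the laws of [y] and [y']. Finite measures that agree on a pi-system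
    are equal; this is used once in each variable. *)
Lemma pi_independent A B : measurable A -> measurable B ->
  P (x @^-1` A `&` y @^-1` B) = (P (x @^-1` A) * P (y' @^-1` B))%E.
Proof.
have mpre d' (T' : measurableType d') (f : O -> T') C :
    measurable_fun setT f -> measurable C -> measurable (f @^-1` C).
  by move=> mf mC; rewrite -[X in measurable X]setTI; exact: mf.
have fine1 E : measurable E -> P E \is a fin_num.
  by move=> mE; exact: fin_num_measure.
have ge0 E : measurable E -> 0 <= fine (P E).
  by move=> mE; rewrite fine_ge0.
have step1 B' A' : G2 B' -> measurable A' ->
    P (x @^-1` A' `&` y @^-1` B') = (P (x @^-1` A') * P (y' @^-1` B'))%E.
  move=> gB mA.
  have mB := mpre _ _ _ _ my (mG2 gB); have mB' := mpre _ _ _ _ my' (mG2 gB).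
  pose m1 := pushforward (mrestr P mB) x.
  pose c : {nonneg R} := NngNum (ge0 _ mB').
  pose m2 := pushforward (mscale c P) x.
  pose m1' : {measure set T1 -> \bar R} :=
    measure_function_pushforward__canonical__measure_function_Measure (mrestr P mB) mx.
  pose m2' : {measure set T1 -> \bar R} :=
    measure_function_pushforward__canonical__measure_function_Measure (mscale c P) mx.
  have E2 C : m2' C = (P (x @^-1` C) * P (y' @^-1` B'))%E.
    by rewrite /m2' /= /pushforward /= /mscale /= fineK ?fine1// muleC.
  have E1 C : m1' C = P (x @^-1` C `&` y @^-1` B') by [].
  rewrite -E1 -E2; apply: (measure_unique G1 (fun=> setT)) => //.
  - by rewrite bigcup_const.
  - by move=> C gC; rewrite E1 E2 indepG.
  - move=> _; rewrite E1 preimage_setT setTI; exact: le_lt_trans (probability_le1 _ _) (ltry _).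
move=> mA mB; have mA' := mpre _ _ _ _ mx mA.
pose c : {nonneg R} := NngNum (ge0 _ mA').
pose m1' : {measure set T2 -> \bar R} :=
  measure_function_pushforward__canonical__measure_function_Measure (mrestr P mA') my.
pose m2' : {measure set T2 -> \bar R} :=
  measure_function_pushforward__canonical__measure_function_Measure (mscale c P) my'.
have E2 C : m2' C = (P (x @^-1` A) * P (y' @^-1` C))%E.
  by rewrite /m2' /= /pushforward /= /mscale /= fineK ?fine1.
have E1 C : m1' C = P (x @^-1` A `&` y @^-1` C).
  by rewrite /m1' /= /pushforward /= /mrestr setIC.
rewrite -E1 -E2; apply: (measure_unique G2 (fun=> setT)) => //.
- by rewrite bigcup_const.
- by move=> C gC; rewrite E1 E2 step1.
- move=> _; rewrite E1 preimage_setT setIT; exact: le_lt_trans (probability_le1 _ _) (ltry _).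
Qed.

End independence.

Section integral_independent.
Local Open Scope ereal_scope.
Variables (R : realType) (dO d1 d2 : measure_display) (O : measurableType dO)
  (T1 : measurableType d1) (T2 : measurableType d2) (P : probability O R).
Variables (x : O -> T1) (y y' : O -> T2).
Hypotheses (mx : measurable_fun setT x) (my : measurable_fun setT y)
  (my' : measurable_fun setT y').
Hypothesis indep : forall A B, measurable A -> measurable B ->
  P (x @^-1` A `&` y @^-1` B) = P (x @^-1` A) * P (y' @^-1` B).

(** Both sides integrate [f] against laws on the product space: that of [(x, y)] and the product of
    the laws of [x] and [y']. These agree on rectangles, hence everywhere. *)
Lemma integral_independent (f : T1 * T2 -> \bar R) :
  measurable_fun [set: (T1 * T2)%type] f -> (forall z, 0 <= f z) ->
  \int[P]_w f (x w, y w) = \int[P]_w \int[P]_w' f (x w, y' w').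
Proof.
move=> mf f0.
have mxy : measurable_fun setT (fun w => (x w, y w)).
  by apply/measurable_fun_pairP; split.
have mxy' : measurable_fun setT (fun z : O * O => (x z.1, y' z.2)).
  apply/measurable_fun_pairP; split => /=.
    by apply: (measurableT_comp mx); exact: measurable_fst.
  by apply: (measurableT_comp my'); exact: measurable_snd.
have mf' : measurable_fun setT (fun z : O * O => f (x z.1, y' z.2)).
  exact: measurableT_comp mf mxy'.
have -> : \int[P]_w \int[P]_w' f (x w, y' w') = \int[P \x P]_z f (x z.1, y' z.2).
  by rewrite fubini_tonelli1.
have E1 : \int[pushforward P (fun w => (x w, y w))]_z f z = \int[P]_w f (x w, y w).
  by rewrite (ge0_integral_pushforward mxy)// => ? _.
have E2 : \int[pushforward (P \x P) (fun z : O * O => (x z.1, y' z.2))]_z f z =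
    \int[P \x P]_z f (x z.1, y' z.2).
  by rewrite (ge0_integral_pushforward mxy')// => ? _.
rewrite -E1 -E2.
pose m1 : {measure set (T1 * T2) -> \bar R} :=
  measure_function_pushforward__canonical__measure_function_Measure P mxy.
pose m2 : {measure set (T1 * T2) -> \bar R} :=
  measure_function_pushforward__canonical__measure_function_Measure (P \x P) mxy'.
have mpre d' (T' : measurableType d') (g : O -> T') C :
    measurable_fun setT g -> measurable C -> measurable (g @^-1` C).
  by move=> mg mC; rewrite -[X in measurable X]setTI; exact: mg.
apply: (eq_measure_integral m2) => A mA _.
pose C : set (set (T1 * T2)) :=
  [set C | exists A B, [/\ measurable A, measurable B & C = A `*` B]].
apply: (measure_unique C (fun=> setT) _ _ _ _ m1 m2) => //.
- rewrite measurable_prod_measurableType //; congr (<<s _ >>).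
  rewrite predeqE; split => [[A1 mA1 [B mB <-]]|[A1 [B [mA1 mB ->]]]].
    by exists A1, B.
  by exists A1 => //; exists B.
- move=> _ _ [X1 [X2 [mX1 mX2 ->]]] [Y1 [Y2 [mY1 mY2 ->]]].
  by rewrite -setXI; exists (X1 `&` Y1), (X2 `&` Y2); split => //; exact: measurableI.
- by move=> _; exists setT, setT; split => //; rewrite setXTT.
- by rewrite bigcup_const.
- move=> _ [A1 [B [mA1 mB ->]]]; rewrite /m1 /m2 /= /pushforward /=.
  rewrite (_ : _ @^-1` _ = x @^-1` A1 `&` y @^-1` B)// indep//.
  rewrite (_ : _ @^-1` _ = x @^-1` A1 `*` y' @^-1` B)// product_measure1E//; exact: mpre.
- move=> _; rewrite /m1 /= /pushforward preimage_setT.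
  exact: le_lt_trans (probability_le1 _ _) (ltry _).
Qed.

End integral_independent.

Section rV_measurability.
Variables (R : realType) (n : nat) (dT : measure_display) (T : measurableType dT).
Local Notation E := 'rV[R]_n.
Implicit Types f g : T -> E.

Lemma measurable_rV_coord f (i : 'I_n) :
  measurable_fun setT f -> measurable_fun setT (fun x => f x 0 i).
Proof.
move=> mf; apply: (measurableT_comp (f := fun x : E => x 0 i)) => //.
exact: measurable_coord.
Qed.

Lemma measurable_funD_rV f g : measurable_fun setT f -> measurable_fun setT g ->
  measurable_fun setT (fun x => f x + g x).
Proof.
move=> mf mg; apply: measurable_fun_rV => i.
under eq_fun do rewrite mxE.
by apply: measurable_funD; exact: measurable_rV_coord.
Qed.

Lemma measurable_funN_rV f : measurable_fun setT f ->
  measurable_fun setT (fun x => - f x).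
Proof.
move=> mf; apply: measurable_fun_rV => i.
under eq_fun do rewrite mxE.
by apply: measurableT_comp => //; exact: measurable_rV_coord.
Qed.

Lemma measurable_funB_rV f g : measurable_fun setT f -> measurable_fun setT g ->
  measurable_fun setT (fun x => f x - g x).
Proof. by move=> mf mg; apply: measurable_funD_rV => //; exact: measurable_funN_rV. Qed.

Lemma measurable_fun_sum_rV (h : nat -> T -> E) (k : nat) :
  (forall i, measurable_fun setT (h i)) ->
  measurable_fun setT (fun x => \sum_(i < k) h i x).
Proof.
move=> mh; elim: k => [|k IH].
  under eq_fun do rewrite big_ord0; exact: measurable_cst.
under eq_fun do rewrite big_ord_recr /=.
exact: measurable_funD_rV.
Qed.

End rV_measurability.

Lemma measurable_preimage d1 d2 (T1 : measurableType d1) (T2 : measurableType d2)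
    (f : T1 -> T2) (A : set T2) :
  measurable_fun setT f -> measurable A -> measurable (f @^-1` A).
Proof. by move=> mf mA; rewrite -[X in measurable X]setTI; exact: mf. Qed.

(** * The Markov property at a fixed time *)

Section path_law.
Variables (R : realType) (d : nat) (dO : measure_display) (O : measurableType dO).
Variables (P : probability O R) (X : R -> O -> 'rV[R]_d).
Hypothesis hX : levy_process P X.
Local Notation E := 'rV[R]_d.
Local Notation S := (paths R d (nat * nat)).
Local Notation S1 := (paths R d nat).

Definition dyadic (m k : nat) : R := k%:R / 2 ^+ m.

Lemma dyadic_ge0 m k : 0 <= dyadic m k.
Proof. by rewrite divr_ge0// exprn_ge0. Qed.

Lemma dyadic_le m k k' : (k <= k')%N -> dyadic m k <= dyadic m k'.
Proof. by move=> kk'; rewrite ler_pM2r ?invr_gt0 ?exprn_gt0// ler_nat. Qed.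

Lemma dyadic_refine m m' k : (m <= m')%N ->
  dyadic m k = dyadic m' (k * 2 ^ (m' - m)).
Proof.
move=> mm'; rewrite /dyadic natrM natrX -{2}(subnK mm') exprD.
have e1 : 2 ^+ m != 0 :> R by rewrite expf_neq0.
have e2 : 2 ^+ (m' - m) != 0 :> R by rewrite expf_neq0.
by field; rewrite e1 e2.
Qed.

Lemma dyadicS m k : dyadic m k.+1 = dyadic m k + dyadic m 1.
Proof. by rewrite /dyadic -mulrDl -natr1. Qed.

(* A path is encoded by its increments at the dyadic times [k / 2 ^ m], indexed by [(m, k)]. *)
Definition pre_path (s : R) (w : O) : S :=
  fun p => X (Num.min (dyadic p.1 p.2) s) w - X 0 w.

Definition post_path (s : R) (w : O) : S :=
  fun p => X (s + dyadic p.1 p.2) w - X s w.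

Lemma measurable_pre_path s : 0 <= s -> measurable_fun setT (pre_path s).
Proof.
move=> s0; apply: measurable_fun_paths => p; apply: measurable_funB_rV.
  by apply: (levy_measurable hX); rewrite le_min s0 dyadic_ge0.
exact: (levy_measurable hX).
Qed.

Lemma measurable_post_path s : 0 <= s -> measurable_fun setT (post_path s).
Proof.
move=> s0; apply: measurable_fun_paths => p; apply: measurable_funB_rV.
  by apply: (levy_measurable hX); rewrite addr_ge0// dyadic_ge0.
exact: (levy_measurable hX).
Qed.

Let pre_incr m s w : S1 :=
  fun k => X (Num.min (dyadic m k.+1) s) w - X (Num.min (dyadic m k) s) w.
Let post_incr m s w : S1 :=
  fun k => X (s + dyadic m k.+1) w - X (s + dyadic m k) w.

Let mpre_incr m s : 0 <= s -> measurable_fun setT (pre_incr m s).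
Proof.
move=> s0; apply: measurable_fun_paths => p; apply: measurable_funB_rV;
by apply: (levy_measurable hX); rewrite le_min s0 dyadic_ge0.
Qed.

Let mpost_incr m s : 0 <= s -> measurable_fun setT (post_incr m s).
Proof.
move=> s0; apply: measurable_fun_paths => p; apply: measurable_funB_rV;
by apply: (levy_measurable hX); rewrite addr_ge0// dyadic_ge0.
Qed.

(** Constraining only finitely many increments keeps these sets within reach of the finite
    independence statement, and boxes with different [n] can still be intersected. *)
Let boxes : set (set S1) := [set C | exists n (A : nat -> set E),
  [/\ (forall i, measurable (A i)), (forall i, (n <= i)%N -> A i = setT) &
      C = [set z | forall k, A k (z k)]]].

Let boxesI : setI_closed boxes.
Proof.
move=> _ _ [n [A [mA nA ->]]] [n' [A' [mA' nA' ->]]].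
exists (maxn n n'), (fun i => A i `&` A' i); split.
- by move=> i; exact: measurableI.
- by move=> i; rewrite geq_max => /andP[/nA -> /nA' ->]; rewrite setIT.
- by apply/seteqP; split => z /= => [[h1 h2] k|h]; split => // k; have [] := h k.
Qed.

Let boxesT : boxes setT.
Proof.
exists 0%N, (fun=> setT); split => //.
by apply/seteqP; split.
Qed.

Let boxesE : measurable = <<s boxes >> :> set (set S1).
Proof.
apply/seteqP; split.
  apply: smallest_sub; first exact: smallest_sigma_algebra.
  move=> _ [i [A [mA ->]]]; apply: sub_sigma_algebra.
  exists i.+1, (fun j => if j == i then A else setT); split.
  - by move=> j; case: ifP.
  - by move=> j ij; case: eqP => // ji; move: ij; rewrite ji ltnn.
  - apply/seteqP; split => z /= => [Az k|/(_ i)]; last by rewrite eqxx.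
    by case: eqP => // ->.
apply: smallest_sub; first exact: sigma_algebra_measurable.
move=> _ [n [A [mA nA ->]]].
rewrite (_ : [set _ | _] = \bigcap_k ((fun z : S1 => z k) @^-1` A k)).
  apply: bigcapT_measurable => k; apply: measurable_preimage => //.
  exact: measurable_path_coord.
by apply/seteqP; split => z /= h k => [_|]; exact: h.
Qed.

Let grid_prob (t : nat -> R) (A : nat -> set E) n n' :
  0 <= t 0%N -> (forall i, t i <= t i.+1) -> (forall i, measurable (A i)) ->
  (n <= n')%N -> (forall i, (n <= i)%N -> A i = setT) ->
  P [set w | forall k, A k (X (t k.+1) w - X (t k) w)] =
  (\prod_(i < n') P [set w | A i (X (t i.+1) w - X (t i) w)%R])%E.
Proof.
move=> t0 ti mA nn' nA; rewrite -(levy_independent_increments hX n' t0 ti mA).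
congr (P _); apply/seteqP; split => w /= h => [i _|i]; first exact: h.
have [ni|ni] := ltnP i n'; first exact: h.
by rewrite nA// (leq_trans nn').
Qed.

(** The grids before and after [s] are concatenated into one nondecreasing sequence of times, to
    which independence of increments applies. The product then splits at index [N], and stationarity
    moves the second factor back to time 0. *)
Let grid_indep m s (A B : set S1) : 0 <= s -> measurable A -> measurable B ->
  P (pre_incr m s @^-1` A `&` post_incr m s @^-1` B) =
  (P (pre_incr m s @^-1` A) * P (post_incr m 0 @^-1` B))%E.
Proof.
move=> s0; move: A B.
apply: (pi_independent (mpre_incr _ s0) (mpost_incr _ s0) (mpost_incr _ (lexx 0))
  boxesI boxesI boxesE boxesE boxesT boxesT).
move=> _ _ [n [A [mA nA ->]]] [n' [B [mB nB ->]]].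
(* From index [N] on the dyadic times are at least [s], so the capped grid has stopped there;
   [N >= n] keeps all constrained increments before the splitting index. *)
pose N := maxn n (Num.truncn (s * 2 ^+ m)).+1.
have NS : s <= dyadic m N.
  rewrite /dyadic ler_pdivlMr ?exprn_gt0//; apply/ltW.
  by apply: (lt_le_trans (truncnS_gt _)); rewrite ler_nat leq_maxr.
pose t i := if (i <= N)%N then Num.min (dyadic m i) s else s + dyadic m (i - N).
have t1 i : (i < N)%N -> t i = Num.min (dyadic m i) s.
  by rewrite /t => /ltnW ->.
have t2 i : t (N + i)%N = s + dyadic m i.
  rewrite /t; case: ifP => [|_]; last by rewrite addKn.
  rewrite -{2}(addn0 N) leq_add2l leqn0 => /eqP ->.
  by rewrite addn0 min_r// /dyadic mul0r addr0.
have t1N i : (i <= N)%N -> t i = Num.min (dyadic m i) s.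
  by rewrite /t => ->.
pose C i := if (i < N)%N then A i else B (i - N)%N.
have t0 : 0 <= t 0%N by rewrite t1N// le_min dyadic_ge0.
have ti i : t i <= t i.+1.
  have [iN|iN] := ltnP i N.
    rewrite t1// t1N//; rewrite le_min ge_min dyadic_le//=.
    by rewrite ge_min lexx orbT.
  by rewrite -(subnKC iN) -addnS !t2 lerD2l dyadic_le.
have mC i : measurable (C i) by rewrite /C; case: ifP.
have nC i : (N + n' <= i)%N -> C i = setT.
  move=> Ni; rewrite /C ltnNge (leq_trans (leq_addr _ _) Ni)/=.
  by apply: nB; rewrite leq_subRL// (leq_trans (leq_addr _ _) Ni).
have -> : pre_incr m s @^-1` [set z | forall k, A k (z k)] `&`
    post_incr m s @^-1` [set z | forall k, B k (z k)] =
    [set w | forall k, C k (X (t k.+1) w - X (t k) w)].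
  apply/seteqP; split => w /= => [[h1 h2] k|h].
    rewrite /C; case: ltnP => kN; first by rewrite t1N// t1//; exact: h1.
    have := h2 (k - N)%N; rewrite /post_incr -!t2 addnS subnKC//.
  split => k.
    have [kN|kN] := ltnP k N; last by rewrite nA// (leq_trans _ kN)// leq_maxl.
    by have := h k; rewrite /C kN t1N// t1.
  have := h (N + k)%N; rewrite /C ltnNge leq_addr/= addKn -addnS !t2//.
rewrite (@grid_prob t C (N + n') (N + n'))// big_split_ord/=; congr (_ * _)%E.
  rewrite (@grid_prob (fun i => Num.min (dyadic m i) s) A n N)//.
  - by apply: eq_bigr => i _; rewrite t1N// t1// /C ltn_ord.
  - by move=> i; rewrite le_min ge_min dyadic_le//= ge_min lexx orbT.
  - exact: leq_maxl.
rewrite (@grid_prob (fun i => 0 + dyadic m i) B n' n')//.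
- apply: eq_bigr => i _; rewrite /C ltnNge leq_addr/= addKn -addnS !t2.
  have st := levy_stationary_increments hX.
  rewrite (dyadicS m i) !addrA.
  rewrite (st (s + dyadic m i) (dyadic m 1) (B i)) ?addr_ge0 ?dyadic_ge0//.
  by rewrite (st (0 + dyadic m i) (dyadic m 1) (B i)) ?addr_ge0 ?dyadic_ge0.
- by rewrite addr_ge0// dyadic_ge0.
- by move=> i; rewrite lerD2l dyadic_le.
Qed.

Let cum (z : S1) : S1 := fun k => \sum_(i < k) z i.

Let mcum : measurable_fun setT cum.
Proof.
apply: measurable_fun_paths => k.
apply: (measurable_fun_sum_rV (h := fun i (z : S1) => z i)) => i.
exact: measurable_path_coord.
Qed.

Let pre_cum m s w : 0 <= s -> cum (pre_incr m s w) = fun k => pre_path s w (m, k).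
Proof.
move=> s0; apply/funext => k; rewrite /cum /pre_path /pre_incr/=.
elim: k => [|k IH]; first by rewrite big_ord0 /dyadic mul0r min_l// subrr.
by rewrite big_ord_recr/= IH addrC subrKA.
Qed.

Let post_cum m s w : cum (post_incr m s w) = fun k => post_path s w (m, k).
Proof.
apply/funext => k; rewrite /cum /post_path /post_incr/=.
elim: k => [|k IH]; first by rewrite big_ord0 /dyadic mul0r addr0 subrr.
by rewrite big_ord_recr/= IH addrC subrKA.
Qed.

(** Events visible on a single dyadic level. They form a pi-system because two levels have a common
    refinement, and they generate everything because each coordinate belongs to one level. *)
Let levels : set (set S) := [set C | measurable C /\
  exists m (A : set S1), measurable A /\ forall s w, 0 <= s ->
    (C (pre_path s w) = A (fun k => pre_path s w (m, k))) /\
    (C (post_path s w) = A (fun k => post_path s w (m, k)))].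

Let raise m m' (A : set S1) : (m <= m')%N -> measurable A ->
  exists A' : set S1, measurable A' /\ forall s w, 0 <= s ->
   (A (fun k => pre_path s w (m, k)) = A' (fun k => pre_path s w (m', k))) /\
   (A (fun k => post_path s w (m, k)) = A' (fun k => post_path s w (m', k))).
Proof.
move=> mm' mA; pose f (z : S1) : S1 := fun k => z (k * 2 ^ (m' - m))%N.
exists (f @^-1` A); split.
  apply: measurable_preimage => //.
  by apply: measurable_fun_paths => k; exact: measurable_path_coord.
move=> s w s0; split; rewrite /preimage /f/=; congr A; apply/funext => k.
  by rewrite /pre_path/= (dyadic_refine _ mm').
by rewrite /post_path/= (dyadic_refine _ mm').
Qed.

Let levelsI : setI_closed levels.
Proof.
move=> C C' [mC [m [A [mA AE]]]] [mC' [m' [A' [mA' AE']]]].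
split; first exact: measurableI.
have [B [mB BE]] := raise (leq_maxl m m') mA.
have [B' [mB' BE']] := raise (leq_maxr m m') mA'.
exists (maxn m m'), (B `&` B'); split; first exact: measurableI.
move=> s w s0; have [e1 e2] := AE _ w s0; have [e1' e2'] := AE' _ w s0.
have [f1 f2] := BE _ w s0; have [f1' f2'] := BE' _ w s0.
by rewrite /setI/= e1 e2 e1' e2' f1 f2 f1' f2'.
Qed.

Let levelsT : levels setT.
Proof. by split => //; exists 0%N, setT. Qed.

Let levelsE : measurable = <<s levels >> :> set (set S).
Proof.
apply/seteqP; split.
  apply: smallest_sub; first exact: smallest_sigma_algebra.
  move=> _ [[n k] [A [mA ->]]]; apply: sub_sigma_algebra; split.
    apply: (@measurable_preimage _ _ _ _ (fun z : S => z (n, k))) => //.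
    exact: measurable_path_coord.
  exists n, [set z | A (z k)]; split => //.
  apply: (@measurable_preimage _ _ _ _ (fun z : S1 => z k)) => //.
  exact: measurable_path_coord.
apply: smallest_sub; first exact: sigma_algebra_measurable.
by move=> C [].
Qed.

(* The path up to time s is independent of the increments after s, which are
   distributed as the path itself. *)
Lemma markov_paths s (A B : set S) : 0 <= s -> measurable A -> measurable B ->
  P (pre_path s @^-1` A `&` post_path s @^-1` B) =
  (P (pre_path s @^-1` A) * P (post_path 0 @^-1` B))%E.
Proof.
move=> s0; move: A B.
apply: (pi_independent (measurable_pre_path s0) (measurable_post_path s0)
  (measurable_post_path (lexx 0)) levelsI levelsI levelsE levelsE levelsT levelsT).
move=> C C' [mC [m [A [mA AE]]]] [mC' [m' [A' [mA' AE']]]].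
have [B [mB BE]] := raise (leq_maxl m m') mA.
have [B' [mB' BE']] := raise (leq_maxr m m') mA'.
set M := maxn m m' in BE BE'.
have -> : pre_path s @^-1` C = pre_incr M s @^-1` (cum @^-1` B).
  apply/seteqP; split => w /=;
  by rewrite pre_cum// (AE _ w s0).1 (BE _ w s0).1.
have e r : 0 <= r -> post_path r @^-1` C' = post_incr M r @^-1` (cum @^-1` B').
  move=> r0; apply/seteqP; split => w /=;
  by rewrite post_cum// (AE' _ w r0).2 (BE' _ w r0).2.
rewrite !e//; apply: grid_indep => //; exact: measurable_preimage.
Qed.

End path_law.

(** * A jointly measurable version of the process *)

Section nonmeasurable.
Import HBNNSimple.

(** Functionals of the raw process need not be measurable, yet must be replaced by functionals of
    its jointly measurable version. The integral of a nonnegative function is a supremum over simple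
    functions below it, and each of these can be set to 0 on the exceptional null set without
    changing its integral. *)
Lemma nonmeasurable_ge0_ae_eq_integral (R : realType) dT (T : measurableType dT)
    (mu : {measure set T -> \bar R}) (f g : T -> \bar R) :
  (forall x, 0 <= f x)%E -> (forall x, 0 <= g x)%E -> {ae mu, forall x, f x = g x} ->
  (\int[mu]_x f x = \int[mu]_x g x)%E.
Proof.
move=> f0 g0 fg.
suff H h k : (forall x, 0 <= h x)%E -> (forall x, 0 <= k x)%E ->
    {ae mu, forall x, h x = k x} -> (\int[mu]_x h x <= \int[mu]_x k x)%E.
  apply/eqP; rewrite eq_le !H//.
  by apply: filterS fg => x ->.
move=> {f g f0 g0 fg} h0 k0 [N [mN N0 hk]].
rewrite !ge0_integralTE//.
apply: ub_ereal_sup => _ [s /= sh <-].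
pose NC := ~` N; have mNC : measurable NC by exact: measurableC.
pose s' := proj_nnsfun s mNC.
have -> : sintegral mu s = sintegral mu s'.
  rewrite -!integralT_nnsfun; apply: ge0_ae_eq_integral => //.
  - by apply/measurable_EFinP; exact: measurable_funP.
  - by apply/measurable_EFinP; exact: measurable_funP.
  - by move=> x _; rewrite lee_fin.
  - by move=> x _; rewrite lee_fin.
  exists N; split => // x /= /not_implyP[_] sx; apply: contrapT => Nx; apply: sx.
  by change ((s x)%:E = (s x * \1_NC x)%:E); rewrite indicE mem_set// mulr1.
apply: ereal_sup_ubound; exists s' => //= x.
change ((s x * \1_NC x)%:E <= k x)%E; rewrite indicE; have [Nx|Nx] := pselect (N x).
  by rewrite memNset ?mulr0//; apply.
rewrite mem_set// mulr1; have <- : h x = k x by apply: contrapT => hkx; exact/Nx/hk.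
exact: sh.
Qed.

End nonmeasurable.

Lemma lebesgue_measure_shift (R : realType) (r : R) (A : set R) : measurable A ->
  pushforward lebesgue_measure (fun x : measurableTypeR R => (x + r : measurableTypeR R)) A =
  lebesgue_measure A.
Proof.
move=> mA.
have ms : measurable_fun setT (fun x : measurableTypeR R => (x + r : measurableTypeR R)).
  by apply: measurable_funD => //; exact: measurable_cst.
symmetry; refine (@lebesgue_measure_unique R
  (measure_function_pushforward__canonical__measure_function_Measure lebesgue_measure ms) _ A mA).
move=> _ [[a b]] _ <- /=.
rewrite /pushforward (_ : _ @^-1` _ = `]a - r, b - r]%classic).
  by rewrite !lebesgue_measure_itv/= !lte_fin ltrD2r -!EFinB opprB addrA subrK.
by apply/seteqP; split => x /=; rewrite !in_itv/= ltrBlDr lerBrDr.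
Qed.

Lemma ge0_integral_shift (R : realType) (r a b : R) (f : R -> \bar R) :
  measurable_fun setT f -> (forall x, 0 <= f x)%E ->
  (\int[lebesgue_measure]_(x in `[(a + r)%R, (b + r)%R]) f x =
   \int[lebesgue_measure]_(x in `[a, b]) f (x + r)%R)%E.
Proof.
move=> mf f0.
pose sh (x : measurableTypeR R) : measurableTypeR R := (x + r)%R.
have ms : measurable_fun setT sh by apply: measurable_funD => //; exact: measurable_cst.
transitivity (\int[pushforward lebesgue_measure sh]_(x in `[(a + r)%R, (b + r)%R]) f x)%E.
  apply: eq_measure_integral => A mA _.
  by first [exact: lebesgue_measure_shift|exact/esym/lebesgue_measure_shift].
rewrite (ge0_integral_pushforward ms)//; last exact: measurable_funS mf.
congr (integral _ _ _).
by apply/seteqP; split => x /=; rewrite !in_itv/= !lerD2r.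
Qed.

(** Index of the first dyadic time of level [n] strictly after [t >= 0]; strictness keeps this time
    inside the filter [t^'+], which excludes [t]. *)
Definition right_grid (R : realType) (t : R) (n : nat) := (Num.truncn (t * 2 ^+ n)).+1.

Lemma right_grid_gt (R : realType) (t : R) n : 0 <= t -> t < dyadic R n (right_grid t n).
Proof.
move=> t0; rewrite /dyadic ltr_pdivlMr ?exprn_gt0//; exact: truncnS_gt.
Qed.

Lemma right_grid_le (R : realType) (t : R) n : 0 <= t -> dyadic R n (right_grid t n) <= t + (2 ^+ n)^-1.
Proof.
move=> t0; have e2 : 0 < 2 ^+ n :> R by rewrite exprn_gt0.
rewrite /dyadic /right_grid ler_pdivrMr// mulrDl mulVf ?gt_eqF// -natr1 lerD2r.
by rewrite truncn_le mulr_ge0// ltW.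
Qed.

Lemma right_grid_cvg (R : realType) (t : R) : 0 <= t -> dyadic R n (right_grid t n) @[n --> \oo] --> t^'+.
Proof.
move=> t0 Q [e /= e0 tQ].
have [m _ hm] := near_infty_natSinv_expn_lt (PosNum e0).
exists m => // n /= mn; apply: tQ; last exact: right_grid_gt.
rewrite /ball/= ltr_distlC; apply/andP; split.
  by rewrite (lt_trans _ (right_grid_gt n t0))// gtrBl.
apply: (le_lt_trans (right_grid_le n t0)); rewrite ltrD2l.
by have := hm n mn; rewrite div1r.
Qed.

Section path_at.
Variables (R : realType) (d : nat).
Local Notation E := 'rV[R]_d.
Local Notation S := (paths R d (nat * nat)).

(* Recovers a right-continuous path from its values at dyadic times; [limn_esup] makes the
   result measurable without any assumption on [z]. *)
Definition path_at (z : S) (t : R) : E :=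
  \row_i fine (limn_esup (fun n => (z (n, right_grid t n) 0 i)%:E)).

(** Time enters [path_at] only through the integers [Num.truncn (t * 2 ^+ n)], so each approximation
    is measurable on countably many product pieces. *)
Lemma measurable_path_at :
  measurable_fun setT (fun p : S * measurableTypeR R => path_at p.1 p.2).
Proof.
apply: measurable_fun_rV => i.
under eq_fun do rewrite mxE.
apply: measurableT_comp => //.
apply: measurable_fun_limn_esup => n; apply/measurable_EFinP => _ A mA; rewrite setTI.
rewrite (_ : _ @^-1` A = \bigcup_k (((fun z : S => z (n, k.+1) 0 i) @^-1` A) `*`
   [set t : measurableTypeR R | Num.truncn (t * 2 ^+ n) = k])); last first.
  apply/seteqP; split => [[z t]/= h|[z t] [k _ [/= h1 h2]]].
    by exists (Num.truncn (t * 2 ^+ n)).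
  by rewrite /right_grid h2.
apply: bigcupT_measurable => k; apply: measurableX.
  apply: measurable_preimage => //.
  by apply: measurable_rV_coord; exact: measurable_path_coord.
have e2 : 0 < 2 ^+ n :> R by rewrite exprn_gt0.
(* Negative reals are truncated to 0, so the fibre over 0 is a half-line, unlike the others. *)
case: k => [|k].
  rewrite (_ : [set t | _] = `]-oo, (1 / 2 ^+ n)%R[%classic)//.
  apply/seteqP; split => x /=; rewrite in_itv/= ltr_pdivlMr//.
    move=> h; have := truncn_le_nat (x * 2 ^+ n) 0; rewrite h leqnn.
    by move/esym.
  by move=> h; apply/eqP; rewrite -leqn0 truncn_le_nat.
rewrite (_ : [set t | _] = `[(k.+1%:R / 2 ^+ n)%R, (k.+2%:R / 2 ^+ n)%R[%classic)//.
apply/seteqP; split => x /=; rewrite in_itv/= ler_pdivrMr// ltr_pdivlMr//.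
  move=> h; apply/andP; split.
    by have := truncn_gt_nat (x * 2 ^+ n) k; rewrite h ltnSn => /esym.
  by have := truncn_le_nat (x * 2 ^+ n) k.+1; rewrite h leqnn => /esym.
by move=> h; apply: truncn_def.
Qed.

Lemma path_at_lim (z : S) (t : R) (y : E) :
  z (n, right_grid t n) @[n --> \oo] --> y -> path_at z t = y.
Proof.
move=> zy; apply/rowP => i; rewrite mxE.
have zyi : z (n, right_grid t n) 0 i @[n --> \oo] --> y 0 i.
  apply: (cvg_comp _ (fun x : E => x 0 i) zy); exact: coord_continuous.
have : (z (n, right_grid t n) 0 i)%:E @[n --> \oo] --> (y 0 i)%:E.
  by apply/fine_cvgP; split; [exact: nearW|exact: zyi].
by move=> /cvg_limn_einf_sup[_ ->].
Qed.

End path_at.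

Section modification.
Variables (R : realType) (d : nat) (dO : measure_display) (O : measurableType dO).
Variables (P : probability O R) (X : R -> O -> 'rV[R]_d).
Hypothesis hX : levy_process P X.
Local Notation E := 'rV[R]_d.
Local Notation S := (paths R d (nat * nat)).

Definition good (w : O) := X 0 w = 0 /\
  forall t, 0 <= t -> X s w @[s --> t^'+] --> X t w.

Lemma ae_good : {ae P, forall w, good w}.
Proof.
apply: filterS2 (levy_start hX) (levy_cadlag hX) => w h0 hc; split => // t t0.
by have [] := hc t t0.
Qed.

Lemma path_at_post s t w : good w -> 0 <= s -> 0 <= t ->
  path_at (post_path X s w) t = X (s + t) w - X s w.
Proof.
move=> [_ gw] s0 t0; apply: path_at_lim; rewrite /post_path/=.
apply: cvgB; last exact: cvg_cst.
apply: (cvg_comp _ (X ^~ w) _ (gw (s + t) _)); last by rewrite addr_ge0.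
move=> Q [e /= e0 tQ]; near=> n.
apply: tQ; last by rewrite ltrD2l right_grid_gt.
rewrite /ball/= opprD addrACA subrr add0r.
near: n; have h := right_grid_cvg t0; apply: (h [set x | `|t - x| < e]).
by exists e.
Unshelve. all: by end_near.
Qed.

Lemma path_at_pre s t w : good w -> 0 <= s -> 0 <= t ->
  path_at (pre_path X s w) t = X (Num.min t s) w.
Proof.
move=> [X0 gw] s0 t0; apply: path_at_lim; rewrite /pre_path/= X0.
under eq_fun do rewrite subr0.
have [ts|st] := ltP t s.
  have h := cvg_comp _ (X ^~ w) (right_grid_cvg t0) (gw t t0).
  apply: cvg_trans h.
  apply: near_eq_cvg; near=> n => /=.
  rewrite min_l//; near: n.
  have h' := right_grid_cvg t0; apply: (h' [set x | x <= s]).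
  exists (s - t) => /=; first by rewrite subr_gt0.
  by move=> x /=; rewrite ltr_distlC => /andP[_]; rewrite subrKC => /ltW.
apply: cvg_near_cst; near=> n.
by rewrite min_r// (le_trans st)// ltW// right_grid_gt.
Unshelve. all: by end_near.
Qed.

(* A version of [X] that is jointly measurable in time and [w]. *)
Definition proc (t : R) (w : O) : E := path_at (post_path X 0 w) t.

Lemma procE t w : good w -> 0 <= t -> proc t w = X t w.
Proof. by move=> gw t0; rewrite /proc path_at_post// add0r gw.1 subr0. Qed.

End modification.

(** * Feynman-Kac kernels *)

Lemma integral_indicator_itv (R : realType) (t : R) (f : R -> \bar R) :
  (\int[lebesgue_measure]_(s in `[0%R, t]) f s =
   \int[lebesgue_measure]_s (if (0 <= s <= t)%R then f s else 0))%E.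
Proof.
rewrite integral_mkcond; apply: eq_integral => s _; rewrite patchE.
by rewrite mem_setE in_itv.
Qed.

Lemma measurable_expeR (R : realType) : measurable_fun setT (@expeR R).
Proof.
rewrite (_ : @expeR R = fun x => if x == +oo%E then +oo%E else
  if x == -oo%E then 0%E else (expR (fine x))%:E); last first.
  by apply/funext => -[r| |].
apply: measurable_fun_ifT => //=; first exact: measurable_fun_eqe.
apply: measurable_fun_ifT => //=; first exact: measurable_fun_eqe.
by apply/measurable_EFinP; apply: measurableT_comp => //; exact: measurable_expR.
Qed.

Section measurable_pairs.
Variables (d0 d1 d2 : measure_display) (T : measurableType d0)
  (T1 : measurableType d1) (T2 : measurableType d2).

Lemma measurable_pair (f : T -> T1) (g : T -> T2) :
  measurable_fun setT f -> measurable_fun setT g ->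
  measurable_fun setT (fun x => (f x, g x)).
Proof. by move=> mf mg; apply/measurable_fun_pairP. Qed.

Lemma measurable_fst_comp (f : T -> T1 * T2) : measurable_fun setT f ->
  measurable_fun setT (fun x => (f x).1).
Proof. by move=> /measurable_fun_pairP[]. Qed.

Lemma measurable_snd_comp (f : T -> T1 * T2) : measurable_fun setT f ->
  measurable_fun setT (fun x => (f x).2).
Proof. by move=> /measurable_fun_pairP[]. Qed.

End measurable_pairs.

Ltac meas := repeat first [assumption | exact: measurable_cst | exact: measurable_id
  | apply: measurable_pair | apply: measurable_fst_comp | apply: measurable_snd_comp
  | apply: measurable_funD_rV | apply: measurable_funB_rV].

Section paths_evaluation.
Variables (R : realType) (d : nat) (dT : measure_display) (T : measurableType dT).

Lemma measurable_path_at_comp (f : T -> paths R d (nat * nat)) (g : T -> measurableTypeR R) :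
  measurable_fun setT f -> measurable_fun setT g ->
  measurable_fun setT (fun x => path_at (f x) (g x)).
Proof.
move=> mf mg; apply: (measurableT_comp (@measurable_path_at R d)
  (g := fun x => (f x, g x))).
exact: measurable_pair.
Qed.

End paths_evaluation.

Opaque path_at post_path pre_path.

Section feynman_kac_kernel.
Variables (R : realType) (d : nat) (dO : measure_display) (O : measurableType dO).
Variables (P : probability O R) (X : R -> O -> 'rV[R]_d).
Hypothesis hX : levy_process P X.
Local Notation E := 'rV[R]_d.
Local Notation S := (paths R d (nat * nat)).
Local Notation leb1 := (@lebesgue_measure R).
Local Notation Y := (post_path X 0).
Local Notation proc := (proc X).

Definition potential (U : E -> R) := measurable_fun setT U /\ forall x, 0 <= U x.

Lemma potential0 : potential (cst 0).
Proof. by split => // x; exact: lexx. Qed.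

Let mY : measurable_fun setT Y := measurable_post_path hX (lexx 0).

Definition additive_functional (U : E -> R) (t : R) (x : E) (z : S) : \bar R :=
  (\int[leb1]_(s in `[0%R, t]) (U (x + path_at z s))%:E)%E.
Local Notation afun := additive_functional.

Lemma measurable_shifted (U : E -> R) : measurable_fun setT U ->
  measurable_fun setT (fun q : E * S * measurableTypeR R =>
    U (q.1.1 + path_at q.1.2 q.2)).
Proof.
move=> mU; apply: measurableT_comp => //; meas.
by apply: measurable_path_at_comp; meas.
Qed.

Lemma afun_ge0 U t x z : potential U -> (0 <= afun U t x z)%E.
Proof. by move=> [_ U0]; apply: integral_ge0 => s _; rewrite lee_fin. Qed.

Lemma measurable_afun U : potential U ->
  measurable_fun setT (fun q : measurableTypeR R * E * S => afun U q.1.1 q.1.2 q.2).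
Proof.
move=> [mU U0].
pose F (p : (measurableTypeR R * E * S) * measurableTypeR R) : \bar R :=
  if (0 <= p.2 <= p.1.1.1) then (U (p.1.1.2 + path_at p.1.2 p.2))%:E else 0%E.
have F0 p : (0 <= F p)%E by rewrite /F; case: ifP => // _; rewrite lee_fin.
have mF : measurable_fun setT F.
  apply: measurable_fun_ifT => //.
    by apply: measurable_and; apply: measurable_fun_ler; meas.
  apply/measurable_EFinP.
  apply: (measurableT_comp (measurable_shifted mU)
    (g := fun p : (measurableTypeR R * E * S) * measurableTypeR R =>
      (p.1.1.2, p.1.2, p.2))).
  by meas.
have := measurable_fun_fubini_tonelli_F (m2 := leb1) F mF F0.
congr (measurable_fun _ _); apply/funext => q.
by rewrite /afun integral_indicator_itv.
Qed.

(* [U1] kills and [U2] creates mass; since [-oo + +oo = -oo], killing wins if both integrals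
   are infinite. *)
Definition weight (U1 U2 : E -> R) (t : R) (x : E) (z : S) : \bar R :=
  expeR (- afun U1 t x z + afun U2 t x z)%E.

Lemma weight_ge0 U1 U2 t x z : (0 <= weight U1 U2 t x z)%E.
Proof. exact: expeR_ge0. Qed.

Lemma measurable_weight U1 U2 : potential U1 -> potential U2 ->
  measurable_fun setT (fun q : measurableTypeR R * E * S => weight U1 U2 q.1.1 q.1.2 q.2).
Proof.
move=> pU1 pU2; apply: measurableT_comp; first exact: measurable_expeR.
apply: emeasurable_funD; last exact: measurable_afun.
by apply: measurableT_comp => //; exact: measurable_afun.
Qed.

Lemma weight0 t x z : weight (cst 0) (cst 0) t x z = 1%E.
Proof. by rewrite /weight /afun /= integral0 oppe0 adde0 expeR0. Qed.

Lemma afun_cat U r s x w : potential U -> good X w -> 0 <= r -> 0 <= s ->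
  afun U (r + s) x (Y w) =
  (afun U r x (Y w) + afun U s (x + proc r w) (post_path X r w))%E.
Proof.
move=> [mU U0] gw r0 s0.
have mUx y (z : S) : measurable_fun setT (fun u => (U (y + path_at z u))%:E).
  apply/measurable_EFinP.
  apply: (measurableT_comp (measurable_shifted mU)
    (g := fun u : measurableTypeR R => (y, z, u))).
  by meas.
rewrite /afun.
have -> : `[0, r + s]%classic = `[0, r[%classic `|` `[r, r + s]%classic :> set R.
  by rewrite (@itv_bndbnd_setU _ _ (BLeft 0) (BLeft r) (BRight (r + s))) ?bnd_simp// lerDl.
have m1 : measurable (`[0, r[%classic : set R) by exact: measurable_itv.
have m2 : measurable (`[r, r + s]%classic : set R) by exact: measurable_itv.
have dis : [disjoint `[0, r[%classic & `[r, r + s]%classic : set R].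
  apply/disj_setPS => u /=; rewrite !in_itv/= => -[/andP[_ ur] /andP[ru _]].
  by have := lt_le_trans ur ru; rewrite ltxx.
have mall D : measurable_fun D (fun u => (U (x + path_at (Y w) u))%:E).
  exact: measurable_funTS.
have U0' D u : D u -> (0 <= (U (x + path_at (Y w) u))%:E)%E by move=> _; rewrite lee_fin.
rewrite (ge0_integral_setU leb1 m1 m2 (mall _) (U0' _) dis).
rewrite integral_itv_bndo_bndc; last exact: mall.
apply: congr2; first by [].
have sh := @ge0_integral_shift R r 0 s _ (mall setT) (U0' (fun=> True) ^~ I).
rewrite add0r (addrC s r) in sh; rewrite {}sh.
apply: eq_integral => u; rewrite inE/= in_itv/= => /andP[u0 us].
have ur0 : 0 <= u + r by rewrite addr_ge0.
rewrite /proc (path_at_post gw (lexx 0) ur0) (path_at_post gw (lexx 0) r0).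
rewrite (path_at_post gw r0 u0) !add0r gw.1 !subr0 -(addrA x) subrKC.
by rewrite (addrC u).
Qed.

Lemma weight_cat U1 U2 r s x w : potential U1 -> potential U2 -> good X w ->
  0 <= r -> 0 <= s ->
  weight U1 U2 (r + s) x (Y w) =
  (weight U1 U2 r x (Y w) * weight U1 U2 s (x + proc r w) (post_path X r w))%E.
Proof.
move=> p1 p2 gw r0 s0; rewrite /weight !afun_cat// -expeRD; congr expeR.
by rewrite oppeD ?ge0_adde_def ?inE ?afun_ge0// addeACA.
Qed.

Lemma proc_cat r s w : good X w -> 0 <= r -> 0 <= s ->
  proc (r + s) w = proc r w + path_at (post_path X r w) s.
Proof.
move=> gw r0 s0; have rs0 : 0 <= r + s by rewrite addr_ge0.
rewrite /proc (path_at_post gw (lexx 0) rs0) (path_at_post gw (lexx 0) r0).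
by rewrite (path_at_post gw r0 s0) !add0r gw.1 !subr0 subrKC.
Qed.

Lemma afun_pre U r x w : good X w -> 0 <= r ->
  afun U r x (Y w) = afun U r x (pre_path X r w).
Proof.
move=> gw r0; apply: eq_integral => u; rewrite inE/= in_itv/= => /andP[u0 ur].
by rewrite path_at_post// path_at_pre// add0r gw.1 subr0 min_l.
Qed.

Definition fk (U1 U2 : E -> R) (t : R) (f : E -> \bar R) (x : E) : \bar R :=
  (\int[P]_w (weight U1 U2 t x (Y w) * f (x + proc t w)%R))%E.

Definition nnmeas (f : E -> \bar R) := measurable_fun setT f /\ forall x, (0 <= f x)%E.

Section mixed.
Variables (U1 U2 : E -> R).
Hypotheses (p1 : potential U1) (p2 : potential U2).

Lemma measurable_fk_integrand f : measurable_fun setT f ->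
  measurable_fun setT (fun q : measurableTypeR R * E * O =>
    (weight U1 U2 q.1.1 q.1.2 (Y q.2) * f (q.1.2 + proc q.1.1 q.2)%R)%E).
Proof.
move=> mf.
have mYq : measurable_fun setT (fun q : measurableTypeR R * E * O => Y q.2).
  by apply: measurableT_comp mY _; exact: measurable_snd.
apply: emeasurable_funM.
  apply: (measurableT_comp (measurable_weight p1 p2)
    (g := fun q : measurableTypeR R * E * O => (q.1.1, q.1.2, Y q.2))).
  by meas.
apply: measurableT_comp => //; meas.
by apply: measurable_path_at_comp; meas.
Qed.

Lemma measurable_fk_integrandx f t x : measurable_fun setT f ->
  measurable_fun setT (fun w =>
    (weight U1 U2 t x (Y w) * f (x + proc t w)%R)%E).
Proof.
move=> mf; apply: (measurableT_comp (measurable_fk_integrand mf)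
  (g := fun w : O => (t : measurableTypeR R, x, w))).
by meas.
Qed.

Lemma fk_ge0 t f x : (forall x, (0 <= f x)%E) -> (0 <= fk U1 U2 t f x)%E.
Proof. by move=> f0; apply: integral_ge0 => w _; rewrite mule_ge0// weight_ge0. Qed.

Lemma measurable_fk2 f : nnmeas f ->
  measurable_fun setT (fun q : measurableTypeR R * E => fk U1 U2 q.1 f q.2).
Proof.
move=> [mf f0].
have := measurable_fun_fubini_tonelli_F (m2 := P) _ (measurable_fk_integrand mf).
by apply => q; rewrite mule_ge0// weight_ge0.
Qed.

Lemma measurable_fk t f : nnmeas f -> measurable_fun setT (fk U1 U2 t f).
Proof.
move=> nf; apply: (measurableT_comp (measurable_fk2 nf)
  (g := fun x : E => (t : measurableTypeR R, x))).
by meas.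
Qed.

Lemma nnmeas_fk t f : nnmeas f -> nnmeas (fk U1 U2 t f).
Proof. by move=> nf; split; [exact: measurable_fk|move=> x; apply: fk_ge0; case: nf]. Qed.

(** The weight up to [r] and the position at [r] are functions of the path stopped at [r], so
    [markov_paths] allows the later increments to be replaced by an independent copy. [Phi] may
    depend on the whole future path. *)
Lemma markov_property r x (Phi : E * S -> \bar R) : 0 <= r ->
  measurable_fun setT Phi -> (forall z, 0 <= Phi z)%E ->
  (\int[P]_w (weight U1 U2 r x (Y w) * Phi ((x + proc r w)%R, post_path X r w)) =
   fk U1 U2 r (fun y => \int[P]_w Phi (y, Y w)) x)%E.
Proof.
move=> r0 mPhi Phi0.
pose F (p : S * S) : \bar R :=
  (weight U1 U2 r x p.1 * Phi ((x + path_at p.1 r)%R, p.2))%E.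
have mx1 : measurable_fun setT (fun p : S * S => path_at p.1 r).
  by apply: measurable_path_at_comp; meas.
have mF : measurable_fun setT F.
  apply: emeasurable_funM.
    apply: (measurableT_comp (measurable_weight p1 p2)
      (g := fun p : S * S => (r : measurableTypeR R, x, p.1))).
    by meas.
  apply: (measurableT_comp mPhi (g := fun p : S * S => ((x + path_at p.1 r), p.2))).
  by meas.
have F0 p : (0 <= F p)%E by rewrite mule_ge0// weight_ge0.
have step1 : (\int[P]_w (weight U1 U2 r x (Y w) * Phi ((x + proc r w)%R, post_path X r w)) =
    \int[P]_w F (pre_path X r w, post_path X r w))%E.
  apply: nonmeasurable_ge0_ae_eq_integral => //.
    by move=> w; rewrite mule_ge0// weight_ge0.
  apply: filterS (ae_good hX) => w gw.
  rewrite /F/= /weight !(afun_pre _ _ gw r0) /proc.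
  by rewrite path_at_post// path_at_pre// add0r gw.1 subr0 minxx.
rewrite step1 (integral_independent (measurable_pre_path hX r0)
  (measurable_post_path hX r0) mY (fun A B => markov_paths hX r0) mF F0).
rewrite /fk; apply: nonmeasurable_ge0_ae_eq_integral.
- by move=> w; apply: integral_ge0.
- move=> w; apply: mule_ge0; first exact: weight_ge0.
  by apply: integral_ge0 => w' _; exact: Phi0.
apply: filterS (ae_good hX) => w gw.
have mPw : measurable_fun setT (fun w' : O => Phi (x + path_at (pre_path X r w) r, Y w')).
  apply: (measurableT_comp mPhi (g := fun w' : O => (x + path_at (pre_path X r w) r, Y w'))).
  by meas.
have := ge0_integralZl P measurableT mPw (fun w' _ => Phi0 _) (weight_ge0 U1 U2 r x (pre_path X r w)).
rewrite /F /= => ->; rewrite /weight !(afun_pre _ _ gw r0) /proc.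
by rewrite (path_at_post gw (lexx 0) r0) (path_at_pre gw r0 r0) add0r gw.1 subr0 minxx.
Qed.

End mixed.

(** The potentials may change at time [r]: Duhamel's formula and the exponential moment identity run
    one semigroup before a given time and another one after it. *)
Lemma fk_mixed U1 U2 W1 W2 r s x f h : potential U1 -> potential U2 ->
  potential W1 -> potential W2 -> 0 <= r -> 0 <= s -> nnmeas f -> nnmeas h ->
  (\int[P]_w (weight U1 U2 r x (Y w) * (f (x + proc r w)%R *
     (weight W1 W2 s (x + proc r w)%R (post_path X r w) *
      h (x + proc r w + path_at (post_path X r w) s)%R))) =
   fk U1 U2 r (fun y => f y * fk W1 W2 s h y) x)%E.
Proof.
move=> p1 p2 q1 q2 r0 s0 [mf f0] [mh h0].
pose Psi (z : E * S) : \bar R := (weight W1 W2 s z.1 z.2 * h (z.1 + path_at z.2 s)%R)%E.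
pose Phi (z : E * S) : \bar R := (f z.1 * Psi z)%E.
have Psi0 z : (0 <= Psi z)%E by rewrite mule_ge0// weight_ge0.
have Phi0 z : (0 <= Phi z)%E by rewrite mule_ge0.
have mPsi : measurable_fun setT Psi.
  apply: emeasurable_funM.
    apply: (measurableT_comp (measurable_weight q1 q2)
      (g := fun p : E * S => (s : measurableTypeR R, p.1, p.2))).
    by meas.
  apply: measurableT_comp => //; meas.
  by apply: measurable_path_at_comp; meas.
have mPhi : measurable_fun setT Phi.
  apply: emeasurable_funM => //; apply: measurableT_comp => //; exact: measurable_fst.
have := @markov_property U1 U2 p1 p2 r x Phi r0 mPhi Phi0.
rewrite /Phi/= => ->; congr (fk _ _ _ _ _); apply/funext => y.
rewrite ge0_integralZl//.
apply: (measurableT_comp mPsi (g := fun w : O => (y, Y w))).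
by meas.
Qed.

Lemma fk_two_times U1 U2 r s x f h : potential U1 -> potential U2 ->
  0 <= r -> 0 <= s -> nnmeas f -> nnmeas h ->
  (\int[P]_w (weight U1 U2 (r + s) x (Y w) *
      (f (x + proc r w)%R * h (x + proc (r + s) w)%R)) =
   fk U1 U2 r (fun y => f y * fk U1 U2 s h y) x)%E.
Proof.
move=> p1 p2 r0 s0 nf nh; rewrite -fk_mixed//.
have [f0 h0] := (nf.2, nh.2).
apply: nonmeasurable_ge0_ae_eq_integral => //.
- by move=> w; rewrite !mule_ge0// weight_ge0.
- by move=> w; rewrite !mule_ge0// weight_ge0.
apply: filterS (ae_good hX) => w gw.
rewrite weight_cat// proc_cat// addrA -!muleA; congr (_ * _)%E.
by rewrite muleCA.
Qed.

Lemma fk_semigroup U1 U2 r s x h : potential U1 -> potential U2 ->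
  0 <= r -> 0 <= s -> nnmeas h ->
  fk U1 U2 (r + s) h x = fk U1 U2 r (fk U1 U2 s h) x.
Proof.
move=> p1 p2 r0 s0 nh.
have n1 : nnmeas (cst 1%E) by split => // y; rewrite /= lee01.
have := @fk_two_times U1 U2 r s x (cst 1%E) h p1 p2 r0 s0 n1 nh.
under eq_integral do rewrite /= mul1e.
rewrite -/(fk U1 U2 (r + s) h x) => ->; congr (fk _ _ _ _ _).
by apply/funext => y /=; rewrite mul1e.
Qed.

End feynman_kac_kernel.

Lemma fk_time0 (R : realType) d dO (O : measurableType dO) (P : probability O R)
    (X : R -> O -> 'rV[R]_d) U1 U2 f y : levy_process P X -> nnmeas f ->
  fk P X U1 U2 0 f y = f y.
Proof.
move=> hX nf; rewrite -[RHS]mule1 -(probability_setT P) -integral_cst//.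
apply: nonmeasurable_ge0_ae_eq_integral => [w|w|].
- by rewrite mule_ge0 ?weight_ge0//; case: nf.
- exact: nf.2.
apply: filterS (ae_good hX) => w gw.
by rewrite /weight /additive_functional !set_itv1 !integral_set1 oppe0 adde0 expeR0 mul1e procE// gw.1 addr0.
Qed.

(** * Exponentials of primitives of integrable functions *)

Lemma expR_sub_quadratic (R : realType) (a b j : R) : 0 <= a -> a <= b ->
  expR (- b) * (b - a) <= j <= expR (- a) * (b - a) ->
  `|expR (- a) - expR (- b) - j| <= (b - a) ^+ 2.
Proof.
move=> a0 ab /andP[]; set K := b - a => j1 j2.
have a1 : expR (- a) <= 1 by rewrite expR_le1 oppr_le0.
have K0 : 0 <= K by rewrite subr_ge0.
have es : expR (- b) = expR (- a) * expR (- K) by rewrite -expRD /K; congr expR; ring.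
have er : expR (- a) = expR (- b) * expR K by rewrite -expRD /K; congr expR; ring.
have e1 : expR (- a) - expR (- b) <= expR (- a) * K.
  rewrite es -{1}(mulr1 (expR (- a))) -mulrBr ler_wpM2l ?expR_ge0//.
  have := expR_ge1Dx (- K); lra.
have e2 : expR (- b) * K <= expR (- a) - expR (- b).
  rewrite er -{3}(mulr1 (expR (- b))) -mulrBr ler_wpM2l ?expR_ge0//.
  have := expR_ge1Dx K; lra.
have e3 : (expR (- a) - expR (- b)) * K <= K ^+ 2.
  rewrite expr2 ler_wpM2r//; apply: (le_trans e1); rewrite ler_piMl//.
rewrite ler_norml; apply/andP; split; nra.
Qed.

Lemma mid_between (R : realFieldType) (a b : R) : a <= b ->
  Num.min a b <= (a + b) / 2 <= Num.max a b.
Proof. by move=> ab; rewrite min_l// max_r//; apply/andP; split; lra. Qed.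

Lemma bisection_step (R : realType) (a b m ea eb em j1 j2 p : R) : 0 <= p ->
  m = (a + b) / 2 -> `|ea - em - j1| <= (m - a) ^+ 2 * p ->
  `|em - eb - j2| <= (b - m) ^+ 2 * p ->
  `|ea - eb - (j1 + j2)| <= (b - a) ^+ 2 * (2^-1 * p).
Proof.
move=> p0 mE i1 i2.
have -> : ea - eb - (j1 + j2) = (ea - em - j1) + (em - eb - j2) by ring.
apply: (le_trans (ler_normD _ _)); apply: (le_trans (lerD i1 i2)).
by rewrite le_eqVlt mE; apply/orP; left; apply/eqP; field.
Qed.

Section exponential_of_primitive.
Variables (R : realType) (v : R -> R) (t : R).
Local Notation mu := (@lebesgue_measure R).
Hypotheses (mv : measurable_fun setT v) (v0 : forall s, 0 <= v s) (t0 : 0 <= t).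
Hypothesis iv : mu.-integrable `[0, t] (EFin \o v).

Let B (s : R) : R := \int[mu]_(u in `[0, s]) v u.
Let h (u : R) : R := v u * expR (- B u).
Let J (r s : R) : R := \int[mu]_(u in `]r, s]) h u.

Let sub_itv b1 r s : 0 <= r -> s <= t ->
  [set` Interval (BSide b1 r) (BRight s)] `<=` `[0, t].
Proof.
move=> r0 st u /=; rewrite !in_itv/= => /andP[ru us].
rewrite (le_trans us st) andbT (le_trans r0)//.
by move: ru; case: b1 => //= /ltW.
Qed.

Let ivS b1 r s : 0 <= r -> s <= t ->
  mu.-integrable [set` Interval (BSide b1 r) (BRight s)] (EFin \o v).
Proof. by move=> r0 st; apply: integrableS iv => //; exact: sub_itv. Qed.

Let BB r s : 0 <= r -> r <= s -> s <= t ->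
  \int[mu]_(u in `]r, s]) v u = B s - B r.
Proof.
move=> r0 rs st; rewrite /B (@Rintegral_itvB _ _ (BLeft 0) (BRight s))//.
exact: ivS.
Qed.

Let B_le r s : 0 <= r -> r <= s -> s <= t -> B r <= B s.
Proof.
move=> r0 rs st; rewrite -subr_ge0 -BB//.
by apply: Rintegral_ge0.
Qed.

Let cB : {within `[0, t], continuous B}.
Proof. exact: (parameterized_integral_continuous t0 iv). Qed.

Let ih : mu.-integrable `[0, t] (EFin \o h).
Proof.
apply: (le_integrable _ _ _ iv) => //.
- apply/measurable_EFinP; apply: measurable_funM; first exact: measurable_funTS.
  apply: measurableT_comp; first exact: measurable_expR.
  apply: measurableT_comp => //.
  by apply: subspace_continuous_measurable_fun => //; exact: cB.
- move=> u /=; rewrite in_itv/= => /andP[u0 ut].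
  rewrite lee_fin /h normrM ler_piMr// ger0_norm ?expR_ge0//.
  by rewrite expR_le1 oppr_le0; apply: Rintegral_ge0.
Qed.

Let ihS b1 r s : 0 <= r -> s <= t ->
  mu.-integrable [set` Interval (BSide b1 r) (BRight s)] (EFin \o h).
Proof. by move=> r0 st; apply: integrableS ih => //; exact: sub_itv. Qed.

Let J_add r m s : 0 <= r -> r <= m -> m <= s -> s <= t -> J r s = J r m + J m s.
Proof.
move=> r0 rm ms st; rewrite /J -(@Rintegral_itvB _ h (BRight r) (BRight s) m)//; last exact: ihS.
by rewrite addrC subrK.
Qed.

Let J_bounds r s : 0 <= r -> r <= s -> s <= t ->
  expR (- B s) * (B s - B r) <= J r s <= expR (- B r) * (B s - B r).
Proof.
move=> r0 rs st; rewrite -BB//.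
have iZ c : mu.-integrable `]r, s] (EFin \o (fun u => c * v u)).
  rewrite (_ : EFin \o _ = (fun x => c%:E * (EFin \o v) x)%E)//.
  by apply: integrableZl => //; exact: ivS.
rewrite -!RintegralZl//; [|exact: ivS|exact: ivS].
apply/andP; split; apply: le_Rintegral => //; try exact: ihS; try exact: iZ.
  move=> u /=; rewrite in_itv/= => /andP[ru us]; rewrite /h mulrC ler_wpM2l//.
  rewrite ler_expR lerN2 B_le//; exact: le_trans (ltW ru).
move=> u /=; rewrite in_itv/= => /andP[ru us]; rewrite /h [leRHS]mulrC ler_wpM2l//.
by rewrite ler_expR lerN2 B_le// ?(ltW ru)// (le_trans us).
Qed.

(** [v] is only integrable, so the increments of [B] over a uniform time mesh are not controlled.
    The interval is cut instead where [B] takes its mean value: this halves the increments of [B]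
    and hence the sum of their squares. *)
Let quadratic_error k r s : 0 <= r -> r <= s -> s <= t ->
  `|expR (- B r) - expR (- B s) - J r s| <= (B s - B r) ^+ 2 / 2 ^+ k.
Proof.
elim: k r s => [|k IH] r s r0 rs st.
  by rewrite expr0 divr1; apply: expR_sub_quadratic; [exact: Rintegral_ge0|exact: B_le|exact: J_bounds].
have [m mrs mE] : exists2 m, m \in `[r, s] & B m = (B r + B s) / 2.
  apply: IVT => //.
    apply: continuous_subspaceW cB; exact: (@sub_itv true).
  exact: mid_between (B_le r0 rs st).
move: mrs; rewrite in_itv/= => /andP[rm ms].
have i1 := IH r m r0 rm (le_trans ms st); have i2 := IH m s (le_trans r0 rm) ms st.
rewrite (J_add r0 rm ms st).
rewrite [2 ^+ k.+1]exprS invfM; apply: (bisection_step _ mE i1 i2).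
by rewrite invr_ge0 exprn_ge0.
Qed.

(** The fundamental theorem of calculus for [exp (- B)], [B] being the primitive of [v]: the
    discrepancy is at most [B t ^ 2 / 2 ^ k] for every [k]. *)
Lemma integral_expR_primitive :
  \int[mu]_(s in `[0, t]) (v s * expR (- \int[mu]_(u in `[0, s]) v u)) =
  1 - expR (- \int[mu]_(u in `[0, t]) v u).
Proof.
have B0 : B 0 = 0 by rewrite /B set_itv1 Rintegral_set1.
have -> : \int[mu]_(s in `[0, t]) (v s * expR (- \int[mu]_(u in `[0, s]) v u)) = J 0 t.
  by rewrite /J Rintegral_itv_obnd_cbnd//; exact: ihS.
apply/eqP; rewrite eq_sym -subr_eq0 -normr_le0; apply/ler_addgt0Pl => e e0.
rewrite addr0 -/(B t).
have q k : `|1 - expR (- B t) - J 0 t| <= B t ^+ 2 / 2 ^+ k.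
  by have := quadratic_error k (lexx 0) t0 (lexx t); rewrite B0 oppr0 expR0 addr0.
have [k kP] : exists k, B t ^+ 2 / 2 ^+ k < e.
  have Bt0 : 0 < B t ^+ 2 + 1 by rewrite ltr_wpDl ?sqr_ge0.
  have ep : 0 < e / (B t ^+ 2 + 1) by rewrite divr_gt0.
  have [m _ hm] := near_infty_natSinv_expn_lt (PosNum ep).
  exists m; have := hm m (leqnn m); rewrite /= ltr_pdivlMr// div1r => h1.
  have p : 0 < (2 ^+ m)^-1 :> R by rewrite invr_gt0 exprn_gt0.
  nra.
exact: le_trans (q k) (ltW kP).
Qed.

End exponential_of_primitive.

Section exponential_of_primitive_ereal.
Local Open Scope ereal_scope.
Variables (R : realType) (v : R -> R) (t : R).
Local Notation mu := (@lebesgue_measure R).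
Hypotheses (mv : measurable_fun setT v) (v0 : forall s, (0 <= v s)%R) (t0 : (0 <= t)%R).

Lemma primitive_le r s : (r <= s)%R ->
  \int[mu]_(u in `[0%R, r]) (v u)%:E <= \int[mu]_(u in `[0%R, s]) (v u)%:E.
Proof.
move=> rs; apply: ge0_subset_integral => //.
- by apply/measurable_EFinP; exact: measurable_funTS.
- by move=> u _; rewrite lee_fin.
- by move=> u /=; rewrite !in_itv/= => /andP[-> /le_trans]; apply.
Qed.

Lemma integral_expeR_primitive : \int[mu]_(u in `[0%R, t]) (v u)%:E < +oo ->
  expeR (- \int[mu]_(u in `[0%R, t]) (v u)%:E) +
  \int[mu]_(s in `[0%R, t]) ((v s)%:E * expeR (- \int[mu]_(u in `[0%R, s]) (v u)%:E)) = 1.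
Proof.
move=> At.
have iv : mu.-integrable `[0%R, t] (EFin \o v).
  apply/integrableP; split; first by apply/measurable_EFinP; exact: measurable_funTS.
  by under eq_integral do rewrite /= ger0_norm//.
have AE s : (s <= t)%R -> \int[mu]_(u in `[0%R, s]) (v u)%:E =
    (\int[mu]_(u in `[0%R, s]) v u)%:E.
  move=> st; rewrite /Rintegral fineK// ge0_fin_numE.
    exact: le_lt_trans (primitive_le st) At.
  by apply: integral_ge0 => u _; rewrite lee_fin.
have AE' s : (s <= t)%R -> expeR (- \int[mu]_(u in `[0%R, s]) (v u)%:E) =
    (expR (- \int[mu]_(u in `[0%R, s]) v u))%:E.
  by move=> st; rewrite AE.
rewrite AE'//.
have -> : \int[mu]_(s in `[0%R, t]) ((v s)%:E * expeR (- \int[mu]_(u in `[0%R, s]) (v u)%:E)) =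
    \int[mu]_(s in `[0%R, t]) (v s * expR (- \int[mu]_(u in `[0%R, s]) v u))%:E.
  by apply: eq_integral => s; rewrite inE/= in_itv/= => /andP[_ st]; rewrite AE'.
have H := integral_expR_primitive mv v0 t0 iv.
rewrite /Rintegral in H.
rewrite -(fineK (x := \int[mu]_(s in `[0%R, t]) (v s * expR (- \int[mu]_(u in `[0%R, s]) v u))%:E)).
  by rewrite /Rintegral in H *; rewrite H -EFinD addrC subrK.
rewrite ge0_fin_numE; last first.
  by apply: integral_ge0 => s _; rewrite lee_fin mulr_ge0 ?expR_ge0.
apply: le_lt_trans At; apply: ge0_le_integral => //.
- by move=> s _; rewrite lee_fin mulr_ge0 ?expR_ge0.
- apply/measurable_EFinP; apply: measurable_funM; first exact: measurable_funTS.
  apply: measurableT_comp; first exact: measurable_expR.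
  apply: measurableT_comp => //.
  apply: subspace_continuous_measurable_fun => //.
  exact: (parameterized_integral_continuous t0 iv).
- by apply/measurable_EFinP; exact: measurable_funTS.
- move=> s _; rewrite lee_fin ler_piMr// expR_le1 oppr_le0.
  by apply: Rintegral_ge0.
Qed.

End exponential_of_primitive_ereal.

Section tonelli_interval.
Local Open Scope ereal_scope.
Variables (R : realType) (dT : measure_display) (T : measurableType dT)
  (m : {sigma_finite_measure set T -> \bar R}).
Local Notation mu := (@lebesgue_measure R).

Lemma tonelli_interval (a b : R) (f : T * measurableTypeR R -> \bar R) :
  measurable_fun setT f -> (forall z, 0 <= f z) ->
  \int[m]_x \int[mu]_(s in `[a, b]) f (x, s) = \int[mu]_(s in `[a, b]) \int[m]_x f (x, s).
Proof.
move=> mf f0.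
pose g (z : T * measurableTypeR R) := if (a <= z.2 <= b)%R then f z else 0.
have mg : measurable_fun setT g.
  apply: measurable_fun_ifT => //.
  by apply: measurable_and; apply: measurable_fun_ler; meas.
have g0 z : 0 <= g z by rewrite /g; case: ifP.
have mkc (h : R -> \bar R) : \int[mu]_(s in `[a, b]) h s =
    \int[mu]_s (if (a <= s <= b)%R then h s else 0).
  rewrite integral_mkcond; apply: eq_integral => s _; rewrite patchE.
  by rewrite mem_setE in_itv.
transitivity (\int[m]_x \int[mu]_s g (x, s)).
  by apply: eq_integral => x _; rewrite mkc.
rewrite (fubini_tonelli g mg g0) mkc; apply: eq_integral => s _.
rewrite /g/=; case: ifP => // _.
by rewrite integral0.
Qed.

Lemma measurable_integral_interval (a : R) (f : T * measurableTypeR R -> \bar R) (b : T -> R) :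
  measurable_fun setT (b : T -> measurableTypeR R) ->
  measurable_fun setT f -> (forall z, 0 <= f z) ->
  measurable_fun setT (fun x => \int[mu]_(s in `[a, b x]) f (x, s)).
Proof.
move=> mb mf f0.
pose g (z : T * measurableTypeR R) := if (a <= z.2 <= b z.1)%R then f z else 0.
have mg : measurable_fun setT g.
  apply: measurable_fun_ifT => //.
  apply: measurable_and; apply: measurable_fun_ler; meas.
  by apply: (measurableT_comp mb); meas.
have g0 z : 0 <= g z by rewrite /g; case: ifP.
have := measurable_fun_fubini_tonelli_F (m2 := mu) g mg g0.
congr (measurable_fun _ _); apply/funext => x.
rewrite integral_mkcond; apply: eq_integral => s _; rewrite patchE.
by rewrite mem_setE in_itv.
Qed.

End tonelli_interval.

(** * Calculus of Feynman-Kac kernels and of their potentials *)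

Section kernel_calculus.
Local Open Scope ereal_scope.
Variables (R : realType) (d : nat) (dO : measure_display) (O : measurableType dO).
Variables (P : probability O R) (X : R -> O -> 'rV[R]_d).
Hypothesis hX : levy_process P X.
Local Notation E := 'rV[R]_d.
Local Notation S := (paths R d (nat * nat)).
Local Notation mu := (@lebesgue_measure R).
Local Notation Y := (post_path X 0).
Local Notation proc := (proc X).
Local Notation afun := additive_functional.
Local Notation fk := (fk P X).
Implicit Types (f g : E -> \bar R) (U : E -> R).

Lemma measurable_shifted_path U x z : potential U ->
  measurable_fun setT (fun s : measurableTypeR R => (U (x + path_at z s)%R)%:E).
Proof.
move=> [mU _]; apply/measurable_EFinP.
apply: (measurableT_comp (measurable_shifted mU)
  (g := fun s : measurableTypeR R => (x, z, s))).
by meas.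
Qed.

Lemma afun_mono_time U r s x z : potential U -> (r <= s)%R -> afun U r x z <= afun U s x z.
Proof.
move=> pU rs; apply: primitive_le rs; last by move=> u; case: pU.
by apply/measurable_EFinP; exact: measurable_shifted_path.
Qed.

Lemma afun_mono U U' t x z : potential U -> potential U' -> (forall y, U y <= U' y)%R ->
  afun U t x z <= afun U' t x z.
Proof.
move=> pU pU' UU'; apply: ge0_le_integral.
- exact: measurable_itv.
- by move=> s _; rewrite lee_fin; case: pU.
- by apply: measurable_funTS; exact: measurable_shifted_path.
- by apply: measurable_funTS; exact: measurable_shifted_path.
- by move=> s _; rewrite lee_fin.
Qed.

Lemma afunD U U' t x z : potential U -> potential U' ->
  afun (fun y => U y + U' y)%R t x z = afun U t x z + afun U' t x z.
Proof.
move=> pU pU'; rewrite /additive_functional -ge0_integralD.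
- by apply: eq_integral => s _; rewrite EFinD.
- exact: measurable_itv.
- by move=> s _; rewrite lee_fin; case: pU.
- by apply: measurable_funTS; exact: measurable_shifted_path.
- by move=> s _; rewrite lee_fin; case: pU'.
- by apply: measurable_funTS; exact: measurable_shifted_path.
Qed.

Lemma potentialD U U' : potential U -> potential U' -> potential (fun y => U y + U' y)%R.
Proof.
move=> [mU U0] [mU' U0']; split; first exact: measurable_funD.
by move=> y; rewrite addr_ge0.
Qed.

Lemma weight_mono U1 U2 U1' U2' t x z : potential U1 -> potential U2 ->
  potential U1' -> potential U2' ->
  (forall y, U1' y <= U1 y)%R -> (forall y, U2 y <= U2' y)%R ->
  weight U1 U2 t x z <= weight U1' U2' t x z.
Proof.
move=> p1 p2 p1' p2' h1 h2; rewrite /weight lee_expeR leeD//; last exact: afun_mono.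
by rewrite leeN2; exact: afun_mono.
Qed.

Section fixed_potentials.
Variables (U1 U2 : E -> R).
Hypotheses (p1 : potential U1) (p2 : potential U2).
Local Notation T := (fk U1 U2).

Lemma le_fk t f g x : nnmeas f -> nnmeas g -> (forall y, f y <= g y) -> T t f x <= T t g x.
Proof.
move=> [mf f0] [mg g0] fg; apply: ge0_le_integral.
- exact: measurableT.
- by move=> w _; rewrite mule_ge0// weight_ge0.
- by apply: (measurable_fk_integrandx hX).
- by apply: (measurable_fk_integrandx hX).
- by move=> w _; apply: lee_wpmul2l => //; exact: weight_ge0.
Qed.

Lemma fkZ t c f x : nnmeas f -> 0 <= c -> T t (fun y => c * f y) x = c * T t f x.
Proof.
move=> [mf f0] c0; rewrite /fk -ge0_integralZl.
- by apply: eq_integral => w _; rewrite muleCA.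
- exact: measurableT.
- by apply: (measurable_fk_integrandx hX).
- by move=> w _; rewrite mule_ge0// weight_ge0.
- exact: c0.
Qed.

Lemma fkD t f g x : nnmeas f -> nnmeas g ->
  T t (fun y => f y + g y) x = T t f x + T t g x.
Proof.
move=> [mf f0] [mg g0]; rewrite /fk -ge0_integralD.
- by apply: eq_integral => w _; rewrite ge0_muleDr.
- exact: measurableT.
- by move=> w _; rewrite mule_ge0// weight_ge0.
- by apply: (measurable_fk_integrandx hX).
- by move=> w _; rewrite mule_ge0// weight_ge0.
- by apply: (measurable_fk_integrandx hX).
Qed.

Lemma fk_integral t a b (F : E * measurableTypeR R -> \bar R) x :
  measurable_fun setT F -> (forall z, 0 <= F z) ->
  T t (fun y => \int[mu]_(s in `[a, b]) F (y, s)) x =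
  \int[mu]_(s in `[a, b]) T t (fun y => F (y, s)) x.
Proof.
move=> mF F0; rewrite /fk.
have mG : measurable_fun setT (fun z : O * measurableTypeR R =>
    weight U1 U2 t x (Y z.1) * F ((x + proc t z.1)%R, z.2)).
  apply: emeasurable_funM.
    apply: (measurableT_comp (measurable_weight p1 p2)
      (g := fun z : O * measurableTypeR R => (t : measurableTypeR R, x, Y z.1))).
    meas; apply: (measurableT_comp (measurable_post_path hX (lexx 0%R))); meas.
  apply: (measurableT_comp mF
    (g := fun z : O * measurableTypeR R => ((x + proc t z.1)%R, z.2))).
  meas; apply: measurable_path_at_comp; meas.
  by apply: (measurableT_comp (measurable_post_path hX (lexx 0%R))); meas.
rewrite -(tonelli_interval P _ _ mG); last first.
  by move=> z; rewrite mule_ge0// weight_ge0.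
apply: eq_integral => w _; symmetry; rewrite /= ge0_integralZl.
- by [].
- exact: measurable_itv.
- apply: measurable_funTS.
  apply: (measurableT_comp mF (g := fun s : measurableTypeR R => ((x + proc t w)%R, s))).
  by meas.
- by move=> s _; exact: F0.
- exact: weight_ge0.
Qed.

Definition green_pot (t : R) f (x : E) : \bar R := \int[mu]_(s in `[0%R, t]) T s f x.

Lemma measurable_fk_time f x : nnmeas f ->
  measurable_fun setT (fun s : measurableTypeR R => T s f x).
Proof.
move=> nf; apply: (measurableT_comp (measurable_fk2 hX p1 p2 nf)
  (g := fun s : measurableTypeR R => (s, x))).
by meas.
Qed.

Lemma nnmeas_green t f : nnmeas f -> nnmeas (green_pot t f).
Proof.
move=> nf; split; last first.
  by move=> x; apply: integral_ge0 => s _; apply: fk_ge0; case: nf.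
apply: (measurable_integral_interval 0 (b := cst t)
  (f := fun z : E * measurableTypeR R => T z.2 f z.1)).
- by meas.
- apply: (measurableT_comp (measurable_fk2 hX p1 p2 nf)
    (g := fun z : E * measurableTypeR R => (z.2, z.1))).
  by meas.
- by move=> z; apply: fk_ge0; case: nf.
Qed.

Lemma fk_green r t f x : nnmeas f -> (0 <= r)%R -> (0 <= t)%R ->
  T r (green_pot t f) x = \int[mu]_(s in `[r, (r + t)%R]) T s f x.
Proof.
move=> nf r0 t0; rewrite /green_pot.
rewrite (fk_integral r 0%R t (F := fun z : E * measurableTypeR R => T z.2 f z.1)).
- have := @ge0_integral_shift R r 0 t (fun s => T s f x) (measurable_fk_time x nf).
  rewrite add0r (addrC t r) => ->; last by move=> s; apply: fk_ge0; case: nf.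
  apply: eq_integral => s; rewrite inE/= in_itv/= => /andP[s0 _].
  by rewrite addrC (fk_semigroup hX).
- apply: (measurableT_comp (measurable_fk2 hX p1 p2 nf)
    (g := fun z : E * measurableTypeR R => (z.2, z.1))).
  by meas.
- by move=> z; apply: fk_ge0; case: nf.
Qed.

Lemma le_green t t' f x : nnmeas f -> (t <= t')%R -> green_pot t f x <= green_pot t' f x.
Proof.
move=> nf tt'; apply: ge0_subset_integral.
- exact: measurable_itv.
- exact: measurable_itv.
- by apply: measurable_funTS; exact: measurable_fk_time.
- by move=> s _; apply: fk_ge0; case: nf.
- by move=> u /=; rewrite !in_itv/= => /andP[-> /le_trans]; apply.
Qed.

Lemma le_green_fun t f g x : nnmeas f -> nnmeas g -> (forall y, f y <= g y) ->
  green_pot t f x <= green_pot t g x.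
Proof.
move=> nf ng fg; apply: ge0_le_integral.
- exact: measurable_itv.
- by move=> s _; apply: fk_ge0; case: nf.
- by apply: measurable_funTS; exact: measurable_fk_time.
- by apply: measurable_funTS; exact: measurable_fk_time.
- by move=> s _; exact: le_fk.
Qed.

Lemma green_add r t f x : nnmeas f -> (0 <= r)%R -> (0 <= t)%R ->
  green_pot (r + t) f x = green_pot r f x + T r (green_pot t f) x.
Proof.
move=> nf r0 t0; rewrite fk_green//.
have m1 : measurable (`[0%R, r[%classic : set R) by exact: measurable_itv.
have m2 : measurable (`[r, (r + t)%R]%classic : set R) by exact: measurable_itv.
have dis : [disjoint `[0%R, r[%classic & `[r, (r + t)%R]%classic : set R].
  apply/disj_setPS => u /=; rewrite !in_itv/= => -[/andP[_ ur] /andP[ru _]].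
  by have := lt_le_trans ur ru; rewrite ltxx.
have mall D : measurable_fun D (fun s => T s f x).
  by apply: measurable_funTS; exact: measurable_fk_time.
have T0 (D : set R) u : D u -> 0 <= T u f x by move=> _; apply: fk_ge0; case: nf.
rewrite /green_pot (@itv_bndbnd_setU _ _ (BLeft 0%R) (BLeft r) (BRight (r + t)%R)) ?bnd_simp ?lerDl//.
rewrite (ge0_integral_setU mu m1 m2 (mall _) (T0 _) dis).
by rewrite integral_itv_bndo_bndc//; exact: mall.
Qed.

End fixed_potentials.

Lemma fk_mono_pot U1 U2 U1' U2' t f x : potential U1 -> potential U2 ->
  potential U1' -> potential U2' ->
  (forall y, U1' y <= U1 y)%R -> (forall y, U2 y <= U2' y)%R -> nnmeas f ->
  fk U1 U2 t f x <= fk U1' U2' t f x.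
Proof.
move=> p1 p2 p1' p2' h1 h2 [mf f0]; apply: ge0_le_integral.
- exact: measurableT.
- by move=> w _; rewrite mule_ge0// weight_ge0.
- by apply: (measurable_fk_integrandx hX).
- by apply: (measurable_fk_integrandx hX).
- by move=> w _; apply: lee_wpmul2r => //; exact: weight_mono.
Qed.

Lemma green_mono_pot U1 U2 U1' U2' t f x : potential U1 -> potential U2 ->
  potential U1' -> potential U2' ->
  (forall y, U1' y <= U1 y)%R -> (forall y, U2 y <= U2' y)%R -> nnmeas f ->
  green_pot U1 U2 t f x <= green_pot U1' U2' t f x.
Proof.
move=> p1 p2 p1' p2' h1 h2 nf; apply: ge0_le_integral.
- exact: measurable_itv.
- by move=> s _; apply: fk_ge0; case: nf.
- by apply: measurable_funTS; exact: measurable_fk_time.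
- by apply: measurable_funTS; exact: measurable_fk_time.
- by move=> s _; exact: fk_mono_pot.
Qed.

Lemma integral_weight_afun U1 U2 U t x : potential U1 -> potential U2 -> potential U ->
  \int[P]_w (\int[mu]_(s in `[0%R, t]) (weight U1 U2 s x (Y w) * (U (x + proc s w)%R)%:E)) =
  green_pot U1 U2 t (EFin \o U) x.
Proof.
move=> p1 p2 pU.
have mG : measurable_fun setT (fun z : O * measurableTypeR R =>
    weight U1 U2 z.2 x (Y z.1) * (U (x + proc z.2 z.1)%R)%:E).
  apply: (measurableT_comp (measurable_fk_integrand hX p1 p2 (f := EFin \o U) _)
    (g := fun z : O * measurableTypeR R => (z.2, x, z.1))).
    by apply/measurable_EFinP; case: pU.
  by meas.
rewrite (tonelli_interval P _ _ mG)//.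
by move=> z; rewrite mule_ge0 ?weight_ge0// lee_fin; case: pU.
Qed.

Lemma integral_afun U t x : potential U ->
  \int[P]_w afun U t x (Y w) = green_pot (cst 0%R) (cst 0%R) t (EFin \o U) x.
Proof.
move=> pU.
rewrite -(integral_weight_afun t x (potential0 R d) (potential0 R d) pU).
apply: eq_integral => w _; apply: eq_integral => s _.
by rewrite weight0 mul1e.
Qed.

Lemma measurable_afun_w U t x : potential U ->
  measurable_fun setT (fun w => afun U t x (Y w)).
Proof.
move=> pU; apply: (measurableT_comp (measurable_afun pU)
  (g := fun w => (t : measurableTypeR R, x, Y w))).
by meas; apply: (measurable_post_path hX (lexx 0%R)).
Qed.

Lemma measurable_weight_w U1 U2 t x : potential U1 -> potential U2 ->
  measurable_fun setT (fun w => weight U1 U2 t x (Y w)).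
Proof.
move=> p1 p2; apply: (measurableT_comp (measurable_weight p1 p2)
  (g := fun w => (t : measurableTypeR R, x, Y w))).
by meas; apply: (measurable_post_path hX (lexx 0%R)).
Qed.

End kernel_calculus.

(** * The Kato class *)

Lemma afunZ (R : realType) d (c : R) (U : 'rV[R]_d -> R) t x z : 0 <= c -> potential U ->
  additive_functional (fun y => c * U y) t x z = (c%:E * additive_functional U t x z)%E.
Proof.
move=> c0 pU; have U0 := pU.2; rewrite /additive_functional -ge0_integralZl.
- by apply: eq_integral => s _; rewrite EFinM.
- exact: measurable_itv.
- by apply: measurable_funTS; exact: measurable_shifted_path.
- by move=> s _; rewrite lee_fin.
- by rewrite lee_fin.
Qed.

Section kato_class.
Local Open Scope ereal_scope.
Variables (R : realType) (d : nat) (dO : measure_display) (O : measurableType dO).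
Variables (P : probability O R) (X : R -> O -> 'rV[R]_d).
Hypothesis hX : levy_process P X.
Local Notation E := 'rV[R]_d.
Local Notation S := (paths R d (nat * nat)).
Local Notation mu := (@lebesgue_measure R).
Local Notation Y := (post_path X 0).
Local Notation proc := (proc X).
Local Notation afun := additive_functional.
Local Notation fk := (fk P X).
Local Notation green := (green_pot P X).
Local Notation zero := (cst 0%R : E -> R).
Implicit Types (f g : E -> \bar R) (U : E -> R).

Let p0 := potential0 R d.

Lemma nnmeas1 : nnmeas (cst 1 : E -> \bar R).
Proof. by split => // x; rewrite /= lee01. Qed.

Lemma nnmeas_EFin U : potential U -> nnmeas (EFin \o U).
Proof. by move=> [mU U0]; split=> [|x]; [exact/measurable_EFinP|rewrite lee_fin]. Qed.

Definition kato_pot U := potential U /\ forall e, (0 < e)%R ->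
  exists t, (0 < t)%R /\ forall x, green zero zero t (EFin \o U) x <= e%:E.

Lemma kato_potP U : (forall x, (0 <= U x)%R) -> kato P X U -> kato_pot U.
Proof.
move=> U0 [mU cU]; have pU : potential U by [].
split; first by [].
move=> e e0.
have : \forall t \near (0%R : R)^'+, ereal_sup (range (fun x : E =>
    \int[P]_w \int[mu]_(s in `[0%R, t]) `|(U (x + X s w)%R)%:E|)) < e%:E.
  by apply: (cU [set y | y < e%:E]); apply: open_ereal_lt'; rewrite lte_fin.
move=> h; have h2 : \forall t \near (0%R : R)^'+, (0 < t)%R by exact: nbhs_right_gt.
have [t [t1 t0]] := filter_ex (filterI h h2).
exists t; split; first exact: t0.
move=> x; apply: le_trans (ltW t1).
apply: ereal_sup_ubound; exists x => //.
rewrite -(integral_afun hX t x pU); apply: nonmeasurable_ge0_ae_eq_integral.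
- by move=> w; apply: integral_ge0 => s _; exact: abse_ge0.
- by move=> w; exact: afun_ge0.
apply: filterS (ae_good hX) => w gw.
apply: eq_integral => s; rewrite inE/= in_itv/= => /andP[s0 _].
by rewrite ger0_norm// -(procE gw s0).
Qed.

Lemma kato_potD U U' : kato_pot U -> kato_pot U' -> kato_pot (fun x => U x + U' x)%R.
Proof.
move=> [pU kU] [pU' kU']; split; first exact: potentialD.
move=> e e0; have e20 : (0 < e / 2)%R by rewrite divr_gt0.
have [t [t0 tU]] := kU _ e20; have [t' [t0' tU']] := kU' _ e20.
exists (Num.min t t'); split; first by rewrite lt_min t0.
move=> x; rewrite -(integral_afun hX); last exact: potentialD.
under eq_integral do rewrite afunD//.
rewrite ge0_integralD//; last 4 first.
- by move=> w _; exact: afun_ge0.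
- exact: (measurable_afun_w hX).
- by move=> w _; exact: afun_ge0.
- exact: (measurable_afun_w hX).
rewrite !(integral_afun hX)// [e]splitr EFinD; apply: leeD.
  apply: le_trans (tU x); apply: (le_green hX) => //; first exact: nnmeas_EFin.
  by rewrite ge_min lexx.
apply: le_trans (tU' x); apply: (le_green hX) => //; first exact: nnmeas_EFin.
by rewrite ge_min lexx orbT.
Qed.

Lemma kato_pot_le U U' : potential U -> (forall x, (U x <= U' x)%R) -> kato_pot U' -> kato_pot U.
Proof.
move=> pU UU' [pU' kU']; split; first by [].
move=> e /kU'[t [t0 tU']]; exists t; split; first exact: t0.
move=> x.
by apply: le_trans (tU' x); apply: (le_green_fun hX) => //; exact: nnmeas_EFin.
Qed.

Lemma afun_cstM (c t : R) (x : E) (z : S) : (0 <= t)%R -> afun (cst c) t x z = (c * t)%:E.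
Proof.
move=> t0; rewrite /additive_functional /= integral_cst//= lebesgue_measure_itv/= lte_fin.
case: ltP => [_|t0']; first by rewrite -EFinB subr0.
have -> : t = 0%R by apply/eqP; rewrite eq_le t0 t0'.
by rewrite mule0 mulr0.
Qed.

Lemma kato_pot_cst (c : R) : (0 <= c)%R -> kato_pot (cst c).
Proof.
move=> c0; have pc : potential (cst c : E -> R) by split.
split; first by [].
move=> e e0; exists (e / (c + 1))%R.
have c1 : (0 < c + 1)%R by rewrite ltr_wpDl.
split; first by rewrite divr_gt0.
move=> x; rewrite -(integral_afun hX)//.
under eq_integral do rewrite afun_cstM ?divr_ge0 ?(ltW e0) ?(ltW c1)//.
rewrite integral_cst//= probability_setT mule1 lee_fin.
rewrite mulrA ler_pdivrMr// mulrC ler_wpM2l ?(ltW e0)//; lra.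
Qed.

Lemma kato_potZ (c : R) U : (0 < c)%R -> kato_pot U -> kato_pot (fun x => c * U x)%R.
Proof.
move=> c0 [[mU U0] kU].
have pcU : potential (fun x => c * U x)%R.
  by split; [exact: measurable_funM|move=> x; rewrite mulr_ge0// ltW].
split; first by [].
move=> e e0; have [t [t0 tU]] := kU _ (divr_gt0 e0 c0).
exists t; split; first exact: t0.
move=> x; rewrite -(integral_afun hX)//.
have -> : \int[P]_w afun (fun x => c * U x)%R t x (Y w) = \int[P]_w (c%:E * afun U t x (Y w)).
  by apply: eq_integral => w _; apply: afunZ => //; exact: ltW.
rewrite ge0_integralZl.
- rewrite (integral_afun hX)//; apply: (@le_trans _ _ (c%:E * (e / c)%:E)).
    by apply: lee_wpmul2l; [rewrite lee_fin ltW|exact: tU].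
  by rewrite -EFinM lee_fin mulrC divfK ?gt_eqF.
- exact: measurableT.
- exact: (measurable_afun_w hX).
- by move=> w _; exact: afun_ge0.
- by rewrite lee_fin ltW.
Qed.

Lemma measurable_fk_time_fun U1 U2 (G : measurableTypeR R * E -> \bar R) x :
  potential U1 -> potential U2 -> measurable_fun setT G -> (forall z, 0 <= G z) ->
  measurable_fun setT (fun s : measurableTypeR R => fk U1 U2 s (fun y => G (s, y)) x).
Proof.
move=> p1 p2 mG G0.
pose F (z : measurableTypeR R * O) : \bar R :=
  weight U1 U2 z.1 x (Y z.2) * G (z.1, (x + proc z.1 z.2)%R).
have mYc : measurable_fun setT (fun z : measurableTypeR R * O => Y z.2).
  by apply: (measurableT_comp (measurable_post_path hX (lexx 0%R))); meas.
have mF : measurable_fun setT F.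
  apply: emeasurable_funM.
    apply: (measurableT_comp (measurable_weight p1 p2)
      (g := fun z : measurableTypeR R * O => (z.1, x, Y z.2))).
    by meas.
  apply: (measurableT_comp mG (g := fun z : measurableTypeR R * O => (z.1, (x + proc z.1 z.2)%R))).
  by meas; apply: measurable_path_at_comp; meas.
apply: (measurable_fun_fubini_tonelli_F (m2 := P) F mF) => z.
by rewrite mule_ge0// weight_ge0.
Qed.

Section khasminskii.
Variables (U : E -> R).
Hypothesis pU : potential U.
Local Notation h t x := (fk zero U t (cst 1) x).

Let ptrans_weight t x w : weight zero U t x (Y w) = expeR (afun U t x (Y w)).
Proof. by rewrite /weight {1}/additive_functional /= integral0 oppe0 add0e. Qed.

Let hE t x : h t x = \int[P]_w expeR (afun U t x (Y w)).
Proof. by rewrite /fk; apply: eq_integral => w _; rewrite /= mule1 ptrans_weight. Qed.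

Lemma le_exp_moment s t x : (s <= t)%R -> h s x <= h t x.
Proof.
move=> st; rewrite !hE; apply: ge0_le_integral.
- exact: measurableT.
- by move=> w _; exact: expeR_ge0.
- by apply: measurableT_comp; [exact: measurable_expeR|exact: (measurable_afun_w hX)].
- by apply: measurableT_comp; [exact: measurable_expeR|exact: (measurable_afun_w hX)].
- by move=> w _; rewrite lee_expeR; exact: afun_mono_time.
Qed.

(** Along each path [exp A_t = 1 + int_0^t U(X_s) exp (A_t - A_s) ds], and the Markov property at
    [s] turns the remaining exponential into [h (t - s)]. *)
Lemma exp_moment_identity t x m : (forall y, (U y <= m)%R) -> (0 <= t)%R ->
  h t x = 1 + \int[mu]_(s in `[0%R, t]) fk zero zero s (fun y => (U y)%:E * h (t - s)%R y) x.
Proof.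
move=> Um t0.
have m0 : (0 <= m)%R by apply: (le_trans _ (Um 0%R)); case: pU.
have pm : potential (cst m : E -> R) by split.
have fin s w : (0 <= s)%R -> afun U s x (Y w) \is a fin_num.
  move=> s0; rewrite ge0_fin_numE; last exact: afun_ge0.
  apply: (@le_lt_trans _ _ (afun (cst m) s x (Y w))); first exact: afun_mono.
  by rewrite afun_cstM// ltry.
pose F (z : O * measurableTypeR R) : \bar R :=
  (U (x + proc z.2 z.1)%R)%:E * (expeR (afun U t x (Y z.1)) * expeR (- afun U z.2 x (Y z.1))).
have mYc : measurable_fun setT (fun z : O * measurableTypeR R => Y z.1).
  by apply: (measurableT_comp (measurable_post_path hX (lexx 0%R))); meas.
have mF : measurable_fun setT F.
  apply: emeasurable_funM.
    apply/measurable_EFinP; apply: measurableT_comp; first by case: pU.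
    by meas; apply: measurable_path_at_comp; meas.
  apply: emeasurable_funM.
    apply: measurableT_comp; first exact: measurable_expeR.
    by apply: (measurableT_comp (measurable_afun_w hX t x pU)); meas.
  apply: measurableT_comp; first exact: measurable_expeR.
  apply: measurableT_comp => //.
  apply: (measurableT_comp (measurable_afun pU)
    (g := fun z : O * measurableTypeR R => (z.2, x, Y z.1))).
  by meas.
have F0 z : 0 <= F z.
  by rewrite !mule_ge0 ?expeR_ge0// lee_fin; case: pU.
(* [integral_expeR_primitive] multiplied by [exp A_t], which is finite because [U] is bounded. *)
have pathid w : expeR (afun U t x (Y w)) = 1 + \int[mu]_(s in `[0%R, t]) F (w, s).
  have mv := measurable_shifted_path x (Y w) pU; move/measurable_EFinP in mv.
  have v0 (s : R) : (0 <= U (x + path_at (Y w) s)%R)%R by case: pU.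
  have lt : afun U t x (Y w) < +oo by rewrite -ge0_fin_numE ?afun_ge0// fin.
  have id := integral_expeR_primitive mv v0 t0 lt.
  have fA : afun U t x (Y w) \is a fin_num by exact: fin.
  set A := afun U t x (Y w) in lt fA *.
  have e1 : expeR A * expeR (- A) = 1 by rewrite -expeRD subee// expeR0.
  rewrite -[LHS]mule1 -[in LHS]id ge0_muleDr ?expeR_ge0//; last first.
    by apply: integral_ge0 => s _; rewrite mule_ge0 ?expeR_ge0// lee_fin.
  rewrite e1; congr (_ + _); rewrite -ge0_integralZl.
  - by apply: eq_integral => s _; rewrite /F/= muleCA.
  - exact: measurable_itv.
  - apply: measurable_funTS; apply: emeasurable_funM; first exact/measurable_EFinP.
    apply: measurableT_comp; first exact: measurable_expeR.
    apply: measurableT_comp => //.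
    apply: (measurableT_comp (measurable_afun pU)
      (g := fun s : measurableTypeR R => (s, x, Y w))).
    by meas.
  - by move=> s _; rewrite mule_ge0 ?expeR_ge0// lee_fin.
  - exact: expeR_ge0.
rewrite hE; under eq_integral do rewrite pathid.
rewrite ge0_integralD//; last 2 first.
- by move=> w _; apply: integral_ge0 => s _; exact: F0.
- apply: (measurable_integral_interval 0 (f := F) (b := cst t)) => //.
rewrite integral_cst//= probability_setT mule1; congr (_ + _).
rewrite (tonelli_interval P 0 t mF F0); apply: eq_integral => s.
rewrite inE/= in_itv/= => /andP[s0 st].
have ts0 : (0 <= t - s)%R by rewrite subr_ge0.
have := fk_mixed hX x p0 p0 p0 pU s0 ts0 (nnmeas_EFin pU) nnmeas1.
move=> <-; apply: nonmeasurable_ge0_ae_eq_integral.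
- by move=> w; exact: F0.
- by move=> w; rewrite !mule_ge0 ?weight_ge0//= ?lee01// lee_fin; case: pU.
apply: filterS (ae_good hX) => w gw.
rewrite /F/= weight0 mul1e mule1; congr (_ * _).
rewrite -{1}(subrKC s t) addrC (addrC (t - s)%R) (afun_cat _ pU gw s0 ts0).
have f1 := fin s w s0.
rewrite expeRD muleAC -expeRD subee// expeR0 mul1e.
by rewrite /weight {2}/additive_functional /= integral0 oppe0 add0e.
Qed.

(** The supremum [M] of [h t] satisfies [M <= 1 + M / 2]. The bound [m] serves to make [M] finite,
    so that it can be moved to the left; the result does not involve [m]. *)
Lemma exp_moment_bounded t m : (forall y, (U y <= m)%R) -> (0 <= t)%R ->
  (forall x, green zero zero t (EFin \o U) x <= (2^-1)%:E) -> forall x, h t x <= 2%:E.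
Proof.
move=> Um t0 gU.
have m0 : (0 <= m)%R by apply: (le_trans _ (Um 0%R)); case: pU.
have pm : potential (cst m : E -> R) by split.
pose M := ereal_sup (range (fun x => h t x)).
have hM x : h t x <= M by apply: ereal_sup_ubound; exists x.
have M0 : 0 <= M by apply: le_trans (hM 0%R); rewrite hE; apply: integral_ge0 => w _; exact: expeR_ge0.
have Mfin : M \is a fin_num.
  rewrite ge0_fin_numE//; apply: (@le_lt_trans _ _ (expR (m * t))%:E); last exact: ltry.
  apply: ub_ereal_sup => _ [x _ <-]; rewrite hE.
  apply: (@le_trans _ _ (\int[P]_w (cst (expR (m * t))%:E w))).
    apply: ge0_le_integral.
    - exact: measurableT.
    - by move=> w _; exact: expeR_ge0.
    - by apply: measurableT_comp; [exact: measurable_expeR|exact: (measurable_afun_w hX)].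
    - exact: measurable_cst.
    - move=> w _; rewrite -[leRHS]/(expeR (m * t)%:E) lee_expeR -(afun_cstM m x (Y w) t0).
      exact: afun_mono.
  by rewrite integral_cst//= probability_setT mule1.
have key x : h t x <= 1 + M * (2^-1)%:E.
  rewrite (exp_moment_identity x Um t0) leeD2l//.
  apply: (@le_trans _ _ (\int[mu]_(s in `[0%R, t]) (M * fk zero zero s (EFin \o U) x))).
    apply: ge0_le_integral.
    - exact: measurable_itv.
    - move=> s _; apply: fk_ge0 => y; rewrite mule_ge0//; first by rewrite lee_fin; case: pU.
      by apply: fk_ge0 => z; rewrite /= lee01.
    - apply: measurable_funTS.
      apply: (measurable_fk_time_fun (G := fun z => (U z.2)%:E * h (t - z.1)%R z.2)) => //.
        apply: emeasurable_funM.
          by apply/measurable_EFinP; apply: measurableT_comp; [case: pU|meas].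
        apply: (measurableT_comp (measurable_fk2 hX p0 pU nnmeas1)
          (g := fun z : measurableTypeR R * E => ((t - z.1)%R : measurableTypeR R, z.2))).
        meas; apply: measurable_funB; meas.
      move=> z; rewrite mule_ge0//; first by rewrite lee_fin; case: pU.
      by apply: fk_ge0 => y; rewrite /= lee01.
    - apply: measurable_funTS; apply: measurable_funeM; apply: (measurable_fk_time hX) => //.
      exact: nnmeas_EFin.
    - move=> s; rewrite /= in_itv/= => /andP[s0 st].
      rewrite -(fkZ hX p0 p0)//; last exact: nnmeas_EFin.
      apply: (le_fk hX) => //.
      + split; last by move=> y; rewrite mule_ge0//; [rewrite lee_fin; case: pU|apply: fk_ge0 => z; rewrite /= lee01].
        apply: emeasurable_funM; first by apply/measurable_EFinP; case: pU.
        by apply: (measurable_fk hX) => //; exact: nnmeas1.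
      + split; last by move=> y; rewrite mule_ge0// lee_fin; case: pU.
        by apply: measurable_funeM; apply/measurable_EFinP; case: pU.
      + move=> y; rewrite muleC; apply: lee_wpmul2r; first by rewrite lee_fin; case: pU.
        apply: le_trans (hM y); apply: le_exp_moment; lra.
  rewrite ge0_integralZl.
  - by apply: lee_wpmul2l => //; exact: gU.
  - exact: measurable_itv.
  - by apply: measurable_funTS; apply: (measurable_fk_time hX) => //; exact: nnmeas_EFin.
  - by move=> s _; apply: fk_ge0 => y; rewrite lee_fin; case: pU.
  - exact: M0.
have : M <= 1 + M * (2^-1)%:E by apply: ub_ereal_sup => _ [x _ <-]; exact: key.
move=> h1 x; apply: (le_trans (hM x)); move: h1.
rewrite -(fineK Mfin) -EFinM -EFinD !lee_fin; lra.
Qed.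

End khasminskii.

End kato_class.

(** * Khasminskii's lemma *)

Section khasminskii_lemma.
Local Open Scope ereal_scope.
Variables (R : realType) (d : nat) (dO : measure_display) (O : measurableType dO).
Variables (P : probability O R) (X : R -> O -> 'rV[R]_d).
Hypothesis hX : levy_process P X.
Local Notation E := 'rV[R]_d.
Local Notation S := (paths R d (nat * nat)).
Local Notation mu := (@lebesgue_measure R).
Local Notation Y := (post_path X 0).
Local Notation proc := (proc X).
Local Notation afun := additive_functional.
Local Notation fk := (fk P X).
Local Notation green := (green_pot P X).
Local Notation zero := (cst 0%R : E -> R).
Implicit Types (f g : E -> \bar R) (U : E -> R).

Let p0 := potential0 R d.

Lemma exp_momentE U t x : fk zero U t (cst 1) x = \int[P]_w expeR (afun U t x (Y w)).
Proof.
apply: eq_integral => w _; rewrite /= mule1 /weight {1}/additive_functional /=.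
by rewrite integral0 oppe0 add0e.
Qed.

(** The bound for the truncations [min (U, m)] is independent of [m], so monotone convergence, in
    time and then over paths, passes it to [U]. *)
Lemma exp_moment_small U t : potential U -> (0 <= t)%R ->
  (forall x, green zero zero t (EFin \o U) x <= (2^-1)%:E) ->
  forall x, fk zero U t (cst 1) x <= 2%:E.
Proof.
move=> pU t0 gU x.
pose Um (m : nat) y := Num.min (U y) m%:R.
have pUm m : potential (Um m).
  split; first by apply: measurable_minr; [case: pU|exact: measurable_cst].
  by move=> y; rewrite le_min ler0n andbT; case: pU.
have UmU m y : (Um m y <= U y)%R by rewrite ge_min lexx.
have Um_mono m n y : (m <= n)%N -> (Um m y <= Um n y)%R.
  by move=> mn; rewrite /Um le_min ge_min lexx/= ge_min ler_nat mn orbT.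
have hm m : fk zero (Um m) t (cst 1) x <= 2%:E.
  have b1 y : (Um m y <= m%:R)%R by rewrite ge_min lexx orbT.
  have b2 y : green zero zero t (EFin \o Um m) y <= (2^-1)%:E.
    by apply: le_trans (gU y); apply: (le_green_fun hX) => //; try (exact: nnmeas_EFin); move=> z; rewrite lee_fin.
  exact: (exp_moment_bounded hX (pUm m) b1 t0 b2 x).
pose g m w := expeR (afun (Um m) t x (Y w)).
have mg m : measurable_fun setT (g m).
  by apply: measurableT_comp; [exact: measurable_expeR|exact: (measurable_afun_w hX)].
have g0 m w : 0 <= g m w by exact: expeR_ge0.
have g_mono w m n : (m <= n)%N -> g m w <= g n w.
  by move=> mn; rewrite lee_expeR; apply: afun_mono => // y; exact: Um_mono.
have cvgA w : afun (Um m) t x (Y w) @[m --> \oo] --> afun U t x (Y w).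
  have -> : afun U t x (Y w) = \int[mu]_(s in `[0%R, t])
      limn (fun m => (Um m (x + path_at (Y w) s)%R)%:E).
    apply: eq_integral => s _; apply/esym/cvg_lim => //.
    apply: cvg_near_cst; exists (Num.truncn (U (x + path_at (Y w) s)%R)).+1 => // m /= Um'.
    congr EFin; rewrite /Um min_l//.
    by apply: ltW; apply: (lt_le_trans (truncnS_gt _)); rewrite ler_nat.
  apply: cvg_monotone_convergence.
  - exact: measurable_itv.
  - by move=> m; apply: measurable_funTS; exact: measurable_shifted_path.
  - by move=> m s _; rewrite lee_fin; case: (pUm m).
  - by move=> s _ m n mn; rewrite lee_fin Um_mono.
have glim w : expeR (afun U t x (Y w)) <= limn (g^~ w).
  have cg : cvgn (g^~ w) by apply: ereal_nondecreasing_is_cvgn => m n; exact: g_mono.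
  have gle m : g m w <= limn (g^~ w).
    have := @ereal_nondecreasing_cvgn _ (g^~ w) (fun a b => @g_mono w a b).
    by move/cvg_lim => ->//; apply: ereal_sup_ubound; exists m.
  have [y yE] := expeR_total (le_trans (g0 0%N w) (gle 0%N)).
  rewrite -yE lee_expeR -(cvg_lim (@ereal_hausdorff R) (cvgA w)); apply: lime_le.
    by apply/cvg_ex; eexists; exact: cvgA.
  by apply: nearW => m; rewrite -lee_expeR yE; exact: gle.
rewrite exp_momentE; apply: (@le_trans _ _ (\int[P]_w limn (g^~ w))).
  apply: ge0_le_integral => //.
  - by move=> w _; exact: expeR_ge0.
  - by apply: measurableT_comp; [exact: measurable_expeR|exact: (measurable_afun_w hX)].
  - apply: (emeasurable_fun_cvg g) => // w _.
    by apply: ereal_nondecreasing_is_cvgn => m n; exact: g_mono.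
rewrite monotone_convergence//; last by move=> w _ m n; exact: g_mono.
apply: lime_le.
  apply: ereal_nondecreasing_is_cvgn => m n mn; apply: ge0_le_integral => //.
  by move=> w _; exact: g_mono.
by apply: nearW => m; rewrite -exp_momentE; exact: hm.
Qed.

Lemma khasminskii U : kato_pot P X U -> exists c, (0 <= c)%R /\
  forall t x, (0 <= t)%R -> fk zero U t (cst 1) x <= (2 * expR (c * t))%:E.
Proof.
move=> [pU kU]; have i2 : (0 < 2^-1 :> R)%R by rewrite invr_gt0.
have [s [s0 gs]] := kU _ i2.
have h2 := exp_moment_small pU (ltW s0) gs.
have nh t := nnmeas_fk hX p0 pU t (@nnmeas1 R d).
have iter n x : fk zero U (n%:R * s)%R (cst 1) x <= (2 ^+ n)%:E.
  elim: n x => [|n IH] x.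
    rewrite mul0r expr0; apply: le_trans (_ : fk zero zero 0 (cst 1) x <= _).
      rewrite exp_momentE /fk; apply: ge0_le_integral.
      - exact: measurableT.
      - by move=> w _; exact: expeR_ge0.
      - by apply: measurableT_comp; [exact: measurable_expeR|exact: (measurable_afun_w hX)].
      - by apply: (measurable_fk_integrandx hX) => //; case: (@nnmeas1 R d).
      - move=> w _; rewrite weight0 mul1e /additive_functional set_itv1 integral_set1.
        by rewrite expeR0.
    rewrite /fk; under eq_integral do rewrite weight0 mul1e /=.
    by rewrite integral_cst//= probability_setT mule1.
  rewrite -natr1 mulrDl mul1r addrC (fk_semigroup hX x p0 pU (ltW s0) _ (@nnmeas1 R d)); last first.
    by rewrite mulr_ge0// ltW.
  apply: (@le_trans _ _ (fk zero U s (fun y => (2 ^+ n)%:E * cst 1 y) x)).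
    apply: (le_fk hX) => //.
    by split => [|y]; rewrite ?mule1 ?lee_fin ?exprn_ge0//=; exact: measurable_cst.
    by move=> y; rewrite /= mule1.
  rewrite (fkZ hX p0 pU)//.
  rewrite exprSr EFinM; apply: lee_wpmul2l; first by rewrite lee_fin exprn_ge0.
  exact: h2.
(* Each step of length [s] doubles the bound, [truncn (t / s) + 1] steps cover [t], and [2 <= e]
   converts the doublings into the exponential rate [s^-1]. *)
exists (s^-1)%R; split; first by rewrite invr_ge0 ltW.
move=> t x t0.
pose n := (Num.truncn (t / s)).+1.
have tn : (t <= n%:R * s)%R by rewrite -ler_pdivrMr// ltW// truncnS_gt.
apply: le_trans (le_exp_moment hX pU x tn) _; apply: le_trans (iter n x) _.
rewrite lee_fin /n exprS ler_wpM2l//.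
have e1 : (2 <= expR 1 :> R)%R by have := expR_ge1Dx (1 : R); lra.
apply: (@le_trans _ _ (expR 1 ^+ Num.truncn (t / s))%R).
  by rewrite lerXn2r// nnegrE ?expR_ge0.
rewrite -expRM_natl mulr1 ler_expR mulrC.
by rewrite truncn_le mulr_ge0// invr_ge0 ltW.
Qed.

Lemma ae_afun_fin U t x : kato_pot P X U -> (0 <= t)%R ->
  {ae P, forall w, afun U t x (Y w) < +oo}.
Proof.
move=> kU t0; have [pU _] := kU; have [c [c0 H]] := khasminskii kU.
have iA : P.-integrable setT (fun w => afun U t x (Y w)).
  apply/integrableP; split; first exact: (measurable_afun_w hX).
  apply: (@le_lt_trans _ _ (fk zero U t (cst 1) x)); last first.
    by apply: (le_lt_trans (H t x t0)); exact: ltry.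
  rewrite exp_momentE; apply: ge0_le_integral.
  - exact: measurableT.
  - by move=> w _; exact: abse_ge0.
  - by apply: measurableT_comp => //; exact: (measurable_afun_w hX).
  - by apply: measurableT_comp; [exact: measurable_expeR|exact: (measurable_afun_w hX)].
  - move=> w _; rewrite gee0_abs ?afun_ge0//; apply: le_trans (expeR_ge1Dx _).
    by rewrite leeDr.
apply: filterS (integrable_ae measurableT iA) => w /(_ I).
by rewrite ge0_fin_numE// afun_ge0.
Qed.

Lemma potential_funrpos (V : E -> R) : measurable_fun setT V -> potential (V^\+)%R.
Proof. by move=> mV; split => [|x]; [exact: measurable_funrpos|exact: funrpos_ge0]. Qed.

Lemma potential_funrneg (V : E -> R) : measurable_fun setT V -> potential (V^\-)%R.
Proof. by move=> mV; split => [|x]; [exact: measurable_funrneg|exact: funrneg_ge0]. Qed.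

(** The conventions differ when both time integrals are infinite: the exponent of [feynman_kac] is
    then [+oo] and that of [weight] is [-oo]. Almost sure finiteness of the creation integral rules
    this out. *)
Lemma feynman_kacE (V : E -> R) t (f : E -> R) x : measurable_fun setT V -> (0 <= t)%R ->
  {ae P, forall w, afun (V^\-)%R t x (Y w) < +oo} -> (forall y, (0 <= f y)%R) ->
  feynman_kac P X V t f x = fk (V^\+)%R (V^\-)%R t (EFin \o f) x.
Proof.
move=> mV t0 fin f0; apply: nonmeasurable_ge0_ae_eq_integral.
- by move=> w; rewrite mule_ge0 ?expeR_ge0// lee_fin.
- by move=> w; rewrite mule_ge0 ?weight_ge0// lee_fin.
apply: filterS2 (ae_good hX) fin => w gw fw.
rewrite -(procE gw t0) /weight; congr (expeR _ * _).
have -> : \int[mu]_(s in `[0%R, t]) (V (x + X s w)%R)%:E =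
    \int[mu]_(s in `[0%R, t]) (V (x + proc s w)%R)%:E.
  by apply: eq_integral => s; rewrite inE/= in_itv/= => /andP[s0 _]; rewrite procE.
rewrite integralE.
have -> : \int[mu]_(s in `[0%R, t]) ((fun s => (V (x + proc s w)%R)%:E)^\+ s) =
    afun (V^\+)%R t x (Y w).
  by apply: eq_integral => s _; rewrite funeposE /funrpos EFin_max.
have -> : \int[mu]_(s in `[0%R, t]) ((fun s => (V (x + proc s w)%R)%:E)^\- s) =
    afun (V^\-)%R t x (Y w).
  by apply: eq_integral => s _; rewrite funenegE /funrneg EFin_max.
rewrite fin_num_oppeB; first by [].
rewrite ge0_fin_numE; first exact: fw.
by apply: afun_ge0; exact: potential_funrneg.
Qed.

End khasminskii_lemma.

(** * A hitting estimate *)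

Section euclidean.
Variables (R : realType) (d : nat).
Local Notation E := 'rV[R]_d.
Implicit Types x y z : E.

Lemma dotvC x y : dotv x y = dotv y x.
Proof. by apply: eq_bigr => i _; rewrite mulrC. Qed.

Lemma dotvDl x y z : dotv (x + y) z = dotv x z + dotv y z.
Proof. by rewrite -big_split; apply: eq_bigr => i _; rewrite mxE mulrDl. Qed.

Lemma dotvDr x y z : dotv z (x + y) = dotv z x + dotv z y.
Proof. by rewrite !(dotvC z) dotvDl. Qed.

Lemma dotvZl a x y : dotv (a *: x) y = a * dotv x y.
Proof. by rewrite mulr_sumr; apply: eq_bigr => i _; rewrite mxE mulrA. Qed.

Lemma dotvZr a x y : dotv x (a *: y) = a * dotv x y.
Proof. by rewrite dotvC dotvZl dotvC. Qed.

Lemma dotv_ge0 x : 0 <= dotv x x.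
Proof. by apply: sumr_ge0 => i _; rewrite -expr2 sqr_ge0. Qed.

Lemma enorm_ge0 x : 0 <= enorm x. Proof. exact: sqrtr_ge0. Qed.

Lemma enorm_sqr x : enorm x ^+ 2 = dotv x x.
Proof. by rewrite sqr_sqrtr// dotv_ge0. Qed.

Lemma coord_le_enorm x i : `|x 0 i| <= enorm x.
Proof.
rewrite -(ler_pXn2r (n := 2)) ?nnegrE ?enorm_ge0// enorm_sqr real_normK ?num_real//.
by rewrite /dotv (bigD1 i)//= expr2 lerDl sumr_ge0// => j _; rewrite -expr2 sqr_ge0.
Qed.

Lemma enorm0_eq0 x : (enorm x == 0) = (x == 0).
Proof.
apply/eqP/eqP => [x0|->]; last by rewrite /enorm /dotv big1 ?sqrtr0// => i _; rewrite mxE mul0r.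
apply/rowP => i; rewrite mxE; apply/eqP; rewrite -normr_eq0 eq_le normr_ge0 andbT.
by rewrite -x0 coord_le_enorm.
Qed.

Lemma enorm0 : enorm (0 : E) = 0. Proof. by apply/eqP; rewrite enorm0_eq0. Qed.

Lemma enormZ a x : enorm (a *: x) = `|a| * enorm x.
Proof.
by rewrite /enorm dotvZl dotvZr mulrA -expr2 sqrtrM ?sqr_ge0// sqrtr_sqr.
Qed.

Lemma enormN x : enorm (- x) = enorm x.
Proof. by rewrite -scaleN1r enormZ normrN1 mul1r. Qed.

Lemma dotv_le x y : dotv x y <= enorm x * enorm y.
Proof.
have [->|x0] := eqVneq x 0.
  by rewrite enorm0 mul0r /dotv big1// => i _; rewrite mxE mul0r.
have [->|y0] := eqVneq y 0.
  by rewrite enorm0 mulr0 /dotv big1// => i _; rewrite mxE mulr0.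
have nx : 0 < enorm x by rewrite lt_def enorm_ge0 enorm0_eq0 x0.
have ny : 0 < enorm y by rewrite lt_def enorm_ge0 enorm0_eq0 y0.
have := dotv_ge0 (enorm y *: x + (- enorm x) *: y).
rewrite dotvDl !dotvDr !dotvZl !dotvZr (dotvC y x) -!enorm_sqr => H.
rewrite -(ler_pM2l (mulr_gt0 nx ny)); nra.
Qed.

Lemma normr_dotv_le x y : `|dotv x y| <= enorm x * enorm y.
Proof.
rewrite ler_norml dotv_le andbT lerNl -mulN1r -dotvZl scaleN1r -(enormN x).
exact: dotv_le.
Qed.

Lemma ler_enormD x y : enorm (x + y) <= enorm x + enorm y.
Proof.
rewrite -(ler_pXn2r (n := 2)) ?nnegrE ?addr_ge0 ?enorm_ge0//.
rewrite enorm_sqr dotvDl !dotvDr (dotvC y x) -!enorm_sqr.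
by have := dotv_le x y; nra.
Qed.

Lemma ler_enormB x y : enorm x - enorm y <= enorm (x - y).
Proof. by rewrite lerBlDr -{1}(subrK y x) ler_enormD. Qed.

Lemma enorm_sub x y : enorm (x - y) = enorm (y - x).
Proof. by rewrite -enormN opprB. Qed.

Lemma measurable_enorm dT (T : measurableType dT) (f : T -> E) :
  measurable_fun setT f -> measurable_fun setT (fun t => enorm (f t)).
Proof.
move=> mf; apply: (measurableT_comp (f := @Num.sqrt R)).
  by apply: continuous_measurable_fun; exact: sqrt_continuous.
apply: (measurable_sum (index_enum 'I_d) (h := fun i t => f t 0 i * f t 0 i)) => i.
by apply: measurable_funM; exact: measurable_rV_coord.
Qed.

Lemma measurable_enorm_id : measurable_fun setT (@enorm R d).
Proof. by apply: (@measurable_enorm _ _ id); exact: measurable_id. Qed.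

Lemma measurable_enorm_ge dT (T : measurableType dT) (f : T -> E) (a : R) :
  measurable_fun setT f -> measurable [set t | a <= enorm (f t)].
Proof.
move=> mf; rewrite (_ : [set _ | _] = (fun t => enorm (f t)) @^-1` `[a, +oo[%classic).
  exact: measurable_preimage (measurable_enorm mf) (measurable_itv _).
by apply/seteqP; split => t /=; rewrite in_itv/= andbT.
Qed.

End euclidean.

Lemma integral_itv_cat (R : realType) (a b c : R) (f : R -> \bar R) : a <= b -> b <= c ->
  measurable_fun setT f -> (forall x, 0 <= f x)%E ->
  (\int[lebesgue_measure]_(s in `[a, c]) f s =
   \int[lebesgue_measure]_(s in `[a, b]) f s + \int[lebesgue_measure]_(s in `[b, c]) f s)%E.
Proof.
move=> ab bc mf f0.
have m1 : measurable (`[a, b[%classic : set R) by exact: measurable_itv.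
have m2 : measurable (`[b, c]%classic : set R) by exact: measurable_itv.
have dis : [disjoint `[a, b[%classic & `[b, c]%classic : set R].
  apply/disj_setPS => u /=; rewrite !in_itv/= => -[/andP[_ ur] /andP[ru _]].
  by have := lt_le_trans ur ru; rewrite ltxx.
have mall (D : set R) : measurable_fun D f by apply: measurable_funTS.
have T0 (D : set R) u : D u -> (0 <= f u)%E by [].
rewrite (@itv_bndbnd_setU _ _ (BLeft a) (BLeft b) (BRight c)) ?bnd_simp//.
rewrite (ge0_integral_setU (@lebesgue_measure R) m1 m2 (mall _) (T0 _) dis).
by rewrite integral_itv_bndo_bndc//; exact: mall.
Qed.

Lemma escape_split (R : realType) (b : bool) (W : \bar R) (m : R) : (0 <= W)%E -> 0 <= m ->
  ((if b then W else 0) + Order.min W m%:E <= W + m%:E * (if b then 1 else 0))%E.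
Proof.
move=> W0 m0; case: b; rewrite ?mule1 ?mule0 ?adde0 ?add0e; last by rewrite ge_min lexx.
by rewrite leeD2l// ge_min lexx orbT.
Qed.

Lemma lee_addn_div (R : realType) (a b : \bar R) (c : R) : (0 <= b)%E ->
  (forall n : nat, a <= b + (c / n.+1%:R)%:E)%E -> (a <= b)%E.
Proof.
move=> b0 H; apply/lee_addgt0Pr => e e0.
have [c0|c0] := leP c 0.
  apply: le_trans (H 0%N) _; apply: leeD2l; rewrite lee_fin.
  by apply: le_trans (ltW e0); rewrite divr1.
pose n := Num.truncn (c / e).
apply: le_trans (H n) _; apply: leeD2l; rewrite lee_fin ler_pdivrMr// mulrC -ler_pdivrMr//.
exact/ltW/truncnS_gt.
Qed.

Lemma leeD_ACA (R : realType) (a1 a2 b1 b2 c1 c2 e1 e2 : \bar R) :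
  (a1 + b1 <= c1 + e1 -> a2 + b2 <= c2 + e2 ->
   a1 + a2 + (b1 + b2) <= c1 + c2 + (e1 + e2))%E.
Proof. by move=> h1 h2; rewrite addeACA (addeACA c1); exact: leeD. Qed.

Lemma escape_gap (R : realType) (d : nat) (x a b : 'rV[R]_d) (r : R) :
  r + 1 <= enorm (x + a) -> enorm (x + b) < r -> 1 <= enorm (b - a).
Proof.
have := ler_enormB (x + a) (x + b).
by rewrite opprD addrACA subrr add0r (enorm_sub a b); lra.
Qed.

Lemma integral_itv_cst (R : realType) (c dl : R) : 0 <= dl ->
  (\int[lebesgue_measure]_(s in `[0%R, dl]) c%:E = (c * dl)%:E)%E.
Proof.
rewrite le_eqVlt => /predU1P[<-|d0].
  by rewrite set_itv1 integral_set1 mulr0.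
by rewrite integral_cst//= lebesgue_measure_itv/= lte_fin d0 sube0 EFinM.
Qed.

Section hitting.
Local Open Scope ereal_scope.
Variables (R : realType) (d : nat) (dO : measure_display) (O : measurableType dO).
Variables (P : probability O R) (X : R -> O -> 'rV[R]_d).
Hypothesis hX : levy_process P X.
Local Notation E := 'rV[R]_d.
Local Notation S := (paths R d (nat * nat)).
Local Notation mu := (@lebesgue_measure R).
Local Notation Y := (post_path X 0).
Local Notation proc := (proc X).
Local Notation afun := additive_functional.
Variables (U1 U2 U : E -> R).
Hypotheses (p1 : potential U1) (p2 : potential U2) (pU : potential U).
Local Notation T := (fk P X U1 U2).
Local Notation green := (green_pot P X U1 U2).
Variables (rho C : R).
Hypothesis supU : forall y, (rho <= enorm y)%R -> U y = 0%R.
Hypothesis disp : forall s, (0 <= s)%R ->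
  P [set w | (1 <= enorm (X s w))%R] <= (C * s)%:E.

Let far (y : E) : \bar R := if (rho + 1 <= enorm y)%R then 1 else 0.
Let UE := EFin \o U.

Let nU : nnmeas UE. Proof. exact: nnmeas_EFin. Qed.

Let nfar : nnmeas far.
Proof.
split; last by move=> y; rewrite /far; case: ifP.
apply: measurable_fun_ifT => //; apply: measurable_fun_ler => //.
exact: (@measurable_enorm_id R d).
Qed.

Let W s x w := weight U1 U2 s x (Y w) * (U (x + proc s w)%R)%:E.
Let M (m : nat) s x := \int[P]_w Order.min (W s x w) m%:R%:E.

Let W0 s x w : 0 <= W s x w.
Proof. by rewrite mule_ge0 ?weight_ge0// lee_fin; case: pU. Qed.

Let mWz : measurable_fun setT (fun q : measurableTypeR R * E * O => W q.1.1 q.1.2 q.2).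
Proof. by apply: (measurable_fk_integrand hX p1 p2 (f := UE)); case: nU. Qed.

Let mW s x : measurable_fun setT (W s x).
Proof. by apply: (measurable_fk_integrandx hX p1 p2 (f := UE)); case: nU. Qed.

Let mM m x : measurable_fun setT (fun s : measurableTypeR R => M m s x).
Proof.
pose g (z : measurableTypeR R * O) := Order.min (W z.1 x z.2) m%:R%:E.
have mg : measurable_fun setT g.
  apply: measurable_mine; last exact: measurable_cst.
  apply: (measurableT_comp mWz (g := fun z : measurableTypeR R * O => (z.1, x, z.2))).
  by meas.
have g0 z : 0 <= g z by rewrite /g le_min W0 lee_fin ler0n.
exact: (measurable_fun_fubini_tonelli_F (m2 := P) g mg g0).
Qed.

Let M0 m s x : 0 <= M m s x.
Proof. by apply: integral_ge0 => w _; rewrite le_min W0 lee_fin ler0n. Qed.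

Let escape_prob r s : (0 <= r)%R -> (0 <= s)%R ->
  \int[P]_w (if (1 <= enorm (proc (r + s) w - proc r w))%R then 1 else 0) <= (C * s)%:E.
Proof.
move=> r0 s0.
have mA : measurable [set y : E | (1 <= enorm y)%R].
  exact: (measurable_enorm_ge (f := id)).
apply: le_trans (disp s0).
rewrite -(levy_stationary_increments hX r0 s0 mA).
rewrite (nonmeasurable_ge0_ae_eq_integral
  (g := fun w => (\1_[set w | (1 <= enorm (X (r + s) w - X r w))%R] w)%:E)).
- rewrite integral_indic ?setIT//.
  apply: measurable_enorm_ge.
  by apply: measurable_funB_rV; apply: (levy_measurable hX) => //; rewrite addr_ge0.
- by move=> w; case: ifP.
- by move=> w; rewrite lee_fin.
- apply: filterS (ae_good hX) => w gw; rewrite !procE ?addr_ge0// indicE.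
  case: ifPn => h; first by rewrite mem_set.
  by rewrite memNset//=; exact/negP.
Qed.

(** A path outside radius [rho + 1] at time [r] that carries a charge at time [r + s] has moved by
    at least 1 in between, an event of probability at most [C * s]. The charge is unbounded, so it
    is truncated at [m] before being compared with this probability. *)
Let escape m r s x : (0 <= r)%R -> (0 <= s)%R ->
  T r (fun y => far y * T s UE y) x + M m (r + s) x <=
  T (r + s)%R UE x + (m%:R * (C * s))%:E.
Proof.
move=> r0 s0; rewrite -(fk_two_times hX x p1 p2 r0 s0 nfar nU).
have mI : measurable_fun setT (fun w : O => 
    if (1 <= enorm (proc (r + s) w - proc r w))%R then 1 else 0 : \bar R).
  apply: measurable_fun_ifT => //; apply: measurable_fun_ler => //.
  apply: measurable_enorm; apply: measurable_funB_rV; apply: measurable_path_at_comp => //.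
    exact: (measurable_post_path hX (lexx 0%R)).
  exact: (measurable_post_path hX (lexx 0%R)).
have m1 : measurable_fun setT (fun w => weight U1 U2 (r + s) x (Y w) *
    (far (x + proc r w)%R * UE (x + proc (r + s) w)%R)).
  apply: emeasurable_funM; first exact: (measurable_weight_w hX).
  have mp u : measurable_fun setT (fun w => (x + proc u w)%R).
    meas; apply: measurable_path_at_comp => //.
    exact: (measurable_post_path hX (lexx 0%R)).
  apply: emeasurable_funM; first by apply: (measurableT_comp nfar.1); exact: mp.
  by apply: (measurableT_comp nU.1); exact: mp.
have n1 w : 0 <= weight U1 U2 (r + s) x (Y w) *
    (far (x + proc r w)%R * UE (x + proc (r + s) w)%R).
  by rewrite mule_ge0 ?weight_ge0// mule_ge0//; [case: nfar|case: nU].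
have n2 w : 0 <= Order.min (W (r + s) x w) m%:R%:E by rewrite le_min W0 lee_fin ler0n.
have m2 : measurable_fun setT (fun w => Order.min (W (r + s) x w) m%:R%:E).
  by apply: measurable_mine; [exact: mW|exact: measurable_cst].
have n3 w : 0 <= (if (1 <= enorm (proc (r + s) w - proc r w))%R then 1 else 0 : \bar R).
  by case: ifP.
have m3 : 0 <= m%:R%:E :> \bar R by rewrite lee_fin ler0n.
apply: (@le_trans _ _ (T (r + s)%R UE x + m%:R%:E *
  \int[P]_w (if (1 <= enorm (proc (r + s) w - proc r w))%R then 1 else 0))); last first.
  by apply: leeD2l; rewrite EFinM; apply: lee_wpmul2l => //; exact: escape_prob.
rewrite /M -(ge0_integralD P measurableT (fun w _ => n1 w) m1 (fun w _ => n2 w) m2).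
rewrite -(ge0_integralZl P measurableT mI (fun w _ => n3 w) m3).
rewrite -(ge0_integralD P measurableT (fun w _ => W0 (r + s) x w) (mW (r + s) x)); last 2 first.
- by move=> w _; rewrite mule_ge0.
- by apply: emeasurable_funM => //; exact: measurable_cst.
apply: ge0_le_integral.
- exact: measurableT.
- by move=> w _; rewrite adde_ge0.
- by apply: emeasurable_funD.
- apply: emeasurable_funD; first exact: mW.
  by apply: emeasurable_funM => //; exact: measurable_cst.
move=> w _.
have := escape_split (1 <= enorm (proc (r + s) w - proc r w))%R (W0 (r + s) x w) (ler0n R m).
apply: le_trans; apply: leeD2r; rewrite /far.
case: ifPn => h1; last by rewrite mul0e mule0; case: ifP => // _; exact: W0.
rewrite mul1e; case: ifPn => h2; first exact: lexx.
have [/supU U00|Ur] := leP rho (enorm (x + proc (r + s) w)%R).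
  by rewrite /UE/= U00 mule0.
exfalso; move/negP: h2; apply.
exact: escape_gap h1 Ur.
Qed.

Section grid.
Variable delta : R.
Hypothesis delta0 : (0 <= delta)%R.

Let q y := far y * green delta UE y.

(** Expected charge collected in those of the first [k] grid steps that start outside radius
    [rho + 1]. *)
Fixpoint escape_error (k : nat) : E -> \bar R :=
  if k is k'.+1 then fun y => q y + T delta (escape_error k') y else cst 0.

Let nq : nnmeas q.
Proof.
have [m1 n1] := nfar; have [m2 n2] := nnmeas_green hX p1 p2 delta nU.
by split; [exact: emeasurable_funM|move=> y; rewrite mule_ge0].
Qed.

Lemma nnmeas_escape_error k : nnmeas (escape_error k).
Proof.
elim: k => [|k IH] /=; first by split => //; exact: measurable_cst.
have [m1 n1] := nq; have [m2 n2] := nnmeas_fk hX p1 p2 delta IH.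
by split; [exact: emeasurable_funD|move=> y; rewrite adde_ge0].
Qed.

Let q_bound m r x : (0 <= r)%R ->
  T r q x + \int[mu]_(s in `[r, (r + delta)%R]) M m s x <=
  \int[mu]_(s in `[r, (r + delta)%R]) T s UE x + (m%:R * (C * delta) * delta)%:E.
Proof.
move=> r0.
pose F (z : E * measurableTypeR R) := far z.1 * T z.2 UE z.1.
have mF : measurable_fun setT F.
  apply: emeasurable_funM; first by apply: (measurableT_comp nfar.1); meas.
  apply: (measurableT_comp (measurable_fk2 hX p1 p2 nU)
    (g := fun z : E * measurableTypeR R => (z.2, z.1))).
  by meas.
have F0 z : 0 <= F z.
  by apply: mule_ge0; [case: nfar|apply: fk_ge0; case: nU].
have -> : T r q x = \int[mu]_(s in `[0%R, delta]) T r (fun y => F (y, s)) x.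
  rewrite -(fk_integral hX p1 p2 r 0%R delta x mF F0); congr (fk _ _ _ _ _ _ _).
  apply/funext => y; rewrite /q /green_pot -ge0_integralZl//.
  - apply: measurable_funTS; exact: measurable_fk_time.
  - by move=> s _; apply: fk_ge0; case: nU.
  - by case: nfar.
have sh (g : R -> \bar R) : measurable_fun setT g -> (forall s, 0 <= g s) ->
    \int[mu]_(s in `[r, (r + delta)%R]) g s = \int[mu]_(s in `[0%R, delta]) g (r + s)%R.
  move=> mg g0; have := @ge0_integral_shift R r 0%R delta g mg g0.
  by rewrite add0r (addrC delta r) => ->; apply: eq_integral => s _; rewrite addrC.
have mshift (g : R -> \bar R) : measurable_fun setT g ->
    measurable_fun setT (fun s : R => g (r + s)%R).
  by move=> mg; apply: (measurableT_comp mg); apply: measurable_funD.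
have T0 s : 0 <= T s UE x by apply: fk_ge0; case: nU.
have mT := measurable_fk_time hX p1 p2 x nU.
have mTF : measurable_fun setT (fun s : measurableTypeR R => T r (fun y => F (y, s)) x).
  apply: (measurable_fun_fubini_tonelli_F (m2 := P)
    (fun z : measurableTypeR R * O => weight U1 U2 r x (Y z.2) * F ((x + proc r z.2)%R, z.1))).
    apply: emeasurable_funM.
      by apply: (measurableT_comp (measurable_weight_w hX r x p1 p2)); meas.
    apply: (measurableT_comp mF (g := fun z : measurableTypeR R * O => ((x + proc r z.2)%R, z.1))).
    meas; apply: measurable_path_at_comp; meas.
    by apply: (measurableT_comp (measurable_post_path hX (lexx 0%R))); meas.
  by move=> z; rewrite mule_ge0 ?weight_ge0.
have TF0 s : 0 <= T r (fun y => F (y, s)) x by apply: fk_ge0 => y; exact: F0.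
rewrite !sh//; last exact: mM.
have md : measurable (`[0%R, delta]%classic : set R) by exact: measurable_itv.
rewrite -(ge0_integralD mu md (fun s _ => TF0 s) (measurable_funTS mTF) (fun s _ => M0 m _ x)
  (measurable_funTS (mshift _ (mM m x)))).
have c0 : 0 <= (m%:R * (C * delta))%:E.
  rewrite lee_fin mulr_ge0//; have := disp delta0.
  by move/(le_trans (measure_ge0 _ _)); rewrite lee_fin.
have -> : (m%:R * (C * delta) * delta)%:E = \int[mu]_(s in `[0%R, delta]) (m%:R * (C * delta))%:E.
  by rewrite integral_itv_cst.
rewrite -(ge0_integralD mu md (fun s _ => T0 _) (measurable_funTS (mshift _ mT)) (fun s _ => c0)
  (measurable_cst _)).
apply: ge0_le_integral.
- exact: md.
- by move=> s _; rewrite adde_ge0.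
- by apply: measurable_funTS; apply: emeasurable_funD; [exact: mTF|exact: (mshift _ (mM m x))].
- by apply: measurable_funTS; apply: emeasurable_funD; [exact: (mshift _ mT)|exact: measurable_cst].
move=> s /=; rewrite in_itv/= => /andP[s0 sd].
apply: le_trans (escape m x r0 s0) _; apply: leeD2l; rewrite lee_fin.
apply: ler_wpM2l => //; apply: ler_wpM2l => //.
have := disp (@ler01 R); move/(le_trans (measure_ge0 _ _)); by rewrite lee_fin mulr1.
Qed.

Lemma escape_error_le m k r x : (0 <= r)%R ->
  T r (escape_error k) x + \int[mu]_(s in `[r, (r + k%:R * delta)%R]) M m s x <=
  \int[mu]_(s in `[r, (r + k%:R * delta)%R]) T s UE x + (k%:R * (m%:R * (C * delta) * delta))%:E.
Proof.
elim: k r => [|k IH] r r0.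
  rewrite !mul0r addr0 set_itv1 !integral_set1 !adde0/=.
  rewrite /fk; under eq_integral do rewrite mule0.
  by rewrite integral0.
have kd : (0 <= k%:R * delta)%R by rewrite mulr_ge0.
have T0 s : 0 <= T s UE x by apply: fk_ge0; case: nU.
have mT := measurable_fk_time hX p1 p2 x nU.
have e1 : (r + k.+1%:R * delta = r + delta + k%:R * delta)%R.
  by rewrite -natr1 mulrDl mul1r addrAC addrA.
rewrite e1 /= (fkD hX p1 p2 r x nq (nnmeas_fk hX p1 p2 delta (nnmeas_escape_error k))).
rewrite -(fk_semigroup hX x p1 p2 r0 delta0 (nnmeas_escape_error k)).
have rd : (r <= r + delta)%R by rewrite lerDl.
have rd' : (r + delta <= r + delta + k%:R * delta)%R by rewrite lerDl.
rewrite (integral_itv_cat rd rd' (mM m x) (fun s => M0 m s x)).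
rewrite (integral_itv_cat rd rd' mT T0).
have -> : (k.+1%:R * (m%:R * (C * delta) * delta) =
    m%:R * (C * delta) * delta + k%:R * (m%:R * (C * delta) * delta))%R.
  by rewrite -natr1 mulrDl mul1r addrC.
rewrite EFinD; apply: leeD_ACA; first exact: q_bound.
by apply: IH; rewrite addr_ge0.
Qed.

End grid.

Section comparison.
Variables (h : E -> \bar R) (t beta c C1 : R).
Hypotheses (nh : nnmeas h) (t0 : (0 <= t)%R) (beta0 : (0 <= beta)%R) (c0 : (0 < c)%R).
Hypothesis excessive : forall s x, (0 <= s <= t)%R -> T s h x <= (expR (beta * s))%:E * h x.
Hypothesis hB : forall y, (enorm y < rho + 1)%R -> c%:E <= h y.
Hypothesis C10 : (0 <= C1)%R.
Hypothesis greenB : forall x, green t UE x <= C1%:E.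

(** Induction over the grid. From a point inside radius [rho + 1] the whole potential is at most
    [C1 <= (C1 / c) h]; from a point outside, the charge of the next step goes to [escape_error] and
    excessivity of [h] carries the bound back by one step. *)
Let grid_bound n k x : (k <= n.+1)%N ->
  green (k%:R * (t / n.+1%:R))%R UE x <=
  (C1 / c * expR (beta * (k%:R * (t / n.+1%:R))))%:E * h x + escape_error (t / n.+1%:R)%R k x.
Proof.
set dl := (t / n.+1%:R)%R.
have dl0 : (0 <= dl)%R by rewrite divr_ge0.
have dlt : (dl <= t)%R by rewrite ler_pdivrMr// ler_peMr// ler1n.
have K0 s : (0 <= C1 / c * expR s)%R by rewrite mulr_ge0 ?expR_ge0// divr_ge0// ltW.
have h0 y : 0 <= h y by case: nh.
elim: k x => [|k IH] x kn.
  rewrite mul0r /green_pot set_itv1 integral_set1 adde_ge0// mule_ge0// lee_fin.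
  exact: K0.
have ktE : (k.+1%:R * dl = dl + k%:R * dl)%R by rewrite -natr1 mulrDl mul1r addrC.
have kt : (k.+1%:R * dl <= t)%R.
  rewrite /dl mulrA (mulrC _ t) -mulrA ler_piMr// ler_pdivrMr// mul1r ler_nat.
  exact: kn.
have ne := nnmeas_escape_error dl k.
have [xB|xB] := ltP (enorm x) (rho + 1)%R.
  apply: (@le_trans _ _ C1%:E).
    by apply: le_trans (greenB x); apply: (le_green hX p1 p2 x nU kt).
  apply: (@le_trans _ _ ((C1 / c * expR (beta * (k.+1%:R * dl)))%:E * h x)); last first.
    by rewrite leeDl//; case: (nnmeas_escape_error dl k.+1).
  apply: (@le_trans _ _ ((C1 / c * expR (beta * (k.+1%:R * dl)))%:E * c%:E)).
    rewrite -EFinM lee_fin mulrAC divfK ?gt_eqF// ler_peMr// -expR0 ler_expR.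
    by rewrite mulr_ge0// mulr_ge0.
  by apply: lee_wpmul2l; [rewrite lee_fin; exact: K0|exact: hB].
have kd0 : (0 <= k%:R * dl)%R by rewrite mulr_ge0.
rewrite ktE (green_add hX p1 p2 x nU dl0 kd0) /= /far xB mul1e.
rewrite [leRHS]addeCA; apply: leeD2l.
have K1 : 0 <= (C1 / c * expR (beta * (k%:R * dl)))%:E by rewrite lee_fin; exact: K0.
have nKh : nnmeas (fun y => (C1 / c * expR (beta * (k%:R * dl)))%:E * h y).
  split; first by apply: emeasurable_funM; [exact: measurable_cst|case: nh].
  by move=> y; rewrite mule_ge0.
apply: le_trans (_ : T dl (fun y => (C1 / c * expR (beta * (k%:R * dl)))%:E * h y +
    escape_error dl k y) x <= _).
  apply: (le_fk hX p1 p2); first exact: (nnmeas_green hX p1 p2 _ nU).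
    split; first by apply: emeasurable_funD; [case: nKh|case: ne].
    by move=> y; rewrite adde_ge0//; [case: nKh|case: ne].
  by move=> y; apply: IH; exact: ltnW.
rewrite (fkD hX p1 p2 dl x nKh ne) (fkZ hX p1 p2 dl x nh K1); apply: leeD2r.
rewrite (_ : C1 / c * expR (beta * (dl + k%:R * dl)) =
    C1 / c * expR (beta * (k%:R * dl)) * expR (beta * dl))%R; last first.
  by rewrite -[RHS]mulrA -expRD -mulrDr (addrC dl).
rewrite (EFinM (_ * expR _)%R) -muleA.
apply: lee_wpmul2l => //.
by apply: excessive; rewrite dl0.
Qed.

(* Away from the ball of radius [rho + 1] a path reaches the support of [U] within one step of
   the grid of mesh [t / n] only with probability [O(1 / n)], so that up to a vanishing error
   the potential is collected after a grid time at which [h >= c]. *)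
Lemma hitting_bound x : green t UE x <= (C1 / c * expR (beta * t))%:E * h x.
Proof.
set K := (C1 / c * expR (beta * t))%:E * h x.
have K0 : 0 <= K.
  rewrite mule_ge0//; last by case: nh.
  by rewrite lee_fin mulr_ge0 ?expR_ge0// divr_ge0// ltW.
have gfin : green t UE x \is a fin_num.
  rewrite ge0_fin_numE; first by apply: le_lt_trans (greenB x) _; exact: ltry.
  by case: (nnmeas_green hX p1 p2 t nU).
(* [grid_bound] and [escape_error_le] are added: the escape error and the finite potential cancel,
   leaving the truncated charge against [K] and the error of [n + 1] steps, each of size
   [m C (t / (n + 1)) ^ 2]. *)
have MK m : \int[mu]_(s in `[0%R, t]) M m s x <= K.
  apply: (@lee_addn_div _ _ _ (m%:R * C * t ^+ 2)%R) => // n.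
  set dl := (t / n.+1%:R)%R.
  have dl0 : (0 <= dl)%R by rewrite divr_ge0.
  have tE : (n.+1%:R * dl = t)%R by rewrite /dl mulrCA divff ?mulr1// pnatr_eq0.
  have e1 := grid_bound x (leqnn n.+1); rewrite -/dl tE -/K in e1.
  have e2 := escape_error_le dl0 m n.+1 x (lexx 0%R); rewrite add0r tE in e2.
  have T0E : T 0 (escape_error dl n.+1) x = escape_error dl n.+1 x by apply: fk_time0 => //; exact: nnmeas_escape_error.
  rewrite T0E in e2.
  rewrite -(leeD2lE (x := green t UE x))//.
  apply: le_trans (leeD2r _ e1) _; rewrite -addeA.
  apply: le_trans (leeD2l _ e2) _; rewrite addeCA; apply: leeD2l; apply: leeD2l.
  rewrite lee_fin le_eqVlt; apply/orP; left; apply/eqP.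
  rewrite /dl; field.
  by rewrite nat1r pnatr_eq0.
have itv : measurable (`[0%R, t]%classic : set R) by exact: measurable_itv.
have minW s w : Order.min (W s x w) m%:R%:E @[m --> \oo] --> W s x w.
  case: (W s x w) (W0 s x w) => [r| |//] r0.
    apply: cvg_near_cst; exists (Num.truncn r).+1 => // m /= rm.
    by rewrite min_l// lee_fin ltW//; apply: (lt_le_trans (truncnS_gt _)); rewrite ler_nat.
  under eq_fun do rewrite (min_r (leey _)).
  apply/cvgeyPge => A; exists (Num.truncn A).+1 => // m /= Am.
  by rewrite lee_fin ltW//; apply: (lt_le_trans (truncnS_gt _)); rewrite ler_nat.
have Mlim s : M m s x @[m --> \oo] --> T s UE x.
  have -> : T s UE x = \int[P]_w limn (fun m => Order.min (W s x w) m%:R%:E).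
    by apply: eq_integral => w _; rewrite (cvg_lim (@ereal_hausdorff R) (minW s w)).
  apply: cvg_monotone_convergence => //.
  - by move=> m; apply: measurable_mine; [exact: mW|exact: measurable_cst].
  - by move=> m w _; rewrite le_min W0 lee_fin ler0n.
  - by move=> w _ m n mn; rewrite le_min ge_min lexx/= ge_min lee_fin ler_nat mn orbT.
have Mcvg : (\int[mu]_(s in `[0%R, t]) M m s x) @[m --> \oo] --> green t UE x.
  have -> : green t UE x = \int[mu]_(s in `[0%R, t]) limn (fun m => M m s x).
    by apply: eq_integral => s _; rewrite (cvg_lim (@ereal_hausdorff R) (Mlim s)).
  apply: cvg_monotone_convergence => //.
  - by move=> m; apply: measurable_funTS; exact: mM.
  - move=> s _ m n mn; apply: ge0_le_integral.
    + exact: measurableT.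
    + by move=> w _; rewrite le_min W0 lee_fin ler0n.
    + by apply: measurable_mine; [exact: mW|exact: measurable_cst].
    + by apply: measurable_mine; [exact: mW|exact: measurable_cst].
    + by move=> w _; rewrite le_min ge_min lexx/= ge_min lee_fin ler_nat mn orbT.
rewrite -(cvg_lim (@ereal_hausdorff R) Mcvg); apply: lime_le.
  by apply/cvg_ex; eexists; exact: Mcvg.
exact: nearW.
Qed.

End comparison.
End hitting.

(** * Small-time behaviour of a symmetric Levy process *)

Section trigonometric_bounds.
Variable R : realType.
Implicit Types x u : R.

Lemma sin_le_id x : 0 <= x -> sin x <= x.
Proof.
move=> x0; have [c _] := @MVT_segment R sin cos 0 x x0 (fun y _ => is_derive_sin y)
  (continuous_subspaceT (@continuous_sin R)).
by rewrite sin0 !subr0 => ->; rewrite ler_piMl// cos_le1.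
Qed.

Lemma sqr_sin_le x : sin x ^+ 2 <= x ^+ 2.
Proof.
wlog x0 : x / 0 <= x => [H|].
  have [/H//|x0] := leP 0 x.
  by rewrite -(sqrrN (sin x)) -(sqrrN x) -sinN; apply: H; rewrite oppr_ge0 ltW.
have [s0|s0] := leP 0 (sin x).
  by rewrite lerXn2r// ?nnegrE// sin_le_id.
have x1 : 1 < x.
  rewrite ltNge; apply/negP => x1; move: s0; rewrite ltNge => /negP; apply.
  apply: sin_ge0_pi; rewrite x0/= (le_trans x1)//.
  by rewrite (le_trans _ (pi_ge2 R))// ler1n.
apply: (@le_trans _ _ 1); last by rewrite -(expr1n R 2) lerXn2r// ?nnegrE// ltW.
by rewrite -(real_normK (num_real _)) -(expr1n R 2) lerXn2r// ?nnegrE// sin_max.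
Qed.

Lemma one_sub_cos x : 1 - cos x = 2 * sin (x / 2) ^+ 2.
Proof.
rewrite {1}(_ : x = (x / 2) *+ 2); last by rewrite -mulr_natr divfK// pnatr_eq0.
by rewrite cos_mulr2n sin2cos2; ring.
Qed.

Lemma one_sub_cos_ge0 x : 0 <= 1 - cos x.
Proof. by rewrite subr_ge0 cos_le1. Qed.

Lemma one_sub_cos_le2 x : 1 - cos x <= 2.
Proof. by have := cos_geN1 x; lra. Qed.

Lemma one_sub_cos_le_sqr x : 1 - cos x <= x ^+ 2 / 2.
Proof. by rewrite one_sub_cos; have := sqr_sin_le (x / 2); nra. Qed.

Lemma one_sub_cos_ge x : `|x| <= 2 -> x ^+ 2 / 8 <= 1 - cos x.
Proof.
wlog x0 : x / 0 <= x => [H|].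
  have [/H//|x0] := leP 0 x.
  rewrite -(sqrrN x) -(normrN x) -(cosN x) => xx; apply: H => //.
  by rewrite oppr_ge0 ltW.
rewrite ger0_norm// => x2; rewrite one_sub_cos.
have x20 : 0 <= x / 2 by lra.
have [c ] := @MVT_segment R sin cos 0 _ x20 (fun y _ => is_derive_sin y)
  (continuous_subspaceT (@continuous_sin R)).
rewrite in_itv/= sin0 !subr0 => /andP[c0 cx] ->.
have c1 : 1 / 2 <= cos c by have := one_sub_cos_le_sqr c; nra.
rewrite exprMn; have : 1 / 4 <= cos c ^+ 2 by nra.
by have := sqr_ge0 (x / 2); nra.
Qed.

Lemma continuous_one_sub_cos_scale x : continuous (fun u => 1 - cos (u * x)).
Proof.
move=> u; apply: cvgB; first exact: cvg_cst.
apply: (continuous_comp (f := fun u => u * x) (g := cos)); last exact: continuous_cos.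
exact: mulrr_continuous.
Qed.

Lemma measurable_one_sub_cos_scale x : measurable_fun setT (fun u : measurableTypeR R => 1 - cos (u * x)).
Proof. by apply: continuous_measurable_fun; exact: continuous_one_sub_cos_scale. Qed.

(* Averaging over frequencies turns [1 - cos] into a bound below away from its zeros. *)
Lemma average_one_sub_cos x :
  ((Num.min 1 (x ^+ 2) / 64)%:E <=
   \int[lebesgue_measure]_(u in `[0%R, 1%R]) (1 - cos (u * x))%:E)%E.
Proof.
have m1 : measurable (`[(1 / 2)%R, 1%R]%classic : set R) by exact: measurable_itv.
have m01 : measurable (`[0%R, 1%R]%classic : set R) by exact: measurable_itv.
have mE D : measurable_fun D (fun u : measurableTypeR R => (1 - cos (u * x))%:E).
  by apply: measurable_funTS; apply/measurable_EFinP; exact: measurable_one_sub_cos_scale.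
have [x2|x2] := leP `|x| 2.
  apply: (@le_trans _ _ (\int[lebesgue_measure]_(u in `[(1 / 2)%R, 1%R]) (1 - cos (u * x))%:E)%E).
    apply: (@le_trans _ _ (\int[lebesgue_measure]_(u in `[(1 / 2)%R, 1%R]) (x ^+ 2 / 32)%:E)%E).
      rewrite integral_cst//= lebesgue_measure_itv/= lte_fin ifT; last by lra.
      rewrite -EFinD -EFinM lee_fin.
      have : Num.min 1 (x ^+ 2) <= x ^+ 2 by rewrite ge_min lexx orbT.
      by lra.
    apply: ge0_le_integral => //.
    - by move=> u _; rewrite lee_fin; have := sqr_ge0 x; lra.
    move=> u; rewrite /= in_itv/= lee_fin => /andP[u1 u2].
    apply: le_trans (one_sub_cos_ge _); last first.
      rewrite normrM (le_trans _ x2)// ler_piMl// ger0_norm//; lra.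
    rewrite exprMn; have : 1 / 4 <= u ^+ 2 by nra.
    by have := sqr_ge0 x; nra.
  apply: ge0_subset_integral => //.
  by move=> u /=; rewrite !in_itv/= => /andP[h ->]; rewrite andbT; lra.
have x0 : x != 0 by apply: contraTneq x2 => ->; rewrite normr0 -leNgt.
pose F u : R := u - sin (u * x) / x.
have dF u : is_derive u 1 F (1 - cos (u * x)).
  have dm : is_derive u 1 (fun v : R => v * x) x.
    have -> : x = x *: (1 : R) by rewrite /GRing.scale/= mulr1.
    rewrite (_ : (fun v => v * (x *: 1)) = x \*: (@id R)); first exact: is_deriveZ.
    by apply/funext => v; rewrite /GRing.scale/= mulr1 mulrC.
  have ds : is_derive u 1 (fun v : R => sin (v * x)) (x * cos (u * x)).
    rewrite mulrC.
    exact: (@is_derive1_comp R sin (fun v : R => v * x) u _ _ (is_derive_sin _) dm).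
  have dd : is_derive u 1 (x^-1 \*: (fun v : R => sin (v * x))) (x^-1 *: (x * cos (u * x))).
    exact: is_deriveZ.
  have -> : F = id - (x^-1 \*: (fun v : R => sin (v * x))).
    by apply/funext => v; rewrite /F !fctE /= /GRing.scale/= (mulrC x^-1).
  have -> : 1 - cos (u * x) = 1 - (x^-1 *: (x * cos (u * x))).
    by rewrite /GRing.scale/= mulKf.
  exact: is_deriveB.
have dFu u : derivable F u 1 by have [] := dF u.
have cF : continuous F.
  by move=> u; apply: differentiable_continuous; apply/derivable1_diffP; exact: dFu.
rewrite (@continuous_FTC2 R (fun u => 1 - cos (u * x)) F 0 1 ltr01).
- rewrite -EFinB lee_fin /F mul0r sin0 mul0r subr0 mul1r.
  have : `|sin x / x| <= 1 / 2.
    rewrite normrM normfV ler_pdivrMr ?normr_gt0//.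
    by have := sin_max x; lra.
  rewrite ler_norml => /andP[_ h].
  have : Num.min 1 (x ^+ 2) <= 1 by rewrite ge_min lexx.
  by lra.
- by apply: continuous_subspaceT; exact: continuous_one_sub_cos_scale.
- split => //.
  + by apply: cvg_at_right_filter; exact: cF.
  + by apply: cvg_at_left_filter; exact: cF.
- by move=> u _; rewrite derive1E; have [] := dF u.
Qed.

End trigonometric_bounds.

(** * Symmetric laws and the Levy-Khintchine formula *)

Section symmetric_laws.
Variables (R : realType) (d : nat) (dO : measure_display) (O : measurableType dO).
Variables (P : probability O R) (X : R -> O -> 'rV[R]_d).
Hypothesis hX : levy_process P X.
Hypothesis sX : symmetric_process P X.
Local Notation E := 'rV[R]_d.

Lemma symmetric_integral t (f : E -> \bar R) : 0 <= t -> measurable_fun setT f ->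
  (forall x, 0 <= f x)%E -> (\int[P]_w f (X t w) = \int[P]_w f (- X t w)%R)%E.
Proof.
move=> t0 mf f0; have mX := levy_measurable hX t0.
have mN : measurable_fun setT (fun w => - X t w) by exact: measurable_funN_rV.
have h1 := ge0_integral_pushforward mX P measurableT mf (fun y _ => f0 y).
have h2 := ge0_integral_pushforward mN P measurableT mf (fun y _ => f0 y).
rewrite !preimage_setT in h1 h2; rewrite -[LHS]h1 -[RHS]h2.
by apply: eq_measure_integral => A mA _; exact: sX.
Qed.

Lemma symmetric_integral_odd t (f : E -> R) : 0 <= t -> measurable_fun setT f ->
  (forall x, f (- x) = - f x) -> (\int[P]_w f (X t w))%R = 0.
Proof.
move=> t0 mf fodd; rewrite /Rintegral integralE.
have -> : (\int[P]_w ((fun w => (f (X t w))%:E)^\- w))%E =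
    (\int[P]_w ((fun w => (f (X t w))%:E)^\+ w))%E.
  under eq_integral do rewrite funenegE -EFinN -fodd.
  under [RHS]eq_integral do rewrite funeposE.
  apply/esym/(@symmetric_integral t (fun x => Order.max (f x)%:E 0)%E) => //.
  - by apply: measurable_maxe; [exact/measurable_EFinP|exact: measurable_cst].
  - by move=> x; rewrite le_max lexx orbT.
have sub0 (a : \bar R) : fine (a - a)%E = 0 by case: a => [r| |] //=; rewrite subrr.
exact: sub0.
Qed.

End symmetric_laws.

Lemma bounded_integrable (R : realType) dT (T : measurableType dT)
    (m : {finite_measure set T -> \bar R}) (f : T -> R) (M : R) :
  measurable_fun setT f -> (forall x, `|f x| <= M) -> m.-integrable setT (EFin \o f).
Proof.
move=> mf fM; apply: (@le_integrable _ _ _ m setT measurableT _ (cst M%:E)).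
- exact/measurable_EFinP.
- by move=> x _ /=; rewrite lee_fin (le_trans (fM x))// ler_norm.
- exact: finite_measure_integrable_cst.
Qed.

Section levy_khintchine_symmetric.
Variables (R : realType) (d : nat) (dO : measure_display) (O : measurableType dO).
Variables (P : probability O R) (X : R -> O -> 'rV[R]_d).
Hypothesis hX : levy_process P X.
Hypothesis sX : symmetric_process P X.
Local Notation E := 'rV[R]_d.
Variable N : {measure set E -> \bar R}.

Definition char_exponent (Q : 'M[R]_d) (xi : E) : R :=
  dotv xi (xi *m Q) / 2 + (\int[N]_y (1 - cos (dotv xi y)))%R.

Lemma measurable_dotv dT (T : measurableType dT) (xi : E) (f : T -> E) :
  measurable_fun setT f -> measurable_fun setT (fun t => dotv xi (f t)).
Proof.
move=> mf; apply: (measurable_sum (index_enum 'I_d) (h := fun i t => xi 0 i * f t 0 i)) => i.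
by apply: measurable_funM; [exact: measurable_cst|exact: measurable_rV_coord].
Qed.

Lemma measurable_cos_dotv dT (T : measurableType dT) (xi : E) (c : R) (f : T -> E) :
  measurable_fun setT f -> measurable_fun setT (fun t => cos (dotv xi (f t) + c)).
Proof.
move=> mf; apply: (measurableT_comp (f := cos)).
  by apply: continuous_measurable_fun; exact: continuous_cos.
by apply: measurable_funD; [exact: measurable_dotv|exact: measurable_cst].
Qed.

Lemma measurable_cos_dotv0 dT (T : measurableType dT) (xi : E) (f : T -> E) :
  measurable_fun setT f -> measurable_fun setT (fun t => cos (dotv xi (f t))).
Proof. by move=> /(measurable_cos_dotv xi 0); under eq_fun do rewrite addr0. Qed.

Lemma one_sub_cos_dotv_le (xi y : E) :
  1 - cos (dotv xi y) <= 2 * Num.max 1 (enorm xi ^+ 2) * Num.min 1 (enorm y ^+ 2).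
Proof.
have M1 : 1 <= Num.max 1 (enorm xi ^+ 2) by rewrite le_max lexx.
have M2 : enorm xi ^+ 2 <= Num.max 1 (enorm xi ^+ 2) by rewrite le_max lexx orbT.
have h1 := one_sub_cos_le2 (dotv xi y); have h2 := one_sub_cos_le_sqr (dotv xi y).
have h3 : dotv xi y ^+ 2 <= enorm xi ^+ 2 * enorm y ^+ 2.
  rewrite -exprMn -(real_normK (num_real (dotv xi y))) lerXn2r ?nnegrE ?mulr_ge0 ?enorm_ge0//.
  exact: normr_dotv_le.
have := sqr_ge0 (enorm y); have := sqr_ge0 (enorm xi).
rewrite minElt; case: ifP => _; nra.
Qed.

(** By symmetry the sine transform vanishes at every time, so [sin (s c) = 0] for all [s >= 0];
    taking [s = pi / (2 |c|)] shows that the imaginary part [c] of the exponent is 0. *)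
Lemma lk_cos (b : E) (Q : 'M[R]_d) (t : R) (xi : E) : levy_khintchine P X b Q N -> 0 <= t ->
  (\int[P]_w (cos (dotv xi (X t w))))%R = expR (- (t * char_exponent Q xi)).
Proof.
move=> lk t0; have [lk1 _] := lk t xi t0; rewrite lk1; clear lk1.
set c := (dotv b xi + _).
suff -> : c = 0 by rewrite mulr0 cos0 mulr1.
apply/eqP; apply: contraT => c0.
pose s := pi / 2 / `|c|.
have s0 : 0 <= s by rewrite divr_ge0// divr_ge0// pi_ge0.
have [_ /esym] := lk s xi s0; rewrite -/c.
rewrite (symmetric_integral_odd hX sX (f := fun x => sin (dotv xi x)) s0); last 2 first.
- apply: (measurableT_comp (f := sin)); last exact: measurable_dotv.
  by apply: continuous_measurable_fun; exact: continuous_sin.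
- by move=> x; rewrite dotvC -scaleN1r dotvZl mulN1r sinN dotvC.
move/eqP; rewrite mulf_eq0 gt_eqF ?expR_gt0//=.
have [cp|cn|ce] := ltgtP c 0; last by rewrite ce eqxx in c0.
- rewrite /s ltr0_norm// (_ : pi / 2 / - c * c = - (pi / 2)); last first.
    by rewrite invrN mulrN mulNr divfK.
  by rewrite sinN sin_pihalf oppr_eq0 oner_eq0.
- by rewrite /s gtr0_norm// divfK// sin_pihalf oner_eq0.
Qed.

Hypothesis Nfin : (\int[N]_y (Num.min 1 (enorm y ^+ 2))%:E < +oo)%E.

Lemma integrable_min_sqr : N.-integrable setT (fun y => (Num.min 1 (enorm y ^+ 2))%:E).
Proof.
apply/integrableP; split.
  apply/measurable_EFinP; apply: measurable_minr; first exact: measurable_cst.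
  by apply: measurable_funX; exact: measurable_enorm_id.
rewrite (eq_integral (fun y => (Num.min 1 (enorm y ^+ 2))%:E))// => y _.
by rewrite gee0_abs// lee_fin le_min ler01/= sqr_ge0.
Qed.

Lemma integrable_one_sub_cos (xi : E) :
  N.-integrable setT (fun y => (1 - cos (dotv xi y))%:E).
Proof.
have := integrableZl measurableT (2 * Num.max 1 (enorm xi ^+ 2)) integrable_min_sqr.
apply: le_integrable => //.
  apply/measurable_EFinP; apply: measurable_funB; first exact: measurable_cst.
  exact: measurable_cos_dotv0.
move=> y _; rewrite -EFinM lee_fin ger0_norm ?one_sub_cos_ge0//.
by apply: le_trans (one_sub_cos_dotv_le xi y) _; exact: ler_norm.
Qed.

Lemma char_exponent_bounded (Q : 'M[R]_d) : exists A, forall xi, enorm xi <= 1 ->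
  char_exponent Q xi <= A.
Proof.
exists (\sum_i \sum_j `|Q j i| + 2 * \int[N]_y Num.min 1 (enorm y ^+ 2)) => xi xi1.
apply: lerD.
  apply: (@le_trans _ _ (dotv xi (xi *m Q) / 2 + dotv xi (xi *m Q) / 2 * 0)).
    by rewrite mulr0 addr0.
  have h : dotv xi (xi *m Q) <= \sum_i \sum_j `|Q j i|.
    rewrite /dotv; apply: ler_sum => i _; rewrite mxE mulr_sumr; apply: ler_sum => j _.
    rewrite (le_trans (ler_norm _))// !normrM.
    have hi := le_trans (coord_le_enorm xi i) xi1.
    have hj := le_trans (coord_le_enorm xi j) xi1.
    rewrite mulrA ler_piMl// -[leRHS]mulr1 ler_pM//.
  have h0 : 0 <= \sum_i \sum_j `|Q j i| by apply: sumr_ge0 => i _; exact: sumr_ge0.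
  by rewrite mulr0 addr0; lra.
rewrite -RintegralZl//; last exact: integrable_min_sqr.
apply: le_Rintegral => //.
- exact: integrable_one_sub_cos.
- by have := integrableZl measurableT 2 integrable_min_sqr.
move=> y _; apply: le_trans (one_sub_cos_dotv_le xi y) _.
rewrite max_l ?mulr1// -(expr1n R 2) lerXn2r// nnegrE ?enorm_ge0//.
Qed.

Lemma integral_one_sub_cos (t : R) (xi : E) : 0 <= t ->
  (\int[P]_w (1 - cos (dotv xi (X t w)))%:E = (1 - \int[P]_w cos (dotv xi (X t w)))%:E)%E.
Proof.
move=> t0; have mX := levy_measurable hX t0.
have i1 : P.-integrable setT (EFin \o (fun w => cos (dotv xi (X t w)))).
  by apply: (bounded_integrable _ (M := 1)) => [|w]; [exact: measurable_cos_dotv0|exact: cos_max].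
have i2 : P.-integrable setT (EFin \o (fun=> 1 : R)).
  by apply: (bounded_integrable _ (M := 1)) => // w; rewrite normr1.
have := RintegralB measurableT i2 i1.
rewrite [X in _ = X - _](_ : _ = 1); last first.
  by rewrite /Rintegral integral_cst//= probability_setT mule1.
move=> <-.
rewrite /Rintegral fineK//; apply: integrable_fin_num => //.
by have := integrableB measurableT i2 i1.
Qed.

(** At each frequency [u e_i] with [u] in [0, 1] one has [1 - E cos (u X_i) = 1 - exp (- t a) <= t
    a]. Averaging over [u] bounds [E min (1, X_i ^ 2)] up to the factor 64 of [average_one_sub_cos],
    and the coordinates are then summed. *)
Lemma small_time_second_moment (b : E) (Q : 'M[R]_d) : levy_khintchine P X b Q N ->
  exists2 C : R, 0 <= C & forall t, 0 <= t ->
    (\int[P]_w (Num.min 1 (enorm (X t w) ^+ 2))%:E <= (C * t)%:E)%E.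
Proof.
move=> lk; have [A hA] := char_exponent_bounded Q.
pose A' := Num.max 0 A.
have A'0 : 0 <= A' by rewrite le_max lexx.
have coord t i : 0 <= t ->
    (\int[P]_w (Num.min 1 (X t w 0 i ^+ 2))%:E <= (64 * A' * t)%:E)%E.
  move=> t0; have mX := levy_measurable hX t0.
  have mXi : measurable_fun setT (fun w => X t w 0 i) by exact: measurable_rV_coord.
  pose F (z : O * measurableTypeR R) := (1 - cos (z.2 * X t z.1 0 i))%:E.
  have mF : measurable_fun setT F.
    apply/measurable_EFinP; apply: measurable_funB; first exact: measurable_cst.
    apply: (measurableT_comp (f := cos)).
      by apply: continuous_measurable_fun; exact: continuous_cos.
    apply: measurable_funM; first by meas.
    by apply: (measurableT_comp mXi); meas.
  have F0 z : (0 <= F z)%E by rewrite lee_fin one_sub_cos_ge0.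
  have e1 : (\int[P]_w (Num.min 1 (X t w 0 i ^+ 2) / 64)%:E <=
      \int[P]_w \int[lebesgue_measure]_(u in `[0%R, 1%R]) F (w, u))%E.
    apply: ge0_le_integral => //.
    - by move=> w _; rewrite lee_fin divr_ge0// le_min ler01 sqr_ge0.
    - apply/measurable_EFinP; apply: measurable_funM; last exact: measurable_cst.
      by apply: measurable_minr; [exact: measurable_cst|exact: measurable_funX].
    - apply: (measurable_integral_interval 0 (b := cst 1) (f := F)) => //.
    - by move=> w _; exact: average_one_sub_cos.
  rewrite (tonelli_interval P 0 1 mF F0) in e1.
  have e2 : (\int[lebesgue_measure]_(u in `[0%R, 1%R]) \int[P]_w F (w, u) <= (A' * t)%:E)%E.
    rewrite -[X in (_ <= X%:E)%E]mulr1 -(integral_itv_cst _ ler01).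
    apply: ge0_le_integral => //.
    - by move=> u _; apply: integral_ge0.
    - apply: measurable_funTS; exact: (measurable_fun_fubini_tonelli_G (m1 := P) F mF F0).
    move=> u; rewrite /= in_itv/= => /andP[u0 u1].
    have uE w : u * X t w 0 i = dotv (u *: (delta_mx 0 i : E)) (X t w).
      rewrite dotvZl /dotv (bigD1 i)//= mxE !eqxx mul1r big1 ?addr0// => j ji.
      by rewrite mxE eqxx/= (negbTE ji) mul0r.
    rewrite /F/=; under eq_integral do rewrite uE.
    rewrite integral_one_sub_cos// (lk_cos _ lk t0) lee_fin.
    set a := char_exponent Q _.
    have aA : a <= A'.
      rewrite le_max; apply/orP; right; apply: hA.
      rewrite enormZ ger0_norm// (_ : enorm _ = 1) ?mulr1//.
      rewrite /enorm /dotv (bigD1 i)//= mxE !eqxx mul1r big1 ?addr0 ?sqrtr1// => j ji.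
      by rewrite mxE eqxx/= (negbTE ji) mul0r.
    have := expR_ge1Dx (- (t * a)); nra.
  have e3 := le_trans e1 e2.
  have -> : (\int[P]_w (Num.min 1 (X t w 0 i ^+ 2))%:E =
      64%:E * \int[P]_w (Num.min 1 (X t w 0 i ^+ 2) / 64)%:E)%E.
    rewrite -ge0_integralZl//.
    - by apply: eq_integral => w _; rewrite -EFinM mulrC divfK// pnatr_eq0.
    - apply/measurable_EFinP; apply: measurable_funM; last exact: measurable_cst.
      by apply: measurable_minr; [exact: measurable_cst|exact: measurable_funX].
    - by move=> w _; rewrite lee_fin divr_ge0// le_min ler01 sqr_ge0.
  by rewrite -mulrA EFinM; apply: lee_wpmul2l.
exists (d%:R * (64 * A')); first by rewrite mulr_ge0// mulr_ge0.
move=> t t0; have mX := levy_measurable hX t0.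
have mm i : measurable_fun setT (fun w => (Num.min 1 (X t w 0 i ^+ 2))%:E).
  apply/measurable_EFinP; apply: measurable_minr; first exact: measurable_cst.
  by apply: measurable_funX; exact: measurable_rV_coord.
apply: (@le_trans _ _ (\int[P]_w (\sum_(i < d) (Num.min 1 (X t w 0 i ^+ 2))%:E))%E).
  apply: ge0_le_integral => //.
  - by move=> w _; rewrite lee_fin le_min ler01 sqr_ge0.
  - apply/measurable_EFinP; apply: measurable_minr; first exact: measurable_cst.
    by apply: measurable_funX; exact: measurable_enorm.
  - exact: emeasurable_sum.
  move=> w _; rewrite sumEFin lee_fin.
  have p0 i : 0 <= Num.min 1 (X t w 0 i ^+ 2) by rewrite le_min ler01 sqr_ge0.
  have [[i Xi]|nX] := pselect (exists i, 1 <= X t w 0 i ^+ 2).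
    rewrite (bigD1 i)//= (min_l Xi); apply: (@le_trans _ _ 1); first by rewrite ge_min lexx.
    by rewrite lerDl sumr_ge0.
  rewrite ge_min; apply/orP; right; rewrite enorm_sqr; apply: ler_sum => i _.
  rewrite min_r -?expr2// leNgt; apply/negP => h; apply: nX; exists i; exact: ltW.
rewrite ge0_integral_sum//; last by move=> i w _; rewrite lee_fin le_min ler01 sqr_ge0.
apply: (@le_trans _ _ (\sum_(i < d) (64 * A' * t)%:E)%E).
  by apply: lee_sum => i _; exact: coord.
by rewrite sumEFin lee_fin sumr_const card_ord -[leLHS]mulr_natl !mulrA.
Qed.

Lemma small_time_tail (b : E) (Q : 'M[R]_d) (r : R) : levy_khintchine P X b Q N -> 0 < r ->
  exists2 C : R, 0 <= C & forall t, 0 <= t -> (P [set w | (r <= enorm (X t w))%R] <= (C * t)%:E)%E.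
Proof.
move=> lk r0; have [C C0 H] := small_time_second_moment lk.
pose c := Num.min 1 (r ^+ 2).
have c0 : 0 < c by rewrite lt_min ltr01 exprn_gt0.
exists (C / c); first by rewrite divr_ge0// ltW.
move=> t t0; have mX := levy_measurable hX t0.
have mA : measurable [set w | r <= enorm (X t w)] by exact: measurable_enorm_ge.
have h : (c%:E * P [set w | (r <= enorm (X t w))%R] <= (C * t)%:E)%E.
  apply: le_trans (H t t0); rewrite -[X in P X]setIT -integral_indic// -ge0_integralZl//; last first.
  - by rewrite lee_fin ltW.
  - exact/measurable_EFinP.
  apply: ge0_le_integral => //.
  - by move=> w _; rewrite mule_ge0// lee_fin// ltW.
  - by apply: emeasurable_funM => //; exact/measurable_EFinP.
  - apply/measurable_EFinP; apply: measurable_minr; first exact: measurable_cst.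
    by apply: measurable_funX; exact: measurable_enorm.
  move=> w _; rewrite indicE -EFinM lee_fin; case: (boolP (w \in _)) => [|_].
    rewrite inE/= => rw; rewrite mulr1 /c le_min ge_min lexx/= ge_min; apply/orP; right.
    by rewrite lerXn2r// ?nnegrE ?enorm_ge0// ltW.
  by rewrite mulr0 le_min ler01 sqr_ge0.
by rewrite (_ : C / c * t = c^-1 * (C * t))%R ?EFinM ?lee_pdivlMl// mulrAC mulrC mulrA.
Qed.

End levy_khintchine_symmetric.

Lemma ge0_integral_dilation (R : realType) (a : R) (f : R -> \bar R) : 0 < a ->
  measurable_fun setT f -> (forall x, 0 <= f x)%E ->
  (\int[lebesgue_measure]_x f x = a%:E * \int[lebesgue_measure]_x f (a * x)%R)%E.
Proof.
move=> a0 mf f0.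
pose sh (x : measurableTypeR R) : measurableTypeR R := a * x.
have ms : measurable_fun setT sh by apply: measurable_funM => //; exact: measurable_cst.
pose push := measure_function_pushforward__canonical__measure_function_Measure
  (@lebesgue_measure R) ms.
pose an : {nonneg R} := NngNum (ltW a0).
transitivity (\int[mscale an push]_x f x)%E.
  apply: eq_measure_integral => A mA _.
  refine (@lebesgue_measure_unique R (mscale an push) _ A mA).
  move=> _ [[b c]] _ <- /=.
  rewrite /mscale/= /pushforward (_ : _ @^-1` _ = `]b / a, c / a]%classic); last first.
    by apply/seteqP; split => x /=; rewrite !in_itv/= /sh ltr_pdivrMr// ler_pdivlMr// mulrC.
  rewrite !lebesgue_measure_itv/= !lte_fin ltr_pM2r ?invr_gt0//.
  case: ifP => _; last by rewrite mule0.
  by rewrite -!EFinB -EFinM -mulrBl mulrC divfK// gt_eqF.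
rewrite ge0_integral_mscale//; congr (_ * _)%E.
by rewrite (ge0_integral_pushforward ms).
Qed.

Lemma measurable_inv_real (R : realType) : measurable_fun setT (@GRing.inv R).
Proof.
rewrite -(setvU [set (0 : R)]); apply/measurable_funU.
- by apply: measurableC; exact: measurable_set1.
- exact: measurable_set1.
split; last exact: measurable_fun_set1.
apply: open_continuous_measurable_fun.
  by rewrite openC; exact: closed_eq.
by move=> x; rewrite inE/= => /eqP x0; exact: inv_continuous.
Qed.

(** * Tent functions as superpositions of cosines *)

Section fejer_kernel.
Variable R : realType.
Local Notation mu := (@lebesgue_measure R).

(* The value at 0 is [0] since [0^-1 = 0]. *)
Definition fejer (u : R) : R := (1 - cos u) / u ^+ 2.

Definition tent (s : R) : R := Num.max 0 (1 - `|s|).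

Lemma fejer_ge0 u : 0 <= fejer u.
Proof. by rewrite divr_ge0 ?one_sub_cos_ge0// sqr_ge0. Qed.

Lemma measurable_fejer : measurable_fun setT (fejer : measurableTypeR R -> R).
Proof.
apply: measurable_funM.
  have := measurable_one_sub_cos_scale (1 : R).
  by under eq_fun do rewrite mulr1.
by apply: (measurableT_comp (@measurable_inv_real R)); exact: measurable_funX.
Qed.

Lemma fejer_le u : fejer u <= 4 * (oneDsqr u)^-1.
Proof.
have u2 := sqr_ge0 u; have o0 : 0 < oneDsqr u by rewrite (lt_le_trans ltr01)// oneDsqr_ge1.
have [->|u0] := eqVneq u 0.
  by rewrite /fejer expr0n/= invr0 mulr0 mulr_ge0// invr_ge0 ltW.
have u20 : 0 < u ^+ 2 by rewrite lt_def sqrf_eq0 u0.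
rewrite /fejer ler_pdivrMr// mulrAC ler_pdivlMr//.
have h1 := one_sub_cos_le2 u; have h2 := one_sub_cos_le_sqr u; have h3 := one_sub_cos_ge0 u.
rewrite /oneDsqr; have [|] := leP 1 (u ^+ 2); nra.
Qed.

Lemma integrable_fejer : mu.-integrable setT (EFin \o fejer).
Proof.
apply/integrableP; split; first by apply/measurable_EFinP; exact: measurable_fejer.
have m4 : measurable_fun setT (fun u : measurableTypeR R => 4 * (oneDsqr u)^-1).
  apply: measurable_funM; first exact: measurable_cst.
  by apply: continuous_measurable_fun; exact: continuous_oneDsqrV.
apply: (@le_lt_trans _ _ (\int[mu]_u (4 * (oneDsqr u)^-1)%:E)%E).
  apply: ge0_le_integral => //.
  - by apply: measurableT_comp => //; apply/measurable_EFinP; exact: measurable_fejer.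
  - exact/measurable_EFinP.
  by move=> u _ /=; rewrite lee_fin ger0_norm ?fejer_ge0// fejer_le.
have p0 u : 0 <= (oneDsqr u)^-1 :> R by rewrite invr_ge0 (le_trans ler01)// oneDsqr_ge1.
under eq_integral do rewrite EFinM.
rewrite ge0_integralZl//; last first.
  by apply/measurable_EFinP; apply: continuous_measurable_fun; exact: continuous_oneDsqrV.
rewrite (ge0_symfun_integralT p0); last 2 first.
- exact: continuous_oneDsqrV.
- by move=> u; rewrite /= /oneDsqr sqrrN.
by rewrite -set_itvcy integral0y_oneDsqr -!EFinM ltry.
Qed.

(** Left unevaluated: a finite and positive mass suffices, since it divides out of
    [superposition]. *)
Definition fejer_mass : R := (\int[mu]_u fejer u)%R.

Lemma fejer_massE : (\int[mu]_u (fejer u)%:E = fejer_mass%:E)%E.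
Proof. by rewrite /fejer_mass /Rintegral fineK//; exact: integrable_fin_num integrable_fejer. Qed.

Lemma fejer_mass_gt0 : 0 < fejer_mass.
Proof.
rewrite -lte_fin -fejer_massE.
apply: (@lt_le_trans _ _ (\int[mu]_(u in `]0%R, 1%R]) (8^-1 : R)%:E)%E).
  by rewrite integral_cst//= lebesgue_measure_itv/= lte_fin ltr01 sube0 mule1 lte_fin.
apply: (@le_trans _ _ (\int[mu]_(u in `]0%R, 1%R]) (fejer u)%:E)%E).
  apply: ge0_le_integral => //.
  - by apply: measurable_funTS; apply/measurable_EFinP; exact: measurable_fejer.
  move=> u; rewrite /= in_itv/= => /andP[u0 u1]; rewrite lee_fin /fejer.
  rewrite ler_pdivlMr ?exprn_gt0// mulrC; apply: one_sub_cos_ge.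
  by rewrite gtr0_norm// (le_trans u1)// ler1n.
apply: ge0_subset_integral => //.
- by apply/measurable_EFinP; exact: measurable_fejer.
- by move=> u _; rewrite lee_fin fejer_ge0.
Qed.

Let kint (a u : R) : R := (1 - cos (u * a)) / u ^+ 2.

Let kint_dil a u : 0 < a -> kint a u = a ^+ 2 * fejer (a * u).
Proof.
move=> a0; rewrite /kint /fejer (mulrC u a); have [->|u0] := eqVneq u 0.
  by rewrite mulr0 cos0 subrr !mul0r mulr0.
by field; rewrite u0 gt_eqF.
Qed.

Let mkint a : measurable_fun setT (kint a : measurableTypeR R -> R).
Proof.
apply: measurable_funM; first exact: measurable_one_sub_cos_scale.
by apply: (measurableT_comp (@measurable_inv_real R)); exact: measurable_funX.
Qed.

Let kint_ge0 a u : 0 <= kint a u.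
Proof. by rewrite divr_ge0 ?one_sub_cos_ge0// sqr_ge0. Qed.

Let kint_int a : (\int[mu]_u (kint a u)%:E = (fejer_mass * `|a|)%:E)%E.
Proof.
wlog a0 : a / 0 <= a => [H|].
  have [/H//|a0] := leP 0 a.
  rewrite -normrN -H ?oppr_ge0 ?ltW//; apply: eq_integral => u _.
  by rewrite /kint mulrN cosN.
move: a0; rewrite le_eqVlt => /predU1P[<-|a0].
  rewrite normr0 mulr0; apply: integral0_eq => u _.
  by rewrite /kint mulr0 cos0 subrr mul0r.
rewrite gtr0_norm//.
have mf : measurable_fun setT (fun u : measurableTypeR R => (fejer u)%:E).
  by apply/measurable_EFinP; exact: measurable_fejer.
have f0 u : (0 <= (fejer u)%:E)%E by rewrite lee_fin fejer_ge0.
have := ge0_integral_dilation a0 mf f0; rewrite fejer_massE => h.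
under eq_integral do rewrite kint_dil// EFinM.
rewrite ge0_integralZl//; last 2 first.
- apply: (measurableT_comp mf); apply: measurable_funM => //; exact: measurable_cst.
- by rewrite lee_fin sqr_ge0.
by rewrite expr2 EFinM -muleA -h -EFinM mulrC.
Qed.

Let kint_integrable a : mu.-integrable setT (EFin \o kint a).
Proof.
apply/integrableP; split; first by apply/measurable_EFinP; exact: mkint.
have := kint_int a; under eq_integral do rewrite -[X in X%:E](ger0_norm (kint_ge0 _ _)).
by move=> h; rewrite /comp/= h ltry.
Qed.

Lemma tent_ge0 s : 0 <= tent s. Proof. by rewrite le_max lexx. Qed.
Lemma tent_le1 s : tent s <= 1.
Proof. by rewrite ge_max ler01 gerBl normr_ge0. Qed.

(** [fejer u * cos (u s)] is a combination of [(1 - cos (u a)) / u ^ 2] for [a = s + 1, s - 1, s],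
    whose integrals are [fejer_mass * |a|] by dilation, and [(|s + 1| + |s - 1|) / 2 - |s|] is the
    tent. *)
Lemma fourier_tent s : (\int[mu]_u (fejer u * cos (u * s)))%R = fejer_mass * tent s.
Proof.
have -> : (\int[mu]_u (fejer u * cos (u * s)))%R =
    (\int[mu]_u (2^-1 * kint (s + 1) u + 2^-1 * kint (s - 1) u - kint s u))%R.
  apply: eq_Rintegral => u _; rewrite /fejer /kint mulrDr mulrBr mulr1 cosD cosB.
  by move: ((u ^+ 2)^-1) => k; field.
have ki a : (\int[mu]_u kint a u)%R = fejer_mass * `|a| by rewrite /Rintegral kint_int.
have kh a : mu.-integrable setT (EFin \o (fun u => 2^-1 * kint a u)).
  by have := integrableZl measurableT 2^-1 (kint_integrable a).
rewrite RintegralB//; last by have := integrableD measurableT (kh (s + 1)) (kh (s - 1)).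
rewrite RintegralD// !RintegralZl// !ki /tent.
rewrite !mulrA !(mulrC _ fejer_mass) -!mulrA -mulrDr -mulrBr; congr (_ * _).
by case: (ger0P (s + 1)) => h1; case: (ger0P (s - 1)) => h2; case: (ger0P s) => h3;
  rewrite maxElt; case: ifPn; rewrite -?leNgt => h4; lra.
Qed.

End fejer_kernel.

Lemma EFin_Rintegral (R : realType) dT (T : measurableType dT) (m : {measure set T -> \bar R})
    (f : T -> R) : m.-integrable setT (EFin \o f) ->
  (\int[m]_t (f t)%:E = (\int[m]_t f t)%:E)%E.
Proof. by move=> fi; rewrite /Rintegral fineK//; exact: integrable_fin_num. Qed.

Section weighted_integrals.
Variables (R : realType) (dT : measure_display) (T : measurableType dT).
Local Notation mu := (@lebesgue_measure R).

Definition weighted_integral (m : {measure set T -> \bar R}) (w H : T -> R) : R :=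
  (\int[m]_t (H t * w t))%R.

Section integrability.
Variables (m : {measure set T -> \bar R}) (w : T -> R).
Hypotheses (w0 : forall t, 0 <= w t) (iw : m.-integrable setT (EFin \o w)).
Local Notation J := (weighted_integral m w).

Let mw : measurable_fun setT w.
Proof. by apply/measurable_EFinP; case/integrableP: iw. Qed.

Lemma weighted_integrable (H : T -> R) : measurable_fun setT H -> (forall t, `|H t| <= 1) ->
  m.-integrable setT (EFin \o (fun t => H t * w t)).
Proof.
move=> mH H1; apply: le_integrable iw => //.
  by apply/measurable_EFinP; apply: measurable_funM.
move=> t _ /=; rewrite lee_fin normrM (ger0_norm (w0 t)) ler_piMl//; exact: H1.
Qed.

Lemma weighted_integral_le (H : T -> R) : measurable_fun setT H -> (forall t, `|H t| <= 1) ->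
  `|J H| <= J (cst 1).
Proof.
move=> mH H1; have iH := weighted_integrable mH H1.
apply: le_trans (le_normr_Rintegral measurableT iH) _.
apply: le_Rintegral => //.
- by have := integrable_norm iH.
- by apply: weighted_integrable => // t; rewrite normr1.
by move=> t _; rewrite normrM (ger0_norm (w0 t)) ler_wpM2r//; exact: H1.
Qed.

Lemma weighted_integralD (H K : T -> R) : measurable_fun setT H -> (forall t, `|H t| <= 1) ->
  measurable_fun setT K -> (forall t, `|K t| <= 1) ->
  J (fun t => (H t + K t) / 2) = (J H + J K) / 2.
Proof.
move=> mH H1 mK K1; have iH := weighted_integrable mH H1; have iK := weighted_integrable mK K1.
rewrite /weighted_integral -RintegralD// -RintegralZr//.
  by apply: eq_Rintegral => t _; rewrite mulrAC mulrDl.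
by have := integrableD measurableT iH iK.
Qed.

End integrability.

Section superposition.
Variables (m : {sigma_finite_measure set T -> \bar R}) (w H s : T -> R).
Hypotheses (w0 : forall t, 0 <= w t) (iw : m.-integrable setT (EFin \o w)).
Hypotheses (mH : measurable_fun setT H) (H1 : forall t, `|H t| <= 1).
Hypothesis ms : measurable_fun setT s.
Local Notation J := (weighted_integral m w).

Let mw : measurable_fun setT w.
Proof. by apply/measurable_EFinP; case/integrableP: iw. Qed.

Let f (z : T * measurableTypeR R) : \bar R :=
  (H z.1 * w z.1 * (fejer z.2 * cos (z.2 * s z.1)))%:E.

Let mcos : measurable_fun setT (fun z : T * measurableTypeR R => cos (z.2 * s z.1)).
Proof.
apply: (measurableT_comp (f := cos)).
  by apply: continuous_measurable_fun; exact: continuous_cos.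
by apply: measurable_funM; [meas|apply: (measurableT_comp ms); meas].
Qed.

Let mf : measurable_fun setT f.
Proof.
apply/measurable_EFinP; apply: measurable_funM.
  by apply: measurable_funM; [apply: (measurableT_comp mH)|apply: (measurableT_comp mw)]; meas.
by apply: measurable_funM; [apply: (measurableT_comp (@measurable_fejer R)); meas|exact: mcos].
Qed.

Let intf : (m \x mu)%E.-integrable setT f.
Proof.
apply/(integrable12ltyP _ _ mf) => //.
apply: (@le_lt_trans _ _ (\int[m]_t \int[mu]_u ((w t)%:E * (fejer u)%:E))%E).
  apply: ge0_le_integral => //.
  - by move=> t _; apply: integral_ge0.
  - apply: (measurable_fun_fubini_tonelli_F (m2 := mu) (fun z => `|f z|)%E) => //.
    exact: measurableT_comp.
  - apply: (measurable_fun_fubini_tonelli_F (m2 := mu)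
      (fun z : T * measurableTypeR R => (w z.1)%:E * (fejer z.2)%:E)%E).
      apply: emeasurable_funM; apply/measurable_EFinP.
        by apply: (measurableT_comp mw); meas.
      by apply: (measurableT_comp (@measurable_fejer R)); meas.
    by move=> z; rewrite mule_ge0// lee_fin ?fejer_ge0.
  move=> t _; apply: ge0_le_integral => //.
  - apply: measurableT_comp => //.
    apply: (measurableT_comp mf (g := fun u : measurableTypeR R => (t, u))); meas.
  - apply: emeasurable_funM; first exact: measurable_cst.
    by apply/measurable_EFinP; exact: measurable_fejer.
  move=> u _; rewrite /f/= -EFinM lee_fin normrM (normrM (H t)) (normrM (fejer u)) (ger0_norm (w0 t)) (ger0_norm (fejer_ge0 u)).
  have := H1 t; have := cos_max (u * s t); have := fejer_ge0 u; have := w0 t.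
  move=> h1 h2 h3 h4; rewrite [leLHS](_ : _ = `|H t| * `|cos (u * s t)| * (w t * fejer u)); last by ring.
  by apply: ler_piMl; [exact: mulr_ge0|apply: mulr_ile1].
under eq_integral => t _.
  rewrite ge0_integralZl//; last 3 first.
  - by apply/measurable_EFinP; exact: measurable_fejer.
  - by move=> u _; rewrite lee_fin fejer_ge0.
  - by rewrite lee_fin.
  rewrite fejer_massE; over.
rewrite ge0_integralZr//; last 3 first.
- exact/measurable_EFinP.
- by move=> t _; rewrite lee_fin.
- by rewrite lee_fin ltW// fejer_mass_gt0.
by rewrite (EFin_Rintegral iw) -EFinM ltry.
Qed.

Let Hcos u : measurable_fun setT (fun t => H t * cos (u * s t)).
Proof.
apply: measurable_funM => //; apply: (measurableT_comp (f := cos)).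
  by apply: continuous_measurable_fun; exact: continuous_cos.
by apply: measurable_funM => //; exact: measurable_cst.
Qed.

Let Hcos1 u t : `|H t * cos (u * s t)| <= 1.
Proof. by rewrite normrM mulr_ile1// cos_max. Qed.

Let innerT u : (\int[m]_t f (t, u) =
  (fejer u * J (fun t => H t * cos (u * s t)))%:E)%E.
Proof.
have ih := weighted_integrable w0 iw (Hcos u) (Hcos1 u).
rewrite EFinM /weighted_integral -EFin_Rintegral// -integralZl//.
by apply: eq_integral => t _; rewrite /f/= -EFinM; congr EFin; ring.
Qed.

Lemma integrable_superposition :
  mu.-integrable setT (EFin \o (fun u => fejer u * J (fun t => H t * cos (u * s t)))).
Proof.
have ib := integrableZl measurableT (J (cst 1)) (integrable_fejer R).
apply: le_integrable ib => //.
  have := measurable_fubini_G intf; congr (measurable_fun _ _).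
  by apply/funext => u; rewrite /fubini_G innerT.
move=> u _; rewrite /comp -EFinM lee_fin (mulrC (fejer u)).
apply: le_trans (ler_norm _); rewrite normrM (ger0_norm (fejer_ge0 u)).
have J1 := weighted_integral_le w0 iw (Hcos u) (Hcos1 u).
by rewrite ler_wpM2r ?fejer_ge0.
Qed.

(* Fubini and the Fourier representation of the tent function. *)
Lemma superposition : fejer_mass R * J (fun t => H t * tent (s t)) =
  (\int[mu]_u (fejer u * J (fun t => H t * cos (u * s t))))%R.
Proof.
apply: EFin_inj; rewrite -(EFin_Rintegral integrable_superposition).
under [RHS]eq_integral do rewrite /= -innerT.
rewrite -(Fubini intf).
have mHt : measurable_fun setT (fun t => H t * tent (s t)).
  apply: measurable_funM => //; apply: measurable_maxr; first exact: measurable_cst.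
  by apply: measurable_funB; [exact: measurable_cst|exact: measurableT_comp].
have iHt : m.-integrable setT (EFin \o (fun t => H t * tent (s t) * w t)).
  apply: weighted_integrable => // t.
  by rewrite normrM mulr_ile1// ger0_norm ?tent_ge0 ?tent_le1.
rewrite EFinM /weighted_integral -(EFin_Rintegral iHt) -integralZl//.
apply: eq_integral => t _; rewrite /f/=.
have ifc : mu.-integrable setT (EFin \o (fun u => fejer u * cos (u * s t))).
  apply: le_integrable (integrable_fejer R) => //.
    apply/measurable_EFinP; apply: measurable_funM; first exact: measurable_fejer.
    apply: (measurableT_comp (f := cos)).
      by apply: continuous_measurable_fun; exact: continuous_cos.
    by apply: measurable_funM => //; exact: measurable_cst.
  by move=> u _ /=; rewrite lee_fin normrM ler_piMr// cos_max.
under [RHS]eq_integral do rewrite EFinM.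
rewrite integralZl// EFin_Rintegral// fourier_tent -!EFinM; congr EFin; ring.
Qed.

End superposition.
End weighted_integrals.

(** * From cosine transforms to tent functions of several variables *)

Section symmetrized_integrals.
Variables (R : realType) (d : nat).
Local Notation E := 'rV[R]_d.
Local Notation mu := (@lebesgue_measure R).

(** Averaging over [phi] and [- phi] removes the sine transform, so that phases can be introduced
    freely while only cosine transforms are known to converge. *)
Definition symmetrized_integral dT (T : measurableType dT) (m : {measure set T -> \bar R})
    (w : T -> R) (phi : T -> E) (G : E -> R) : R :=
  (weighted_integral m w (G \o phi) + weighted_integral m w (fun t => G (- phi t))) / 2.

Section one_measure.
Variables (dT : measure_display) (T : measurableType dT).
Variables (m : {sigma_finite_measure set T -> \bar R}) (w : T -> R) (phi : T -> E).
Hypotheses (w0 : forall t, 0 <= w t) (iw : m.-integrable setT (EFin \o w)).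
Hypothesis mphi : measurable_fun setT phi.
Local Notation S := (symmetrized_integral m w phi).

Let mphiN : measurable_fun setT (fun t => - phi t).
Proof. exact: measurable_funN_rV. Qed.

Lemma symmetrized_integral_le (H : E -> R) : measurable_fun setT H ->
  (forall y, `|H y| <= 1) -> `|S H| <= S (cst 1).
Proof.
move=> mH H1; rewrite /symmetrized_integral normrM (ger0_norm (_ : 0 <= 2^-1)) ?invr_ge0//.
rewrite ler_wpM2r ?invr_ge0//; apply: le_trans (ler_normD _ _) _; apply: lerD.
  exact: (weighted_integral_le w0 iw (measurableT_comp mH mphi) (fun t => H1 _)).
exact: (weighted_integral_le w0 iw (measurableT_comp mH mphiN) (fun t => H1 _)).
Qed.

Lemma symmetrized_integral_avg (H K : E -> R) : measurable_fun setT H ->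
  (forall t, `|H t| <= 1) -> measurable_fun setT K -> (forall t, `|K t| <= 1) ->
  S (fun y => (H y + K y) / 2) = (S H + S K) / 2.
Proof.
move=> mH H1 mK K1; rewrite /symmetrized_integral /comp.
rewrite (weighted_integralD w0 iw (H := fun t => H (phi t)) (K := fun t => K (phi t)));
  [|exact: measurableT_comp|by []|exact: measurableT_comp|by []].
rewrite (weighted_integralD w0 iw (H := fun t => H (- phi t)) (K := fun t => K (- phi t)));
  [|exact: measurableT_comp|by []|exact: measurableT_comp|by []].
by field.
Qed.

Lemma symmetrized_integral_cos (xi : E) (c : R) :
  S (fun y => cos (dotv xi y + c)) = cos c * weighted_integral m w (fun t => cos (dotv xi (phi t))).
Proof.
have mc a : measurable_fun setT (fun t => cos (dotv xi (phi t) + a)) by exact: measurable_cos_dotv.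
have mcN a : measurable_fun setT (fun t => cos (dotv xi (- phi t) + a)) by exact: measurable_cos_dotv.
have c1 t a : `|cos (dotv xi (phi t) + a)| <= 1 by exact: cos_max.
rewrite /symmetrized_integral /comp.
rewrite -(weighted_integralD w0 iw (mc c) (fun t => cos_max _) (mcN c) (fun t => cos_max _)).
rewrite /weighted_integral -RintegralZl//; last first.
  by apply: weighted_integrable => // [|t]; [exact: measurable_cos_dotv0|exact: cos_max].
apply: eq_Rintegral => t _; rewrite mulrA; congr (_ * _).
have -> : dotv xi (- phi t) = - dotv xi (phi t) by rewrite dotvC -scaleN1r dotvZl mulN1r dotvC.
by rewrite !cosD cosN sinN; field.
Qed.

Section tent_factor.
Variables (H s : E -> R).
Hypotheses (mH : measurable_fun setT H) (H1 : forall y, `|H y| <= 1).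
Hypothesis ms : measurable_fun setT s.

Let mHp : measurable_fun setT (H \o phi). Proof. exact: measurableT_comp. Qed.
Let msp : measurable_fun setT (s \o phi). Proof. exact: measurableT_comp. Qed.
Let mHn : measurable_fun setT (fun t => H (- phi t)).
Proof. by apply: (measurableT_comp mH). Qed.
Let msn : measurable_fun setT (fun t => s (- phi t)).
Proof. by apply: (measurableT_comp ms). Qed.

Let i1 := integrable_superposition w0 iw mHp (fun t => H1 (phi t)) msp.
Let i2 := integrable_superposition w0 iw mHn (fun t => H1 (- phi t)) msn.

Let integrandE u : fejer u * S (fun y => H y * cos (u * s y)) =
  (fejer u * weighted_integral m w (fun t => (H \o phi) t * cos (u * (s \o phi) t)) +
   fejer u * weighted_integral m w (fun t => H (- phi t) * cos (u * s (- phi t)))) / 2.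
Proof. by rewrite /symmetrized_integral -mulrDr mulrA. Qed.

Let i12 : mu.-integrable setT (EFin \o (fun u =>
  fejer u * weighted_integral m w (fun t => (H \o phi) t * cos (u * (s \o phi) t)) +
  fejer u * weighted_integral m w (fun t => H (- phi t) * cos (u * s (- phi t))))).
Proof. by have := integrableD measurableT i1 i2. Qed.

Lemma symmetrized_superposition_integrable :
  mu.-integrable setT (EFin \o (fun u => fejer u * S (fun y => H y * cos (u * s y)))).
Proof.
have := integrableZl measurableT 2^-1 i12; apply: eq_integrable => // u _.
by rewrite /= integrandE -EFinM mulrC.
Qed.

Lemma symmetrized_superposition : fejer_mass R * S (fun y => H y * tent (s y)) =
  (\int[mu]_u (fejer u * S (fun y => H y * cos (u * s y))))%R.
Proof.
under [RHS]eq_Rintegral do rewrite integrandE.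
rewrite RintegralZr// RintegralD//.
rewrite -(superposition w0 iw mHp (fun t => H1 (phi t)) msp).
rewrite -(superposition w0 iw mHn (fun t => H1 (- phi t)) msn).
by rewrite /symmetrized_integral mulrA mulrDr.
Qed.

End tent_factor.
End one_measure.

Section convergence.
Variables (dT dT' : measure_display) (T : measurableType dT) (T' : measurableType dT').
Variables (m : {sigma_finite_measure set T -> \bar R}) (w : nat -> T -> R) (phi : nat -> T -> E).
Variables (m' : {sigma_finite_measure set T' -> \bar R}) (w' : T' -> R) (phi' : T' -> E).
Hypotheses (w0 : forall n t, 0 <= w n t) (iw : forall n, m.-integrable setT (EFin \o w n)).
Hypotheses (w'0 : forall t, 0 <= w' t) (iw' : m'.-integrable setT (EFin \o w')).
Hypotheses (mphi : forall n, measurable_fun setT (phi n)) (mphi' : measurable_fun setT phi').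
Local Notation S n := (symmetrized_integral m (w n) (phi n)).
Local Notation S' := (symmetrized_integral m' w' phi').

Hypothesis cvg_cos : forall xi,
  weighted_integral m (w n) (fun t => cos (dotv xi (phi n t))) @[n --> \oo] -->
  weighted_integral m' w' (fun t => cos (dotv xi (phi' t))).

Let total_bounded : exists B, forall n, S n (cst 1) <= B.
Proof.
have e1 : (cst 1 : E -> R) = (fun y : E => cos (dotv (0 : E) y + 0)).
  by apply/funext => y; rewrite /dotv big1 ?addr0 ?cos0// => i _; rewrite mxE mul0r.
have cS : S n (cst 1) @[n --> \oo] --> S' (cst 1).
  rewrite e1 symmetrized_integral_cos//.
  under eq_fun do rewrite symmetrized_integral_cos//.
  by apply: cvgMr; exact: cvg_cos.
have /cvg_seq_bounded[M [_ hM]] : cvgn (fun n => S n (cst 1)) by apply/cvg_ex; eexists; exact: cS.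
exists (M + 1) => n; apply: le_trans (ler_norm _) _; apply: (hM (M + 1)) => //.
by rewrite ltrDl.
Qed.

(** A tent factor is a mixture of cosines with the integrable weight [fejer]. The total masses
    converge, as cosine transforms at frequency 0, and are therefore bounded: dominated convergence
    in the frequency applies. *)
Let cvg_step (H s : E -> R) : measurable_fun setT H -> (forall y, `|H y| <= 1) ->
  measurable_fun setT s ->
  (forall u, S n (fun y => H y * cos (u * s y)) @[n --> \oo] --> S' (fun y => H y * cos (u * s y))) ->
  S n (fun y => H y * tent (s y)) @[n --> \oo] --> S' (fun y => H y * tent (s y)).
Proof.
move=> mH H1 ms cu; have [B hB] := total_bounded.
have iS n := symmetrized_superposition_integrable (w0 n) (iw n) (mphi n) mH H1 ms.
have iS' := symmetrized_superposition_integrable w'0 iw' mphi' mH H1 ms.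
have mHc u : measurable_fun setT (fun y : E => H y * cos (u * s y)).
  apply: measurable_funM => //; apply: (measurableT_comp (f := cos)).
    by apply: continuous_measurable_fun; exact: continuous_cos.
  by apply: measurable_funM => //; exact: measurable_cst.
have Hc1 u y : `|H y * cos (u * s y)| <= 1 by rewrite normrM mulr_ile1// cos_max.
have cI : (\int[mu]_u (fejer u * S n (fun y => H y * cos (u * s y)))%:E)%E @[n --> \oo] -->
    (\int[mu]_u (fejer u * S' (fun y => H y * cos (u * s y)))%:E)%E.
  have iB := integrableZl measurableT B (integrable_fejer R).
  have h1 n : measurable_fun setT (fun u : measurableTypeR R => (fejer u * S n (fun y => H y * cos (u * s y)))%:E).
    by case/integrableP: (iS n).
  have h2 : measurable_fun setT (fun u : measurableTypeR R => (fejer u * S' (fun y => H y * cos (u * s y)))%:E).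
    by case/integrableP: iS'.
  have [||_ _] := dominated_convergence measurableT h1 h2 _ iB _.
  - apply: aeW => u _; apply: cvg_EFin; first exact: nearW.
    by apply: cvgMr; exact: cu.
  - apply: aeW => u n _; rewrite -EFinM lee_fin mulrC normrM (ger0_norm (fejer_ge0 u)).
    rewrite ler_wpM2r ?fejer_ge0//; apply: le_trans (hB n).
    exact: (symmetrized_integral_le (w0 n) (iw n) (mphi n) (mHc u) (Hc1 u)).
  exact.
have k0 := fejer_mass_gt0 R.
have e n : S n (fun y => H y * tent (s y)) = (fejer_mass R)^-1 *
    fine (\int[mu]_u (fejer u * S n (fun y => H y * cos (u * s y)))%:E)%E.
  by rewrite -[fine _](symmetrized_superposition (w0 n) (iw n) (mphi n) mH H1 ms) mulKf ?gt_eqF.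
have e' : S' (fun y => H y * tent (s y)) = (fejer_mass R)^-1 *
    fine (\int[mu]_u (fejer u * S' (fun y => H y * cos (u * s y)))%:E)%E.
  by rewrite -[fine _](symmetrized_superposition w'0 iw' mphi' mH H1 ms) mulKf ?gt_eqF.
under eq_fun do rewrite e; rewrite e'; apply: cvgMr.
apply: fine_cvg; rewrite fineK//; exact: integrable_fin_num iS'.
Qed.

Definition tent_product (l : seq 'I_d) (z : E) (r : R) (y : E) : R :=
  \prod_(i <- l) tent ((y 0 i - z 0 i) / r).

Lemma measurable_tent_coord (i : 'I_d) (z r : R) :
  measurable_fun setT (fun y : E => (y 0 i - z) / r).
Proof.
apply: measurable_funM; last exact: measurable_cst.
by apply: measurable_funB; [exact: measurable_coord|exact: measurable_cst].
Qed.

Lemma measurable_tent_product l z r : measurable_fun setT (tent_product l z r).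
Proof.
apply: measurable_prod => i _; apply: measurable_maxr; first exact: measurable_cst.
apply: measurable_funB; first exact: measurable_cst.
by apply: measurableT_comp => //; exact: measurable_tent_coord.
Qed.

Lemma tent_product_ge0 l z r y : 0 <= tent_product l z r y.
Proof. by apply: prodr_ge0 => i _; exact: tent_ge0. Qed.

Lemma tent_product_le1 l z r y : tent_product l z r y <= 1.
Proof. by apply: prodr_ile1 => i _; rewrite tent_ge0 tent_le1. Qed.

Lemma tent_product_cvg l z r : 
  S n (tent_product l z r) @[n --> \oo] --> S' (tent_product l z r).
Proof.
(* The extra cosine closes the induction: each tent contributes a factor [cos (u (y_i - z_i) / r)],
   and the product of two cosines is an average of two cosines with shifted frequency and phase. *)
suff H xi c : S n (fun y => tent_product l z r y * cos (dotv xi y + c)) @[n --> \oo] -->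
    S' (fun y => tent_product l z r y * cos (dotv xi y + c)).
  have e : (fun y : E => tent_product l z r y * cos (dotv (0 : E) y + 0)) = tent_product l z r.
    apply/funext => y; rewrite /dotv big1 ?addr0 ?cos0 ?mulr1// => i _.
    by rewrite mxE mul0r.
  by have := H 0 0; rewrite e.
elim: l xi c => [|i l IH] xi c.
  have e : (fun y : E => tent_product [::] z r y * cos (dotv xi y + c)) =
      (fun y => cos (dotv xi y + c)).
    by apply/funext => y; rewrite /tent_product big_nil mul1r.
  rewrite e symmetrized_integral_cos//.
  under eq_fun do rewrite symmetrized_integral_cos//.
  by apply: cvgMr; exact: cvg_cos.
have e : (fun y : E => tent_product (i :: l) z r y * cos (dotv xi y + c)) =
    (fun y => tent_product l z r y * cos (dotv xi y + c) * tent ((y 0 i - z 0 i) / r)).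
  by apply/funext => y; rewrite /tent_product big_cons; ring.
have mG xi' c' : measurable_fun setT (fun y : E => tent_product l z r y * cos (dotv xi' y + c')).
  apply: measurable_funM; first exact: measurable_tent_product.
  exact: (measurable_cos_dotv _ _ (f := id)).
have G1 xi' c' (y : E) : `|tent_product l z r y * cos (dotv xi' y + c')| <= 1.
  rewrite normrM mulr_ile1// ?cos_max// ger0_norm ?tent_product_ge0//.
  exact: tent_product_le1.
rewrite e; apply: cvg_step => //; first exact: measurable_tent_coord.
move=> u; pose e_i := (u / r) *: (delta_mx 0 i : E).
have eu (y : E) : dotv e_i y = u / r * y 0 i.
  rewrite dotvZl; congr (_ * _); rewrite /dotv (bigD1 i)//= mxE !eqxx mul1r big1 ?addr0// => j ji.
  by rewrite mxE eqxx/= (negbTE ji) mul0r.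
have e2 : (fun y : E => tent_product l z r y * cos (dotv xi y + c) *
      cos (u * ((y 0 i - z 0 i) / r))) =
    (fun y => (tent_product l z r y * cos (dotv (xi + e_i) y + (c - u / r * z 0 i)) +
      tent_product l z r y * cos (dotv (xi + - e_i) y + (c + u / r * z 0 i))) / 2).
  apply/funext => y; rewrite !dotvDl eu.
  have -> : dotv (- e_i) y = - (u / r * y 0 i) by rewrite -eu -scaleN1r dotvZl mulN1r.
  have -> : u * ((y 0 i - z 0 i) / r) = u / r * y 0 i - u / r * z 0 i by ring.
  move: (dotv xi y) (u / r * y 0 i) (u / r * z 0 i) => a b0 c0.
  have -> : a + b0 + (c - c0) = (a + c) + (b0 - c0) by ring.
  have -> : a + - b0 + (c + c0) = (a + c) - (b0 - c0) by ring.
  by rewrite (cosD (a + c)) (cosB (a + c)); field.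
rewrite e2 symmetrized_integral_avg//.
under eq_fun do rewrite symmetrized_integral_avg//.
by apply: cvgMl; apply: cvgD; exact: IH.
Qed.

End convergence.
End symmetrized_integrals.

Section second_difference.
Variables (R : realType) (d : nat) (eta : 'rV[R]_d).
Local Notation E := 'rV[R]_d.

(** In the frequency variable. On [cos (xi.y)] it acts as multiplication by [1 - cos (eta.y)]; on a
    quadratic form it gives a constant, so that its square annihilates the Gaussian part of the
    exponent. *)
Definition second_difference (F : E -> R) (xi : E) : R :=
  F xi - (F (xi + eta) + F (xi - eta)) / 2.
Local Notation D := second_difference.

Lemma second_difference_cos (xi y : E) :
  D (fun zeta => cos (dotv zeta y)) xi = cos (dotv xi y) * (1 - cos (dotv eta y)).
Proof.
rewrite /D !dotvDl (_ : dotv (- eta) y = - dotv eta y); last by rewrite -scaleN1r dotvZl mulN1r.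
by rewrite cosB cosD; field.
Qed.

Lemma second_difference2_affine (k : R) (F : E -> R) (xi : E) :
  k * D (D F) xi = D (D (fun zeta => k * (F zeta - 1))) xi.
Proof.
rewrite /D; move: (F _) (F _) (F _) (F _) (F _) (F _) (F _) => a1 a2 a3 a4 a5 a6 a7.
by field.
Qed.

Lemma second_difference2_quadratic (q A : E -> R) (c : R) (xi : E) :
  (forall z, D q z = c) -> D (D (fun z => - A z)) xi = D (D (fun z => - (q z / 2 + A z))) xi.
Proof.
move=> Dq; have := Dq xi; have := Dq (xi + eta); have := Dq (xi - eta); rewrite /D {Dq} => h1 h2 h3.
lra.
Qed.

Lemma second_difference_cvg (F : nat -> E -> R) (G : E -> R) :
  (forall xi, F n xi @[n --> \oo] --> G xi) ->
  forall xi, D (F n) xi @[n --> \oo] --> D G xi.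
Proof. by move=> FG xi; apply: cvgB => //; apply: cvgMl; apply: cvgD. Qed.

Lemma second_difference_integral dT (T : measurableType dT) (m : {measure set T -> \bar R})
    (F : E -> T -> R) : (forall xi, m.-integrable setT (EFin \o F xi)) ->
  forall xi, m.-integrable setT (EFin \o (fun t => D (F^~ t) xi)) /\
   (\int[m]_t D (F^~ t) xi)%R = D (fun zeta => \int[m]_t F zeta t)%R xi.
Proof.
move=> iF xi.
have iS : m.-integrable setT (EFin \o (fun t => F (xi + eta) t + F (xi - eta) t)).
  by have := integrableD measurableT (iF (xi + eta)) (iF (xi - eta)).
have iS2 : m.-integrable setT (EFin \o (fun t => (F (xi + eta) t + F (xi - eta) t) / 2)).
  have := integrableZl measurableT 2^-1 iS; apply: eq_integrable => // t _.
  by rewrite /= -EFinM mulrC.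
split; first by have := integrableB measurableT (iF xi) iS2.
by rewrite /D RintegralB// RintegralZr// RintegralD.
Qed.

End second_difference.

Lemma cvg_expR_difference_quotient (R : realType) (a : R) : 0 <= a ->
  n.+1%:R * (expR (- (n.+1%:R^-1 * a)) - 1) @[n --> \oo] --> - a.
Proof.
move=> a0; apply/cvgrPdist_le => e e0.
(* [expR_sub_quadratic] leaves an error of at most [a ^ 2 / (n + 1)]. *)
exists (Num.truncn (a ^+ 2 / e)) => // n /= an.
have n0 : 0 < n.+1%:R :> R by rewrite ltr0n.
have x0 : 0 <= n.+1%:R^-1 * a by rewrite mulr_ge0// invr_ge0 ltW.
have := @expR_sub_quadratic R 0 (n.+1%:R^-1 * a) (n.+1%:R^-1 * a) (lexx 0) x0.
rewrite subr0 oppr0 expR0 mul1r lexx andbT ler_piMl//; last first.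
  by rewrite -[leRHS]expR0 ler_expR oppr_le0.
move/(_ isT) => H.
have -> : - a - n.+1%:R * (expR (- (n.+1%:R^-1 * a)) - 1) =
    n.+1%:R * (1 - expR (- (n.+1%:R^-1 * a)) - n.+1%:R^-1 * a).
  by rewrite 2!mulrBr mulrA divff ?gt_eqF// mul1r; ring.
rewrite normrM gtr0_norm//; apply: (le_trans (ler_wpM2l (ltW n0) H)).
rewrite exprMn mulrA (_ : n.+1%:R * n.+1%:R^-1 ^+ 2 = n.+1%:R^-1); last first.
  by rewrite expr2 mulrA divff ?mul1r// gt_eqF.
rewrite mulrC ler_pdivrMr// -ler_pdivrMl// mulrC.
apply/ltW; apply: (lt_le_trans (truncnS_gt _)); by rewrite ler_nat ltnS.
Qed.

Section cubes.
Variables (R : realType) (d : nat).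
Local Notation E := 'rV[R]_d.

Definition cube (z : E) (r : R) : set E := [set y | forall i, `|y 0 i - z 0 i| < r].

Lemma measurable_cube z r : measurable (cube z r).
Proof.
apply: (measurable_rV_box (A := fun i => [set a | `|a - z 0 i| < r])) => i.
rewrite (_ : [set _ | _] = `]z 0 i - r, z 0 i + r[%classic); first exact: measurable_itv.
by apply/seteqP; split => a /=; rewrite in_itv/= ltr_distl.
Qed.

Lemma cubeN z r y : cube z r (- y) <-> cube (- z) r y.
Proof.
have e i : `|(- y) 0 i - z 0 i| = `|y 0 i - (- z) 0 i|.
  by rewrite !mxE opprK -normrN opprB opprK addrC.
by split => h i; have := h i; rewrite e.
Qed.

Definition cube_tent (z : E) (r : R) : E -> R := tent_product (index_enum 'I_d) z r.

Lemma cube_tent_ge z r y : 0 < r -> cube z (r / 2) y -> (2 ^+ d)^-1 <= cube_tent z r y.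
Proof.
move=> r0 h; rewrite -exprVn /cube_tent /tent_product -{1}(card_ord d) -prodr_const.
apply: ler_prod => i _; rewrite invr_ge0 ler0n/= /tent le_max; apply/orP; right.
rewrite normrM normfV (gtr0_norm r0).
have : `|y 0 i - z 0 i| / r <= 1 / 2.
  by rewrite ler_pdivrMr// mul1r mulrC ltW//; exact: h.
lra.
Qed.

Lemma cube_tent_notin z r y : 0 < r -> ~ cube z r y -> cube_tent z r y = 0.
Proof.
move=> r0 /existsNP[i /negP]; rewrite -leNgt => hi.
rewrite /cube_tent /tent_product (bigD1 i)//= (_ : tent _ = 0) ?mul0r//.
by apply/max_idPl; rewrite subr_le0 normrM normfV (gtr0_norm r0) ler_pdivlMr// mul1r.
Qed.

Lemma cube_quarter (a r b : R) : a < r -> 4 * r <= b -> a <= 1 / 4 * b.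
Proof. by lra. Qed.

Lemma cube_far (z y : E) (r : R) i : 4 * r <= `|z 0 i| -> cube z r y -> r <= enorm y.
Proof.
move=> zr /(_ i) h; apply: le_trans (coord_le_enorm y i).
have := ler_dist_dist (z 0 i) (y 0 i); rewrite (distrC (z 0 i)).
move: (y 0 i) (z 0 i) h zr => a c h zr; rewrite ler_norml => /andP[_ h2].
have := normr_ge0 (a - c); lra.
Qed.

End cubes.

Section sigma_finite_copy.
Variables (R : realType) (dT : measure_display) (T : measurableType dT).
Variables (m : {measure set T -> \bar R}) (sf : sigma_finite setT m).

(** Attaches a proof of sigma-finiteness to a given measure. The proof is an argument, so that the
    structure can be declared once and then used for the Levy measure. *)
Definition sigma_finite_copy of sigma_finite setT m : set T -> \bar R := m.

HB.instance Definition _ := isMeasure.Build _ _ _ (sigma_finite_copy sf)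
  (measure0 m) (measure_ge0 m) (@measure_semi_sigma_additive _ _ _ m).
HB.instance Definition _ := Measure_isSigmaFinite.Build _ _ _ (sigma_finite_copy sf) sf.

Lemma integral_sigma_finite_copy (f : T -> \bar R) :
  (\int[sigma_finite_copy sf]_x f x = \int[m]_x f x)%E.
Proof. exact: eq_measure_integral. Qed.

End sigma_finite_copy.

(** * Small-time jump rates of cubes *)

Section small_time_jumps.
Variables (R : realType) (d : nat) (dO : measure_display) (O : measurableType dO).
Variables (P : probability O R) (X : R -> O -> 'rV[R]_d).
Hypothesis hX : levy_process P X.
Hypothesis sX : symmetric_process P X.
Local Notation E := 'rV[R]_d.
Variables (N : {measure set E -> \bar R}) (b : E) (Q : 'M[R]_d).
Hypothesis N0 : N [set 0] = 0%E.
Hypothesis Nfin : (\int[N]_y (Num.min 1 (enorm y ^+ 2))%:E < +oo)%E.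
Hypothesis Qpos : forall xi : E, 0 <= dotv xi (xi *m Q).
Hypothesis lk : levy_khintchine P X b Q N.

Lemma levy_measure_tail (r : R) : 0 < r -> (N [set y | (r <= enorm y)%R] < +oo)%E.
Proof.
move=> r0; pose c := Num.min 1 (r ^+ 2).
have c0 : 0 < c by rewrite lt_min ltr01 exprn_gt0.
have mA : measurable [set y : E | r <= enorm y] by exact: (measurable_enorm_ge (f := id)).
have h : (c%:E * N [set y | (r <= enorm y)%R] <= \int[N]_y (Num.min 1 (enorm y ^+ 2))%:E)%E.
  rewrite -[X in N X]setIT -integral_indic// -ge0_integralZl//; last first.
  - by rewrite lee_fin ltW.
  - exact/measurable_EFinP.
  apply: ge0_le_integral => //.
  - by move=> w _; rewrite mule_ge0// lee_fin// ltW.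
  - by apply: emeasurable_funM => //; exact/measurable_EFinP.
  - by case/integrableP: (integrable_min_sqr Nfin).
  move=> w _; rewrite indicE -EFinM lee_fin; case: (boolP (w \in _)) => [|_].
    rewrite inE/= => rw; rewrite mulr1 /c le_min ge_min lexx/= ge_min; apply/orP; right.
    by rewrite lerXn2r// ?nnegrE ?enorm_ge0// ltW.
  by rewrite mulr0 le_min ler01 sqr_ge0.
have := le_lt_trans h Nfin.
have := measure_ge0 N [set y | (r <= enorm y)%R].
move: (N [set y | (r <= enorm y)%R]) => [x _ _|_|//]; first exact: ltry.
by rewrite gt0_muley ?lte_fin.
Qed.

Let N_sigma_finite : sigma_finite setT N.
Proof.
pose F k : set E := [set y | k.+1%:R^-1 <= enorm y] `|` [set 0].
exists F.
  apply/esym/seteqP; split => // y _.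
  have [->|y0] := eqVneq y 0; first by exists 0%N => //; right.
  have e0 : 0 < enorm y by rewrite lt_def enorm_ge0 enorm0_eq0 y0.
  have [k _ hk] := near_infty_natSinv_lt (PosNum e0).
  by exists k => //; left; apply/ltW; have := hk k (leqnn k).
move=> k; have mA : measurable [set y : E | k.+1%:R^-1 <= enorm y].
  exact: (measurable_enorm_ge (f := id)).
have m0 : measurable ([set 0] : set E).
  rewrite (_ : [set 0] = [set y : E | forall i, [set 0 : R] (y 0 i)]).
    by apply: (measurable_rV_box (A := fun=> [set 0])) => i; exact: measurable_set1.
  by apply/seteqP; split => y /= => [-> i|h]; [rewrite mxE|apply/rowP => i; rewrite mxE; exact: h].
split; first exact: measurableU.
apply: (@le_lt_trans _ _ (N [set y | (k.+1%:R^-1 <= enorm y)%R] + N [set (0 : E)%R])%E).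
  exact: measureU2.
by rewrite N0 adde0; apply: levy_measure_tail; rewrite invr_gt0.
Qed.

Local Notation N' := (sigma_finite_copy N_sigma_finite).

Section frequency.
Variable eta : E.
Local Notation D := (second_difference eta).

(* Of fourth order at [0]: neither the Gaussian part nor the small jumps survive in the limit. *)
Definition jump_weight (y : E) : R := (1 - cos (dotv eta y)) ^+ 2.

Lemma jump_weight_ge0 y : 0 <= jump_weight y. Proof. exact: sqr_ge0. Qed.

Lemma jump_weight_le4 y : jump_weight y <= 4.
Proof.
by have := one_sub_cos_ge0 (dotv eta y); have := one_sub_cos_le2 (dotv eta y); rewrite /jump_weight; nra.
Qed.

Lemma jump_weightN y : jump_weight (- y) = jump_weight y.
Proof.
rewrite /jump_weight (_ : dotv eta (- y) = - dotv eta y) ?cosN//.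
by rewrite dotvC -scaleN1r dotvZl mulN1r dotvC.
Qed.

Lemma measurable_jump_weight dT (T : measurableType dT) (f : T -> E) :
  measurable_fun setT f -> measurable_fun setT (fun t => jump_weight (f t)).
Proof.
move=> mf; apply: measurable_funX; apply: measurable_funB; first exact: measurable_cst.
exact: measurable_cos_dotv0.
Qed.

Lemma integrable_jump_weight : N.-integrable setT (EFin \o jump_weight).
Proof.
apply: le_integrable (integrableZl measurableT 2 (integrable_one_sub_cos Nfin eta)) => //.
  by apply/measurable_EFinP; exact: (measurable_jump_weight (f := id)).
move=> y _; rewrite /comp -EFinM lee_fin ger0_norm ?jump_weight_ge0//.
apply: le_trans (ler_norm _).
by have := one_sub_cos_ge0 (dotv eta y); have := one_sub_cos_le2 (dotv eta y); rewrite /jump_weight; nra.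
Qed.

Lemma second_difference2_cos (xi y : E) :
  D (D (fun zeta => cos (dotv zeta y))) xi = cos (dotv xi y) * jump_weight y.
Proof.
have -> : D (fun zeta => cos (dotv zeta y)) =
    (fun zeta => cos (dotv zeta y) * (1 - cos (dotv eta y))).
  by apply/funext => z; exact: second_difference_cos.
have -> f k : D (fun zeta => f zeta * k) xi = D f xi * k.
  by rewrite /D; field.
by rewrite second_difference_cos /jump_weight; ring.
Qed.

Lemma integral_cos_jump_weight (xi : E) :
  (\int[N]_y (cos (dotv xi y) * jump_weight y))%R =
  D (D (fun zeta => - \int[N]_y (1 - cos (dotv zeta y)))%R) xi.
Proof.
pose F zeta (y : E) := cos (dotv zeta y) - 1.
have iF zeta : N.-integrable setT (EFin \o F zeta).
  have := integrableZl measurableT (-1) (integrable_one_sub_cos Nfin zeta).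
  by apply: eq_integrable => // y _; rewrite /= -EFinM /F; congr EFin; ring.
have FE zeta : (\int[N]_y F zeta y)%R = - (\int[N]_y (1 - cos (dotv zeta y)))%R.
  rewrite -mulN1r -RintegralZl//; last exact: integrable_one_sub_cos.
  by apply: eq_Rintegral => y _; rewrite /F; ring.
have h1 := second_difference_integral eta iF.
have h2 := second_difference_integral eta (F := fun z y => D (F^~ y) z) (fun z => (h1 z).1).
have [_] := h2 xi.
under [X in _ = D X _ -> _]eq_fun => z do rewrite (h1 z).2.
under [X in _ = D (D X) _ -> _]eq_fun => z do rewrite FE.
move=> <-; apply: eq_Rintegral => y _; rewrite -second_difference2_cos /D /F.
by field.
Qed.

(** Two second differences of [E cos (xi.X_(1/n)) = exp (- a(xi) / n)] in [xi] produce the weight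
    [(1 - cos (eta.y)) ^ 2]. As [n (exp (- a / n) - 1)] tends to [- a], the limit is the iterated
    second difference of [- a], from which the Gaussian part has dropped out. *)
Lemma cvg_cos_jump_weight (xi : E) :
  weighted_integral P (fun w => n.+1%:R * jump_weight (X n.+1%:R^-1 w))
    (fun w => cos (dotv xi (X n.+1%:R^-1 w))) @[n --> \oo] -->
  weighted_integral N jump_weight (fun y => cos (dotv xi y)).
Proof.
have n0 n : 0 <= n.+1%:R^-1 :> R by rewrite invr_ge0.
pose a := char_exponent N Q.
have a0 zeta : 0 <= a zeta.
  apply: addr_ge0; first by rewrite divr_ge0.
  by apply: Rintegral_ge0 => y _; exact: one_sub_cos_ge0.
pose F n zeta := n.+1%:R * (expR (- (n.+1%:R^-1 * a zeta)) - 1).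
have FE n : weighted_integral P (fun w => n.+1%:R * jump_weight (X n.+1%:R^-1 w))
    (fun w => cos (dotv xi (X n.+1%:R^-1 w))) = D (D (F n)) xi.
  pose G zeta w : R := cos (dotv zeta (X n.+1%:R^-1 w)).
  have mX := levy_measurable hX (n0 n).
  have iG zeta : P.-integrable setT (EFin \o G zeta).
    by apply: (bounded_integrable _ (M := 1)) => [|w]; [exact: measurable_cos_dotv0|exact: cos_max].
  have h1 := second_difference_integral eta iG.
  have h2 := second_difference_integral eta (F := fun z w => D (G^~ w) z) (fun z => (h1 z).1).
  have [ih] := h2 xi.
  under [X in _ = D X _ -> _]eq_fun => z do rewrite (h1 z).2.
  under [X in _ = D (D X) _ -> _]eq_fun => z do rewrite /G (lk_cos hX sX z lk (n0 n)).
  move=> e; rewrite /weighted_integral.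
  transitivity (n.+1%:R * (\int[P]_w D (D (G^~ w)) xi))%R.
    rewrite -RintegralZl//; apply: eq_Rintegral => w _.
    by rewrite (second_difference2_cos xi (X n.+1%:R^-1 w)) mulrCA.
  by rewrite e second_difference2_affine.
under eq_fun do rewrite FE.
have -> : weighted_integral N jump_weight (fun y => cos (dotv xi y)) = D (D (fun zeta => - a zeta)) xi.
  rewrite /weighted_integral integral_cos_jump_weight.
  apply: (@second_difference2_quadratic _ _ _ (fun u => dotv u (u *m Q)) _ (- dotv eta (eta *m Q))) => z.
  rewrite /D mulmxDl mulmxBl !dotvDl !dotvDr.
  by rewrite -!(scaleN1r eta) -!(scaleN1r (eta *m Q)) !dotvZl !dotvZr; field.
apply: second_difference_cvg => zeta; apply: second_difference_cvg => z.
exact: cvg_expR_difference_quotient.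
Qed.

Let w n (o : O) := n.+1%:R * jump_weight (X n.+1%:R^-1 o).
Local Notation S n := (symmetrized_integral P (w n) (X n.+1%:R^-1)).
Local Notation S' := (symmetrized_integral N' jump_weight id).

Let w0 n o : 0 <= w n o. Proof. by rewrite mulr_ge0// jump_weight_ge0. Qed.

Let mX n : measurable_fun setT (X n.+1%:R^-1).
Proof. by apply: (levy_measurable hX); rewrite invr_ge0. Qed.

Let iw n : P.-integrable setT (EFin \o w n).
Proof.
apply: (bounded_integrable _ (M := n.+1%:R * 4)) => [|o].
  apply: measurable_funM; first exact: measurable_cst.
  exact: measurable_jump_weight.
by rewrite ger0_norm// ler_wpM2l// jump_weight_le4.
Qed.

Let iN' : N'.-integrable setT (EFin \o jump_weight).
Proof.
by have /integrableP[m1 m2] := integrable_jump_weight; apply/integrableP; split.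
Qed.

Let wN' f : weighted_integral N' jump_weight f = weighted_integral N jump_weight f.
Proof. by rewrite /weighted_integral /Rintegral integral_sigma_finite_copy. Qed.

Lemma small_time_tent l z r : S n (tent_product l z r) @[n --> \oo] --> S' (tent_product l z r).
Proof.
apply: tent_product_cvg => //.
- exact: jump_weight_ge0.
- by move=> xi; rewrite wN'; exact: cvg_cos_jump_weight.
Qed.

Lemma small_time_tent_symmetric n (G : E -> R) : measurable_fun setT G -> (forall y, 0 <= G y) ->
  S n G = weighted_integral P (w n) (G \o X n.+1%:R^-1).
Proof.
move=> mG G0; rewrite /symmetrized_integral.
rewrite (_ : weighted_integral P (w n) (fun o => G (- X n.+1%:R^-1 o)) =
  weighted_integral P (w n) (G \o X n.+1%:R^-1)); first by field.
have n0 : 0 <= n.+1%:R^-1 :> R by rewrite invr_ge0.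
rewrite /weighted_integral /Rintegral; congr fine; symmetry.
have mf : measurable_fun setT (fun y => (G y * (n.+1%:R * jump_weight y))%:E).
  apply/measurable_EFinP; apply: measurable_funM => //; apply: measurable_funM => //.
  exact: (measurable_jump_weight (f := id)).
have f0 y : (0 <= (G y * (n.+1%:R * jump_weight y))%:E)%E.
  by rewrite lee_fin mulr_ge0// mulr_ge0// jump_weight_ge0.
have := symmetric_integral hX sX n0 mf f0.
by under [X in _ = X -> _]eq_integral do rewrite jump_weightN.
Qed.

End frequency.

Section one_cube.
Variables (z : E) (i0 : 'I_d) (r : R).
Hypotheses (r0 : 0 < r) (zr : 4 * r <= `|z 0 i0|).
Let eta : E := (pi / z 0 i0) *: delta_mx 0 i0.
Let v := jump_weight eta.

Let z0 : z 0 i0 != 0.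
Proof. by apply: contraTneq zr => ->; rewrite normr0 -ltNge mulr_gt0. Qed.

Let jump_weight_cube y : cube z r y -> 1 <= v y.
Proof.
move=> h; have hi := h i0.
have e : dotv eta y = pi * ((y 0 i0 - z 0 i0) / z 0 i0) + pi.
  rewrite /eta dotvZl (_ : dotv _ _ = y 0 i0); first by field.
  rewrite /dotv (bigD1 i0)//= mxE !eqxx mul1r big1 ?addr0// => j ji.
  by rewrite mxE eqxx/= (negbTE ji) mul0r.
have q4 : `|(y 0 i0 - z 0 i0) / z 0 i0| <= 1 / 4.
  by rewrite normrM normfV ler_pdivrMr ?normr_gt0//; exact: cube_quarter hi zr.
have : 0 <= cos (pi * ((y 0 i0 - z 0 i0) / z 0 i0)).
  apply: cos_ge0_pihalf; move: q4; rewrite ler_norml => /andP[h1 h2].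
  by have := pi_gt0 R; nra.
rewrite /v /jump_weight e cosDpi; nra.
Qed.

Let r2 : r / 2 <= r.
Proof. by rewrite ler_pdivrMr// mulr_natr mulr2n lerDl ltW. Qed.

Let tents := cube_tent z r.

Let mtents dT (T : measurableType dT) (f : T -> E) : measurable_fun setT f ->
  measurable_fun setT (fun t => tents (f t)).
Proof. by move=> mf; apply: measurableT_comp => //; exact: measurable_tent_product. Qed.

Let tents0 y : 0 <= tents y. Proof. exact: tent_product_ge0. Qed.

Let tents1 y : `|tents y| <= 1.
Proof. by rewrite ger0_norm// tent_product_le1. Qed.

Let cube_tail (s : R) : s <= r -> (N (cube z s) < +oo)%E.
Proof.
move=> sr; apply: le_lt_trans (levy_measure_tail r0); apply: le_measure; rewrite ?inE.
- exact: measurable_cube.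
- exact: (measurable_enorm_ge (f := id)).
by move=> y h; apply: (cube_far zr) => i; exact: lt_le_trans (h i) sr.
Qed.

Let cubeN_tail : (N (cube (- z) r) < +oo)%E.
Proof.
apply: le_lt_trans (levy_measure_tail r0); apply: le_measure; rewrite ?inE.
- exact: measurable_cube.
- exact: (measurable_enorm_ge (f := id)).
by move=> y /cubeN h; rewrite /= -enormN; exact: (cube_far zr).
Qed.

Let iN (G : E -> R) : measurable_fun setT G -> (forall y, `|G y| <= 1) ->
  N.-integrable setT (EFin \o (fun y => G y * v y)).
Proof.
apply: weighted_integrable; first exact: jump_weight_ge0.
exact: integrable_jump_weight.
Qed.

Let weighted_integral_cube (G : E -> R) (A : set E) : measurable A -> measurable_fun setT G ->
  (forall y, 0 <= G y <= 1) -> (forall y, ~ A y -> G y = 0) -> (N A < +oo)%E ->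
  weighted_integral N v G <= 4 * fine (N A).
Proof.
move=> mA mG G01 GA NA.
have G1 y : `|G y| <= 1 by have /andP[g0 g1] := G01 y; rewrite ger0_norm.
have NAf : N A \is a fin_num by rewrite ge0_fin_numE.
rewrite /weighted_integral -lee_fin EFinM (fineK NAf) -(EFin_Rintegral (iN mG G1)).
rewrite -[X in N X]setIT -integral_indic// -ge0_integralZl//; last exact/measurable_EFinP.
apply: ge0_le_integral => //.
- by move=> y _; rewrite lee_fin mulr_ge0 ?jump_weight_ge0//; have /andP[] := G01 y.
- by case/integrableP: (iN mG G1).
- by apply: emeasurable_funM => //; exact/measurable_EFinP.
move=> y _; rewrite indicE -EFinM lee_fin; have /andP[g0 g1] := G01 y.
case: (boolP (y \in A)) => [_|yA]; last by rewrite GA ?mul0r ?mulr0//; move: yA; rewrite notin_setE.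
by have := jump_weight_le4 eta y; have := jump_weight_ge0 eta y; rewrite mulr1 -/v; nra.
Qed.

Local Notation w n := (fun o => n.+1%:R * jump_weight eta (X n.+1%:R^-1 o)).
Local Notation S n := (symmetrized_integral P (w n) (X n.+1%:R^-1)).
Local Notation S' := (symmetrized_integral N' v id).

Let S'_le : S' tents <= 2 * (fine (N (cube z r)) + fine (N (cube (- z) r))).
Proof.
have wN' f : weighted_integral N' v f = weighted_integral N v f.
  by rewrite /weighted_integral /Rintegral integral_sigma_finite_copy.
rewrite /symmetrized_integral !wN'.
have t01 y : 0 <= tents y <= 1 by rewrite tents0 tent_product_le1.
have h1 : weighted_integral N v (tents \o id) <= 4 * fine (N (cube z r)).
  apply: weighted_integral_cube => //.
  - exact: measurable_cube.
  - exact: (mtents (f := id)).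
  - by move=> y h; exact: cube_tent_notin.
  - exact: cube_tail.
have h2 : weighted_integral N v (fun y => tents (- id y)) <= 4 * fine (N (cube (- z) r)).
  apply: weighted_integral_cube => //.
  - exact: measurable_cube.
  - by apply: mtents; exact: measurable_funN_rV.
  - by move=> y h; apply: cube_tent_notin => // /cubeN.
lra.
Qed.

Let S'_ge : (2 ^+ d.+1)^-1 * fine (N (cube z (r / 2))) <= S' tents.
Proof.
have wN' f : weighted_integral N' v f = weighted_integral N v f.
  by rewrite /weighted_integral /Rintegral integral_sigma_finite_copy.
rewrite /symmetrized_integral !wN'.
have h1 : (2 ^+ d)^-1 * fine (N (cube z (r / 2))) <= weighted_integral N v (tents \o id).
  have c2 : 0 <= (2 ^+ d)^-1 :> R by rewrite invr_ge0 exprn_ge0.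
    have mc := measurable_cube z (r / 2).
  rewrite /weighted_integral -lee_fin EFinM fineK ?ge0_fin_numE ?cube_tail//.
  rewrite -(EFin_Rintegral (iN (mtents (f := id) (@measurable_id _ _ _)) tents1)).
  rewrite -[X in N X]setIT -integral_indic// -ge0_integralZl//; last exact/measurable_EFinP.
  apply: ge0_le_integral => //.
  - by apply: emeasurable_funM => //; exact/measurable_EFinP.
  - by case/integrableP: (iN (mtents (f := id) (@measurable_id _ _ _)) tents1).
  move=> y _; rewrite indicE -EFinM lee_fin.
  case: (boolP (y \in _)) => [|_]; last by rewrite mulr0 mulr_ge0// jump_weight_ge0.
  rewrite inE => yc; have h := cube_tent_ge r0 yc.
  have : 1 <= v y by apply: jump_weight_cube => i; exact: lt_le_trans (yc i) r2.
  rewrite mulr1 => v1; apply: le_trans h _; rewrite ler_peMr//.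
have h2 : 0 <= weighted_integral N v (fun y => tents (- id y)).
  by apply: Rintegral_ge0 => y _; rewrite mulr_ge0 ?jump_weight_ge0.
rewrite exprS invfM -mulrA; lra.
Qed.

(** The tent product is at least [2 ^- d] on the half cube and vanishes off the cube, and the weight
    lies between 1 and 4 on the cube. The opposite cube enters through the symmetrization of [N]. *)
Lemma small_time_cube_le (L : R) :
  2 ^+ d.+1 * (fine (N (cube z r)) + fine (N (cube (- z) r))) < L ->
  \forall n \near \oo, (n.+1%:R%:E * P [set o | cube z (r / 2) (X n.+1%:R^-1 o)] <= L%:E)%E.
Proof.
move=> HL; have p2 : 0 < 2 ^+ d :> R by rewrite exprn_gt0.
have : S' tents < L / 2 ^+ d.
  apply: le_lt_trans S'_le _; rewrite ltr_pdivlMr//; apply: le_lt_trans HL.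
  by rewrite exprS; lra.
move/(cvgr_lt _ (@small_time_tent eta (index_enum 'I_d) z r)); apply: filterS => n.
have mX : measurable_fun setT (X n.+1%:R^-1) by apply: (levy_measurable hX); rewrite invr_ge0.
rewrite small_time_tent_symmetric => [H||]; last 2 first.
- exact: measurable_tent_product.
- exact: tents0.
have mA : measurable [set o | cube z (r / 2) (X n.+1%:R^-1 o)].
  exact: measurable_preimage mX (measurable_cube _ _).
have iw : P.-integrable setT (EFin \o (fun o => tents (X n.+1%:R^-1 o) * w n o)).
  apply: (bounded_integrable _ (M := n.+1%:R * 4)) => [|o].
    apply: measurable_funM; first exact: mtents.
    apply: measurable_funM; first exact: measurable_cst.
    exact: measurable_jump_weight.
  rewrite ger0_norm ?mulr_ge0 ?jump_weight_ge0//.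
  apply: (@le_trans _ _ (1 * (w n o))); last by rewrite mul1r ler_wpM2l// jump_weight_le4.
  by rewrite ler_wpM2r ?mulr_ge0 ?jump_weight_ge0// tent_product_le1.
apply: (@le_trans _ _ ((2 ^+ d)%:E * (weighted_integral P (w n) (tents \o X n.+1%:R^-1))%:E)%E); last first.
  by rewrite -EFinM lee_fin mulrC -ler_pdivlMr// ltW.
have miw : measurable_fun setT (EFin \o (fun o => tents (X n.+1%:R^-1 o) * w n o)).
  by case/integrableP: iw.
have tw0 o : [set: O] o -> (0 <= (tents (X n.+1%:R^-1 o) * w n o)%:E)%E.
  by move=> _; rewrite lee_fin mulr_ge0// mulr_ge0// jump_weight_ge0.
have p2' : (0 <= (2 ^+ d)%:E :> \bar R)%E by rewrite lee_fin ltW.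
rewrite /weighted_integral -(EFin_Rintegral iw) -(ge0_integralZl P measurableT miw tw0 p2').
rewrite -[X in P X]setIT -integral_indic// -ge0_integralZl//; last exact/measurable_EFinP.
apply: ge0_le_integral => //.
- by apply: emeasurable_funM => //; exact/measurable_EFinP.
- by apply: emeasurable_funM => //; case/integrableP: iw.
move=> o _; rewrite indicE -!EFinM lee_fin.
case: (boolP (o \in _)) => [|_]; last first.
  by rewrite mulr0; apply: mulr_ge0; [exact: ltW|apply: mulr_ge0 => //; rewrite mulr_ge0// jump_weight_ge0].
rewrite inE => /= yc; have h := cube_tent_ge r0 yc.
have : 1 <= v (X n.+1%:R^-1 o) by apply: jump_weight_cube => i; exact: lt_le_trans (yc i) r2.
rewrite mulr1 => v1; rewrite (mulrA (2 ^+ d)) -[leLHS]mul1r; apply: ler_pM => //.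
  by rewrite -ler_pdivrMl// mulr1.
by rewrite ler_peMr.
Qed.

Lemma small_time_cube_ge (L : R) : L < (2 ^+ d.+3)^-1 * fine (N (cube z (r / 2))) ->
  \forall n \near \oo, (L%:E <= n.+1%:R%:E * P [set o | cube z r (X n.+1%:R^-1 o)])%E.
Proof.
move=> HL.
(* [2 ^- (d + 3)] collects [2 ^- d] from the tents, 1 / 2 from the symmetrization and 1 / 4 from the
   bound 4 on the weight. *)
have : 4 * L < S' tents.
  apply: lt_le_trans S'_ge; have p2 : 0 < 2 ^+ d :> R by rewrite exprn_gt0.
  have := HL; rewrite !exprS !invfM; lra.
move/(cvgr_gt _ (@small_time_tent eta (index_enum 'I_d) z r)); apply: filterS => n.
have mX : measurable_fun setT (X n.+1%:R^-1) by apply: (levy_measurable hX); rewrite invr_ge0.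
rewrite small_time_tent_symmetric => [H||]; last 2 first.
- exact: measurable_tent_product.
- exact: tents0.
have mA : measurable [set o | cube z r (X n.+1%:R^-1 o)].
  exact: measurable_preimage mX (measurable_cube _ _).
have iw : P.-integrable setT (EFin \o (fun o => tents (X n.+1%:R^-1 o) * w n o)).
  apply: (bounded_integrable _ (M := n.+1%:R * 4)) => [|o].
    apply: measurable_funM; first exact: mtents.
    apply: measurable_funM; first exact: measurable_cst.
    exact: measurable_jump_weight.
  rewrite ger0_norm ?mulr_ge0 ?jump_weight_ge0//.
  apply: (@le_trans _ _ (1 * (w n o))); last by rewrite mul1r ler_wpM2l// jump_weight_le4.
  by rewrite ler_wpM2r ?mulr_ge0 ?jump_weight_ge0// tent_product_le1.
have h4 : ((weighted_integral P (w n) (tents \o X n.+1%:R^-1))%:E <=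
    (4 * n.+1%:R)%:E * P [set o | cube z r (X n.+1%:R^-1 o)])%E.
  rewrite /weighted_integral -(EFin_Rintegral iw).
  rewrite -[X in P X]setIT -integral_indic// -ge0_integralZl//; last exact/measurable_EFinP.
  apply: ge0_le_integral => //.
  - by move=> o _; rewrite lee_fin mulr_ge0// mulr_ge0// jump_weight_ge0.
  - by case/integrableP: iw.
  - by apply: emeasurable_funM => //; exact/measurable_EFinP.
  move=> o _; rewrite indicE -EFinM lee_fin.
  case: (boolP (o \in _)) => [_|yA]; last first.
    by rewrite /tents cube_tent_notin ?mul0r ?mulr0//; move: yA; rewrite notin_setE.
  rewrite mulr1 -[leRHS]mul1r; apply: ler_pM; rewrite ?mulr_ge0 ?jump_weight_ge0//.
    exact: tent_product_le1.
  by rewrite (mulrC 4) ler_wpM2l// jump_weight_le4.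
have : ((4 * L)%:E <= 4%:E * (n.+1%:R%:E * P [set o | cube z r (X n.+1%:R^-1 o)]))%E.
  rewrite muleA -EFinM; apply: le_trans h4; rewrite lee_fin ltW//.
by rewrite EFinM lee_pmul2l.
Qed.

End one_cube.
End small_time_jumps.

(** * A semiconcave profile of the Levy density *)

Section hyperbolic_cosine.
Variable R : realType.
Implicit Types u v : R.

Definition cosh u : R := (expR u + expR (- u)) / 2.

Lemma cosh_gt0 u : 0 < cosh u.
Proof. by rewrite divr_gt0// addr_gt0 ?expR_gt0. Qed.

Lemma cosh0 : cosh 0 = 1 :> R.
Proof. by rewrite /cosh oppr0 expR0; field. Qed.

Lemma cosh_normr u : cosh `|u| = cosh u.
Proof.
have [u0|u0] := leP 0 u; first by rewrite ger0_norm.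
by rewrite ltr0_norm// /cosh opprK addrC.
Qed.

Lemma coshDB u v : cosh (u + v) + cosh (u - v) = 2 * cosh u * cosh v.
Proof.
by rewrite /cosh !opprD !opprK !expRD; field.
Qed.

Lemma expR_le_cosh u : expR `|u| / 2 <= cosh u.
Proof. by rewrite -cosh_normr ler_pM2r// lerDl expR_ge0. Qed.

Lemma cosh_add_le u v : cosh (u + v) <= expR `|v| * cosh u.
Proof.
rewrite /cosh mulrA ler_pM2r// mulrDr -!expRD; apply: lerD; rewrite ler_expR.
  by rewrite addrC lerD2r ler_norm.
by rewrite opprD addrC lerD2r -normrN ler_norm.
Qed.

Lemma cosh_mono u v : 0 <= u -> u <= v -> cosh u <= cosh v.
Proof.
move=> u0 uv; have := coshDB ((u + v) / 2) ((v - u) / 2).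
have -> : (u + v) / 2 + (v - u) / 2 = v by field.
have -> : (u + v) / 2 - (v - u) / 2 = u by field.
move=> h.
suff : 0 <= (expR ((u + v) / 2) - expR (- ((u + v) / 2))) * (expR ((v - u) / 2) - expR (- ((v - u) / 2))).
  rewrite mulrBl !mulrBr -!expRD.
  have -> : (u + v) / 2 + (v - u) / 2 = v by field.
  have -> : (u + v) / 2 + - ((v - u) / 2) = u by field.
  have -> : - ((u + v) / 2) + (v - u) / 2 = - u by field.
  have -> : - ((u + v) / 2) + - ((v - u) / 2) = - v by field.
  by rewrite /cosh; lra.
by apply: mulr_ge0; rewrite subr_ge0 ler_expR; lra.
Qed.

Lemma cosh_sub1_le u (B : R) : 0 <= u -> u <= B -> cosh u - 1 <= u ^+ 2 * expR B.
Proof.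
move=> u0 uB.
have e : cosh u - 1 = (expR u - 1) ^+ 2 * expR (- u) / 2.
  by rewrite /cosh expRN; field; rewrite gt_eqF// expR_gt0.
have h1 : expR u - 1 <= u * expR u.
  have := expR_ge1Dx (- u); rewrite expRN => h.
  have := ler_wpM2r (expR_ge0 u) h; rewrite mulVf ?gt_eqF ?expR_gt0//.
  by rewrite mulrDl mul1r; lra.
have h0 : 0 <= expR u - 1 by rewrite subr_ge0 -expR0 ler_expR.
have h2 : (expR u - 1) ^+ 2 <= u ^+ 2 * expR u ^+ 2.
  by rewrite -exprMn lerXn2r// nnegrE ?mulr_ge0 ?expR_ge0.
have h3 : u ^+ 2 * expR u ^+ 2 * expR (- u) = u ^+ 2 * expR u.
  by rewrite (expr2 (expR u)) -!mulrA -expRD subrr expR0 mulr1.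
have h4 : expR u <= expR B by rewrite ler_expR.
have u2 := sqr_ge0 u; have e0 := expR_ge0 u.
have h5 : (expR u - 1) ^+ 2 * expR (- u) <= u ^+ 2 * expR u.
  by rewrite -h3 ler_wpM2r// expR_ge0.
have h6 : u ^+ 2 * expR u <= u ^+ 2 * expR B by rewrite ler_wpM2l.
have h7 : 0 <= u ^+ 2 * expR u by rewrite mulr_ge0.
by rewrite e; lra.
Qed.

End hyperbolic_cosine.

Section profile.
Variables (R : realType) (d : nat) (hd : (0 < d)%N).
Local Notation E := 'rV[R]_d.
Variables (nut : E -> R) (K : R).
Hypotheses (nut_gt0 : forall x, 0 < nut x) (K1 : 1 <= K).
Hypothesis nut_growth : forall x y, enorm x <= enorm y + 1 -> nut y <= K * nut x.

(** [nut] can grow by a factor [K] per unit step towards the origin, and the largest coordinate of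
    [v] is at least [|v| / d]. The rate [d * ln K] thus makes [q v] dominate [K ^ |v|] up to the
    factor [2 d]. *)
Let lam : R := d%:R * ln K.

Let K0 : 0 < K. Proof. exact: lt_le_trans K1. Qed.
Let lam0 : 0 <= lam. Proof. by rewrite mulr_ge0// ln_ge0. Qed.
Let d0 : 0 < d%:R :> R. Proof. by rewrite ltr0n. Qed.

Let nut_growth_nat n x y : enorm x <= enorm y + n.+1%:R -> nut y <= K ^+ n.+1 * nut x.
Proof.
elim: n x => [|n IH] x xy; first by rewrite expr1; exact: nut_growth.
have [xy1|xy1] := leP (enorm x) (enorm y + 1).
  apply: le_trans (nut_growth xy1) _; rewrite exprS -mulrA ler_pM2l//.
  by apply: ler_peMl; [exact: ltW|exact: exprn_ege1].
have ex : 1 < enorm x by have := enorm_ge0 y; lra.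
have x0 : 0 < enorm x by exact: lt_trans ex.
(* [x] moved by one unit towards the origin. *)
pose z := ((enorm x - 1) / enorm x) *: x.
have ez : enorm z = enorm x - 1.
  by rewrite enormZ ger0_norm ?divfK ?gt_eqF// divr_ge0 ?ltW// subr_gt0.
apply: (@le_trans _ _ (K ^+ n.+1 * nut z)).
  apply: IH; rewrite ez; move: xy; rewrite -[n.+2%:R]natr1; lra.
rewrite [K ^+ n.+2]exprSr -mulrA ler_pM2l ?exprn_gt0//; apply: nut_growth.
by rewrite ez subrK.
Qed.

Let nut_growth_exp x y : nut y <= K * expR (ln K * enorm (x - y)) * nut x.
Proof.
pose n := Num.truncn (enorm (x - y)).
have h1 : enorm x <= enorm y + n.+1%:R.
  have := ler_enormB x y; have := truncnS_gt (enorm (x - y)); rewrite -/n; lra.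
apply: le_trans (nut_growth_nat h1) _; rewrite ler_pM2r// exprS ler_pM2l//.
rewrite -{1}(lnK K0) -expRM_natl ler_expR mulrC ler_wpM2l ?ln_ge0//.
by rewrite truncn_le enorm_ge0.
Qed.

Let q (v : E) : R := (\sum_i cosh (lam * v 0 i)) / d%:R.

Let q_gt0 v : 0 < q v.
Proof.
rewrite divr_gt0// (bigD1 (Ordinal hd))//= ltr_pwDl ?cosh_gt0//.
by apply: sumr_ge0 => i _; exact/ltW/cosh_gt0.
Qed.

Let q0 : q 0 = 1.
Proof.
rewrite /q (eq_bigr (fun=> 1)) => [|i _]; last by rewrite mxE mulr0 cosh0.
by rewrite sumr_const card_ord divff// gt_eqF.
Qed.

Let enorm_le_coord (v : E) : exists i, enorm v <= d%:R * `|v 0 i|.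
Proof.
have [i hi] : exists i, forall j, `|v 0 j| <= `|v 0 i|.
  have [i _ hi] := @Order.TotalTheory.arg_maxP _ R 'I_d (Ordinal hd) xpredT (fun j => `|v 0 j|) isT.
  by exists i => j; exact: hi.
exists i; rewrite -(ler_pXn2r (n := 2)) ?nnegrE ?enorm_ge0 ?mulr_ge0//.
rewrite enorm_sqr exprMn; apply: (@le_trans _ _ (\sum_(j < d) `|v 0 i| ^+ 2)).
  apply: ler_sum => j _; rewrite -expr2 -(real_normK (num_real (v 0 j))).
  by rewrite lerXn2r ?nnegrE.
rewrite sumr_const card_ord -[leLHS]mulr_natl ler_wpM2r ?sqr_ge0//.
by rewrite expr2 ler_peMl// ler1n.
Qed.

Let expR_le_q v : expR (ln K * enorm v) <= 2 * d%:R * q v.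
Proof.
have [i hi] := enorm_le_coord v.
rewrite /q -mulrA (mulrC d%:R) divfK ?gt_eqF//.
apply: (@le_trans _ _ (2 * cosh (lam * v 0 i))).
  apply: (@le_trans _ _ (expR `|lam * v 0 i|)).
    rewrite ler_expR normrM (ger0_norm lam0) /lam (mulrC d%:R) -mulrA.
    by rewrite ler_wpM2l ?ln_ge0.
  by have := expR_le_cosh (lam * v 0 i); lra.
rewrite ler_pM2l// (bigD1 i)//= lerDl; apply: sumr_ge0 => j _; exact/ltW/cosh_gt0.
Qed.

Let qD u y : q (u + y) + q (u - y) <= 2 * cosh (lam * enorm y) * q u.
Proof.
rewrite /q -mulrDl mulrA ler_pM2r ?invr_gt0// -big_split mulr_sumr.
apply: ler_sum => i _; rewrite /= !mxE mulrDr mulrBr coshDB.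
have ca := ltW (cosh_gt0 (lam * u 0 i)).
have cb : cosh (lam * y 0 i) <= cosh (lam * enorm y).
  rewrite -(cosh_normr (lam * y 0 i)); apply: cosh_mono; first exact: normr_ge0.
  by rewrite normrM (ger0_norm lam0); apply: ler_wpM2l => //; exact: coord_le_enorm.
have := ler_wpM2l ca cb.
by move: (cosh _) (cosh _) (cosh _) => a b c; lra.
Qed.

Let q_harnack u y : q (u + y) <= expR (lam * enorm y) * q u.
Proof.
rewrite /q mulrA ler_pM2r ?invr_gt0// mulr_sumr; apply: ler_sum => i _.
rewrite mxE mulrDr; apply: le_trans (cosh_add_le _ _) _.
rewrite ler_pM2r ?cosh_gt0// ler_expR normrM (ger0_norm lam0) ler_wpM2l//.
exact: coord_le_enorm.
Qed.

(* The infimal convolution with [q] is comparable to [nut] but inherits from [cosh]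
   a multiplicative second difference bound. *)
Definition profile (x : E) : R := inf [set nut a * q (x - a) | a in [set: E]].
Local Notation g := profile.

Let hinf x : has_inf [set nut a * q (x - a) | a in [set: E]].
Proof.
split; first by exists (nut 0 * q (x - 0)); exists 0.
by exists 0 => _ [a _ <-]; rewrite mulr_ge0// ltW.
Qed.

Let g_le x a : g x <= nut a * q (x - a).
Proof. by apply: ge_inf; [exact: (hinf x).2|exists a]. Qed.

Let g_ge x c : (forall a, c <= nut a * q (x - a)) -> c <= g x.
Proof. by move=> h; apply: lb_le_inf; [exact: (hinf x).1|move=> _ [a _ <-]]. Qed.

Lemma profile_le x : g x <= nut x.
Proof. by apply: le_trans (g_le x x) _; rewrite subrr q0 mulr1. Qed.

Lemma profile_ge x : nut x <= 2 * d%:R * K * g x.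
Proof.
have C0 : 0 < 2 * d%:R * K by rewrite !mulr_gt0.
rewrite -ler_pdivrMl//; apply: g_ge => a; rewrite ler_pdivrMl//.
apply: le_trans (nut_growth_exp a x) _.
rewrite (mulrC (nut a)) !mulrA ler_pM2r// (mulrC _ K) -!mulrA ler_pM2l// mulrA.
by rewrite enorm_sub; exact: expR_le_q.
Qed.

Lemma profile_gt0 x : 0 < g x.
Proof.
have C0 : 0 < 2 * d%:R * K by rewrite !mulr_gt0.
by rewrite -(pmulr_rgt0 _ C0); apply: lt_le_trans (profile_ge x).
Qed.

Lemma profile_second_difference x y :
  g (x + y) + g (x - y) <= 2 * cosh (lam * enorm y) * g x.
Proof.
have c0 : 0 < 2 * cosh (lam * enorm y) by rewrite mulr_gt0 ?cosh_gt0.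
rewrite -ler_pdivrMl//; apply: g_ge => a; rewrite ler_pdivrMl//.
apply: le_trans (lerD (g_le _ a) (g_le _ a)) _; rewrite -mulrDr mulrCA ler_pM2l//.
have -> : x + y - a = (x - a) + y by rewrite addrAC.
have -> : x - y - a = (x - a) - y by rewrite addrAC.
exact: qD.
Qed.

Lemma profile_harnack x y : g (x + y) <= expR (lam * enorm y) * g x.
Proof.
rewrite -ler_pdivrMl ?expR_gt0//; apply: g_ge => a; rewrite ler_pdivrMl ?expR_gt0//.
apply: le_trans (g_le _ a) _; rewrite [leRHS]mulrCA ler_pM2l//.
by rewrite (_ : x + y - a = (x - a) + y) ?q_harnack// addrAC.
Qed.

Lemma profile_bounded x : g x <= K * nut 0.
Proof.
apply: le_trans (profile_le x) _; apply: nut_growth.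
by rewrite enorm0 addr_ge0// enorm_ge0.
Qed.

(** By [profile_harnack] every superlevel set is open. *)
Lemma measurable_profile : measurable_fun setT g.
Proof.
apply: (measurability _ (RGenOInfty.measurableE R)).
move=> _ [_ [r ->] <-]; rewrite setTI; apply: sub_sigma_algebra => /=.
rewrite openE => x /=; rewrite in_itv /= andbT => rx.
have gx := profile_gt0 x.
(* The second term keeps the level positive when [r <= 0], so that [ln (g x / s)] is meaningful. *)
pose s := Num.max r (g x / 2).
have sx : s < g x by rewrite gt_max rx/=; lra.
have s0 : 0 < s by rewrite lt_max; apply/orP; right; rewrite divr_gt0.
pose B := lam * d%:R + 1.
have B0 : 0 < B by rewrite ltr_wpDl// mulr_ge0// ltW.
have l0 : 0 < ln (g x / s) by rewrite ln_gt0// ltr_pdivlMr// mul1r.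
apply/nbhs_ballP; exists (ln (g x / s) / B) => /=; first by rewrite divr_gt0.
move=> y [_ xy]; rewrite /= in_itv/= andbT.
have [i hi] := enorm_le_coord (x - y).
have h : enorm (x - y) < d%:R * (ln (g x / s) / B).
  apply: le_lt_trans hi _; rewrite ltr_pM2l//.
  by have := xy 0 i; rewrite /ball/= !mxE.
apply: (@le_lt_trans _ _ s); first by rewrite le_max lexx.
have := profile_harnack y (x - y); rewrite addrC subrK => h2.
have h3 : expR (lam * enorm (x - y)) < g x / s.
  rewrite -[ltRHS](@lnK R) ?posrE ?divr_gt0// ltr_expR.
  apply: (@le_lt_trans _ _ (lam * (d%:R * (ln (g x / s) / B)))).
    by rewrite ler_wpM2l// ltW.
  rewrite mulrA mulrCA gtr_pMr// ltr_pdivrMr// mul1r /B; lra.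
have gy := profile_gt0 y.
have : g x < g x / s * g y by apply: le_lt_trans h2 _; rewrite ltr_pM2r.
by rewrite mulrAC (ltr_pdivlMr _ _ s0) (ltr_pM2l gx).
Qed.

End profile.

(** The density may blow up at 0. Composing it with the map that sends the ball of radius 1 / 2 to
    one point of its boundary gives a function with controlled growth everywhere. [C1] serves when
    the image of [x] is the farther one and [C2] otherwise. *)
Lemma truncated_density (R : realType) (d : nat) (nu : 'rV[R]_d -> R) : (0 < d)%N ->
  (forall x, x != 0 -> 0 < nu x) ->
  (exists2 C : R, 1 <= C & forall x y, 1 / 2 <= enorm y -> enorm y <= enorm x ->
     enorm x <= enorm y + 1 -> C^-1 * nu y <= nu x <= C * nu y) ->
  (exists2 C : R, 1 <= C &
    forall x y, 1 / 2 <= enorm y -> enorm y <= enorm x -> nu x <= C * nu y) ->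
  exists (nut : 'rV[R]_d -> R) (K : R), [/\ 1 <= K, (forall x, 0 < nut x),
    (forall x y, enorm x <= enorm y + 1 -> nut y <= K * nut x) &
    (forall x, 1 / 2 <= enorm x -> nut x = nu x)].
Proof.
move=> hd nu0 [C1 C11 H1] [C2 C21 H2].
pose e0 : 'rV[R]_d := (1 / 2) *: delta_mx 0 (Ordinal hd).
have ee : enorm e0 = 1 / 2.
  rewrite enormZ ger0_norm// (_ : enorm _ = 1) ?mulr1//.
  rewrite /enorm /dotv (bigD1 (Ordinal hd))//= mxE !eqxx mul1r big1 ?addr0 ?sqrtr1// => j ji.
  by rewrite mxE eqxx/= (negbTE ji) mul0r.
pose c x := if enorm x < 1 / 2 then e0 else x.
have c2 x : 1 / 2 <= enorm (c x).
  by rewrite /c; case: ltP => //; rewrite ee.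
have cmax x : enorm (c x) = Num.max (1 / 2) (enorm x).
  rewrite /c maxElt; case: (ltP (enorm x)) => h; first by rewrite ee; case: ltP => //; lra.
  case: ltP => // h2; apply/eqP; rewrite eq_le h h2//.
exists (fun x => nu (c x)), (C1 + C2); split.
- by lra.
- move=> x; apply: nu0; rewrite -enorm0_eq0 gt_eqF// (lt_le_trans _ (c2 x))//; lra.
- move=> x y xy.
  have p : 0 < nu (c x).
    by apply: nu0; rewrite -enorm0_eq0 gt_eqF// (lt_le_trans _ (c2 x))//; lra.
  have [h|h] := leP (enorm (c x)) (enorm (c y)).
    by have := H2 _ _ (c2 x) h; nra.
  have h3 : enorm (c x) <= enorm (c y) + 1.
    rewrite !cmax ge_max; apply/andP; split.
      have : 1 / 2 <= Num.max (1 / 2) (enorm y) by rewrite le_max lexx.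
      lra.
    have : enorm y <= Num.max (1 / 2) (enorm y) by rewrite le_max lexx orbT.
    lra.
  have /andP[h4 _] := H1 _ _ (c2 y) (ltW h) h3.
  have C10 : 0 < C1 by lra.
  move: h4; rewrite ler_pdivrMl// => h4; nra.
- by move=> x x2; rewrite /c ltNge x2.
Qed.

(** Nothing is known on the convergence of [a n], only that [b] eventually dominates it at each
    point where [w] is nonzero. Dominated convergence is applied to the positive part of [a n - b],
    which is eventually 0. *)
Lemma eventually_integral_le (R : realType) dT (T : measurableType dT)
    (m : {measure set T -> \bar R}) (w b : T -> R) (a : nat -> T -> R) (C e : R) :
  (forall t, 0 <= w t) -> (forall t, 0 <= b t) -> (forall n t, 0 <= a n t <= C) ->
  m.-integrable setT (EFin \o w) -> measurable_fun setT b ->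
  (forall n, measurable_fun setT (a n)) -> 0 < e ->
  (forall t, w t != 0 -> \forall n \near \oo, a n t <= b t) ->
  \forall n \near \oo, (\int[m]_t (w t * a n t)%:E <= \int[m]_t (w t * b t)%:E + e%:E)%E.
Proof.
move=> w0 b0 aC iw mb ma e0 ab.
have mw : measurable_fun setT w by apply/measurable_EFinP; case/integrableP: iw.
pose f n t := w t * Num.max 0 (a n t - b t).
have mf n : measurable_fun setT (EFin \o f n).
  apply/measurable_EFinP; apply: measurable_funM => //.
  by apply: measurable_maxr; [exact: measurable_cst|exact: measurable_funB].
have f0 n t : 0 <= f n t by rewrite mulr_ge0// le_max lexx.
have iC : m.-integrable setT (fun t => (C%:E * (w t)%:E)%E) by exact: integrableZl.
have [||_ _ cf] := dominated_convergence measurableT mf (measurable_cst (0 : \bar R)%E) _ iC _.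
- apply: aeW => t _; have [w00|wt] := eqVneq (w t) 0.
    by rewrite /f /comp; under eq_fun do rewrite w00 mul0r; exact: cvg_cst.
  apply: cvg_near_cst; apply: filterS (ab t wt) => n h.
  by rewrite /= /f max_l ?mulr0// subr_le0.
- apply: aeW => t n _; rewrite /= -EFinM lee_fin ger0_norm// /f (mulrC C); apply: ler_wpM2l => //.
  have /andP[a0 a1] := aC n t; have bt := b0 t.
  by rewrite ge_max; apply/andP; split; lra.
have z : (\int[m]_(t in setT) cst (0 : \bar R)%E t = 0)%E by rewrite integral_cst// mul0e.
rewrite z in cf.
have ce : \forall n \near \oo, (\int[m]_(t in setT) (EFin \o f n) t < e%:E)%E.
  by have := cf _ (open_ereal_lt' (_ : 0%:E < e%:E)%E); apply; rewrite lte_fin.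
apply: filterS ce => n hn.
apply: (@le_trans _ _ (\int[m]_t ((w t * b t)%:E + (f n t)%:E))%E).
  apply: ge0_le_integral => //.
  - by move=> t _; rewrite lee_fin mulr_ge0//; have /andP[] := aC n t.
  - by apply/measurable_EFinP; exact: measurable_funM.
  - by apply: emeasurable_funD; [apply/measurable_EFinP; exact: measurable_funM|exact: mf].
  move=> t _; rewrite -EFinD lee_fin /f -mulrDr ler_wpM2l//.
  have : a n t - b t <= Num.max 0 (a n t - b t) by rewrite le_max lexx orbT.
  lra.
rewrite ge0_integralD//.
- by apply: leeD2l; exact: ltW.
- by move=> t _; rewrite lee_fin mulr_ge0.
- by apply/measurable_EFinP; exact: measurable_funM.
- by move=> t _; rewrite lee_fin.
- exact: mf.
Qed.

(** * The profile is excessive *)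

(* A one-sided Dini version of Gronwall's inequality: the Lipschitz bound forbids
   upward jumps and the second hypothesis is only required along some [h -> 0+]. *)
Lemma dini_gronwall (R : realType) (u : R -> R) (C C' : R) : 0 <= C -> 0 <= u 0 ->
  (forall t h, 0 <= t -> 0 <= h -> u (t + h) <= u t + C' * h) ->
  (forall t e dl, 0 <= t -> 0 < e -> 0 < dl -> exists h,
     [/\ 0 < h, h < dl & u (t + h) <= u t + h * (C * u t + e)]) ->
  forall t, 0 <= t -> u t <= expR (C * t) * u 0.
Proof.
move=> C0 u0 lip dini T T0.
suff H e : 0 < e -> u T <= expR (C * T) * (u 0 + e * (1 + T)).
  apply/ler_addgt0Pr => e e0.
  have p : 0 < expR (C * T) * (1 + T) by rewrite mulr_gt0 ?expR_gt0//; lra.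
  have := H (e / (expR (C * T) * (1 + T))) (divr_gt0 e0 p).
  rewrite mulrDr (_ : expR (C * T) * (e / (expR (C * T) * (1 + T)) * (1 + T)) = e)//.
  by rewrite mulrCA divfK// gt_eqF.
(* The summand [e * (1 + t)] makes [F] absorb the slack [e] of the Dini hypothesis. *)
move=> e0; pose F t := expR (C * t) * (u 0 + e * (1 + t)).
have Fmono s t : 0 <= s -> s <= t -> F s <= F t.
  move=> s0 st; apply: ler_pM; rewrite ?expR_ge0//.
  - by rewrite addr_ge0// mulr_ge0// ?ltW//; lra.
  - by rewrite ler_expR ler_wpM2l.
  - by rewrite lerD2l ler_pM2l//; lra.
have Fstep t h : 0 <= t -> 0 <= h -> F t + h * (C * F t + e) <= F (t + h).
  move=> t0 h0; rewrite /F (mulrDr C t h) expRD.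
  have e1 : 1 <= expR (C * t) by rewrite -expR0 ler_expR mulr_ge0.
  have e2 := expR_ge1Dx (C * h).
  set a := expR (C * t) in e1 *; set bb := expR (C * h) in e2 *.
  have A0 : 0 <= u 0 + e * (1 + t) by rewrite addr_ge0// mulr_ge0 ?ltW//; lra.
  have -> : u 0 + e * (1 + (t + h)) = u 0 + e * (1 + t) + e * h by ring.
  move: (u 0 + e * (1 + t)) A0 => A A0.
  have eh : 0 <= e * h by rewrite mulr_ge0// ltW.
  have Ch : 0 <= C * h by rewrite mulr_ge0.
  apply: (@le_trans _ _ (a * (1 + C * h) * (A + e * h))); last first.
    rewrite ler_wpM2r ?addr_ge0// ler_wpM2l//; lra.
  have -> : a * (1 + C * h) * (A + e * h) =
    a * A + h * (C * (a * A)) + a * (e * h) + a * (C * h) * (e * h) by ring.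
  have h1 : e * h <= a * (e * h) by rewrite ler_peMl.
  have h2 : 0 <= a * (C * h) * (e * h) by rewrite !mulr_ge0//; lra.
  have -> : h * (C * (a * A) + e) = h * (C * (a * A)) + e * h by ring.
  lra.
(* [S] need not be an interval. The Lipschitz bound shows that it contains its supremum, and the
   Dini hypothesis then reaches beyond the supremum unless this is [T]. *)
pose S := [set t | 0 <= t <= T /\ u t <= F t].
have S0 : S 0.
  split; first by rewrite lexx.
  by rewrite /F mulr0 expR0 mul1r addr0 mulr1 lerDl ltW.
have supS : has_sup S by split; [exists 0|exists T => t [/andP[]]].
pose s := sup S.
have s0 : 0 <= s by apply: sup_upper_bound => //.
have sT : s <= T by apply: ge_sup; [exists 0|move=> t [/andP[]]].
have Ss : u s <= F s.
  apply/ler_addgt0Pr => e' e'0.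
  pose C1 := Num.max 1 C'.
  have C10 : 0 < C1 by rewrite lt_max ltr01.
  have [t [/andP[t0 tT] tF] ts] := sup_adherent (divr_gt0 e'0 C10) supS.
  have tles : t <= s by apply: sup_upper_bound => //; split => //; rewrite t0.
  have := lip t (s - t) t0; rewrite subr_ge0 => /(_ tles); rewrite addrC subrK => h.
  apply: (le_trans h); apply: lerD; first exact: le_trans (Fmono _ _ t0 tles).
  apply: (@le_trans _ _ (C1 * (s - t))).
    by rewrite ler_wpM2r ?subr_ge0// le_max lexx orbT.
  rewrite mulrC -ler_pdivlMr//; rewrite -/s in ts; lra.
have [sT'|sT'] := ltP s T; last first.
  by have -> : T = s by apply/eqP; rewrite eq_le sT sT'.
have Ts : 0 < T - s by rewrite subr_gt0.
have [h [h0 hT uh]] := dini s e _ s0 e0 Ts.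
have : S (s + h).
  split; first by apply/andP; split; lra.
  apply: (le_trans uh); apply: le_trans (Fstep _ _ s0 (ltW h0)).
  apply: lerD => //; rewrite ler_pM2l// lerD2r ler_wpM2l//.
by move=> /(sup_upper_bound supS); rewrite -/s gerDl leNgt h0.
Qed.

Section cube_measure.
Variables (R : realType) (d : nat).
Local Notation E := 'rV[R]_d.

Lemma lebesgue_cube (z : E) (r : R) : 0 <= r ->
  lebesgue_rV R d (cube z r) = ((2 * r) ^+ d)%:E.
Proof.
move=> r0; pose A i := `]z 0 i - r, z 0 i + r[%classic : set R.
have -> : cube z r = [set y : E | forall i, A i (y 0 i)].
  by apply/seteqP; split => y h i; have := h i; rewrite /A/= in_itv/= ltr_distl.
rewrite lebesgue_rV_box; last by move=> i; exact: measurable_itv.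
rewrite (eq_bigr (fun=> (2 * r)%:E)) => [|i _].
  rewrite -(big_morph EFin (fun x y => EFinM x y) (erefl : 1%:E = 1%E)).
  by rewrite prodr_const card_ord.
rewrite /A lebesgue_measure_itv/= lte_fin; case: ltP => h.
  by rewrite -EFinD; congr EFin; ring.
by congr EFin; lra.
Qed.

Lemma cube_sym (z y : E) r : cube z r y <-> cube y r z.
Proof. by split => h i; rewrite distrC; exact: h. Qed.

Lemma cube_enorm (z y : E) r : 0 <= r -> cube z r y -> enorm (y - z) <= d%:R * r.
Proof.
move=> r0 h; rewrite -(ler_pXn2r (n := 2)) ?nnegrE ?enorm_ge0 ?mulr_ge0//.
rewrite enorm_sqr exprMn; apply: (@le_trans _ _ (\sum_(j < d) r ^+ 2)).
  apply: ler_sum => j _; rewrite -expr2 -(real_normK (num_real _)).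
  by rewrite lerXn2r ?nnegrE// !mxE ltW//; exact: h.
rewrite sumr_const card_ord -[leLHS]mulr_natl ler_wpM2r ?sqr_ge0//.
by case: d => [|k]; [rewrite expr0n|rewrite expr2 ler_peMl// ler1n].
Qed.

Lemma enorm_large_coord (z : E) (s : R) : (0 < d)%N -> d%:R * s <= enorm z -> exists i, s <= `|z 0 i|.
Proof.
move=> hd h; apply: contrapT => /forallNP H.
have d0 : 0 < d%:R :> R by rewrite ltr0n.
have Hs i : `|z 0 i| < s by rewrite ltNge; apply/negP; exact: H.
have s0 : 0 < s by exact: le_lt_trans (normr_ge0 _) (Hs (Ordinal hd)).
suff : enorm z < d%:R * s by rewrite ltNge h.
pose s' := \big[Num.max/0]_i `|z 0 i|.
have s's : s' < s by apply/bigmax_ltP; split.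
apply: (@le_lt_trans _ _ (d%:R * s')); last by rewrite ltr_pM2l.
have s'0 : 0 <= s' by apply: bigmax_ge_id.
rewrite -(ler_pXn2r (n := 2)) ?nnegrE ?enorm_ge0 ?mulr_ge0//.
rewrite enorm_sqr exprMn; apply: (@le_trans _ _ (\sum_(j < d) s' ^+ 2)).
  apply: ler_sum => j _; rewrite -expr2 -(real_normK (num_real _)).
  by rewrite lerXn2r ?nnegrE// /s' (le_bigmax _ (fun i => `|z 0 i|)).
rewrite sumr_const card_ord -[leLHS]mulr_natl ler_wpM2r ?sqr_ge0//.
by rewrite expr2 ler_peMl// ler1n.
Qed.

End cube_measure.

Lemma affine_le (R : realFieldType) (G c t b k : R) :
  G * (c * t) <= b * (c * t) -> G * (1 + c * t) + b * (k * t) <= G + (b * c + b * k) * t.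
Proof. lra. Qed.

Lemma fk_free (R : realType) (d : nat) (dO : measure_display) (O : measurableType dO)
    (P : probability O R) (X : R -> O -> 'rV[R]_d) t f x :
  levy_process P X -> 0 <= t -> nnmeas f ->
  fk P X (cst 0) (cst 0) t f x = (\int[P]_o f (x + X t o)%R)%E.
Proof.
move=> hX t0 [_ f0]; rewrite /fk; apply: nonmeasurable_ge0_ae_eq_integral => [w|w|].
- by rewrite mule_ge0// weight_ge0.
- exact: f0.
by apply: filterS (ae_good hX) => w gw; rewrite weight0 mul1e procE.
Qed.

Section generator.
Variables (R : realType) (d : nat) (hd : (0 < d)%N) (dO : measure_display) (O : measurableType dO).
Variables (P : probability O R) (X : R -> O -> 'rV[R]_d).
Hypothesis hX : levy_process P X.
Hypothesis sX : symmetric_process P X.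
Local Notation E := 'rV[R]_d.
Local Notation leb := (lebesgue_rV R d).
Variables (N : {measure set E -> \bar R}) (b : E) (Q : 'M[R]_d).
Hypothesis N0 : N [set 0] = 0%E.
Hypothesis Nfin : (\int[N]_y (Num.min 1 (enorm y ^+ 2))%:E < +oo)%E.
Hypothesis Qpos : forall xi : E, 0 <= dotv xi (xi *m Q).
Hypothesis lk : levy_khintchine P X b Q N.
Variables (nu nut : E -> R) (K C3 : R).
Hypothesis mnu : measurable_fun setT nu.
Hypothesis NE : forall A : set E, measurable A -> N A = (\int[leb]_(y in A) (nu y)%:E)%E.
Hypotheses (K1 : 1 <= K) (nut_gt0 : forall x, 0 < nut x).
Hypothesis nut_growth : forall x y, enorm x <= enorm y + 1 -> nut y <= K * nut x.
Hypothesis nutE : forall x, 1 / 2 <= enorm x -> nut x = nu x.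
Hypothesis convolution : forall x y, 1 <= enorm (y - x) ->
  (\int[leb]_(z in [set z | (1 / 2 < enorm (z - x))%R /\ (1 / 2 < enorm (z - y))%R])
     (nu (x - z)%R * nu (z - y)%R)%:E <= (C3 * nu (x - y)%R)%:E)%E.

Local Notation g := (profile nut K).
Let L : R := d%:R * ln K.
Let B := K * nut 0.

Let K0 : 0 < K. Proof. exact: lt_le_trans K1. Qed.
Let L0 : 0 <= L. Proof. by rewrite mulr_ge0// ln_ge0. Qed.
Let d0 : 0 < d%:R :> R. Proof. by rewrite ltr0n. Qed.
Let B0 : 0 < B. Proof. by rewrite mulr_gt0. Qed.
Let g0 x : 0 < g x. Proof. exact: (profile_gt0 hd nut_gt0 K1 nut_growth). Qed.
Let gB x : g x <= B. Proof. by apply: profile_bounded. Qed.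
Let mg : measurable_fun setT g.
Proof. exact: (measurable_profile hd nut_gt0 K1 nut_growth). Qed.
Let gH x y : g (x + y) <= expR (L * enorm y) * g x.
Proof. exact: (profile_harnack hd nut_gt0 K1). Qed.
Let gH1 x y : enorm y <= 1 -> g (x + y) <= expR L * g x.
Proof.
move=> y1; apply: le_trans (gH x y) _; apply: ler_wpM2r; first exact: ltW.
by rewrite ler_expR -[leRHS]mulr1; apply: ler_wpM2l.
Qed.
Let g_le x : g x <= nut x. Proof. by apply: profile_le. Qed.
Let g_ge x : nut x <= 2 * d%:R * K * g x.
Proof. exact: (profile_ge hd nut_gt0 K1 nut_growth). Qed.

Let mfar (a : R) : measurable [set y : E | a <= enorm y].
Proof. exact: (measurable_enorm_ge (f := id)). Qed.

Let msh (x : E) : measurable_fun setT (fun y : E => x + y).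
Proof. by apply: measurable_funD_rV => //; exact: measurable_cst. Qed.

Let mgsh (x : E) : measurable_fun setT (fun y : E => g (x + y)).
Proof. exact: (measurableT_comp mg (msh x)). Qed.

Let mind (A : set E) : measurable A -> measurable_fun setT (fun y => \1_A y : R).
Proof. by move=> mA; exact: measurable_indic. Qed.

Let nut_nu x : 7 / 8 <= enorm x -> nut x = nu x.
Proof. by move=> h; apply: nutE; lra. Qed.

Let mass_cube (z : E) r : 0 < r -> d%:R * r <= 1 / 4 -> 7 / 8 <= enorm z ->
  fine (N (cube z r)) <= K * nut z * (2 * r) ^+ d /\
  K^-1 * nut z * (2 * r) ^+ d <= fine (N (cube z r)).
Proof.
move=> r0 dr zr; have mc := measurable_cube z r.
have bd y : cube z r y -> [/\ nu y <= K * nut z & K^-1 * nut z <= nu y].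
  move=> yc; have h := cube_enorm (ltW r0) yc.
  have h1 := ler_enormB y z; have h2 := ler_enormB z y; rewrite enorm_sub in h2.
  rewrite -nutE; last by lra.
  split; first by apply: nut_growth; lra.
  by rewrite ler_pdivrMl//; apply: nut_growth; lra.
have m0 (c : R) : measurable_fun (cube z r) (fun _ : E => c%:E) by exact: measurable_cst.
have mn : measurable_fun (cube z r) (fun y => (nu y)%:E).
  by apply: measurable_funTS; exact/measurable_EFinP.
have nu0 y : cube z r y -> (0 <= (nu y)%:E)%E.
  move=> /bd[_ h]; rewrite lee_fin; apply: le_trans h.
  by rewrite mulr_ge0 ?invr_ge0 ?ltW.
have up : (N (cube z r) <= (K * nut z * (2 * r) ^+ d)%:E)%E.
  rewrite NE//; apply: (@le_trans _ _ (\int[leb]_(y in cube z r) (K * nut z)%:E)%E).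
    by apply: ge0_le_integral => //= y /bd[h _]; rewrite ?lee_fin// mulr_ge0 ?ltW.
  by rewrite integral_cst//= (lebesgue_cube z (ltW r0)) -EFinM.
have lo : ((K^-1 * nut z * (2 * r) ^+ d)%:E <= N (cube z r))%E.
  rewrite NE//; apply: (@le_trans _ _ (\int[leb]_(y in cube z r) (K^-1 * nut z)%:E)%E).
    by rewrite integral_cst//= (lebesgue_cube z (ltW r0)) -EFinM.
  apply: ge0_le_integral => //= y; first by rewrite lee_fin mulr_ge0 ?invr_ge0 ?ltW.
  by move=> /bd[_ h]; rewrite lee_fin.
have fN : N (cube z r) \is a fin_num.
  by rewrite ge0_fin_numE//; apply: le_lt_trans up _; exact: ltry.
by split; rewrite -lee_fin fineK.
Qed.

(** Half-side giving cubes of Euclidean radius at most 1 / 8. Those centred at distance at least 7 /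
    8 from the origin avoid the ball of radius 1 / 2, where [nut] may differ from [nu], and their
    centres have a coordinate of size at least [4 r]. *)
Let r : R := (8 * d%:R)^-1.
Let r0 : 0 < r. Proof. by rewrite invr_gt0 mulr_gt0. Qed.
Let dr : d%:R * r = 1 / 8.
Proof. by rewrite /r invfM mulrCA divff ?gt_eqF// mulr1 div1r. Qed.

Let large_coord (z : E) : 7 / 8 <= enorm z -> exists i, 4 * r <= `|z 0 i|.
Proof.
move=> h; apply: enorm_large_coord => //; rewrite mulrCA dr; lra.
Qed.

(** The final [+ 1] provides the strict inequality required by [small_time_cube_le]. *)
Let Cc := 2 ^+ d.+1 * (2 * K ^+ 2 * (2 * r) ^+ d) + 1.

Let Cc0 : 0 < Cc.
Proof.
apply: ltr_wpDl => //; rewrite !mulr_ge0 ?exprn_ge0 ?mulr_ge0//; exact: ltW.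
Qed.

Let jump_rate_le (z : E) : 7 / 8 <= enorm z ->
  \forall n \near \oo, (n.+1%:R%:E * P [set o | cube z (r / 2) (X n.+1%:R^-1 o)] <= (Cc * nut z)%:E)%E.
Proof.
move=> zr; have [i hi] := large_coord zr.
have dr' : d%:R * r <= 1 / 4 by rewrite dr; lra.
apply: (small_time_cube_le hX sX N0 Nfin Qpos lk r0 hi).
have [h1 _] := mass_cube r0 dr' zr.
have zr' : 7 / 8 <= enorm (- z) by rewrite enormN.
have [h2 _] := mass_cube r0 dr' zr'.
have h3 : nut (- z) <= K * nut z by apply: nut_growth; rewrite enormN lerDl.
have p : 0 < (2 * r) ^+ d by rewrite exprn_gt0// mulr_gt0.
have p2 : 0 < 2 ^+ d.+1 :> R by rewrite exprn_gt0.
rewrite /Cc mulrDl mul1r; apply: ltr_pwDr => //.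
rewrite -mulrA ler_pM2l//.
have h4 : fine (N (cube (- z) r)) <= K * (K * nut z) * (2 * r) ^+ d.
  by apply: le_trans h2 _; rewrite ler_pM2r// ler_pM2l.
have h5 : fine (N (cube z r)) <= K * (K * nut z) * (2 * r) ^+ d.
  apply: le_trans h1 _; rewrite ler_pM2r// ler_pM2l// ler_peMl// ltW//.
have -> : 2 * K ^+ 2 * (2 * r) ^+ d * nut z =
   K * (K * nut z) * (2 * r) ^+ d + K * (K * nut z) * (2 * r) ^+ d by ring.
exact: lerD.
Qed.

Let C4 := (K * C3 + B * K * 2 ^+ d) * (2 * d%:R * K).

Let far_density (z : E) : R := \1_[set z | 7 / 8 <= enorm z] z * nu z.

Let far_density_ge0 z : 0 <= far_density z.
Proof.
rewrite /far_density indicE; case: (boolP (z \in _)) => [|_]; last by rewrite mul0r.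
by rewrite inE/= => h; rewrite mul1r -nut_nu// ltW.
Qed.

Let mfar_density : measurable_fun setT far_density.
Proof. by apply: measurable_funM => //; apply: mind; exact: mfar. Qed.

(** (A1)(3) for the points 0 and [- x] bounds the part where [x + z] lies outside radius 1 / 2. On
    the rest [g] is at most [B], [nu z] is at most [K * nut x], and the region fits in a cube of
    volume [2 ^ d]. *)
Let far_integral (x : E) : 1 <= enorm x ->
  (\int[leb]_z (g (x + z) * far_density z)%:E <= (C4 * g x)%:E)%E.
Proof.
move=> x1; pose D := [set z : E | (1 / 2 < enorm (z - 0))%R /\ (1 / 2 < enorm (z + x))%R].
have mlt (f : E -> E) : measurable_fun setT f -> measurable [set z | 1 / 2 < enorm (f z)].
  move=> mf; rewrite (_ : [set _ | _] = (fun z => enorm (f z)) @^-1` `]1 / 2, +oo[%classic).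
    exact: measurable_preimage (measurable_enorm mf) (measurable_itv _).
  by apply/seteqP; split => z /=; rewrite in_itv/= andbT.
have mD : measurable D.
  rewrite (_ : D = [set z : E | 1 / 2 < enorm (z - 0)] `&` [set z | 1 / 2 < enorm (z + x)]).
    apply: measurableI; apply: mlt; first by apply: measurable_funB_rV => //; exact: measurable_cst.
    by apply: measurable_funD_rV => //; exact: measurable_cst.
  by apply/seteqP; split.
have cv := @convolution 0 (- x).
rewrite subr0 enormN sub0r opprK in cv; have {}cv := cv x1; rewrite -/D in cv.
pose F1 z : R := \1_D z * (nu (0 - z) * nu (z + x)).
pose F2 z : R := \1_(cube (- x) 1) z.
have D2 z : D z -> 1 / 2 <= enorm (0 - z) /\ 1 / 2 <= enorm (z + x).
  by move=> [h1 h2]; rewrite sub0r enormN; rewrite subr0 in h1; split; exact: ltW.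
have F10 z : 0 <= F1 z.
  rewrite /F1 indicE; case: (boolP (z \in D)) => [|_]; last by rewrite mul0r.
  rewrite inE => /D2[h1 h2]; rewrite mul1r -!nutE//.
  by rewrite mulr_ge0// ltW.
have mc := measurable_cube (- x) 1.
have mF1 : measurable_fun setT F1.
  apply: measurable_funM; first exact: mind.
  apply: measurable_funM; apply: (measurableT_comp mnu).
    by apply: measurable_funB_rV => //; exact: measurable_cst.
  by apply: measurable_funD_rV => //; exact: measurable_cst.
have iF1 : (\int[leb]_z (F1 z)%:E <= (C3 * nut x)%:E)%E.
  rewrite (nutE (_ : 1 / 2 <= enorm x)); last by lra.
  apply: le_trans cv; rewrite [leRHS]integral_mkcond le_eqVlt; apply/orP; left; apply/eqP.
  apply: eq_integral => z _; rewrite !patchE /F1 indicE.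
  by case: ifP => _; rewrite ?mul1r ?mul0r.
have iF2 : (\int[leb]_z (F2 z)%:E = (2 ^+ d)%:E)%E.
  have := lebesgue_cube (- x) (@ler01 R); rewrite mulr1 => <-.
  by rewrite /F2 integral_indic// setIT.
have KF1 z : (0 <= K%:E * (F1 z)%:E)%E by rewrite mule_ge0 ?lee_fin// ltW.
have BK0 : 0 <= B * (K * nut x) by rewrite mulr_ge0 ?ltW ?mulr_gt0.
have F20 z : 0 <= F2 z by [].
have BF2 z : (0 <= (B * (K * nut x))%:E * (F2 z)%:E)%E by rewrite mule_ge0 ?lee_fin.
have mF1' : measurable_fun setT (fun z => (F1 z)%:E) by exact/measurable_EFinP.
have mF2' : measurable_fun setT (fun z => (F2 z)%:E) by apply/measurable_EFinP; exact: mind.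
have mKF1 : measurable_fun setT (fun z => K%:E * (F1 z)%:E)%E.
  by apply: emeasurable_funM => //; exact: measurable_cst.
have mBF2 : measurable_fun setT (fun z => (B * (K * nut x))%:E * (F2 z)%:E)%E.
  by apply: emeasurable_funM => //; exact: measurable_cst.
apply: (@le_trans _ _ (\int[leb]_z (K%:E * (F1 z)%:E + (B * (K * nut x))%:E * (F2 z)%:E))%E).
  apply: ge0_le_integral.
  - exact: measurableT.
  - by move=> z _; rewrite lee_fin mulr_ge0// ltW.
  - by apply/measurable_EFinP; apply: measurable_funM.
  - by apply: emeasurable_funD.
  move=> z _; rewrite -!EFinM -EFinD lee_fin.
  rewrite /far_density indicE; case: (boolP (z \in _)) => [|_]; last first.
    by rewrite mul0r mulr0 addr_ge0// mulr_ge0// ltW.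
  rewrite inE/= mul1r => z7.
  have [xz|xz] := ltP (1 / 2) (enorm (x + z)).
    have Dz : D z by split; rewrite ?subr0; [lra|rewrite addrC].
    have [z1 z2] := D2 z Dz.
    apply: (@le_trans _ _ (K * F1 z)); last by rewrite lerDl mulr_ge0.
    rewrite /F1 indicE mem_set// mul1r -!nutE//; last by lra.
    rewrite sub0r (addrC z).
    have h1 : nut z <= K * nut (- z) by apply: nut_growth; rewrite enormN lerDl.
    rewrite mulrA mulrC; apply: ler_pM => //; exact: ltW.
  apply: (@le_trans _ _ (B * (K * nut x) * F2 z)); last first.
    by rewrite lerDr mulr_ge0// ltW.
  rewrite /F2 indicE mem_set ?mulr1; last first.
    move=> i; apply: (@le_lt_trans _ _ (1 / 2)); last by lra.
    apply: le_trans xz; have := coord_le_enorm (x + z) i.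
    by rewrite !mxE opprK addrC.
  rewrite -nut_nu//; apply: ler_pM; [exact: ltW|exact: ltW|exact: gB|apply: nut_growth].
  have := ler_enormB x (- z); rewrite opprK enormN; lra.
rewrite (ge0_integralD leb measurableT (fun z _ => KF1 z) mKF1 (fun z _ => BF2 z) mBF2).
have K0e : (0 <= K%:E :> \bar R)%E by rewrite lee_fin ltW.
have BKe : (0 <= (B * (K * nut x))%:E :> \bar R)%E by rewrite lee_fin.
have F1e z : [set: E] z -> (0 <= (F1 z)%:E)%E by rewrite lee_fin.
have F2e z : [set: E] z -> (0 <= (F2 z)%:E)%E by rewrite lee_fin.
rewrite (ge0_integralZl leb measurableT mF1' F1e K0e) (ge0_integralZl leb measurableT mF2' F2e BKe).
rewrite iF2 -EFinM; apply: (@le_trans _ _ (K%:E * (C3 * nut x)%:E + (B * (K * nut x) * 2 ^+ d)%:E)%E).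
  by apply: leeD2r; apply: lee_wpmul2l.
rewrite -EFinM -EFinD lee_fin.
rewrite (_ : K * (C3 * nut x) + B * (K * nut x) * 2 ^+ d = (K * C3 + B * K * 2 ^+ d) * nut x); last by ring.
rewrite /C4 -(mulrA _ _ (g x)).
apply: ler_wpM2l; last exact: g_ge.
have BK : 0 <= B * K * 2 ^+ d.
  by apply: mulr_ge0; [apply: mulr_ge0; exact: ltW|rewrite exprn_ge0].
apply: addr_ge0 => //; apply: mulr_ge0; first exact: ltW.
have : (0 <= (C3 * nut x)%:E)%E by apply: le_trans iF1; apply: integral_ge0 => z _; rewrite lee_fin.
by rewrite lee_fin pmulr_lge0.
Qed.

Let Ct : R := sval (cid2 (small_time_tail hX sX Nfin (r := 1 / 2) lk (divr_gt0 ltr01 (ltr0n R 2)))).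
Let Ct0 : 0 <= Ct.
Proof. by rewrite /Ct; case: cid2. Qed.
Let tail t : 0 <= t -> (P [set o | (1 / 2 <= enorm (X t o))%R] <= (Ct * t)%:E)%E.
Proof. by rewrite /Ct; case: cid2 => ? ? h; exact: h. Qed.

Let Cm : R := sval (cid2 (small_time_second_moment hX sX Nfin lk)).
Let Cm0 : 0 <= Cm.
Proof. by rewrite /Cm; case: cid2. Qed.
Let second_moment t : 0 <= t -> (\int[P]_o (Num.min 1 (enorm (X t o) ^+ 2))%:E <= (Cm * t)%:E)%E.
Proof. by rewrite /Cm; case: cid2 => ? ? h; exact: h. Qed.

Let ninv n : 0 <= n.+1%:R^-1 :> R. Proof. by rewrite invr_ge0. Qed.

Let mX n : measurable_fun setT (X n.+1%:R^-1).
Proof. exact: (levy_measurable hX). Qed.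

Let tailn n : (n.+1%:R%:E * P [set o | (1 / 2 <= enorm (X n.+1%:R^-1 o))%R] <= Ct%:E)%E.
Proof.
apply: (@le_trans _ _ (n.+1%:R%:E * (Ct * n.+1%:R^-1)%:E)%E).
  by apply: lee_wpmul2l; [rewrite lee_fin|exact: tail].
by rewrite -EFinM lee_fin mulrCA divff ?mulr1// pnatr_eq0.
Qed.

Let big n o : R := \1_[set y : E | 1 <= enorm y] (X n.+1%:R^-1 o).

Let C5 := expR L * (Cc * C4 + 1) / (r ^+ d).

(* Averaging over the centre of a small cube containing the jump replaces the law of
   the jump by the jump rates of cubes. *)
Let jump_integral_far (x : E) : 1 <= enorm x -> \forall n \near \oo,
  (n.+1%:R%:E * \int[P]_o (g (x + X n.+1%:R^-1 o) * big n o)%:E <= (C5 * g x)%:E)%E.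
Proof.
move=> x1; pose A := [set z : E | 7 / 8 <= enorm z].
have mA : measurable A by exact: mfar.
pose w z := g (x + z) * \1_A z.
have w0 z : 0 <= w z by rewrite mulr_ge0// ltW.
have mw : measurable_fun setT w by apply: measurable_funM => //; exact: mind.
have iw : leb.-integrable setT (EFin \o w).
  apply/integrableP; split; first exact/measurable_EFinP.
  apply: (@le_lt_trans _ _ (\int[leb]_z ((expR (L * enorm x))%:E * (far_density z)%:E))%E).
    apply: ge0_le_integral => //.
    - by do 2 apply: measurableT_comp => //.
    - by apply: emeasurable_funM; [exact: measurable_cst|exact/measurable_EFinP].
    move=> z _; rewrite -EFinM lee_fin ger0_norm// /w /far_density indicE.
    case: (boolP (z \in A)) => [|_]; last by rewrite mulr0 mul0r mulr0.
    rewrite inE/= => z7; rewrite mulr1 mul1r -nut_nu// addrC.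
    by apply: le_trans (gH z x) _; rewrite ler_wpM2l ?expR_ge0.
  have fe z : [set: E] z -> (0 <= (far_density z)%:E)%E by rewrite lee_fin.
  have ee : (0 <= (expR (L * enorm x))%:E :> \bar R)%E by rewrite lee_fin expR_ge0.
  have mfe : measurable_fun setT (fun z => (far_density z)%:E) by exact/measurable_EFinP.
  rewrite (ge0_integralZl leb measurableT mfe fe ee).
  have -> : (\int[leb]_z (far_density z)%:E = N A)%E.
    rewrite NE// [RHS]integral_mkcond; apply: eq_integral => z _.
    by rewrite /far_density patchE indicE; case: ifP => _; rewrite ?mul1r ?mul0r.
  have NA : N A \is a fin_num.
    by rewrite ge0_fin_numE//; apply: (levy_measure_tail Nfin).
  by rewrite -(fineK NA) -EFinM ltry.
pose c0 := cube (0 : E) (r / 2).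
have mc0 : measurable c0 by exact: measurable_cube.
have cE z y : cube z (r / 2) y <-> c0 (y - z).
  by split => h i; have := h i; rewrite !mxE ?subr0.
have r20 : 0 < r / 2 by rewrite divr_gt0.
have cubed z y : c0 (y - z) -> enorm (y - z) <= 1 / 16.
  move=> yz; have h := cube_enorm (ltW r20) (proj2 (cE z y) yz).
  apply: (le_trans h).
  by rewrite mulrA dr -mulrA -invfM -natrM div1r.
pose I n (z : E * O) : \bar R := (\1_c0 (X n.+1%:R^-1 z.2 - z.1))%:E.
have mI n : measurable_fun setT (I n).
  apply/measurable_EFinP; apply: (measurableT_comp (mind mc0)).
  by apply: measurable_funB_rV; [apply: (measurableT_comp (mX n))|]; meas.
have I0 n z : (0 <= I n z)%E by rewrite lee_fin.
pose p n (z : E) := (\int[P]_o I n (z, o))%E.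
have mp n : measurable_fun setT (p n).
  exact: (measurable_fun_fubini_tonelli_F (m2 := P) (I n) (mI n) (I0 n)).
have p0 n z : (0 <= p n z)%E by exact: integral_ge0.
have pE n z : p n z = P [set o | cube z (r / 2) (X n.+1%:R^-1 o)].
  have mS : measurable [set o | cube z (r / 2) (X n.+1%:R^-1 o)].
    exact: measurable_preimage (mX n) (measurable_cube _ _).
  rewrite -[X in P X]setIT -integral_indic//; apply: eq_integral => o _.
  rewrite /I !indicE; congr ((_ : bool)%:R%:E); apply/idP/idP; rewrite !inE.
    by move=> h; exact: (proj2 (cE _ _) h).
  by move=> h; exact: (proj1 (cE _ _) h).
(* Uniform in [n] and [z]: the tail estimate provides the domination for
   [eventually_integral_le]. *)
have pA n z : A z -> (n.+1%:R%:E * p n z <= Ct%:E)%E.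
  move=> zA; apply: le_trans (tailn n); apply: lee_wpmul2l; first by rewrite lee_fin.
  rewrite pE; apply: le_measure; rewrite ?inE.
  - exact: measurable_preimage (mX n) (measurable_cube _ _).
  - exact: measurable_enorm_ge.
  move=> o /= h'; have h := cubed _ _ (proj1 (cE _ _) h'); have := ler_enormB z (X n.+1%:R^-1 o).
  by rewrite enorm_sub; move: zA; rewrite /A/=; lra.
pose a n z := fine (n.+1%:R%:E * p n z)%E * \1_A z.
have aE n z : A z -> ((a n z)%:E = n.+1%:R%:E * p n z)%E.
  move=> zA; rewrite /a indicE mem_set// mulr1 fineK// ge0_fin_numE.
    by apply: le_lt_trans (pA n z zA) _; exact: ltry.
  by rewrite mule_ge0// lee_fin.
have a01 n z : 0 <= a n z <= Ct.
  have [zA|zA] := pselect (A z).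
    by rewrite -!lee_fin aE// pA// andbT mule_ge0// lee_fin.
  by rewrite /a indicE memNset// mulr0 lexx.
have ma n : measurable_fun setT (a n).
  apply: measurable_funM; last exact: mind.
  apply: measurableT_comp; first exact: fine_measurable.
  by apply: emeasurable_funM => //; exact: measurable_cst.
have bd0 z : 0 <= Cc * far_density z by rewrite mulr_ge0// ltW.
have mb : measurable_fun setT (fun z => Cc * far_density z).
  by apply: measurable_funM => //; exact: measurable_cst.
have ev z : w z != 0 -> \forall n \near \oo, a n z <= Cc * far_density z.
  move=> wz; have zA : A z.
    by apply: contraPP wz => zA; rewrite /w indicE memNset// mulr0 eqxx.
  have := jump_rate_le zA; apply: filterS => n h.
  rewrite -lee_fin aE// pE; apply: le_trans h _.
  by rewrite lee_fin /far_density indicE mem_set// mul1r nut_nu.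
have := eventually_integral_le w0 bd0 a01 iw mb ma (g0 x) ev.
apply: filterS => n hn.
have iwb : (\int[leb]_z (w z * (Cc * far_density z))%:E <= (Cc * (C4 * g x))%:E)%E.
  rewrite EFinM; apply: le_trans (lee_wpmul2l _ (far_integral x1)); last by rewrite lee_fin ltW.
  rewrite -ge0_integralZl//; last 3 first.
  - by apply/measurable_EFinP; exact: measurable_funM.
  - by move=> z _; rewrite lee_fin mulr_ge0// ltW.
  - by rewrite lee_fin ltW.
  rewrite le_eqVlt; apply/orP; left; apply/eqP; apply: eq_integral => z _.
  rewrite -EFinM; congr EFin; rewrite /w /far_density !indicE.
  by case: (z \in A); rewrite ?mulr1 ?mul1r ?mulr0 ?mul0r ?mulr0// mulrCA.
have rd0 : 0 < r ^+ d by rewrite exprn_gt0.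
(* [r ^ d] is the volume of the set of centres [z] whose cube contains the jump [y], and for these
   [g (x + y) <= e ^ L g (x + z)]. *)
have key : ((r ^+ d)%:E * \int[P]_o (g (x + X n.+1%:R^-1 o) * big n o)%:E <=
    (expR L)%:E * \int[leb]_z ((w z)%:E * p n z))%E.
  have pt o : ((r ^+ d)%:E * (g (x + X n.+1%:R^-1 o) * big n o)%:E <=
      (expR L)%:E * \int[leb]_z ((w z)%:E * I n (z, o)))%E.
    rewrite /big indicE; case: (boolP (_ \in _)) => [|_]; last first.
      rewrite mulr0 mule0 mule_ge0 ?lee_fin ?expR_ge0// integral_ge0// => z _.
      by rewrite mule_ge0 ?lee_fin.
    rewrite inE/= mulr1; set y := X _ o => y1.
    have mc1 : measurable_fun setT (fun z : E => (\1_c0 (y - z) : R)%:E).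
      apply/measurable_EFinP; apply: (measurableT_comp (mind mc0)).
      by apply: measurable_funB_rV => //; exact: measurable_cst.
    have -> : ((r ^+ d)%:E = \int[leb]_z (\1_c0 (y - z) : R)%:E)%E.
      have := lebesgue_cube y (ltW r20); rewrite (mulrC 2) divfK// => <-.
      rewrite -[X in lebesgue_rV _ _ X]setIT -integral_indic//; last exact: measurable_cube.
      apply: eq_integral => z _; rewrite !indicE; congr ((_ : bool)%:R%:E).
      apply/idP/idP; rewrite !inE => h; first exact: (proj1 (cE _ _) (proj1 (cube_sym _ _ _) h)).
      exact: (proj1 (cube_sym _ _ _) (proj2 (cE _ _) h)).
    have c00 z : [set: E] z -> (0 <= (\1_c0 (y - z) : R)%:E)%E by rewrite lee_fin.
    have gy0 : (0 <= (g (x + y))%:E)%E by rewrite lee_fin ltW.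
    have ee : (0 <= (expR L)%:E :> \bar R)%E by rewrite lee_fin expR_ge0.
    have mwe : measurable_fun setT (fun z => (w z)%:E) by exact/measurable_EFinP.
    have mwI : measurable_fun setT (fun z => (w z)%:E * I n (z, o))%E.
      by apply: emeasurable_funM.
    have wI0 z : [set: E] z -> (0 <= (w z)%:E * I n (z, o))%E by rewrite mule_ge0 ?lee_fin.
    rewrite muleC -(ge0_integralZl leb measurableT mc1 c00 gy0).
    rewrite -(ge0_integralZl leb measurableT mwI wI0 ee).
    apply: ge0_le_integral => //.
    - by move=> z _; rewrite mule_ge0// lee_fin.
    - by apply: emeasurable_funM => //; exact: measurable_cst.
    - by apply: emeasurable_funM => //; exact: measurable_cst.
    move=> z _; rewrite /I -/y !indicE; case: (boolP (_ \in c0)) => [|_]; last first.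
      by rewrite !mule0.
    rewrite inE => /cubed yz; rewrite !mule1 -EFinM lee_fin /w indicE mem_set ?mulr1; last first.
      by rewrite /A/=; have := ler_enormB y (y - z); rewrite subKr; lra.
    rewrite (_ : x + y = x + z + (y - z)); last by rewrite -addrA subrKC.
    by apply: gH1; apply: le_trans yz _; lra.
  have mgb : measurable_fun setT (fun o => (g (x + X n.+1%:R^-1 o) * big n o)%:E).
    apply/measurable_EFinP; apply: measurable_funM; first exact: (measurableT_comp (mgsh x) (mX n)).
    exact: (measurableT_comp (mind (mfar 1)) (mX n)).
  have gb0 o : [set: O] o -> (0 <= (g (x + X n.+1%:R^-1 o) * big n o)%:E)%E.
    by rewrite lee_fin mulr_ge0// ltW.
  have rde : (0 <= (r ^+ d)%:E)%E by rewrite lee_fin ltW.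
  have ee : (0 <= (expR L)%:E :> \bar R)%E by rewrite lee_fin expR_ge0.
  pose J (z : E * O) := ((w z.1)%:E * I n z)%E.
  have mJ : measurable_fun setT J.
    apply: emeasurable_funM => //; apply/measurable_EFinP.
    exact: (measurableT_comp mw measurable_fst).
  have J0 z : (0 <= J z)%E by rewrite mule_ge0 ?lee_fin.
  have mG : measurable_fun setT (fun o => \int[leb]_z J (z, o))%E.
    exact: (measurable_fun_fubini_tonelli_G (m1 := leb) J mJ J0).
  have G0 o : [set: O] o -> (0 <= \int[leb]_z J (z, o))%E by move=> _; exact: integral_ge0.
  rewrite -(ge0_integralZl P measurableT mgb gb0 rde).
  apply: (@le_trans _ _ (\int[P]_o ((expR L)%:E * \int[leb]_z J (z, o)))%E).
    apply: ge0_le_integral => //.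
    - by move=> o _; rewrite mule_ge0// gb0.
    - by apply: emeasurable_funM => //; exact: measurable_cst.
    - by apply: emeasurable_funM => //; exact: measurable_cst.
  rewrite (ge0_integralZl P measurableT mG G0 ee); apply: lee_wpmul2l => //.
  rewrite le_eqVlt; apply/orP; left; apply/eqP.
  transitivity (\int[leb]_z \int[P]_o J (z, o))%E; first exact: (esym (fubini_tonelli J mJ J0)).
  apply: eq_integral => z _; rewrite /p -ge0_integralZl//.
  - exact: (measurableT_comp (mI n) (measurable_pair1 z)).
  - by rewrite lee_fin.
have nE : (n.+1%:R%:E * \int[leb]_z ((w z)%:E * p n z) = \int[leb]_z (w z * a n z)%:E)%E.
  have mwp : measurable_fun setT (fun z => (w z)%:E * p n z)%E.
    by apply: emeasurable_funM => //; apply/measurable_EFinP.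
  have wp0 z : [set: E] z -> (0 <= (w z)%:E * p n z)%E by rewrite mule_ge0// lee_fin.
  have n0 : (0 <= n.+1%:R%:E :> \bar R)%E by rewrite lee_fin.
  rewrite -(ge0_integralZl leb measurableT mwp wp0 n0).
  apply: eq_integral => z _; have [zA|zA] := pselect (A z).
    by rewrite [RHS]EFinM aE// muleCA.
  by rewrite /w indicE memNset// mulr0 mul0r mul0e mule0.
have h2 : (n.+1%:R%:E * \int[leb]_z ((w z)%:E * p n z) <= ((Cc * C4 + 1) * g x)%:E)%E.
  rewrite nE; apply: le_trans hn _; rewrite mulrDl mul1r -mulrA EFinD.
  by apply: leeD2r.
have Z0 : (0 <= \int[P]_o (g (x + X n.+1%:R^-1 o) * big n o)%:E)%E.
  by apply: integral_ge0 => o _; rewrite lee_fin mulr_ge0// ltW.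
have Y0 : (0 <= \int[leb]_z ((w z)%:E * p n z))%E.
  by apply: integral_ge0 => z _; rewrite mule_ge0// lee_fin.
have n0 : (0 <= n.+1%:R%:E :> \bar R)%E by rewrite lee_fin.
have e0 : (0 <= (expR L)%:E :> \bar R)%E by rewrite lee_fin expR_ge0.
have h3 := lee_wpmul2l n0 key; rewrite muleCA [leRHS]muleCA in h3.
have h4 := le_trans h3 (lee_wpmul2l e0 h2); rewrite -EFinM mulrA in h4.
rewrite /C5 (_ : _ / _ * _ = (r ^+ d)^-1 * (expR L * (Cc * C4 + 1) * g x)); last by rewrite mulrAC mulrC.
by rewrite EFinM lee_pdivlMl.
Qed.

(** Symmetry replaces [f (X t)] by the mean of [f (X t)] and [f (- X t)], so that
    [profile_second_difference] applies. For [|y| <= 1] one has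
    [cosh (L |y|) - 1 <= L ^ 2 |y| ^ 2 e ^ L], which the truncated second moment integrates to
    O(t). *)
Let small_jumps t x : 0 <= t ->
  (\int[P]_o (g (x + X t o))%:E <= (g x * (1 + L ^+ 2 * expR L * Cm * t))%:E +
     \int[P]_o (g (x + X t o) * \1_[set y : E | 1 <= enorm y] (X t o))%:E)%E.
Proof.
move=> t0; have mXt := levy_measurable hX t0.
pose s (y : E) : R := \1_[set y : E | 1 <= enorm y] y.
have ms : measurable_fun setT s by apply: mind; exact: mfar.
have s01 y : 0 <= s y <= 1 by rewrite /s indicE; case: (_ \in _); rewrite ?lexx ?ler01.
pose f y := g (x + y) * (1 - s y).
have f0 y : 0 <= f y by rewrite mulr_ge0 ?subr_ge0 ?(ltW (g0 _))//; have /andP[] := s01 y.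
have mf : measurable_fun setT f.
  apply: measurable_funM; first exact: mgsh.
  by apply: measurable_funB => //; exact: measurable_cst.
have mfe : measurable_fun setT (EFin \o f) by exact/measurable_EFinP.
have mfX : measurable_fun setT (fun o => (f (X t o))%:E) := measurableT_comp mfe mXt.
have fX0 o : [set: O] o -> (0 <= (f (X t o))%:E)%E by rewrite lee_fin.
have fNX0 o : [set: O] o -> (0 <= (f (- X t o))%:E)%E by rewrite lee_fin.
have mfNX : measurable_fun setT (fun o => (f (- X t o))%:E).
  by apply: (measurableT_comp mfe); exact: measurable_funN_rV.
have -> : (\int[P]_o (g (x + X t o))%:E = \int[P]_o (f (X t o))%:E + \int[P]_o (g (x + X t o) * s (X t o))%:E)%E.
  have gs0 o : [set: O] o -> (0 <= (g (x + X t o) * s (X t o))%:E)%E.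
    by move=> _; rewrite lee_fin mulr_ge0 ?(ltW (g0 _))//; have /andP[] := s01 (X t o).
  have mgs : measurable_fun setT (fun o => (g (x + X t o) * s (X t o))%:E).
    apply/measurable_EFinP; apply: measurable_funM; first exact: (measurableT_comp (mgsh x) mXt).
    exact: (measurableT_comp ms mXt).
  rewrite -(ge0_integralD P measurableT fX0 mfX gs0 mgs).
  by apply: eq_integral => o _; rewrite -EFinD /f mulrBr mulr1 subrK.
apply: leeD2r.
set I := (\int[P]_o (f (X t o))%:E)%E.
have IN : I = (\int[P]_o (f (- X t o))%:E)%E.
  by apply: (symmetric_integral hX sX t0 mfe) => y; rewrite lee_fin.
pose A := L ^+ 2 * expR L.
have A0 : 0 <= A by rewrite mulr_ge0 ?sqr_ge0 ?expR_ge0.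
pose m (y : E) := Num.min 1 (enorm y ^+ 2).
have m0 y : 0 <= m y by rewrite le_min ler01 sqr_ge0.
have mm : measurable_fun setT (fun o => (m (X t o))%:E).
  apply/measurable_EFinP; apply: measurable_minr; first exact: measurable_cst.
  by apply: measurable_funX; exact: measurable_enorm mXt.
have gA : 0 <= 2 * g x * A by apply: mulr_ge0 => //; apply: mulr_ge0 => //; exact: ltW.
have pt y : f y + f (- y) <= 2 * g x + 2 * g x * A * m y.
  rewrite /f /s !indicE; case: (boolP (_ \in _)) => [|].
    rewrite inE/= => y1; rewrite mem_set/= ?enormN// subrr !mulr0 addr0.
    by apply: addr_ge0; apply: mulr_ge0 => //; exact: ltW.
  rewrite notin_setE/= => /negP; rewrite -ltNge => y1.
  rewrite memNset/= ?enormN; last by apply/negP; rewrite -ltNge.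
  rewrite subr0 !mulr1; apply: le_trans (profile_second_difference hd nut_gt0 K1 x y) _.
  have my : m y = enorm y ^+ 2.
    by apply/min_idPr; rewrite expr_le1 ?enorm_ge0// ltW.
  have u0 : 0 <= L * enorm y by rewrite mulr_ge0// enorm_ge0.
  have uL : L * enorm y <= L by rewrite ler_piMr// ltW.
  have := cosh_sub1_le u0 uL; rewrite -/L exprMn my /A.
  move: (cosh _) (enorm y ^+ 2) (expR L) (g x) (g0 x) => c e q G G0 h.
  rewrite (_ : 2 * c * G = 2 * G * c); last by ring.
  rewrite (_ : 2 * G + 2 * G * (L ^+ 2 * q) * e = 2 * G * (1 + L ^+ 2 * e * q)); last by ring.
  by apply: ler_wpM2l; [rewrite mulr_ge0// ltW|rewrite addrC -lerBlDr].
have II : (I + I <= (2 * (g x * (1 + L ^+ 2 * expR L * Cm * t)))%:E)%E.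
  rewrite {2}IN -(ge0_integralD P measurableT fX0 mfX fNX0 mfNX).
  apply: (@le_trans _ _ (\int[P]_o ((2 * g x)%:E + (2 * g x * A)%:E * (m (X t o))%:E))%E).
    apply: ge0_le_integral => //.
    - by move=> o _; rewrite -EFinD lee_fin addr_ge0.
    - exact: emeasurable_funD.
    - apply: emeasurable_funD; first exact: measurable_cst.
      by apply: emeasurable_funM => //; exact: measurable_cst.
    by move=> o _; rewrite -EFinM -!EFinD lee_fin; exact: pt.
  have me0 o : [set: O] o -> (0 <= (m (X t o))%:E)%E by rewrite lee_fin.
  have gAe : (0 <= (2 * g x * A)%:E)%E by rewrite lee_fin.
  have c0 o : [set: O] o -> (0 <= (2 * g x)%:E)%E by rewrite lee_fin mulr_ge0 ?(ltW (g0 _)).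
  have mcst : measurable_fun [set: O] (cst (2 * g x)%:E) by exact: measurable_cst.
  have gm0 o : [set: O] o -> (0 <= (2 * g x * A)%:E * (m (X t o))%:E)%E.
    by move=> _; rewrite mule_ge0// lee_fin.
  have mgm : measurable_fun setT (fun o => (2 * g x * A)%:E * (m (X t o))%:E)%E.
    by apply: emeasurable_funM => //; exact: measurable_cst.
  rewrite (ge0_integralD P measurableT c0 mcst gm0 mgm) (ge0_integralZl P measurableT mm me0 gAe).
  rewrite integral_cst// [X in (_ * X)%E]probability_setT mule1.
  apply: (@le_trans _ _ ((2 * g x)%:E + (2 * g x * A)%:E * (Cm * t)%:E)%E).
    by apply: leeD2l; apply: lee_wpmul2l => //; exact: second_moment.
  rewrite -EFinM -EFinD lee_fin /A; rewrite le_eqVlt; apply/orP; left; apply/eqP; ring.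
rewrite leNgt; apply/negP => h; have := lteD h h; rewrite ltNge; apply/negP.
by rewrite negbK; rewrite mulr_natl mulr2n EFinD in II.
Qed.

Let far_jumps t x : 0 <= t ->
  (\int[P]_o (g (x + X t o) * \1_[set y : E | 1 <= enorm y] (X t o))%:E <= (B * (Ct * t))%:E)%E.
Proof.
move=> t0; have mXt := levy_measurable hX t0.
have mS : measurable [set o | 1 / 2 <= enorm (X t o)] by exact: measurable_enorm_ge.
rewrite EFinM; apply: le_trans (lee_wpmul2l _ (tail t0)); last by rewrite lee_fin ltW.
have B0e : (0 <= B%:E :> \bar R)%E by rewrite lee_fin ltW.
rewrite -[X in P X]setIT -integral_indic// -(ge0_integralZl P measurableT _ _ B0e)//; last first.
  by apply/measurable_EFinP; exact: measurable_indic.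
apply: ge0_le_integral => //.
- by move=> o _; rewrite lee_fin mulr_ge0// ltW.
- apply/measurable_EFinP; apply: measurable_funM; first exact: (measurableT_comp (mgsh x) mXt).
  exact: (measurableT_comp (mind (mfar 1)) mXt).
- apply: emeasurable_funM; first exact: measurable_cst.
  by apply/measurable_EFinP; exact: measurable_indic.
move=> o _; rewrite -EFinM lee_fin !indicE; apply: ler_pM => //; first exact: ltW.
rewrite ler_nat; case: (boolP (X t o \in _)) => //; rewrite inE/= => h.
by rewrite mem_set//=; apply: le_trans h; lra.
Qed.

Let C6 := Num.max C5 (B * Ct * (expR L / g 0)).

Let jump_integral (x : E) : \forall n \near \oo,
  (n.+1%:R%:E * \int[P]_o (g (x + X n.+1%:R^-1 o) * big n o)%:E <= (C6 * g x)%:E)%E.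
Proof.
have [x1|x1] := leP 1 (enorm x).
  have := jump_integral_far x1; apply: filterS => n h; apply: le_trans h _.
  by rewrite lee_fin ler_wpM2r ?(ltW (g0 _))// le_max lexx.
(* In the unit ball [g] is at least [g 0 / e ^ L], so the crude bound on large jumps is already a
   multiple of [g x]. *)
apply: nearW => n; have n0 : (0 <= n.+1%:R%:E :> \bar R)%E by rewrite lee_fin.
apply: le_trans (lee_wpmul2l n0 (far_jumps x (ninv n))) _; rewrite -EFinM lee_fin.
have -> : n.+1%:R * (B * (Ct * n.+1%:R^-1)) = B * Ct by field; rewrite ?pnatr_eq0.
apply: (@le_trans _ _ (B * Ct * (expR L / g 0) * g x)); last first.
  by rewrite ler_wpM2r ?(ltW (g0 _))// le_max lexx orbT.
rewrite -(mulrA (B * Ct) (expR L / g 0) (g x)); apply: ler_peMr.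
  by apply: mulr_ge0 => //; exact: ltW.
rewrite mulrAC ler_pdivlMr// mul1r.
by have := @gH1 x (- x); rewrite subrr enormN; apply; exact: ltW.
Qed.

Let C7 := L ^+ 2 * expR L * Cm.
Let C7_ge0 : 0 <= C7.
Proof. by apply: mulr_ge0 => //; rewrite mulr_ge0 ?sqr_ge0 ?expR_ge0. Qed.
Let C8 := B * C7 + B * Ct.
Let C8_ge0 : 0 <= C8.
Proof. by apply: addr_ge0; apply: mulr_ge0 => //; exact: ltW. Qed.
Let C9 := C7 + C6.
Let C9_ge0 : 0 <= C9.
Proof.
apply: addr_ge0 => //; rewrite le_max; apply/orP; right.
by rewrite !mulr_ge0 ?invr_ge0 ?expR_ge0 ?(ltW (g0 _))// ltW.
Qed.

Local Notation T := (fk P X (cst 0) (cst 0)).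
Let p0 := potential0 R d.
Let ng : nnmeas (EFin \o g).
Proof. by split=> [|x]; [exact/measurable_EFinP|rewrite lee_fin ltW]. Qed.

(** Crude but uniform in [x]: it supplies the Lipschitz hypothesis of [dini_gronwall] and the
    domination of the difference quotients. *)
Let T_le_time t x : 0 <= t -> (T t (EFin \o g) x <= (g x + C8 * t)%:E)%E.
Proof.
move=> t0; rewrite (fk_free x hX t0 ng).
apply: le_trans (small_jumps x t0) _; apply: le_trans (leeD2l _ (far_jumps x t0)) _.
rewrite -EFinD lee_fin -/C7; apply: affine_le.
by apply: ler_wpM2r; [exact: mulr_ge0|exact: gB].
Qed.

Let T_le_jump x : \forall n \near \oo,
  (T n.+1%:R^-1 (EFin \o g) x <= (g x + n.+1%:R^-1 * (C9 * g x))%:E)%E.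
Proof.
have := jump_integral x; apply: filterS => n h; rewrite (fk_free x hX (ninv n) ng).
apply: le_trans (small_jumps x (ninv n)) _; rewrite -/C7.
have {}h : (\int[P]_o (g (x + X n.+1%:R^-1 o) * big n o)%:E <= (n.+1%:R^-1 * (C6 * g x))%:E)%E.
  by rewrite EFinM lee_pdivlMl.
apply: le_trans (leeD2l _ h) _; rewrite -EFinD lee_fin /C9; rewrite le_eqVlt; apply/orP; left; apply/eqP; ring.
Qed.

Let T_bounded t x : 0 <= t -> (T t (EFin \o g) x <= B%:E)%E.
Proof.
move=> t0; rewrite (fk_free x hX t0 ng) -[leRHS]mule1 -(probability_setT P) -integral_cst//.
apply: ge0_le_integral => //.
- by move=> o _; rewrite lee_fin ltW.
- apply/measurable_EFinP; exact: (measurableT_comp (mgsh x) (levy_measurable hX t0)).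
- by move=> o _; rewrite lee_fin.
Qed.

(* Integrating the pointwise bounds [T_le_jump] against the law of [X t] needs only
   [T_le_time] as a domination. *)
Let profile_gronwall t x : 0 <= t -> (T t (EFin \o g) x <= (expR (C9 * t) * g x)%:E)%E.
Proof.
have T0 t1 y : (0 <= T t1 (EFin \o g) y)%E by apply: fk_ge0 => z; rewrite lee_fin ltW.
have Tfin t1 y : 0 <= t1 -> T t1 (EFin \o g) y \is a fin_num.
  move=> t10; rewrite ge0_fin_numE//; exact: le_lt_trans (T_bounded y t10) (ltry _).
pose u (s : R) := fine (T s (EFin \o g) x).
have uE s : 0 <= s -> (u s)%:E = T s (EFin \o g) x by move=> s0; rewrite fineK// Tfin.
have u0 : u 0 = g x.
  rewrite /u (fk_free x hX (lexx 0) ng).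
  rewrite (_ : (\int[P]_o _)%E = (\int[P]_o (g x)%:E)%E).
    by rewrite integral_cst// [X in (_ * X)%E]probability_setT mule1.
  apply: nonmeasurable_ge0_ae_eq_integral => [w|w|].
  - by rewrite lee_fin ltW.
  - by rewrite lee_fin ltW.
  by apply: filterS (levy_start hX) => w ->; rewrite addr0.
have ncst (c : R) : 0 <= c -> nnmeas (fun _ : E => c%:E).
  by move=> c0; split; [exact: measurable_cst|move=> _; rewrite lee_fin].
have Tcst s (c : R) : 0 <= s -> 0 <= c -> T s (fun=> c%:E) x = c%:E.
  move=> s0 c0; rewrite (fk_free x hX s0 (ncst c c0)).
  by rewrite integral_cst// [X in (_ * X)%E]probability_setT mule1.
move=> t0; rewrite -uE// lee_fin -u0; apply: (@dini_gronwall _ u C9 C8) => //.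
- by rewrite -lee_fin uE.
- move=> s h s0 h0; have sh0 : 0 <= s + h by exact: addr_ge0.
  have c0 : 0 <= C8 * h by exact: mulr_ge0.
  rewrite -lee_fin uE// EFinD uE// (fk_semigroup hX x p0 p0 s0 h0 ng) -(Tcst s _ s0 c0).
  rewrite -(fkD hX p0 p0 s x ng (ncst _ c0)).
  apply: (le_fk hX p0 p0 s x (nnmeas_fk hX p0 p0 h ng)).
    by split; [apply: emeasurable_funD => //; case: ng|move=> y; rewrite adde_ge0// lee_fin ltW].
  by move=> y; exact: T_le_time.
- move=> s e dl s0 e0 dl0.
  (* Positive part of the difference quotient over the time step [1 / (n + 1)]. The threshold from
     which [C9 * g] bounds it depends on the point, so a single step is chosen only after
     integration. *)
  pose a n y := n.+1%:R * Num.max 0 (fine (T n.+1%:R^-1 (EFin \o g) y) - g y).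
  have ma n : measurable_fun setT (a n).
    apply: measurable_funM; first exact: measurable_cst.
    apply: measurable_maxr; first exact: measurable_cst.
    apply: measurable_funB => //; apply: (measurableT_comp (fine_measurable measurableT)).
    by have [] := nnmeas_fk hX p0 p0 n.+1%:R^-1 ng.
  have aC n y : 0 <= a n y <= C8.
    have h0 : 0 <= Num.max 0 (fine (T n.+1%:R^-1 (EFin \o g) y) - g y).
      by rewrite le_max lexx.
    rewrite mulr_ge0//= -ler_pdivlMl// ge_max mulr_ge0//= lerBlDl -lee_fin fineK ?Tfin// mulrC.
    exact: T_le_time.
  have ab y : \forall n \near \oo, a n y <= C9 * g y.
    have := T_le_jump y; apply: filterS => n h.
    rewrite /a -ler_pdivlMl// ge_max; apply/andP; split.
      by rewrite !mulr_ge0 ?(ltW (g0 _)).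
    by rewrite lerBlDl -lee_fin fineK ?Tfin.
  have mp : measurable_fun setT (fun o => x + X s o).
    by apply: measurable_funD_rV; [exact: measurable_cst|exact: (levy_measurable hX)].
  have i1 : P.-integrable setT (EFin \o (cst 1 : O -> R)).
    exact: (finite_measure_integrable_cst P 1).
  have mgX : measurable_fun setT (fun o => g (x + X s o)) := measurableT_comp mg mp.
  have w0 (o : O) : 0 <= (cst 1 : O -> R) o by exact: ler01.
  have b0 o : 0 <= C9 * g (x + X s o) by rewrite mulr_ge0 ?(ltW (g0 _)).
  have mb : measurable_fun setT (fun o => C9 * g (x + X s o)).
    by apply: measurable_funM => //; exact: measurable_cst.
  have ev := @eventually_integral_le R dO O P (cst 1) (fun o => C9 * g (x + X s o))
    (fun n o => a n (x + X s o)) C8 e w0 b0 (fun n o => aC n (x + X s o)) i1 mb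
    (fun n => measurableT_comp (ma n) mp) e0 (fun o _ => ab (x + X s o)).
  have [n _ nP] := filterI ev (near_infty_natSinv_lt (PosNum dl0)).
  have [{}ev /= ndl] := nP n (leqnn n); exists n.+1%:R^-1; split => //.
  have h0 := ninv n; have sh0 : 0 <= s + n.+1%:R^-1 by exact: addr_ge0.
  have mae : measurable_fun setT (fun o => (a n (x + X s o))%:E).
    by apply/measurable_EFinP; exact: (measurableT_comp (ma n) mp).
  have a0e o : [set: O] o -> (0 <= (a n (x + X s o))%:E)%E.
    by move=> _; rewrite lee_fin; case/andP: (aC n (x + X s o)).
  have mge : measurable_fun setT (fun o => (g (x + X s o))%:E) by exact/measurable_EFinP.
  have g0e o : [set: O] o -> (0 <= (g (x + X s o))%:E)%E by rewrite lee_fin ltW.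
  have h0e : (0 <= n.+1%:R^-1%:E :> \bar R)%E by rewrite lee_fin.
  have C9e : (0 <= C9%:E :> \bar R)%E by rewrite lee_fin.
  have evi : (\int[P]_o (a n (x + X s o))%:E <= (C9 * u s + e)%:E)%E.
    rewrite EFinD EFinM uE// (fk_free x hX s0 ng) -(ge0_integralZl P measurableT mge g0e C9e).
    move: ev; rewrite (eq_integral (fun o => (a n (x + X s o))%:E)) => [h|o _]; last by rewrite mul1r.
    apply: le_trans h _; apply: leeD2r; rewrite le_eqVlt; apply/orP; left; apply/eqP.
    by apply: eq_integral => o _; rewrite mul1r EFinM.
  rewrite -lee_fin uE// EFinD EFinM uE// (fk_semigroup hX x p0 p0 s0 h0 ng).
  rewrite (fk_free x hX s0 (nnmeas_fk hX p0 p0 _ ng)) (fk_free x hX s0 ng).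
  apply: le_trans (leeD2l _ (lee_wpmul2l h0e evi)).
  have ha0 o : [set: O] o -> (0 <= n.+1%:R^-1%:E * (a n (x + X s o))%:E)%E.
    by move=> ?; rewrite mule_ge0// a0e.
  have mha : measurable_fun setT (fun o => n.+1%:R^-1%:E * (a n (x + X s o))%:E)%E.
    by apply: emeasurable_funM => //; exact: measurable_cst.
  rewrite -(ge0_integralZl P measurableT mae a0e h0e) -(ge0_integralD P measurableT g0e mge ha0 mha).
  have [mTh Th0] := nnmeas_fk hX p0 p0 n.+1%:R^-1 ng.
  apply: ge0_le_integral.
  - exact: measurableT.
  - by move=> o _; exact: Th0.
  - exact: (measurableT_comp mTh mp).
  - by apply: emeasurable_funD.
  move=> o _; rewrite -EFinM -EFinD -[leLHS]fineK ?Tfin// lee_fin /a mulrA mulVf ?pnatr_eq0// mul1r.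
  by rewrite -lerBlDl le_max lexx orbT.
Qed.

(** A jump into the cube of half-side [r] around [- x] brings the path within 1 / 8 of the
    origin. *)
Let jump_rate_ge x : 2 <= enorm x -> \forall n \near \oo,
  (((2 ^+ d.+4)^-1 * (K^-1 * (K^-1 * nut x) * r ^+ d))%:E <=
    n.+1%:R%:E * P [set o | (enorm (x + X n.+1%:R^-1 o) < 1 / 2)%R])%E.
Proof.
move=> x2; have r20 : 0 < r / 2 by rewrite divr_gt0.
have x7 : 7 / 8 <= enorm (- x) by rewrite enormN; apply: le_trans x2; lra.
have [i hi] := large_coord x7.
have dr' : d%:R * (r / 2) <= 1 / 4 by rewrite mulrA dr; lra.
have [_ h1] := mass_cube r20 dr' x7; rewrite mulrCA divff// mulr1 in h1.
have h2 : K^-1 * nut x <= nut (- x).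
  by rewrite ler_pdivrMl//; apply: nut_growth; rewrite enormN lerDl.
have rd0 : 0 < r ^+ d by rewrite exprn_gt0.
have q0 : 0 < K^-1 * (K^-1 * nut x) * r ^+ d by rewrite !mulr_gt0 ?invr_gt0.
have h3 : K^-1 * (K^-1 * nut x) * r ^+ d <= fine (N (cube (- x) (r / 2))).
  by apply: le_trans h1; rewrite ler_pM2r// ler_pM2l ?invr_gt0.
have HL : (2 ^+ d.+4)^-1 * (K^-1 * (K^-1 * nut x) * r ^+ d) <
    (2 ^+ d.+3)^-1 * fine (N (cube (- x) (r / 2))).
  apply: (@lt_le_trans _ _ ((2 ^+ d.+3)^-1 * (K^-1 * (K^-1 * nut x) * r ^+ d))).
    by rewrite ltr_pM2r// ltf_pV2 ?posrE ?exprn_gt0// ltr_eXn2l ?ltr1n.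
  by rewrite ler_pM2l// invr_gt0 exprn_gt0.
have := small_time_cube_ge hX sX N0 Nfin Qpos lk r0 hi HL.
apply: filterS => n h; apply: le_trans h _; apply: lee_wpmul2l; first by rewrite lee_fin.
have mxX : measurable_fun setT (fun o => x + X n.+1%:R^-1 o).
  by apply: measurable_funD_rV => //; exact: measurable_cst.
apply: le_measure; rewrite ?inE.
- exact: measurable_preimage (mX n) (measurable_cube _ _).
- rewrite (_ : [set _ | _] = ~` [set o | 1 / 2 <= enorm (x + X n.+1%:R^-1 o)]).
    by apply: measurableC; exact: measurable_enorm_ge.
  by apply/seteqP; split => o /=; rewrite ltNge => /negP.
move=> o /= /(cube_enorm (ltW r0)); rewrite opprK addrC dr => h'.
by apply: le_lt_trans h' _; lra.
Qed.

Lemma profile_excessive : exists2 C : R, 0 <= C &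
  forall t x, 0 <= t -> (T t (EFin \o g) x <= (expR (C * t) * g x)%:E)%E.
Proof. by exists C9 => // t x; exact: profile_gronwall. Qed.

Lemma profile_jump_rate : exists2 c : R, 0 < c & forall x, 2 <= enorm x ->
  \forall n \near \oo,
  ((c * g x)%:E <= n.+1%:R%:E * P [set o | (enorm (x + X n.+1%:R^-1 o) < 1 / 2)%R])%E.
Proof.
exists ((2 ^+ d.+4)^-1 * (K^-1 * K^-1 * r ^+ d)).
  by rewrite !mulr_gt0 ?invr_gt0 ?exprn_gt0.
move=> x /jump_rate_ge; apply: filterS => n; apply: le_trans; rewrite lee_fin.
rewrite -!mulrA ler_pM2l ?invr_gt0 ?exprn_gt0// !ler_pM2l ?invr_gt0//.
by rewrite mulrC ler_pM2r ?exprn_gt0.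
Qed.

End generator.

(** * The ground state *)

(** Everything that the later arguments use of the profile; its comparison with [nu] is confined to
    the outside of the ball of radius 1 / 2. *)
Record levy_profile (R : realType) (d : nat) (dO : measure_display) (O : measurableType dO)
    (P : probability O R) (X : R -> O -> 'rV[R]_d) (nu g : 'rV[R]_d -> R) : Prop :=
  LevyProfile {
  levy_profile_measurable : measurable_fun setT g ;
  levy_profile_gt0 : forall x, 0 < g x ;
  levy_profile_bounded : exists B : R, forall x, g x <= B ;
  levy_profile_harnack : exists2 L : R, 0 <= L &
    forall x y, g (x + y) <= expR (L * enorm y) * g x ;
  levy_profile_le : forall x, 1 / 2 <= enorm x -> g x <= nu x ;
  levy_profile_ge : exists2 C : R, 0 < C &
    forall x, 1 / 2 <= enorm x -> nu x <= C * g x ;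
  levy_profile_excessive : exists2 C : R, 0 <= C & forall t x, 0 <= t ->
    (fk P X (cst 0%R) (cst 0%R) t (EFin \o g) x <= (expR (C * t) * g x)%:E)%E ;
  levy_profile_jump_rate : exists2 c : R, 0 < c & forall x, 2 <= enorm x ->
    \forall n \near \oo, ((c * g x)%:E <=
      n.+1%:R%:E * P [set o | (enorm (x + X n.+1%:R^-1 o) < 1 / 2)%R])%E }.

Lemma levy_profile_exists (R : realType) (d : nat) (dO : measure_display)
    (O : measurableType dO) (P : probability O R) (X : R -> O -> 'rV[R]_d)
    (nu : 'rV[R]_d -> R) : (0 < d)%N -> levy_process P X -> regular_A1 P X nu ->
  exists g, levy_profile P X nu g.
Proof.
move=> hd hX [sX mnu nu0 [N [N0 Nfin [b [Q [_ Qpos lk]]]] NE] A1 A2 [C3 _ A3]].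
have half : 0 < (1 / 2 : R) <= 1 / 2 by rewrite lexx andbT divr_gt0.
have [nut [K [K1 nut0 growth nutE]]] := truncated_density hd nu0 (A1 _ half) A2.
exists (profile nut K); split.
- exact: measurable_profile.
- exact: profile_gt0.
- by exists (K * nut 0); apply: profile_bounded.
- exists (d%:R * ln K); first by rewrite mulr_ge0// ln_ge0.
  by move=> x y; apply: profile_harnack.
- by move=> x x1; rewrite -nutE//; apply: profile_le.
- exists (2 * d%:R * K); first by rewrite !mulr_gt0 ?ltr0n// (lt_le_trans ltr01).
  by move=> x x1; rewrite -nutE//; apply: profile_ge.
- exact: (profile_excessive hd hX sX N0 Nfin Qpos lk mnu NE K1 nut0 growth nutE A3).
- exact: (profile_jump_rate hd hX sX N0 Nfin Qpos lk mnu NE K1 nut0 growth nutE).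
Qed.

Lemma levy_tail (R : realType) (d : nat) (dO : measure_display)
    (O : measurableType dO) (P : probability O R) (X : R -> O -> 'rV[R]_d)
    (nu : 'rV[R]_d -> R) (r : R) : levy_process P X -> regular_A1 P X nu -> 0 < r ->
  exists2 C : R, 0 <= C &
    forall t, 0 <= t -> (P [set w | (r <= enorm (X t w))%R] <= (C * t)%:E)%E.
Proof.
move=> hX [sX _ _ [N [_ Nfin [b [Q [_ _ lk]]]] _] _ _ _] r0.
exact: (small_time_tail hX sX Nfin lk r0).
Qed.

Lemma levy_second_moment (R : realType) (d : nat) (dO : measure_display)
    (O : measurableType dO) (P : probability O R) (X : R -> O -> 'rV[R]_d)
    (nu : 'rV[R]_d -> R) : levy_process P X -> regular_A1 P X nu ->
  exists2 C : R, 0 <= C & forall t, 0 <= t ->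
    (\int[P]_w (Num.min 1 (enorm (X t w) ^+ 2))%:E <= (C * t)%:E)%E.
Proof.
move=> hX [sX _ _ [N [_ Nfin [b [Q [_ _ lk]]]] _] _ _ _].
exact: (small_time_second_moment hX sX Nfin lk).
Qed.

(** [nu x <= C nu y] for all [y] in a cube of side [q] that lies between radius 1 / 2 and radius
    [|x|]. Integrating over the cube bounds [nu x * q ^ d] by [C] times the finite mass of the Levy
    measure outside radius 1 / 2. *)
Lemma density_vanishes (R : realType) (d : nat) (dO : measure_display)
    (O : measurableType dO) (P : probability O R) (X : R -> O -> 'rV[R]_d)
    (nu : 'rV[R]_d -> R) : (0 < d)%N -> regular_A1 P X nu ->
  forall e, 0 < e -> exists r : R, forall x, r <= enorm x -> nu x <= e.
Proof.
move=> hd [_ mnu nu0 [N [N0 Nfin _] NE] _ [C C1 A2] _] e e0.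
have C0 : 0 < C := lt_le_trans ltr01 C1.
have half0 : 0 < (1 / 2 : R) by rewrite divr_gt0.
have mT : measurable [set y : 'rV[R]_d | 1 / 2 <= enorm y].
  exact: (measurable_enorm_ge (f := id)).
have NT := levy_measure_tail Nfin half0.
set m := N _ in NT; have mE : (fine m)%:E = m by rewrite fineK// ge0_fin_numE// measure_ge0.
have m0 : 0 <= fine m by rewrite -lee_fin mE measure_ge0.
(* [q >= 1] gives [q <= q ^ d] in every dimension; the other term gives [C m / q <= e]. *)
pose q := Num.max 1 (C * fine m / e).
have q1 : 1 <= q by rewrite le_max lexx.
have qm : C * fine m / e <= q by rewrite le_max lexx orbT.
have q0 : 0 < q := lt_le_trans ltr01 q1.
pose z : 'rV[R]_d := const_mx (1 / 2 + q / 2).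
have q20 : 0 <= q / 2 by rewrite divr_ge0// ltW.
exists (d%:R * (1 / 2 + q)) => x xr.
have bd y : cube z (q / 2) y -> 1 / 2 <= enorm y /\ nu x <= C * nu y.
  move=> yz; have y1 : 1 / 2 <= enorm y.
    apply: le_trans (coord_le_enorm y (Ordinal hd)); apply: le_trans (ler_norm _).
    by have := yz (Ordinal hd); rewrite mxE ltr_distl => /andP[h _]; lra.
  split => //; apply: A2 => //; apply: le_trans xr.
  rewrite -[y]subr0; apply: cube_enorm; first by lra.
  move=> i; have := yz i; rewrite !mxE subr0 ltr_distl ltr_norml => /andP[h1 h2].
  by apply/andP; split; lra.
have x0 : 0 < nu x.
  have : 0 < enorm x by apply: lt_le_trans xr; rewrite mulr_gt0 ?ltr0n// addr_gt0.
  by move=> h; apply: nu0; apply/eqP => x0; rewrite x0 enorm0 ltxx in h.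
have key : ((nu x * q ^+ d)%:E <= (C * fine m)%:E)%E.
  rewrite EFinM [leRHS]EFinM mE.
  have -> : ((q ^+ d)%:E = lebesgue_rV R d (cube z (q / 2)))%E.
    by rewrite lebesgue_cube// mulrC divfK.
  have mc := measurable_cube z (q / 2).
  rewrite -integral_cst//.
  apply: (@le_trans _ _ (\int[lebesgue_rV R d]_(y in cube z (q / 2)) (C%:E * (nu y)%:E))%E).
    apply: ge0_le_integral => //.
    - by move=> y _; rewrite lee_fin ltW.
    - apply: emeasurable_funM; first exact: measurable_cst.
      by apply: measurable_funTS; exact/measurable_EFinP.
    - by move=> y /bd[_ h]; rewrite -EFinM lee_fin.
  have C0e : (0 <= C%:E :> \bar R)%E by rewrite lee_fin ltW.
  have mn : measurable_fun (cube z (q / 2)) (fun y => (nu y)%:E).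
    by apply: measurable_funTS; exact/measurable_EFinP.
  have n0 y : cube z (q / 2) y -> (0 <= (nu y)%:E)%E.
    move=> /bd[y1 h]; rewrite lee_fin -(pmulr_rge0 _ C0); apply: le_trans h; exact: ltW.
  rewrite (ge0_integralZl (lebesgue_rV R d) mc mn n0 C0e) -NE//.
  apply: lee_wpmul2l => //; apply: le_measure; rewrite ?inE//.
  by move=> y /bd[].
move: key; rewrite lee_fin => key.
have qd : q <= q ^+ d by exact: ler_eXnr.
have : nu x * q <= C * fine m by apply: le_trans key; rewrite ler_pM2l.
rewrite -ler_pdivlMr// => h; apply: le_trans h _.
by rewrite ler_pdivrMr// -ler_pdivrMl// mulrC.
Qed.

(** * From almost every point to every point *)

Section translation.
Variable R : realType.

Lemma lebesgue_rV_shift d (x : 'rV[R]_d) (A : set 'rV[R]_d) : measurable A ->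
  lebesgue_rV R d [set y | A (x + y)] = lebesgue_rV R d A.
Proof.
elim: d x A => [|d IH] x A mA.
  rewrite (_ : [set y | A (x + y)] = A)//; apply/seteqP; split => y /=;
    by rewrite (_ : x + y = y)//; apply/rowP => -[].
have msh : measurable_fun setT (fun y : 'rV[R]_d.+1 => x + y).
  by apply: measurable_funD_rV => //; exact: measurable_cst.
have mS : measurable [set y | A (x + y)] by exact: measurable_preimage msh mA.
pose pre (B : set 'rV[R]_d.+1) := @rV_cons R d @^-1` B.
have mpre B : measurable B -> measurable (pre B).
  by move=> mB; exact: measurable_preimage (@measurable_rV_cons R d) mB.
rewrite /= /lebesgue_step /pushforward -/(pre _) -/(pre A).
rewrite /product_measure1 /=.
pose x' : 'rV[R]_d := \row_i x 0 (lift ord0 i).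
pose F (a : measurableTypeR R) := lebesgue_rV R d (xsection (pre A) a).
have mF : measurable_fun setT F by exact: measurable_fun_xsection (mpre _ mA).
transitivity (\int[lebesgue_measure]_a F (a + x 0 ord0)%R)%E.
  apply: eq_integral => a _; rewrite /F -[RHS](IH x').
    congr (lebesgue_rV R d _); apply/seteqP; split => v /=;
      rewrite /xsection/= !inE /pre/= (_ : x + rV_cons (a, v) = rV_cons (a + x 0 ord0, x' + v))//;
      by apply/rowP => i; rewrite !mxE; case: unliftP => [j|] -> //=; rewrite ?mxE// addrC.
  exact: measurable_xsection (mpre _ mA).
have ms : measurable_fun setT (fun a : measurableTypeR R => (a + x 0 ord0 : measurableTypeR R)).
  by apply: measurable_funD => //; exact: measurable_cst.
have := ge0_integral_pushforward ms lebesgue_measure measurableT mF (fun y _ => measure_ge0 _ _).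
rewrite preimage_setT => <-; apply: eq_measure_integral => B mB _.
exact: lebesgue_measure_shift.
Qed.

Lemma ae_dense d (Q : 'rV[R]_d -> Prop) (x : 'rV[R]_d) (r : R) :
  {ae lebesgue_rV R d, forall y, Q y} -> 0 < r -> exists2 y, cube x r y & Q y.
Proof.
move=> [N [mN N0 QN]] r0; apply: contrapT => /forall2NP H.
have : (lebesgue_rV R d (cube x r) <= lebesgue_rV R d N)%E.
  apply: le_measure; rewrite ?inE//; first exact: measurable_cube.
  by move=> y yx; apply: QN => /= Qy; case: (H y).
by rewrite [X in (_ <= X)%E]N0 (lebesgue_cube x (ltW r0)) lee_fin leNgt exprn_gt0// mulr_gt0.
Qed.

(** The law of [X t] has a density, so an identity valid almost everywhere in space can be used
    along the process at a positive time, whatever the starting point. *)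
Lemma ae_transition d (dO : measure_display) (O : measurableType dO) (P : probability O R)
    (X : R -> O -> 'rV[R]_d) p (Q : 'rV[R]_d -> Prop) t x :
  levy_process P X -> transition_density P X p -> 0 < t ->
  {ae lebesgue_rV R d, forall y, Q y} -> {ae P, forall w, Q (x + X t w)}.
Proof.
move=> hX tp t0 [N [mN N0 QN]]; have [p0 mp pE] := tp t t0.
have msh : measurable_fun setT (fun y : 'rV[R]_d => x + y).
  by apply: measurable_funD_rV => //; exact: measurable_cst.
have mS : measurable [set y | N (x + y)] by exact: measurable_preimage msh mN.
exists [set w | N (x + X t w)]; split.
- exact: measurable_preimage (measurableT_comp msh (levy_measurable hX (ltW t0))) mN.
- rewrite (pE [set y | N (x + y)])//; apply: null_set_integral => //.
    by apply: measurable_funTS; exact/measurable_EFinP.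
  exact: (eq_trans (lebesgue_rV_shift x mN) N0).
- by move=> w /= h; apply: QN.
Qed.

End translation.

Lemma continuous_enorm_near (R : realType) d (f : 'rV[R]_d -> R) (x : 'rV[R]_d) (e : R) :
  {for x, continuous f} -> 0 < e ->
  exists2 r, 0 < r & forall y, enorm (y - x) < r -> `|f y - f x| < e.
Proof.
move=> /cvgrPdist_lt cf e0; have /nbhs_ballP[r /= r0 H] := cf e e0.
exists r => // y yr; rewrite distrC; apply: H; split => // i j; rewrite ord1.
rewrite /ball /= distrC; apply: le_lt_trans yr.
by have := coord_le_enorm (y - x) j; rewrite !mxE.
Qed.

Lemma ball_lower_bound (R : realType) d (f : 'rV[R]_d -> R) (rho : R) :
  continuous f -> (forall x, 0 < f x) -> exists2 c : R, 0 < c & forall y, enorm y <= rho -> c <= f y.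
Proof.
move=> cf f0; have [r0|r0] := ltP rho 0.
  exists 1 => // y yr; suff : enorm y < 0 by rewrite ltNge enorm_ge0.
  exact: le_lt_trans yr r0.
pose A : set 'rV[R]_d := [set v | forall i, `[- rho, rho]%classic (v ord0 i)].
have cA : compact A by apply: (@rV_compact R d (fun=> `[- rho, rho]%classic)) => i; exact: segment_compact.
have A0 : A !=set0.
  by exists 0 => i /=; rewrite mxE in_itv/= oppr_le0 r0.
have [c _ cmin] := EVT_min_rV A0 cA (continuous_subspaceT cf).
exists (f c) => // y yr; apply: cmin; rewrite inE => i /=; rewrite in_itv/= -ler_norml.
exact: le_trans (coord_le_enorm _ _) yr.
Qed.

(** Used with [b = A / e], where [A] is a creation integral: creation over a short time is 1 up to
    [e] times an exponential moment of [A / e], which Khasminskii's lemma bounds. *)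
Lemma expR_interpolation (R : realType) (e b : R) : 0 < e -> e <= 1 / 2 -> 0 <= b ->
  expR (e * b) <= 1 + e * expR b.
Proof.
move=> e0 e2 b0; have h1 := expR_ge1Dx (- (e * b)).
have p := expR_gt0 (e * b).
have h2 : expR (e * b) - 1 <= e * b * expR (e * b).
  have : (1 - e * b) * expR (e * b) <= 1.
    apply: (@le_trans _ _ (expR (- (e * b)) * expR (e * b))); first by rewrite ler_pM2r.
    by rewrite -expRD addNr expR0.
  move: (expR (e * b)) => q; lra.
have h3 : b <= expR ((1 - e) * b).
  apply: (@le_trans _ _ (expR (b / 4 + b / 4))).
    have q1 := expR_ge1Dx (b / 4); rewrite expRD.
    apply: (@le_trans _ _ ((1 + b / 4) * (1 + b / 4))).
      rewrite -subr_ge0 (_ : _ - _ = (1 - b / 4) ^+ 2); first exact: sqr_ge0.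
      by field.
    by apply: ler_pM => //; lra.
  rewrite ler_expR (_ : b / 4 + b / 4 = 1 / 2 * b); last by field.
  by rewrite ler_wpM2r//; lra.
rewrite addrC -lerBlDr; apply: le_trans h2 _; rewrite -mulrA ler_pM2l//.
rewrite (_ : expR b = expR ((1 - e) * b) * expR (e * b)) ?ler_pM2r//.
by rewrite -expRD; congr expR; ring.
Qed.

Section eigenfunction.
Local Open Scope ereal_scope.
Variables (R : realType) (d : nat) (dO : measure_display) (O : measurableType dO).
Variables (P : probability O R) (X : R -> O -> 'rV[R]_d) (p : R -> 'rV[R]_d -> R).
Local Notation E := 'rV[R]_d.
Hypotheses (hX : levy_process P X) (tp : transition_density P X p).
Hypothesis tail : forall r : R, (0 < r)%R -> exists2 C : R, (0 <= C)%R &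
  forall t, (0 <= t)%R -> P [set w | (r <= enorm (X t w))%R] <= (C * t)%:E.
Variables (V phi : E -> R) (lambda M : R).
Hypotheses (mV : measurable_fun setT V) (kV : kato_pot P X (V^\-)%R).
Hypotheses (cphi : continuous phi) (phi0 : forall x, (0 <= phi x)%R).
Hypothesis phiM : forall x, (phi x <= M)%R.
Hypothesis mphi : measurable_fun setT phi.
Hypothesis eigen : forall t, (0 < t)%R -> {ae lebesgue_rV R d, forall x,
  feynman_kac P X V t phi x = (expR (- (lambda * t)) * phi x)%:E}.

Local Notation zero := (cst 0%R : E -> R).
Local Notation T := (fk P X (V^\+)%R (V^\-)%R).
Local Notation phiE := (EFin \o phi).
Let z0 := potential0 R d.
Let pp : potential (V^\+)%R := potential_funrpos mV.
Let pn : potential (V^\-)%R := potential_funrneg mV.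
Let nphi : nnmeas phiE. Proof. exact: nnmeas_EFin. Qed.

Lemma eigen_ae t : (0 < t)%R -> {ae lebesgue_rV R d, forall x,
  T t phiE x = (expR (- (lambda * t)) * phi x)%:E}.
Proof.
move=> t0; apply: filterS (eigen t0) => x <-; apply/esym/feynman_kacE => //.
- exact: ltW.
- by apply: ae_afun_fin => //; exact: ltW.
Qed.

(** Valid at every [x]: the eigenvalue equation, at time [t - delta], is only evaluated at the
    position reached at time [delta], whose law has a density. *)
Let eigen_split delta t x : (0 < delta)%R -> (delta < t)%R ->
  T t phiE x = (expR (- (lambda * (t - delta))))%:E * T delta phiE x.
Proof.
move=> d0 dt; have td : (0 < t - delta)%R by rewrite subr_gt0.
rewrite -{1}(subrKC delta t) (fk_semigroup hX x pp pn (ltW d0) (ltW td) nphi).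
rewrite -(fkZ hX pp pn delta x nphi); last by rewrite lee_fin expR_ge0.
apply: nonmeasurable_ge0_ae_eq_integral => [w|w|].
- by apply: mule_ge0; [exact: weight_ge0|apply: fk_ge0; case: nphi].
- apply: mule_ge0; first exact: weight_ge0.
  by rewrite mule_ge0// lee_fin ?expR_ge0.
apply: filterS2 (ae_transition x hX tp d0 (eigen_ae td)) (ae_good hX) => w hw gw.
by rewrite (procE gw (ltW d0)) hw EFinM.
Qed.

Let short_time x e : (0 < e)%R -> exists2 d0 : R, (0 < d0)%R &
  forall delta, (0 < delta)%R -> (delta < d0)%R -> T delta phiE x <= (phi x + e)%:E.
Proof.
move=> e0; have M0 : (0 <= M)%R := le_trans (phi0 0%R) (phiM 0%R).
have e30 : (0 < e / 3)%R by rewrite divr_gt0.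
have cx : {for x, continuous phi} by exact: cphi.
have [r r0 cr] := continuous_enorm_near cx e30.
have [C C0 HC] := tail r0.
pose M1 := (M + 1)%R.
have M10 : (0 < M1)%R by rewrite ltr_wpDl.
pose eps : R := (Num.min (1 / 2) (e / (6 * M1 * expR 1)))%R.
have den0 : (0 < 6 * M1 * expR 1)%R by rewrite mulr_gt0 ?expR_gt0// mulr_gt0.
have eps0 : (0 < eps)%R by rewrite lt_min !divr_gt0.
have eps2 : (eps <= 1 / 2)%R by rewrite ge_min lexx.
have epse : (eps * (6 * M1 * expR 1) <= e)%R.
  by rewrite -ler_pdivlMr// ge_min lexx orbT.
pose U y := (eps^-1 * (V^\-)%R y)%R.
have epsi : (0 < eps^-1)%R by rewrite invr_gt0.
have kU : kato_pot P X U := kato_potZ hX epsi kV.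
have pU : potential U by case: kU.
have [c [c0 Hc]] := khasminskii hX kU.
exists (Num.min (c + 1)^-1 (e / (3 * (M1 * C + 1))) : R)%R.
  by rewrite lt_min invr_gt0 ltr_wpDl//= divr_gt0// mulr_gt0// ltr_wpDl// mulr_ge0// (ltW M10).
move=> delta dl0; rewrite lt_min => /andP[dlc dlC].
have dl0' := ltW dl0.
have n1 := nnmeas1 R d.
have le1 : T delta phiE x <= fk P X zero zero delta phiE x +
    (eps * M1)%:E * fk P X zero U delta (cst 1) x.
  have em0 : 0 <= (eps * M1)%:E by rewrite lee_fin mulr_ge0// ltW.
  have mI1 := measurable_fk_integrandx hX pp pn delta x (nphi.1).
  have mI2 := measurable_fk_integrandx hX z0 z0 delta x (nphi.1).
  have mI3 := measurable_fk_integrandx hX z0 pU delta x n1.1.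
  have I20 w : [set: O] w -> 0 <= weight zero zero delta x (post_path X 0 w) * phiE (x + proc X delta w)%R.
    by move=> _; rewrite mule_ge0 ?weight_ge0// lee_fin.
  have I30 w : [set: O] w -> 0 <= weight zero U delta x (post_path X 0 w) * 1.
    by move=> _; rewrite mule_ge0 ?weight_ge0.
  have mI4 : measurable_fun setT (fun w => (eps * M1)%:E * (weight zero U delta x (post_path X 0 w) * 1)).
    by apply: emeasurable_funM => //; exact: measurable_cst.
  have I40 w : [set: O] w -> 0 <= (eps * M1)%:E * (weight zero U delta x (post_path X 0 w) * 1).
    by move=> _; rewrite mule_ge0// I30.
  rewrite /fk -(ge0_integralZl P measurableT mI3 I30 em0) -(ge0_integralD P measurableT I20 mI2 I40 mI4).
  apply: ge0_le_integral.
  - exact: measurableT.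
  - by move=> w _; rewrite mule_ge0 ?weight_ge0// lee_fin.
  - exact: mI1.
  - exact: emeasurable_funD.
  move=> w _; rewrite weight0 mul1e mule1; set y := (x + _)%R.
  apply: (@le_trans _ _ (weight zero (V^\-)%R delta x (post_path X 0 w) * (phi y)%:E)).
    apply: lee_wpmul2r; first by rewrite lee_fin.
    by apply: weight_mono => //; case: pp.
  have aU : additive_functional U delta x (post_path X 0 w) =
      eps^-1%:E * additive_functional (V^\-)%R delta x (post_path X 0 w).
    by apply: afunZ => //; exact: ltW.
  rewrite /weight aU; have A0 : 0 <= additive_functional (V^\-)%R delta x (post_path X 0 w).
    exact: afun_ge0.
  rewrite /additive_functional/= integral0 oppe0 !add0e -/(additive_functional _ _ _ _).
  have phy : (0 <= (phi y)%:E) by rewrite lee_fin.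
  have phyM : ((phi y) <= M1)%R by apply: (le_trans (phiM y)); rewrite lerDl.
  move: (additive_functional _ _ _ _) A0 => [a|_|//].
  - rewrite lee_fin => a0; rewrite -EFinM /= -!EFinM -EFinD lee_fin.
    have b0 : (0 <= eps^-1 * a)%R by rewrite mulr_ge0// ltW.
    have := expR_interpolation eps0 eps2 b0; rewrite mulVKf ?gt_eqF// => h.
    apply: (@le_trans _ _ ((1 + eps * expR (eps^-1 * a)) * phi y)%R).
      by rewrite ler_wpM2r.
    by rewrite mulrDl mul1r lerD2l mulrAC ler_wpM2r ?expR_ge0// ler_wpM2l// ltW.
  - rewrite gt0_muley ?lte_fin//= gt0_muley; last by rewrite lte_fin mulr_gt0.
    by rewrite addey ?leey.
have le2 : fk P X zero zero delta phiE x <= (phi x + e / 3 + M1 * (C * delta))%:E.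
  rewrite (fk_free x hX dl0' nphi).
  have mXd := levy_measurable hX dl0'.
  pose S := [set w | (r <= enorm (X delta w))%R].
  have mS : measurable S by exact: measurable_enorm_ge.
  apply: (@le_trans _ _ (\int[P]_w ((phi x + e / 3)%:E + (M1 * \1_S w)%:E))).
    apply: ge0_le_integral => //.
    - by move=> w _; rewrite lee_fin.
    - case: nphi => mphiE _; apply: (measurableT_comp mphiE).
      by apply: measurable_funD_rV => //; exact: measurable_cst.
    - by apply/measurable_EFinP; apply: measurable_funD; [exact: measurable_cst|apply: measurable_funM; [exact: measurable_cst|exact: measurable_indic]].
    move=> w _; rewrite -EFinD lee_fin indicE; case: (boolP (w \in S)) => [_|].
      rewrite mulr1; apply: (le_trans (phiM _)); rewrite /M1.
      by have := phi0 x; move: e30; lra.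
    rewrite notin_setE /S /= => /negP; rewrite -ltNge => h.
    rewrite mulr0 addr0; have := cr (x + X delta w)%R; rewrite addrC addKr => /(_ h).
    by rewrite ltr_distl => /andP[_ /ltW].
  have c0e w : [set: O] w -> 0 <= (phi x + e / 3)%:E by rewrite lee_fin addr_ge0// ltW.
  have i0e w : [set: O] w -> 0 <= (\1_S w : R)%:E by rewrite lee_fin.
  have mi : measurable_fun setT (fun w => (\1_S w : R)%:E) by apply/measurable_EFinP; exact: measurable_indic.
  have M1e : 0 <= M1%:E by rewrite lee_fin ltW.
  have -> : \int[P]_w ((phi x + e / 3)%:E + (M1 * \1_S w)%:E) = (phi x + e / 3)%:E + M1%:E * P S.
    have mc : measurable_fun [set: O] (cst (phi x + e / 3)%:E) by exact: measurable_cst.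
    have mmi : measurable_fun setT (fun w => (M1 * \1_S w)%:E).
      by apply/measurable_EFinP; apply: measurable_funM; [exact: measurable_cst|exact: measurable_indic].
    have mi0 w : [set: O] w -> 0 <= (M1 * \1_S w)%:E.
      by move=> _; rewrite lee_fin mulr_ge0// ltW.
    rewrite (ge0_integralD P measurableT c0e mc mi0 mmi) integral_cst//.
    rewrite [X in _ * X + _]probability_setT mule1; congr (_ + _).
    rewrite -[in RHS](setIT S) -integral_indic// -(ge0_integralZl P measurableT mi i0e M1e).
    by apply: eq_integral => w _; rewrite EFinM.
  apply: (le_trans (leeD2l _ (lee_wpmul2l M1e (HC delta dl0')))).
  by rewrite -EFinM -EFinD.
apply: (le_trans le1); apply: (le_trans (leeD le2 (lee_wpmul2l _ (Hc delta x dl0')))).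
  by rewrite lee_fin mulr_ge0 ?ltW.
rewrite -EFinM -EFinD lee_fin.
have hc : (expR (c * delta) <= expR 1)%R.
  rewrite ler_expR; have c10 : (0 < c + 1)%R by rewrite ltr_wpDl.
  apply: (@le_trans _ _ ((c + 1) * delta)%R); first by rewrite ler_wpM2r// lerDl.
  by rewrite -ler_pdivlMl// mulr1 ltW.
have hC : (M1 * (C * delta) <= e / 3)%R.
  have q0 : (0 < 3 * (M1 * C + 1))%R by rewrite mulr_gt0// ltr_wpDl// mulr_ge0// ltW.
  move: dlC; rewrite ltr_pdivlMr// => h; rewrite mulrA.
  have : (0 <= delta)%R := dl0'.
  move: h; rewrite mulrDr mulrDr mulr1 => h dd.
  by rewrite ler_pdivlMr//; move: h dd; move: (M1 * C)%R => q; lra.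
have he : (eps * M1 * (2 * expR (c * delta)) <= e / 3)%R.
  apply: (@le_trans _ _ (eps * M1 * (2 * expR 1)%R)%R).
    by rewrite ler_wpM2l ?ler_pM2l// mulr_ge0 ?ltW.
  move: epse; move: (expR 1) => q; lra.
move: hC he; lra.
Qed.

(** [eigen_split] writes [T t phi x] through an arbitrarily short time [delta], and [T delta phi x]
    is at most [phi x] up to an error that vanishes with [delta]. The upper half of the eigenvalue
    equation thus holds at every point. *)
Lemma eigen_excessive t x : (0 <= t)%R -> T t phiE x <= (expR (- (lambda * t)) * phi x)%:E.
Proof.
rewrite le_eqVlt => /predU1P[<-|t0].
  by rewrite mulr0 oppr0 expR0 mul1r fk_time0.
apply/lee_addgt0Pr => eta eta0.
set Q := expR _; have Q0 : (0 < Q)%R by exact: expR_gt0.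
have ph2 : (0 < phi x + 2)%R by rewrite ltr_wpDl.
have den : (0 < Q * (phi x + 2))%R by exact: mulr_gt0.
pose e : R := (Num.min 1 (eta / (Q * (phi x + 2))))%R.
have e0 : (0 < e)%R by rewrite lt_min ltr01 divr_gt0.
have e1 : (e <= 1)%R by rewrite ge_min lexx.
have eeta : (e * (Q * (phi x + 2)) <= eta)%R by rewrite -ler_pdivlMr// ge_min lexx orbT.
have [d0 d00 Hd] := short_time x e0.
have l0 : (0 < `|lambda| + 1)%R by rewrite ltr_wpDl.
have lne : (0 < ln (1 + e) / (`|lambda| + 1))%R by rewrite divr_gt0// ln_gt0// ltrDl.
pose delta := (Num.min (Num.min d0 t) (ln (1 + e) / (`|lambda| + 1)) / 2)%R.
have m0 : (0 < Num.min (Num.min d0 t) (ln (1 + e) / (`|lambda| + 1)))%R.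
  by rewrite !lt_min d00 t0.
have dl0 : (0 < delta)%R by rewrite divr_gt0.
have dlm : (delta < Num.min (Num.min d0 t) (ln (1 + e) / (`|lambda| + 1)))%R.
  by rewrite /delta; move: m0; lra.
move: dlm; rewrite !lt_min => /andP[/andP[dld dlt] dll].
rewrite (eigen_split x dl0 dlt).
apply: (le_trans (lee_wpmul2l _ (Hd _ dl0 dld))); first by rewrite lee_fin expR_ge0.
rewrite -EFinM -EFinD lee_fin.
have -> : expR (- (lambda * (t - delta))) = (Q * expR (lambda * delta))%R.
  by rewrite /Q -expRD; congr expR; ring.
have hl : (expR (lambda * delta) <= 1 + e)%R.
  have e10 : (0 < 1 + e)%R by rewrite addr_gt0.
  rewrite -[leRHS](lnK (_ : 1 + e \is Num.pos)%R) ?posrE// ler_expR.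
  apply: (@le_trans _ _ ((`|lambda| + 1) * delta)%R).
    by apply: ler_wpM2r; [exact: ltW|rewrite (le_trans (ler_norm lambda))// lerDl].
  by rewrite mulrC -ler_pdivlMr// ltW.
apply: (@le_trans _ _ (Q * ((1 + e) * (phi x + e)))%R).
  rewrite -mulrA ler_pM2l//; apply: ler_wpM2r => //.
  by rewrite addr_ge0// ltW.
apply: (@le_trans _ _ (Q * phi x + e * (Q * (phi x + 2)))%R); last by rewrite lerD2l.
rewrite (_ : (e * (Q * (phi x + 2)) = Q * (e * (phi x + 2)))%R); last by rewrite mulrCA.
rewrite -mulrDr ler_pM2l//; have := mulr_ge0 (ltW e0) (_ : 0 <= 1 - e)%R.
by rewrite subr_ge0 => /(_ e1); lra.
Qed.

End eigenfunction.

(** * Duhamel's formula *)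

Section duhamel.
Local Open Scope ereal_scope.
Variables (R : realType) (d : nat) (dO : measure_display) (O : measurableType dO).
Variables (P : probability O R) (X : R -> O -> 'rV[R]_d).
Hypothesis hX : levy_process P X.
Local Notation E := 'rV[R]_d.
Local Notation mu := (@lebesgue_measure R).
Local Notation Y := (post_path X 0).
Local Notation proc := (proc X).
Local Notation afun := additive_functional.
Local Notation fk := (fk P X).
Local Notation green := (green_pot P X).
Local Notation zero := (cst 0%R : E -> R).

(* Duhamel's formula for the perturbation of the weight [weight W1 W2] by [exp(-A^U)];
   [weight Z1 Z2] stands for the product of the two. *)
Let duhamel (W1 W2 Z1 Z2 U : E -> R) t f x :
  potential W1 -> potential W2 -> potential Z1 -> potential Z2 -> potential U ->
  (0 <= t)%R -> nnmeas f ->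
  {ae P, forall w, afun U t x (Y w) < +oo} ->
  (forall s w, (0 <= s <= t)%R -> afun U t x (Y w) < +oo ->
     weight Z1 Z2 s x (Y w) = weight W1 W2 s x (Y w) * expeR (- afun U s x (Y w))) ->
  fk W1 W2 t f x = fk Z1 Z2 t f x +
    \int[mu]_(s in `[0%R, t]) fk Z1 Z2 s (fun y => (U y)%:E * fk W1 W2 (t - s)%R f y) x.
Proof.
move=> pW1 pW2 pZ1 pZ2 pU t0 nf finA WZ; have [mU U0] := pU; have [mf f0] := nf.
pose G w := weight W1 W2 t x (Y w) * f (x + proc t w)%R.
have mG : measurable_fun setT G := measurable_fk_integrandx hX pW1 pW2 t x mf.
have G0 w : 0 <= G w by rewrite mule_ge0 ?weight_ge0.
pose F (z : O * measurableTypeR R) : \bar R :=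
  (U (x + proc z.2 z.1)%R)%:E * (expeR (- afun U z.2 x (Y z.1)) * G z.1).
have mYc : measurable_fun setT (fun z : O * measurableTypeR R => Y z.1).
  by apply: (measurableT_comp (measurable_post_path hX (lexx 0%R))); meas.
have mF : measurable_fun setT F.
  apply: emeasurable_funM.
    apply/measurable_EFinP; apply: (measurableT_comp mU).
    by meas; apply: measurable_path_at_comp; meas.
  apply: emeasurable_funM; last by apply: (measurableT_comp mG); meas.
  apply: measurableT_comp; first exact: measurable_expeR.
  apply: measurableT_comp => //.
  apply: (measurableT_comp (measurable_afun pU)
    (g := fun z : O * measurableTypeR R => (z.2, x, Y z.1))).
  by meas.
have F0 z : 0 <= F z by rewrite !mule_ge0 ?expeR_ge0// lee_fin.
have mI : measurable_fun setT (fun w => \int[mu]_(s in `[0%R, t]) F (w, s)).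
  exact: (measurable_integral_interval 0 (f := F) (b := cst t)).
have I0 w : [set: O] w -> 0 <= \int[mu]_(s in `[0%R, t]) F (w, s).
  by move=> _; apply: integral_ge0 => s _; exact: F0.
have mZ := measurable_fk_integrandx hX pZ1 pZ2 t x mf.
have Z0 w : [set: O] w -> 0 <= weight Z1 Z2 t x (Y w) * f (x + proc t w)%R.
  by move=> _; rewrite mule_ge0 ?weight_ge0.
have pathid w : afun U t x (Y w) < +oo ->
    G w = weight Z1 Z2 t x (Y w) * f (x + proc t w)%R + \int[mu]_(s in `[0%R, t]) F (w, s).
  move=> lt; have mv := measurable_shifted_path x (Y w) pU; have mv' := mv.
  move/measurable_EFinP in mv'.
  have id := integral_expeR_primitive mv' (fun s => U0 _) t0 lt.
  rewrite WZ ?t0 ?lexx// -[LHS]mul1e -[in LHS]id ge0_muleDl ?expeR_ge0//; last first.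
    by apply: integral_ge0 => s _; rewrite mule_ge0 ?expeR_ge0// lee_fin.
  congr (_ + _); first by rewrite /G muleCA muleA.
  rewrite muleC -ge0_integralZl.
  - by apply: eq_integral => s _; rewrite /F/= muleC -muleA.
  - exact: measurable_itv.
  - apply: measurable_funTS; apply: emeasurable_funM => //.
    apply: measurableT_comp; first exact: measurable_expeR.
    apply: measurableT_comp => //.
    apply: (measurableT_comp (measurable_afun pU)
      (g := fun s : measurableTypeR R => (s, x, Y w))).
    by meas.
  - by move=> s _; rewrite mule_ge0 ?expeR_ge0// lee_fin.
  - exact: G0.
rewrite [LHS](_ : _ = \int[P]_w (weight Z1 Z2 t x (Y w) * f (x + proc t w)%R +
    \int[mu]_(s in `[0%R, t]) F (w, s))); last first.
  apply: nonmeasurable_ge0_ae_eq_integral => [w|w|]; first exact: G0.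
    by apply: adde_ge0; [exact: Z0|exact: I0].
  by apply: filterS finA => w /pathid.
rewrite (ge0_integralD P measurableT Z0 mZ I0 mI); congr (_ + _).
rewrite (tonelli_interval P 0 t mF F0); apply: eq_integral => s.
rewrite inE/= in_itv/= => /andP[s0 st].
have ts0 : (0 <= t - s)%R by rewrite subr_ge0.
rewrite -(fk_mixed hX x pZ1 pZ2 pW1 pW2 s0 ts0 (nnmeas_EFin pU) nf).
apply: nonmeasurable_ge0_ae_eq_integral.
- by move=> w; exact: F0.
- by move=> w; rewrite !mule_ge0 ?weight_ge0//= lee_fin.
apply: filterS2 finA (ae_good hX) => w lt gw.
have ss : (0 <= s <= t)%R by rewrite s0.
rewrite (WZ s w ss lt) /F/= /G.
have tE : t = (s + (t - s))%R by rewrite subrKC.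
rewrite [in X in weight W1 W2 X]tE (weight_cat _ pW1 pW2 gw s0 ts0).
have -> : proc t w = (proc s w + path_at (post_path X s w) (t - s))%R.
  by rewrite {1}tE (proc_cat gw s0 ts0).
rewrite (addrA x).
set a := weight _ _ _ _ _; set b := weight _ _ _ _ _; set c := expeR _.
by rewrite -!muleA (muleCA c a) (muleCA _%:E a) (muleCA _%:E c).
Qed.

Lemma duhamel_killing U t f x : potential U -> (0 <= t)%R -> nnmeas f ->
  {ae P, forall w, afun U t x (Y w) < +oo} ->
  fk zero zero t f x = fk U zero t f x +
    \int[mu]_(s in `[0%R, t]) fk U zero s (fun y => (U y)%:E * fk zero zero (t - s)%R f y) x.
Proof.
move=> pU t0 nf finA; have p0 := potential0 R d; apply: duhamel => // s w _ _.
by rewrite weight0 mul1e /weight /additive_functional /= integral0 adde0.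
Qed.

Lemma duhamel_creation V U t f x : potential V -> potential U -> (0 <= t)%R -> nnmeas f ->
  {ae P, forall w, afun U t x (Y w) < +oo} ->
  fk V U t f x = fk V zero t f x +
    \int[mu]_(s in `[0%R, t]) fk V zero s (fun y => (U y)%:E * fk V U (t - s)%R f y) x.
Proof.
move=> pV pU t0 nf finA; have p0 := potential0 R d; apply: duhamel => // s w /andP[s0 st] lt.
have fs : afun U s x (Y w) \is a fin_num.
  rewrite ge0_fin_numE ?afun_ge0//; apply: le_lt_trans lt; exact: afun_mono_time.
by rewrite /weight -expeRD -addeA subee// /additive_functional/= integral0.
Qed.

Lemma creation_le V U t f B x : potential V -> kato_pot P X U -> (0 <= t)%R -> nnmeas f ->
  (0 <= B)%R -> (forall s y, (0 <= s <= t)%R -> fk V U s f y <= B%:E) ->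
  fk V U t f x <= fk V zero t f x + B%:E * green V zero t (EFin \o U) x.
Proof.
move=> pV kU t0 nf B0 HB; have pU := kU.1; have p0 := potential0 R d.
rewrite (duhamel_creation pV pU t0 nf (ae_afun_fin hX x kU t0)); apply: leeD2l.
have nU := nnmeas_EFin pU.
have mU : measurable_fun setT (fun s : measurableTypeR R => fk V zero s (EFin \o U) x).
  exact: measurable_fk_time.
have B0e : 0 <= B%:E by rewrite lee_fin.
rewrite /green_pot -ge0_integralZl//.
- apply: ge0_le_integral => //.
  + move=> s _; apply: fk_ge0 => y; rewrite mule_ge0 ?fk_ge0 ?lee_fin//; first exact: pU.2.
    exact: nf.2.
  + apply: measurable_funTS.
    apply: (measurable_fk_time_fun hX (G := fun z => (U z.2)%:E * fk V U (t - z.1)%R f z.2)) => //.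
      apply: emeasurable_funM.
        by apply/measurable_EFinP; apply: measurableT_comp; [case: pU|meas].
      apply: (measurableT_comp (measurable_fk2 hX pV pU nf)
        (g := fun z : measurableTypeR R * E => ((t - z.1)%R : measurableTypeR R, z.2))).
      meas; apply: measurable_funB; meas.
    move=> z; rewrite mule_ge0//; first by rewrite lee_fin; case: pU.
    by apply: fk_ge0; case: nf.
  + by apply: emeasurable_funM; [exact: measurable_cst|exact: measurable_funTS].
  move=> s; rewrite /= in_itv/= => /andP[s0 st].
  rewrite -(fkZ hX pV p0 s x nU B0e).
  have [mT T0] := nnmeas_fk hX pV pU (t - s)%R nf; have [mUe U0e] := nU.
  apply: (le_fk hX pV p0) => [||y].
  - by split; [exact: emeasurable_funM|move=> y; rewrite mule_ge0 ?T0//; exact: U0e].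
  - split; first by apply: emeasurable_funM; [exact: measurable_cst|exact: mUe].
    by move=> y; rewrite mule_ge0//; exact: U0e.
  rewrite muleC; apply: lee_wpmul2r; first exact: U0e.
  by apply: HB; rewrite subr_ge0 st gerBl.
- exact: measurable_funTS.
- by move=> s _; apply: fk_ge0; case: nU.
Qed.

End duhamel.

(** * Bounded paths and local Kato potentials *)

Section bounded_paths.
Variables (R : realType) (d : nat).
Local Notation E := 'rV[R]_d.

Lemma cvg_enorm (F : set_system R) (f : R -> E) (l : E) (e : R) : Filter F ->
  f x @[x --> F] --> l -> 0 < e -> \forall s \near F, enorm (f s - l) < e.
Proof.
move=> FF /cvg_ball fl e0; have d1 : 0 < d%:R + 1 :> R by rewrite ltr_wpDl.
have r0 : 0 < e / (d%:R + 1) by rewrite divr_gt0.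
have H := fl _ r0; apply: (filterS _ (H : F (fun s => ball l (e / (d%:R + 1)) (f s)))) => s [_ h].
have c : cube l (e / (d%:R + 1)) (f s) by move=> i; rewrite distrC; exact: (h 0 i).
apply: (le_lt_trans (cube_enorm (ltW r0) c)).
by rewrite mulrA ltr_pdivrMr// mulrDr mulr1 mulrC ltrDl.
Qed.

Lemma locally_bounded (F : set_system R) (f : R -> E) (l : E) : Filter F ->
  f x @[x --> F] --> l -> \forall s \near F, enorm (f s) <= enorm l + 1.
Proof.
move=> FF fl; have := cvg_enorm FF fl ltr01; apply: filterS => s h.
by have := ler_enormB (f s) l; lra.
Qed.

(** Let [s] be the supremum of the [u] such that the path is bounded on [0, u]. The left limit
    bounds the path just before [s] and right continuity just after it, so [s] cannot be smaller
    than [t]. *)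
Lemma cadlag_bounded (f : R -> E) (t : R) : 0 <= t ->
  (forall s, 0 <= s -> f u @[u --> s^'+] --> f s /\ (0 < s -> cvg (f u @[u --> s^'-]))) ->
  exists B : R, forall s, 0 <= s <= t -> enorm (f s) <= B.
Proof.
move=> t0 fc.
pose S := [set u | 0 <= u <= t /\ exists B : R, forall s, 0 <= s <= u -> enorm (f s) <= B].
have S0 : S 0.
  split; first by rewrite lexx.
  by exists (enorm (f 0)) => s; rewrite -eq_le => /eqP <-.
have supS : has_sup S by split; [exists 0|exists t => u [/andP[]]].
pose s := sup S.
have s0 : 0 <= s by apply: sup_upper_bound => //.
have st : s <= t by apply: ge_sup; [exists 0|move=> u [/andP[]]].
have Ss : S s.
  have [-> //|sp] := eqVneq s 0.
  have {}sp : 0 < s by rewrite lt_neqAle eq_sym sp.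
  have [_ /(_ sp) lc] := fc s s0.
  have [e /= e0 He] := locally_bounded _ lc.
  have [u [/andP[u0 ut] [B HB]] us] := sup_adherent e0 supS.
  split; first by rewrite s0.
  exists (Num.max (Num.max B (enorm (f s))) (enorm (lim (f u @[u --> s^'-])) + 1)).
  move=> v /andP[v0]; rewrite le_eqVlt => /predU1P[->|vs].
    by rewrite !le_max lexx orbT.
  have [vu|uv] := leP v u; first by rewrite !le_max HB ?v0.
  rewrite le_max; apply/orP; right; apply: He => //=.
  by rewrite -/s in us; rewrite gtr0_norm ?subr_gt0//; lra.
have [ts|ts] := leP t s.
  have -> : t = s by apply/eqP; rewrite eq_le ts st.
  by case: Ss.
have [rc _] := fc s s0; have [e /= e0 He] := locally_bounded _ rc.
case: Ss => _ [B HB].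
pose v := s + Num.min (e / 2) (t - s).
have e2 : 0 < e / 2 by rewrite divr_gt0.
have sv : s < v by rewrite /v ltrDl lt_min e2 subr_gt0.
suff : S v by move=> /(sup_upper_bound supS); rewrite -/s leNgt sv.
have m1 : Num.min (e / 2) (t - s) <= e / 2 by rewrite ge_min lexx.
have m2 : Num.min (e / 2) (t - s) <= t - s by rewrite ge_min lexx orbT.
split; first by apply/andP; split; rewrite /v in sv *; lra.
exists (Num.max B (enorm (f s) + 1)) => u /andP[u0 uv].
have [us|su] := leP u s; first by rewrite le_max HB ?u0.
rewrite le_max; apply/orP; right; apply: He => //=.
by rewrite ltr0_norm ?subr_lt0// /v in uv *; lra.
Qed.

End bounded_paths.

Section local_kato.
Local Open Scope ereal_scope.
Variables (R : realType) (d : nat) (dO : measure_display) (O : measurableType dO).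
Variables (P : probability O R) (X : R -> O -> 'rV[R]_d).
Hypothesis hX : levy_process P X.
Local Notation Y := (post_path X 0).
Local Notation zero := (cst 0%R : 'rV[R]_d -> R).

Lemma measurable_eball (r : R) : measurable (eball (0 : 'rV[R]_d) r).
Proof.
rewrite (_ : eball _ _ = ~` [set y | (r <= enorm y)%R]).
  by apply: measurableC; exact: (measurable_enorm_ge (f := id)).
by apply/seteqP; split => y; rewrite /eball/= subr0 ltNge => /negP.
Qed.

Lemma potential_restrict U (A : set 'rV[R]_d) : potential U -> measurable A ->
  potential (fun y => U y * \1_A y)%R.
Proof.
move=> [mU U0] mA; split; last by move=> y; rewrite mulr_ge0.
by apply: measurable_funM => //; exact: measurable_indic.
Qed.

(* Paths are bounded on bounded time intervals, so that the local Kato condition suffices. *)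
Lemma ae_afun_fin_local U t x : potential U -> kato_loc P X U -> (0 <= t)%R ->
  {ae P, forall w, additive_functional U t x (Y w) < +oo}.
Proof.
move=> pU kU t0.
pose Uk (k : nat) y : R := (U y * \1_(eball 0 k.+1%:R) y)%R.
have kUk k : kato_pot P X (Uk k).
  apply: (kato_potP hX); first exact: (potential_restrict pU (measurable_eball k.+1%:R)).2.
  exact: (kU 0%R k.+1%:R).
have finA : {ae P, forall w, forall k, additive_functional (Uk k) t x (Y w) < +oo}.
  by apply/ae_foralln => k; exact: ae_afun_fin.
apply: filterS3 finA (ae_good hX) (levy_cadlag hX) => w fin gw cad.
have [B HB] := cadlag_bounded t0 cad.
pose k := Num.truncn (enorm x + B).
apply: le_lt_trans (fin k); rewrite le_eqVlt; apply/orP; left; apply/eqP.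
apply: eq_integral => s; rewrite inE/= in_itv/= => /andP[s0 st].
rewrite -/(proc X s w) (procE gw s0) /Uk indicE mem_set ?mulr1//.
rewrite /eball/= subr0; apply: le_lt_trans (truncnS_gt _).
by apply: (le_trans (ler_enormD _ _)); rewrite lerD2l HB// s0.
Qed.

(* Jensen's inequality for [exp], from the tangent at the mean value. *)
Lemma weight_le_mean U (s : R) x z : potential U -> (0 < s)%R ->
  weight U zero s x z <= (s^-1)%:E *
    \int[lebesgue_measure]_(r in `[0%R, s]) (expR (- (s * U (x + path_at z r))))%:E.
Proof.
move=> pU s0; have [mU U0] := pU.
have mv := measurable_shifted_path x z pU.
set I := \int[_]_(r in _) _; have I0 : 0 <= I.
  by apply: integral_ge0 => r _; rewrite lee_fin expR_ge0.
have A0 := afun_ge0 s x z pU.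
rewrite /weight [X in _ + X]/additive_functional /= integral0 adde0.
have AE : additive_functional U s x z = \int[lebesgue_measure]_(r in `[0%R, s]) (U (x + path_at z r)%R)%:E by [].
move: (additive_functional U s x z) A0 AE => [a|_ _|//]; last first.
  by rewrite /= mule_ge0// lee_fin invr_ge0 ltW.
rewrite lee_fin => a0 AE; rewrite lee_pdivlMl// -EFinN /= -EFinM.
have mE : measurable_fun `[0%R, s] (fun r : measurableTypeR R => (expR (- (s * U (x + path_at z r))))%:E).
  apply: measurable_funTS; apply/measurable_EFinP; apply: measurableT_comp; first exact: measurable_expR.
  apply: measurableT_comp => //; apply: measurable_funM; first exact: measurable_cst.
  exact/measurable_EFinP.
have mv' : measurable_fun `[0%R, s] (fun r : measurableTypeR R => (U (x + path_at z r)%R)%:E).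
  exact: measurable_funTS.
have k0 : 0 <= (expR (- a) * s)%:E by rewrite lee_fin mulr_ge0 ?expR_ge0// ltW.
have v0 r : `[0%R, s]%classic r -> 0 <= (U (x + path_at z r)%R)%:E by rewrite lee_fin.
have e0 r : `[0%R, s]%classic r -> 0 <= (expR (- (s * U (x + path_at z r))))%:E.
  by rewrite lee_fin expR_ge0.
have mkv : measurable_fun `[0%R, s] (fun r : measurableTypeR R => (expR (- a) * s)%:E * (U (x + path_at z r)%R)%:E).
  by apply: emeasurable_funM => //; exact: measurable_cst.
have kv0 r : `[0%R, s]%classic r -> 0 <= (expR (- a) * s)%:E * (U (x + path_at z r)%R)%:E.
  by move=> ?; rewrite mule_ge0// v0.
have key : ((expR (- a) * (1 + a)) * s)%:E <= I + (expR (- a) * s)%:E * a%:E.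
  rewrite AE -(ge0_integralZl lebesgue_measure (measurable_itv _) mv' v0 k0).
  rewrite -(ge0_integralD lebesgue_measure (measurable_itv _) e0 mE kv0 mkv).
  rewrite -(integral_itv_cst _ (ltW s0)); apply: ge0_le_integral => //.
  - by move=> r _; rewrite lee_fin mulr_ge0 ?expR_ge0// addr_ge0.
  - exact: emeasurable_funD.
  move=> r _; rewrite -EFinM -EFinD lee_fin; set v := U _.
  have -> : expR (- (s * v)) = (expR (- a) * expR (a - s * v))%R.
    by rewrite -expRD; congr expR; ring.
  rewrite -mulrA -mulrDr ler_pM2l ?expR_gt0//.
  by have := expR_ge1Dx (a - s * v); lra.
have -> : (s * expR (- a))%:E = ((expR (- a) * (1 + a)) * s)%:E - ((expR (- a) * s) * a)%:E.
  by rewrite -EFinB; congr EFin; ring.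
by rewrite leeBlDr// EFinM.
Qed.

End local_kato.

Section liminf.
Local Open Scope ereal_scope.
Variable R : realType.
Implicit Types (u : (\bar R)^nat) (c : \bar R).

Lemma le_limn_einf u c : (\forall n \near \oo, c <= u n) -> c <= limn_einf u.
Proof.
case=> N _ HN; rewrite limn_einf_lim (cvg_lim _ (@cvg_einfs_sup R u))//.
apply: (@le_trans _ _ (einfs u N)); last by apply: ereal_sup_ubound; exists N.
by apply: le_ereal_inf_tmp => _ [n /= Nn <-]; exact: HN.
Qed.

Lemma limn_einf_le u c : (\forall n \near \oo, u n <= c) -> limn_einf u <= c.
Proof.
case=> N _ HN; rewrite limn_einf_lim (cvg_lim _ (@cvg_einfs_sup R u))//.
apply: ge_ereal_sup => _ [m _ <-]; apply: (@le_trans _ _ (u (maxn m N))).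
  by apply: ereal_inf_lbound; exists (maxn m N) => //=; exact: leq_maxl.
by apply: HN; exact: leq_maxr.
Qed.

Lemma measurable_limn_einf dT (T : measurableType dT) (D : set T) (f : (T -> \bar R)^nat) :
  (forall n, measurable_fun D (f n)) -> measurable_fun D (fun x => limn_einf (f ^~ x)).
Proof.
move=> mf; have -> : (fun x => limn_einf (f ^~ x)) = (fun x => - limn_esup ((fun n y => - f n y) ^~ x)).
  by apply/funext => x; rewrite -limn_einfN; congr limn_einf; apply/funext => n /=; rewrite oppeK.
apply: measurableT_comp => //; apply: measurable_fun_limn_esup => n.
exact: measurableT_comp.
Qed.

End liminf.

(** * Inequalities between potentials *)

Section green_calculus.
Local Open Scope ereal_scope.
Variables (R : realType) (d : nat) (dO : measure_display) (O : measurableType dO).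
Variables (P : probability O R) (X : R -> O -> 'rV[R]_d).
Hypothesis hX : levy_process P X.
Local Notation E := 'rV[R]_d.
Local Notation mu := (@lebesgue_measure R).
Local Notation Y := (post_path X 0).
Local Notation zero := (cst 0%R : E -> R).

Lemma integral_interval_swap (t s : R) (K : measurableTypeR R * measurableTypeR R -> \bar R) :
  measurable_fun setT K -> (forall z, 0 <= K z) ->
  \int[mu]_(r in `[0%R, t]) \int[mu]_(u in `[0%R, s]) K (r, u) =
  \int[mu]_(u in `[0%R, s]) \int[mu]_(r in `[0%R, t]) K (r, u).
Proof.
move=> mK K0; pose ind (r : measurableTypeR R) : R := \1_(`[0%R, t]%classic) r.
pose K' (z : measurableTypeR R * measurableTypeR R) := (ind z.1)%:E * K z.
have mK' : measurable_fun setT K'.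
  apply: emeasurable_funM => //; apply/measurable_EFinP.
  by apply: (measurableT_comp (f := ind)) => //; exact: measurable_indic.
have K'0 z : 0 <= K' z by rewrite mule_ge0// lee_fin.
have indE (r : measurableTypeR R) (k : \bar R) :
    (ind r)%:E * k = if r \in `[0%R, t]%classic then k else 0.
  by rewrite /ind indicE; case: ifP; rewrite ?mul1e ?mul0e.
rewrite [LHS]integral_mkcond.
transitivity (\int[mu]_r \int[mu]_(u in `[0%R, s]) K' (r, u)).
  apply: eq_integral => r _; rewrite patchE /K' /=; case: ifPn => rt.
    by apply: eq_integral => u _; rewrite indE rt.
  by rewrite integral0_eq// => u _; rewrite indE (negbTE rt).
rewrite (tonelli_interval mu 0 s mK' K'0); apply: eq_integral => u _.
by rewrite [RHS]integral_mkcond; apply: eq_integral => r _; rewrite patchE /K' /= indE.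
Qed.

Section kernel.
Variables U1 U2 : E -> R.
Hypotheses (p1 : potential U1) (p2 : potential U2).
Local Notation T := (fk P X U1 U2).
Local Notation green := (green_pot P X U1 U2).

Lemma green_le_cst t f x B : nnmeas f -> (0 <= t)%R -> 0 <= B ->
  (forall s, (0 <= s <= t)%R -> T s f x <= B) -> green t f x <= t%:E * B.
Proof.
move=> nf t0 B0 H; apply: (@le_trans _ _ (\int[mu]_(s in `[0%R, t]) B)).
  apply: ge0_le_integral => //.
  - by move=> s _; apply: fk_ge0; exact: nf.2.
  - by apply: measurable_funTS; exact: measurable_fk_time.
rewrite integral_cst//= muleC lebesgue_measure_itv/= lte_fin.
case: ltP => [_|t0']; first by rewrite sube0.
by have -> : t = 0%R by apply/eqP; rewrite eq_le t0' t0.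
Qed.

Lemma green_comm t s f x : nnmeas f -> (0 <= t)%R -> (0 <= s)%R ->
  green t (green s f) x = green s (green t f) x.
Proof.
move=> nf t0 s0; have mf2 := measurable_fk2 hX p1 p2 nf.
have f0 y : 0 <= f y := nf.2 y.
pose K (z : measurableTypeR R * measurableTypeR R) := T (z.1 + z.2)%R f x.
have mK : measurable_fun setT K.
  apply: (measurableT_comp (measurable_fk_time hX p1 p2 x nf)).
  by apply: measurable_funD; meas.
have K0 z : 0 <= K z by exact: fk_ge0.
have mF : measurable_fun setT (fun z : E * measurableTypeR R => T z.2 f z.1).
  by apply: (measurableT_comp mf2 (g := fun z : E * measurableTypeR R => (z.2, z.1))); meas.
have key a b : (0 <= a)%R -> (0 <= b)%R ->
    green a (green b f) x = \int[mu]_(r in `[0%R, a]) \int[mu]_(u in `[0%R, b]) T (r + u)%R f x.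
  move=> a0 b0; apply: eq_integral => r; rewrite inE/= in_itv/= => /andP[r0 _].
  rewrite (fk_integral hX p1 p2 r 0%R b x mF); last by move=> z; exact: fk_ge0.
  apply: eq_integral => u; rewrite inE/= in_itv/= => /andP[u0 _].
  by rewrite (fk_semigroup hX x p1 p2 r0 u0 nf).
rewrite (key t s t0 s0) (key s t s0 t0).
have := integral_interval_swap t s mK K0; rewrite /K /= => ->.
by apply: eq_integral => u _; apply: eq_integral => r _; rewrite addrC.
Qed.

(** After the exchange of the two times, the integrand at an outer time [u <= s] only collects [f]
    between [u] and [u + t], hence at most the potential up to [t + s]. *)
Lemma green_green_le t s f x : nnmeas f -> (0 <= t)%R -> (0 <= s)%R ->
  green t (green s f) x <= s%:E * green (t + s)%R f x.
Proof.
move=> nf t0 s0; rewrite green_comm//; have ng := nnmeas_green hX p1 p2 t nf.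
have g0 r y : 0 <= green r f y := (nnmeas_green hX p1 p2 r nf).2 y.
apply: green_le_cst => // u /andP[u0 us].
apply: (@le_trans _ _ (green (u + t)%R f x)); first by rewrite (green_add hX)// leeDr.
by apply: (le_green hX) => //; rewrite addrC lerD2l.
Qed.

Lemma green_fk_le t s f x : nnmeas f -> (0 <= t)%R -> (0 <= s)%R ->
  green t (T s f) x <= green (s + t)%R f x.
Proof.
move=> nf t0 s0.
have g0 r y : 0 <= green r f y := (nnmeas_green hX p1 p2 r nf).2 y.
have -> : green t (T s f) x = T s (green t f) x; last by rewrite (green_add hX)// leeDr.
have f0 y : 0 <= f y := nf.2 y.
have mF : measurable_fun setT (fun z : E * measurableTypeR R => T z.2 f z.1).
  apply: (measurableT_comp (measurable_fk2 hX p1 p2 nf)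
    (g := fun z : E * measurableTypeR R => (z.2, z.1))); meas.
rewrite (fk_integral hX p1 p2 s 0%R t x mF); last by move=> z; exact: fk_ge0.
apply: eq_integral => r; rewrite inE/= in_itv/= => /andP[r0 _].
by rewrite -(fk_semigroup hX x p1 p2 r0 s0 nf) addrC (fk_semigroup hX x p1 p2 s0 r0 nf).
Qed.

(** Fatou's lemma over paths and then in time. No rate is required of the pointwise bound
    [h <= f n]. *)
Lemma green_fatou t (f : nat -> E -> \bar R) h K x : (forall n, nnmeas (f n)) -> nnmeas h ->
  (forall y, \forall n \near \oo, h y <= f n y) ->
  (\forall n \near \oo, green t (f n) x <= K) -> green t h x <= K.
Proof.
move=> nf nh hf fK.
have step s : T s h x <= limn_einf (fun n => T s (f n) x).
  apply: le_trans (fatou P measurableT _ _) => //.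
  - apply: ge0_le_integral => //.
    + by move=> w _; rewrite mule_ge0 ?weight_ge0//; exact: nh.2.
    + by apply: (measurable_fk_integrandx hX) => //; exact: nh.1.
    + apply: measurable_limn_einf => n.
      by apply: (measurable_fk_integrandx hX) => //; exact: (nf n).1.
    move=> w _; apply: le_limn_einf; have := hf (x + proc X s w)%R; apply: filterS => n hn.
    by apply: lee_wpmul2l => //; exact: weight_ge0.
  - by move=> n; apply: (measurable_fk_integrandx hX) => //; exact: (nf n).1.
  - by move=> n w _; rewrite mule_ge0 ?weight_ge0//; exact: (nf n).2.
have mT n : measurable_fun setT (fun s : measurableTypeR R => T s (f n) x).
  exact: measurable_fk_time.
have T0 n s : 0 <= T s (f n) x by apply: fk_ge0; exact: (nf n).2.
apply: le_trans (limn_einf_le fK).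
apply: le_trans (fatou mu (measurable_itv _) _ _) => //.
- apply: ge0_le_integral => //.
  + by move=> s _; apply: fk_ge0; exact: nh.2.
  + by apply: measurable_funTS; exact: measurable_fk_time.
  + by apply: measurable_limn_einf => n; exact: measurable_funTS.
  by move=> n; exact: measurable_funTS.
Qed.

End kernel.

(** A particle is killed at most once: along almost every path the killing collected is
    [1 - exp (- A_t)], however large [U] is. *)
Lemma green_killing_le1 U t x : potential U -> (0 <= t)%R ->
  {ae P, forall w, additive_functional U t x (Y w) < +oo} ->
  green_pot P X U zero t (EFin \o U) x <= 1.
Proof.
move=> pU t0 finA; have p0 := potential0 R d.
rewrite -(integral_weight_afun hX t x pU p0 pU).
rewrite -(mule1 1) -[X in _ <= 1 * X](probability_setT P) -integral_cst//.
have F0 w : 0 <= \int[mu]_(s in `[0%R, t]) (weight U zero s x (Y w) * (U (x + proc X s w)%R)%:E).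
  by apply: integral_ge0 => s _; rewrite mule_ge0 ?weight_ge0// lee_fin; exact: pU.2.
have mF : measurable_fun setT
    (fun w => \int[mu]_(s in `[0%R, t]) (weight U zero s x (Y w) * (U (x + proc X s w)%R)%:E)).
  apply: (measurable_integral_interval 0%R (b := cst t)
    (f := fun z : O * measurableTypeR R => weight U zero z.2 x (Y z.1) * (U (x + proc X z.2 z.1)%R)%:E)).
  - exact: measurable_cst.
  - apply: (measurableT_comp (measurable_fk_integrand hX pU p0 (f := EFin \o U) _)
      (g := fun z : O * measurableTypeR R => (z.2, x, z.1))).
      by apply/measurable_EFinP; exact: pU.1.
    by meas.
  - by move=> z; rewrite mule_ge0 ?weight_ge0// lee_fin; exact: pU.2.
apply: ae_ge0_le_integral => //.
apply: filterS finA => w lt _.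
have mv := measurable_shifted_path x (Y w) pU; move/measurable_EFinP in mv.
have := integral_expeR_primitive mv (fun s => pU.2 _) t0 lt; move=> <-.
apply: (@le_trans _ _ (\int[mu]_(s in `[0%R, t]) ((U (x + proc X s w)%R)%:E *
    expeR (- \int[mu]_(u in `[0%R, s]) (U (x + path_at (Y w) u)%R)%:E)))).
  rewrite le_eqVlt; apply/orP; left; apply/eqP; apply: eq_integral => s _.
  by rewrite muleC /weight /additive_functional/= integral0 adde0.
by rewrite leeDr// expeR_ge0.
Qed.

End green_calculus.

(** * Ground state domination *)

Section bump.
Variables (R : realType) (d : nat).
Local Notation E := 'rV[R]_d.

Definition bump (y : E) : R := Num.max 0 (1 - enorm y ^+ 2).

Lemma bump_ge0 y : 0 <= bump y.
Proof. by rewrite le_max lexx. Qed.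

Lemma bump_le1 y : bump y <= 1.
Proof. by rewrite ge_max ler01/= lerBlDr lerDl sqr_ge0. Qed.

Lemma bump_out y : 1 <= enorm y -> bump y = 0.
Proof. by move=> h; apply/max_idPl; rewrite subr_le0 exprn_ege1. Qed.

Lemma bump_in y : enorm y < 1 / 2 -> 3 / 4 <= bump y.
Proof.
move=> h; rewrite le_max; apply/orP; right.
have : enorm y ^+ 2 <= (1 / 2) ^+ 2.
  by rewrite lerXn2r ?nnegrE ?enorm_ge0// ltW.
by rewrite (_ : (1 / 2) ^+ 2 = 1 / 4 :> R); [lra|field].
Qed.

Lemma measurable_bump : measurable_fun setT bump.
Proof.
apply: measurable_maxr; first exact: measurable_cst.
apply: measurable_funB; first exact: measurable_cst.
by apply: measurable_funX; exact: measurable_enorm_id.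
Qed.

Lemma potential_bump : potential bump.
Proof. by split; [exact: measurable_bump|exact: bump_ge0]. Qed.

Lemma parallelogram (x y : E) :
  enorm (x + y) ^+ 2 + enorm (x - y) ^+ 2 = 2 * enorm x ^+ 2 + 2 * enorm y ^+ 2.
Proof.
rewrite !enorm_sqr /dotv !mulr_sumr -!big_split /=; apply: eq_bigr => i _.
by rewrite !mxE; ring.
Qed.

(** For [1 - |x| ^ 2] in place of [bump] the parallelogram identity gives equality with [2 |y| ^ 2].
    Cutting at 0 can only raise the two neighbours, and the cases [bump x = 0] and [|y| >= 1] are
    immediate. *)
Lemma bump_second_difference x y :
  2 * bump x <= bump (x + y) + bump (x - y) + 2 * Num.min 1 (enorm y ^+ 2).
Proof.
have h1 := bump_ge0 (x + y); have h2 := bump_ge0 (x - y); have h3 := bump_le1 x.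
have [y1|y1] := leP 1 (enorm y ^+ 2); first by lra.
have [x1|x1] := leP (1 - enorm x ^+ 2) 0.
  have -> : bump x = 0 by exact/max_idPl.
  by have := sqr_ge0 (enorm y); lra.
have -> : bump x = 1 - enorm x ^+ 2 by apply/max_idPr; exact: ltW.
have p1 : 1 - enorm (x + y) ^+ 2 <= bump (x + y) by rewrite le_max lexx orbT.
have p2 : 1 - enorm (x - y) ^+ 2 <= bump (x - y) by rewrite le_max lexx orbT.
by have := parallelogram x y; lra.
Qed.

End bump.

Section bump_semigroup.
Local Open Scope ereal_scope.
Variables (R : realType) (d : nat) (dO : measure_display) (O : measurableType dO).
Variables (P : probability O R) (X : R -> O -> 'rV[R]_d).
Hypotheses (hX : levy_process P X) (sX : symmetric_process P X).
Local Notation E := 'rV[R]_d.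
Local Notation zero := (cst 0%R : E -> R).
Local Notation bumpE := (EFin \o @bump R d).
Let nb : nnmeas bumpE := nnmeas_EFin (@potential_bump R d).

Let mshX t x : (0 <= t)%R -> measurable_fun setT (fun w => x + X t w)%R.
Proof.
by move=> t0; apply: measurable_funD_rV; [exact: measurable_cst|exact: (levy_measurable hX)].
Qed.

Lemma bump_semigroup_ge (C : R) t x : (0 <= t)%R ->
  \int[P]_w (Num.min 1 (enorm (X t w) ^+ 2))%R%:E <= (C * t)%:E ->
  (bump x)%:E <= fk P X zero zero t bumpE x + (C * t)%:E.
Proof.
move=> t0; set M := \int[P]_w _ => MC; rewrite (fk_free x hX t0 nb).
have mXt := levy_measurable hX t0.
set I := \int[P]_w _.
have mI : measurable_fun setT (fun w => bumpE (x + X t w)%R) := measurableT_comp nb.1 (mshX x t0).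
have m2 : measurable_fun setT (fun y : E => (bump (x + y))%:E).
  by apply: (measurableT_comp nb.1); apply: measurable_funD_rV => //; exact: measurable_cst.
have mI' : measurable_fun setT (fun w => bumpE (x - X t w)%R).
  by apply: (measurableT_comp nb.1); apply: measurable_funB_rV => //; exact: measurable_cst.
have II : I = \int[P]_w bumpE (x - X t w)%R.
  by rewrite /I (symmetric_integral hX sX t0 m2)// => y; rewrite lee_fin bump_ge0.
have mM : measurable_fun setT (fun w => (Num.min 1 (enorm (X t w) ^+ 2))%R%:E).
  apply/measurable_EFinP; apply: measurable_minr; first exact: measurable_cst.
  by apply: measurable_funX; exact: measurable_enorm mXt.
have M0 w : [set: O] w -> 0 <= (Num.min 1 (enorm (X t w) ^+ 2))%R%:E.
  by move=> _; rewrite lee_fin le_min ler01 sqr_ge0.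
have b0 w : [set: O] w -> 0 <= bumpE (x + X t w)%R by rewrite lee_fin bump_ge0.
have b0' w : [set: O] w -> 0 <= bumpE (x - X t w)%R by rewrite lee_fin bump_ge0.
have I1 : I <= 1.
  rewrite -(probability_setT P) -[X in _ <= X]mul1e -integral_cst//.
  by apply: ge0_le_integral => // w _; rewrite lee_fin bump_le1.
have I0 : 0 <= I by apply: integral_ge0 => w _; exact: b0.
have M00 : 0 <= M by exact: integral_ge0.
have key : (2 * bump x)%:E <= I + I + 2%:E * M.
  rewrite {2}II -(ge0_integralZl P measurableT mM M0)//.
  rewrite -(ge0_integralD P measurableT b0 mI b0' mI').
  have bb0 w : [set: O] w -> 0 <= bumpE (x + X t w)%R + bumpE (x - X t w)%R.
    by move=> ?; apply: adde_ge0; [exact: b0|exact: b0'].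
  have mbb : measurable_fun setT (fun w => bumpE (x + X t w)%R + bumpE (x - X t w)%R).
    exact: emeasurable_funD.
  have m20 w : [set: O] w -> 0 <= 2%:E * (Num.min 1 (enorm (X t w) ^+ 2))%R%:E.
    by move=> ?; rewrite mule_ge0 ?M0.
  have mm2 : measurable_fun setT (fun w => 2%:E * (Num.min 1 (enorm (X t w) ^+ 2))%R%:E).
    by apply: emeasurable_funM => //; exact: measurable_cst.
  rewrite -(ge0_integralD P measurableT bb0 mbb m20 mm2).
  rewrite -[leLHS]mule1 -(probability_setT P) -integral_cst//.
  apply: ge0_le_integral => //.
  - by move=> w _; rewrite lee_fin mulr_ge0// bump_ge0.
  - exact: emeasurable_funD.
  by move=> w _; rewrite -EFinM -!EFinD lee_fin bump_second_difference.
have fI : I \is a fin_num by rewrite ge0_fin_numE//; apply: le_lt_trans I1 (ltry _).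
have fM : M \is a fin_num by rewrite ge0_fin_numE//; apply: le_lt_trans MC (ltry _).
move: key MC; rewrite -(fineK fI) -(fineK fM) -EFinM -!EFinD !lee_fin; lra.
Qed.

Lemma bump_semigroup_le (C : R) t x : (0 <= t)%R ->
  P [set w | (1 <= enorm (X t w))%R] <= (C * t)%:E ->
  fk P X zero zero t bumpE x <= (\1_[set y | (enorm y < 2)%R] x + C * t)%:E.
Proof.
move=> t0 PC; rewrite (fk_free x hX t0 nb).
have mXt := levy_measurable hX t0.
pose S := [set w | (1 <= enorm (X t w))%R].
have mS : measurable S by exact: measurable_enorm_ge.
set a : R := \1_ _ x; have a0 : (0 <= a)%R by rewrite /a indicE; case: (_ \in _).
rewrite EFinD; apply: le_trans (leeD2l _ PC).
have i0 w : [set: O] w -> 0 <= (\1_S w : R)%:E by rewrite lee_fin.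
have mi : measurable_fun setT (fun w => (\1_S w : R)%:E) by apply/measurable_EFinP; exact: measurable_indic.
have c0 w : [set: O] w -> 0 <= a%:E by rewrite lee_fin.
have mc : measurable_fun [set: O] (cst a%:E) by exact: measurable_cst.
rewrite -[X in X + _]mule1 -(probability_setT P) -integral_cst//.
rewrite -[X in _ <= _ + P X]setIT -integral_indic// -(ge0_integralD P measurableT c0 mc i0 mi).
apply: ge0_le_integral => //.
- by move=> w _; rewrite lee_fin bump_ge0.
- exact: (measurableT_comp nb.1 (mshX x t0)).
- exact: emeasurable_funD.
move=> w _; rewrite -EFinD lee_fin /a !indicE.
case: (boolP (x \in _)) => [_|]; first by apply: (le_trans (bump_le1 _)); rewrite lerDl.
rewrite notin_setE/= => /negP; rewrite -leNgt => x2.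
case: (boolP (w \in S)) => [_|]; first by rewrite add0r; exact: bump_le1.
rewrite notin_setE /S/= => /negP; rewrite -ltNge => w1.
rewrite addr0 bump_out//; have := ler_enormB x (- X t w).
by rewrite opprK enormN; lra.
Qed.

End bump_semigroup.

Section green_linear.
Local Open Scope ereal_scope.
Variables (R : realType) (d : nat) (dO : measure_display) (O : measurableType dO).
Variables (P : probability O R) (X : R -> O -> 'rV[R]_d).
Hypothesis hX : levy_process P X.
Variables U1 U2 : 'rV[R]_d -> R.
Hypotheses (p1 : potential U1) (p2 : potential U2).
Local Notation T := (fk P X U1 U2).
Local Notation green := (green_pot P X U1 U2).

Let mT f (t : R) x : nnmeas f ->
  measurable_fun (`[0%R, t]%classic : set (measurableTypeR R)) (fun s => T s f x).
Proof. by move=> nf; apply: measurable_funTS; exact: measurable_fk_time. Qed.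

Let T0 f (D : set R) x : nnmeas f -> forall s, D s -> 0 <= T s f x.
Proof. by move=> nf s _; apply: fk_ge0; exact: nf.2. Qed.

Lemma greenD t f h x : nnmeas f -> nnmeas h ->
  green t (fun y => f y + h y) x = green t f x + green t h x.
Proof.
move=> nf nh; rewrite /green_pot.
rewrite -(ge0_integralD lebesgue_measure (measurable_itv _) (@T0 f _ x nf) (@mT f t x nf) (@T0 h _ x nh) (@mT h t x nh)).
by apply: eq_integral => s _; rewrite (fkD hX p1 p2 s x nf nh).
Qed.

Lemma greenZ t (c : R) f x : nnmeas f -> (0 <= c)%R ->
  green t (fun y => c%:E * f y) x = c%:E * green t f x.
Proof.
move=> nf c0; have c0e : 0 <= c%:E by rewrite lee_fin.
rewrite /green_pot -(ge0_integralZl lebesgue_measure (measurable_itv _) (@mT f t x nf) (@T0 f _ x nf) c0e).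
by apply: eq_integral => s _; rewrite (fkZ hX p1 p2 s x nf c0e).
Qed.

Lemma nnmeasD f h : nnmeas f -> nnmeas h -> nnmeas (fun y : 'rV[R]_d => f y + h y : \bar R).
Proof.
by move=> [mf f0] [mh h0]; split; [exact: emeasurable_funD|move=> y; rewrite adde_ge0].
Qed.

Lemma nnmeasM f h : nnmeas f -> nnmeas h -> nnmeas (fun y : 'rV[R]_d => f y * h y : \bar R).
Proof.
by move=> [mf f0] [mh h0]; split; [exact: emeasurable_funM|move=> y; rewrite mule_ge0].
Qed.

Lemma nnmeas_cst (c : \bar R) : 0 <= c -> nnmeas (fun _ : 'rV[R]_d => c).
Proof. by move=> c0; split; [exact: measurable_cst|]. Qed.

End green_linear.

Lemma lee_cancel_fin (R : realType) (a f : \bar R) (u s v m w : R) : a \is a fin_num ->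
  (a + f <= a + u%:E + s%:E * v%:E + m%:E * w%:E)%E -> (f <= (u + s * v + m * w)%:E)%E.
Proof. by move=> fa; rewrite -!EFinM -!addeA -!EFinD leeD2lE// addrA. Qed.

(** * Domination for a killed semigroup *)

Section ground_state_domination.
Local Open Scope ereal_scope.
Variables (R : realType) (d : nat) (dO : measure_display) (O : measurableType dO).
Variables (P : probability O R) (X : R -> O -> 'rV[R]_d) (nu g : 'rV[R]_d -> R).
Local Notation E := 'rV[R]_d.
Hypotheses (hX : levy_process P X) (sX : symmetric_process P X).
Hypothesis pg : levy_profile P X nu g.
Variables (Ct Cm : R).
Hypothesis tail : forall t, (0 <= t)%R -> P [set w | (1 <= enorm (X t w))%R] <= (Ct * t)%:E.
Hypothesis moment : forall t, (0 <= t)%R ->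
  \int[P]_w (Num.min 1 (enorm (X t w) ^+ 2))%R%:E <= (Cm * t)%:E.
Hypotheses (Ct0 : (0 <= Ct)%R) (Cm0 : (0 <= Cm)%R).
Variables (W phi : E -> R) (beta : R).
Hypothesis pW : potential W.
Hypothesis finW : forall t x, (0 <= t)%R ->
  {ae P, forall w, additive_functional W t x (post_path X 0 w) < +oo}.
Hypotheses (mphi : measurable_fun setT phi) (phi0 : forall x, (0 < phi x)%R).
Hypothesis phi_lower : forall rho : R, exists2 c : R, (0 < c)%R &
  forall y, (enorm y <= rho)%R -> (c <= phi y)%R.
Hypothesis beta0 : (0 <= beta)%R.
Local Notation zero := (cst 0%R : E -> R).
Local Notation T := (fk P X W zero).
Local Notation T0 := (fk P X zero zero).
Local Notation green := (green_pot P X W zero).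
Local Notation phiE := (EFin \o phi).
Hypothesis excessive : forall t x, (0 <= t)%R -> T t phiE x <= (expR (beta * t))%:E * phiE x.

Let p0 := potential0 R d.
Let pphi : potential phi. Proof. by split => // x; exact: ltW. Qed.
Let nphi : nnmeas phiE. Proof. exact: nnmeas_EFin. Qed.
Let pgg : potential g.
Proof. by case: pg => mg g0 _ _ _ _ _ _; split => // x; exact: ltW. Qed.
Let ng : nnmeas (EFin \o g). Proof. exact: nnmeas_EFin. Qed.

Let ind (r : R) (y : E) : R := \1_[set y | (enorm y < r)%R] y.

Let mball (r : R) : measurable [set y : E | (enorm y < r)%R].
Proof.
rewrite (_ : [set _ | _] = ~` [set y | (r <= enorm y)%R]).
  by apply: measurableC; exact: (measurable_enorm_ge (f := id)).
by apply/seteqP; split => y /=; rewrite ltNge => /negP.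
Qed.

Let pind r : potential (ind r).
Proof. by split; [exact: measurable_indic|move=> y; rewrite /ind indicE; case: (_ \in _)]. Qed.

Let indE r y : ind r y = if (enorm y < r)%R then 1%R else 0%R.
Proof.
rewrite /ind indicE; case: ifPn => h; first by rewrite mem_set.
by rewrite memNset//=; exact/negP.
Qed.

Lemma semigroup_le_excessive a f t x : nnmeas f -> (0 <= t)%R -> (0 <= a)%R ->
  (forall y, f y <= (a * phi y)%:E) -> T t f x <= (a * (expR (beta * t) * phi x))%:E.
Proof.
move=> nf t0 a0 fphi; have a0e : 0 <= a%:E by rewrite lee_fin.
apply: (@le_trans _ _ (T t (fun y => a%:E * phiE y) x)).
  have na : nnmeas (fun y => a%:E * phiE y) by apply: nnmeasM nphi; exact: nnmeas_cst.
  by apply: (le_fk hX pW p0 t x nf na) => y; rewrite -EFinM; exact: fphi.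
rewrite (fkZ hX pW p0 t x nphi a0e) EFinM; apply: lee_wpmul2l => //.
exact: excessive.
Qed.

Lemma green_le_excessive a f t x : nnmeas f -> (0 <= t)%R -> (0 <= a)%R ->
  (forall y, f y <= (a * phi y)%:E) -> green t f x <= (t * (a * (expR (beta * t) * phi x)))%:E.
Proof.
move=> nf t0 a0 fphi; rewrite EFinM; apply: green_le_cst => //.
  by rewrite lee_fin !mulr_ge0 ?expR_ge0// ltW.
move=> s /andP[s0 st]; apply: (le_trans (semigroup_le_excessive x nf s0 a0 fphi)).
rewrite lee_fin; apply: ler_wpM2l => //; apply: ler_wpM2r; first exact: ltW.
by rewrite ler_expR ler_wpM2l.
Qed.

Variable t : R.
Hypothesis t0 : (0 < t)%R.

(** Radius 3 is the radius 2 of the local charge plus the margin 1 of [hitting_bound]. *)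
Let c2 := sval (cid2 (phi_lower 3)).
Let c20 : (0 < c2)%R. Proof. by rewrite /c2; case: cid2. Qed.
Let phic y : (enorm y <= 3)%R -> (c2 <= phi y)%R.
Proof. by rewrite /c2; case: cid2 => ? ? h; exact: h. Qed.

Let ind_phi r y : (r <= 3)%R -> (ind r y <= c2^-1 * phi y)%R.
Proof.
move=> r3; rewrite indE; case: ifPn => h; last by rewrite mulr_ge0 ?invr_ge0// ltW.
by rewrite ler_pdivlMl// mulr1 phic//; apply: ltW; apply: lt_le_trans r3.
Qed.

(** The potential of the whole killing rate is at most 1, so its part inside radius 2 has the
    bounded potential that [hitting_bound] asks for. *)
Let local_killing (x : E) (s : R) : (0 <= s)%R ->
  green s (fun y => (W y * ind 2 y)%:E) x <= (c2^-1 * expR (beta * s) * phi x)%:E.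
Proof.
move=> s0; have pU : potential (fun y => W y * ind 2 y)%R by exact: potential_restrict.
have := hitting_bound hX pW p0 pU (rho := 2) (C := Ct) _ tail nphi s0 beta0 c20 _ _ ler01 _ x.
rewrite mul1r => H; rewrite EFinM; apply: H.
- by move=> y y2; rewrite indE ltNge y2 mulr0.
- by move=> u y /andP[u0 _]; exact: excessive.
- by move=> y y3; rewrite lee_fin phic// ltW//; apply: (lt_le_trans y3); lra.
- move=> y; apply: le_trans (green_killing_le1 hX pW s0 (finW y s0)).
  apply: (le_green_fun hX) => //; [exact: nnmeas_EFin|exact: nnmeas_EFin|].
  move=> z; rewrite lee_fin indE; case: ifP => _; rewrite ?mulr1// mulr0.
  exact: pW.2.
Qed.

Let g_bound : exists2 B : R, (0 < B)%R & forall y, (g y <= B)%R.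
Proof.
have [B HB] := levy_profile_bounded pg; exists B => //.
exact: lt_le_trans (levy_profile_gt0 pg 0%R) (HB 0%R).
Qed.

Let far y : R := (1 - ind 2 y)%R.

Let pfar : potential far.
Proof.
split; first by apply: measurable_funB; [exact: measurable_cst|exact: (pind 2).1].
by move=> y; rewrite /far indE; case: ifP => _; rewrite ?subrr ?subr0.
Qed.

Let nbump : nnmeas (EFin \o @bump R d). Proof. exact: nnmeas_EFin (@potential_bump R d). Qed.

(* Splits off the killing before [s]; the free semigroup moves [bump] out of the ball of
   radius 2 only with small probability. *)
Let free_bump_le s y : (0 <= s)%R ->
  T0 s (EFin \o @bump R d) y <= T s (EFin \o @bump R d) y +
    green s (fun z => (W z * ind 2 z)%:E + (Ct * s)%:E * (W z)%:E) y.
Proof.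
move=> s0; rewrite (duhamel_killing hX pW s0 nbump (finW y s0)); apply: leeD2l.
have nW := nnmeas_EFin pW.
have cs0 : 0 <= (Ct * s)%:E by rewrite lee_fin mulr_ge0.
have n1 : nnmeas (fun z => (W z * ind 2 z)%:E).
  exact: nnmeas_EFin (potential_restrict pW (mball 2)).
have n2 : nnmeas (fun z => (W z * ind 2 z)%:E + (Ct * s)%:E * (W z)%:E).
  by apply: nnmeasD n1 _; apply: nnmeasM nW; exact: nnmeas_cst.
apply: ge0_le_integral => //.
- move=> u _; apply: fk_ge0 => z; rewrite mule_ge0 ?lee_fin ?pW.2//.
  by apply: fk_ge0; exact: nbump.2.
- apply: measurable_funTS.
  apply: (measurable_fk_time_fun hX (G := fun z => (W z.2)%:E * T0 (s - z.1)%R (EFin \o @bump R d) z.2)) => //.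
    apply: emeasurable_funM.
      by apply/measurable_EFinP; apply: measurableT_comp; [exact: pW.1|meas].
    apply: (measurableT_comp (measurable_fk2 hX p0 p0 nbump)
      (g := fun z : measurableTypeR R * E => ((s - z.1)%R : measurableTypeR R, z.2))).
    meas; apply: measurable_funB; meas.
  move=> z; rewrite mule_ge0 ?lee_fin ?pW.2//.
  by apply: fk_ge0; exact: nbump.2.
- by apply: measurable_funTS; exact: measurable_fk_time.
move=> u; rewrite /= in_itv/= => /andP[u0 us].
have su0 : (0 <= s - u)%R by rewrite subr_ge0.
have n3 := nnmeas_fk hX p0 p0 (s - u)%R nbump.
apply: (le_fk hX pW p0 u y (nnmeasM nW n3) n2) => z.
apply: (@le_trans _ _ ((W z)%:E * (ind 2 z + Ct * (s - u))%:E)).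
  apply: lee_wpmul2l; first by rewrite lee_fin pW.2.
  exact: (bump_semigroup_le hX z su0 (tail su0)).
rewrite -EFinM -EFinM -EFinD lee_fin mulrDr lerD2l mulrC ler_wpM2r ?pW.2//.
by rewrite ler_wpM2l// gerBl.
Qed.

(** In this order: [bump] collected in the extra time [s], killing inside radius 2, and the decrease
    of [bump] under a free step; each per unit of [s]. *)
Let K := (c2^-1 * (expR (beta * 1) * expR (beta * t)) + c2^-1 * expR (beta * (t + 1)) +
  Cm * (t * (c2^-1 * expR (beta * t))))%R.

Let K_ge0 : (0 <= K)%R.
Proof.
have i0 : (0 <= c2^-1)%R by rewrite invr_ge0 ltW.
by rewrite !addr_ge0// !mulr_ge0 ?expR_ge0// ltW.
Qed.

(** The potential of [bump] is compared with itself across a free step of length [s]. On the unit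
    ball the free step loses at most [Cm s]; replacing it by a killed step costs the killing during
    [s]; after a killed step the potential only gains what is collected between [t] and [t + s]. The
    finite potential of [bump] cancels, and the mass that the free step brings from afar is bounded
    by these losses. *)
Let far_bump_le (s : R) x : (0 < s)%R -> (s <= 1)%R ->
  green t (fun y => (far y)%:E * T0 s (EFin \o @bump R d) y) x <= (s * (K * phi x + Ct * s))%:E.
Proof.
move=> s0 s1; have s0' := ltW s0; have t0' := ltW t0.
set b := EFin \o @bump R d.
have nW := nnmeas_EFin pW.
have n1 : nnmeas (fun z => (W z * ind 2 z)%:E).
  exact: nnmeas_EFin (potential_restrict pW (mball 2)).
have cs0 : 0 <= (Ct * s)%:E by rewrite lee_fin mulr_ge0.
have n2 : nnmeas (fun z => (W z * ind 2 z)%:E + (Ct * s)%:E * (W z)%:E).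
  by apply: nnmeasD n1 _; apply: nnmeasM nW; exact: nnmeas_cst.
have nT0 := nnmeas_fk hX p0 p0 s nbump.
have nT := nnmeas_fk hX pW p0 s nbump.
have nfar := nnmeas_EFin pfar.
have nI := nnmeas_EFin (pind 1).
have nfT : nnmeas (fun y => (far y)%:E * T0 s b y) := nnmeasM nfar nT0.
have nG := nnmeas_green hX pW p0 s n2.
have i0 : (0 <= c2^-1)%R by rewrite invr_ge0 ltW.
have cm0 : (0 <= Cm * s)%R by rewrite mulr_ge0.
have b1 y : b y <= (c2^-1 * phi y)%:E.
  rewrite lee_fin; have [y1|y1] := leP 1%R (enorm y).
    by rewrite bump_out// mulr_ge0// ltW.
  apply: (le_trans (bump_le1 y)); rewrite ler_pdivlMl// mulr1 phic//.
  by apply: ltW; apply: (lt_trans y1); rewrite ltr1n.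
have fb : green t b x \is a fin_num.
  rewrite ge0_fin_numE; last exact: (nnmeas_green hX pW p0 t nbump).2.
  exact: le_lt_trans (green_le_excessive x nbump t0' i0 b1) (ltry _).
have step1 : green t b x + green t (fun y => (far y)%:E * T0 s b y) x <=
    green t (T0 s b) x + (Cm * s)%:E * green t (EFin \o ind 1) x.
  rewrite -(greenZ hX pW p0 t x nI cm0) -(greenD hX pW p0 t x nbump nfT).
  have nZ : nnmeas (fun y => (Cm * s)%:E * (ind 1 y)%:E).
    by apply: nnmeasM nI; apply: nnmeas_cst; rewrite lee_fin.
  rewrite -(greenD hX pW p0 t x nT0 nZ).
  apply: (le_green_fun hX pW p0 t x (nnmeasD nbump nfT) (nnmeasD nT0 nZ)) => y.
  have T0y : 0 <= T0 s b y := nT0.2 y.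
  have [y1|y1] := ltP (enorm y) 1%R.
    have -> : far y = 0%R by rewrite /far indE (lt_trans y1) ?ltr1n// subrr.
    rewrite mul0e adde0 (indE 1 y) y1 mule1.
    exact: (bump_semigroup_ge hX sX y s0' (moment s0')).
  rewrite /b /= bump_out// add0e (indE 1 y) ltNge y1 /= mule0 adde0.
  rewrite /far indE; case: ifP => _; first by rewrite subrr mul0e.
  by rewrite subr0 mul1e.
have step2 : green t (T0 s b) x <= green (s + t)%R b x +
    s%:E * green (t + s)%R (fun z => (W z * ind 2 z)%:E + (Ct * s)%:E * (W z)%:E) x.
  apply: (@le_trans _ _ (green t (T s b) x + green t (green s
      (fun z => (W z * ind 2 z)%:E + (Ct * s)%:E * (W z)%:E)) x)).
    rewrite -(greenD hX pW p0 t x nT nG).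
    by apply: (le_green_fun hX pW p0 t x nT0 (nnmeasD nT nG)) => y; exact: free_bump_le.
  by apply: leeD; [exact: green_fk_le|exact: green_green_le].
have step3 : green (s + t)%R b x <= green t b x + (s * (c2^-1 * (expR (beta * 1) * expR (beta * t)) * phi x))%:E.
  rewrite addrC (green_add hX pW p0)//; apply: leeD2l.
  have h y : green s b y <= ((s * c2^-1 * expR (beta * 1)) * phi y)%:E.
    apply: (le_trans (green_le_excessive y nbump s0' i0 b1)); rewrite lee_fin.
    rewrite -!mulrA ler_pM2l// ler_wpM2l// ler_wpM2r ?(ltW (phi0 y))//.
    by rewrite ler_expR ler_wpM2l.
  have k0 : (0 <= s * c2^-1 * expR (beta * 1))%R by rewrite !mulr_ge0 ?expR_ge0.
  apply: (le_trans (semigroup_le_excessive x (nnmeas_green hX pW p0 s nbump) t0' k0 h)).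
  by rewrite lee_fin le_eqVlt; apply/orP; left; apply/eqP; ring.
have ts0 : (0 <= t + s)%R by rewrite addr_ge0.
have step4 : green (t + s)%R (fun z => (W z * ind 2 z)%:E + (Ct * s)%:E * (W z)%:E) x <=
    (c2^-1 * expR (beta * (t + 1)) * phi x + Ct * s)%:E.
  have nZ : nnmeas (fun y => (Ct * s)%:E * (W y)%:E).
    by apply: nnmeasM nW; exact: nnmeas_cst.
  rewrite (greenD hX pW p0 (t + s)%R x n1 nZ) (greenZ hX pW p0 (t + s)%R x nW); last exact: mulr_ge0.
  rewrite EFinD; apply: leeD.
    apply: (le_trans (local_killing x ts0)); rewrite lee_fin ler_wpM2r ?(ltW (phi0 x))//.
    by rewrite ler_wpM2l// ler_expR ler_wpM2l// lerD2l.
  rewrite -[leRHS]mule1; apply: lee_wpmul2l => //.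
  exact: (green_killing_le1 hX pW ts0 (finW x ts0)).
have step5 : green t (EFin \o ind 1) x <= (t * (c2^-1 * (expR (beta * t) * phi x)))%:E.
  by apply: green_le_excessive => // y; rewrite lee_fin ind_phi// ler1n.
have s0e : 0 <= s%:E by rewrite lee_fin.
have cme : 0 <= (Cm * s)%:E by rewrite lee_fin.
have h1 := le_trans step2 (leeD step3 (lee_wpmul2l s0e step4)).
have := le_trans step1 (leeD h1 (lee_wpmul2l cme step5)).
move=> /(lee_cancel_fin fb) h; apply: (le_trans h).
by rewrite lee_fin /K le_eqVlt; apply/orP; left; apply/eqP; ring.
Qed.

Lemma green_profile_le : exists2 C : R, (0 <= C)%R & forall x,
  green t (EFin \o g) x <= (C * phi x)%:E.
Proof.
have [B B0 HB] := g_bound; have t0' := ltW t0.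
have [c c0 Hc] := levy_profile_jump_rate pg.
have i0 : (0 <= c2^-1)%R by rewrite invr_ge0 ltW.
(* [3 / 4] is the lower bound of [bump] on the ball of radius 1 / 2 that the jump reaches, [c] the
   constant of the jump rate. *)
pose a := (3 / 4 * c)%R; have a0 : (0 < a)%R by rewrite mulr_gt0 ?divr_gt0.
pose h y := (a * (far y * g y))%:E.
have nh : nnmeas h.
  apply: nnmeas_EFin; split.
    by apply: measurable_funM; [exact: measurable_cst|apply: measurable_funM; [exact: pfar.1|exact: pgg.1]].
  by move=> y; apply: mulr_ge0; [exact: ltW|apply: mulr_ge0; [exact: pfar.2|exact: pgg.2]].
pose f (n : nat) y := (n.+1%:R)%:E * ((far y)%:E * T0 n.+1%:R^-1 (EFin \o @bump R d) y).
have nff n : nnmeas (fun y => (far y)%:E * T0 n.+1%:R^-1 (EFin \o @bump R d) y).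
  by apply: nnmeasM; [exact: nnmeas_EFin pfar|exact: nnmeas_fk].
have nf n : nnmeas (f n) by apply: nnmeasM (nff n); apply: nnmeas_cst; rewrite lee_fin.
have nV n : (0 < n.+1%:R^-1 :> R)%R by rewrite invr_gt0.
have nV1 n : (n.+1%:R^-1 <= 1 :> R)%R by rewrite invf_le1 ?ler1n.
have hf y : \forall n \near \oo, h y <= f n y.
  have [y2|y2] := ltP (enorm y) 2%R.
    apply: nearW => n; rewrite /h /far indE y2 subrr mul0r mulr0.
    exact: (nf n).2.
  have := Hc y y2; apply: filterS => n hn.
  rewrite /h /f /far indE ltNge y2 /= subr0 mul1r mul1e.
  have n0e : 0 <= n.+1%:R%:E :> \bar R by rewrite lee_fin.
  have q0 : 0 <= (3 / 4)%:E :> \bar R by rewrite lee_fin divr_ge0.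
  apply: (@le_trans _ _ ((3 / 4)%:E * (n.+1%:R%:E *
      P [set o | (enorm (y + X n.+1%:R^-1 o) < 1 / 2)%R]))).
    by apply: le_trans (lee_wpmul2l q0 hn); rewrite -EFinM lee_fin /a mulrA.
  rewrite muleCA; apply: lee_wpmul2l => //.
  have mXn : measurable_fun setT (fun o => y + X n.+1%:R^-1 o)%R.
    by apply: measurable_funD_rV; [exact: measurable_cst|exact: (levy_measurable hX (ltW (nV n)))].
  have mS : measurable [set o | (enorm (y + X n.+1%:R^-1 o) < 1 / 2)%R].
    exact: measurable_preimage mXn (mball (1 / 2)).
  rewrite (fk_free y hX (ltW (nV n)) nbump) -[X in P X]setIT -integral_indic//.
  have mi : measurable_fun setT (fun o => (\1_[set o | (enorm (y + X n.+1%:R^-1 o) < 1 / 2)%R] o : R)%:E).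
    by apply/measurable_EFinP; exact: measurable_indic.
  have i0e o : [set: O] o -> 0 <= (\1_[set o | (enorm (y + X n.+1%:R^-1 o) < 1 / 2)%R] o : R)%:E.
    by rewrite lee_fin.
  rewrite -(ge0_integralZl P measurableT mi i0e q0); apply: ge0_le_integral => //.
  - by apply: emeasurable_funM => //; exact: measurable_cst.
  - exact: (measurableT_comp nbump.1 mXn).
  move=> o _; rewrite -EFinM lee_fin indicE.
  case: (boolP (o \in _)) => [|_]; last by rewrite mulr0 bump_ge0.
  by rewrite inE/= mulr1 => /bump_in.
(* [far_bump_le] divided by its time step [s = 1 / (n + 1)] leaves [K phi x + Ct s], whose second
   term vanishes as [n] grows. *)
have Gh x : green t h x <= (K * phi x)%:E.
  apply/lee_addgt0Pr => e e0; rewrite -EFinD.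
  apply: (green_fatou hX pW p0 nf nh hf).
  have C10 : (0 < e / (Ct + 1))%R by rewrite divr_gt0// ltr_wpDl.
  have := near_infty_natSinv_lt (PosNum C10); apply: filterS => n /= hn.
  have n0 : (0 <= n.+1%:R :> R)%R by [].
  rewrite /f (greenZ hX pW p0 t x (nff n) n0).
  have n0e : 0 <= n.+1%:R%:E :> \bar R by rewrite lee_fin.
  apply: (le_trans (lee_wpmul2l n0e (far_bump_le x (nV n) (nV1 n)))).
  rewrite -EFinM lee_fin mulrA mulfV ?pnatr_eq0// mul1r lerD2l.
  apply: (@le_trans _ _ ((Ct + 1) * n.+1%:R^-1)%R); first by rewrite ler_wpM2r// ?lerDl// ltW.
  by rewrite mulrC -ler_pdivlMr ?ltr_wpDl// ltW.
have gE y : (g y)%:E <= a^-1%:E * h y + (B * ind 2 y)%:E.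
  rewrite /h -EFinM -EFinD lee_fin mulKf ?gt_eqF//.
  rewrite /far; have [y2|y2] := ltP (enorm y) 2%R; rewrite indE ?y2 ?(ltNge (enorm y)) ?y2 /=.
    by rewrite subrr mul0r add0r mulr1.
  by rewrite subr0 mul1r mulr0 addr0.
have pB : potential (fun y => B * ind 2 y)%R.
  split; first by apply: measurable_funM; [exact: measurable_cst|exact: (pind 2).1].
  by move=> y; rewrite mulr_ge0 ?(pind 2).2// ltW.
have nB := nnmeas_EFin pB.
have ai : (0 <= a^-1)%R by rewrite invr_ge0 ltW.
have nah : nnmeas (fun y => a^-1%:E * h y) by apply: nnmeasM nh; apply: nnmeas_cst; rewrite lee_fin.
exists (a^-1 * K + t * (B * c2^-1 * expR (beta * t)))%R.
  by rewrite addr_ge0 ?mulr_ge0 ?expR_ge0 ?(ltW B0).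
move=> x; apply: (le_trans (le_green_fun hX pW p0 t x ng (nnmeasD nah nB) gE)).
rewrite (greenD hX pW p0 t x nah nB) (greenZ hX pW p0 t x nh ai) mulrDl EFinD.
apply: leeD; first by rewrite -mulrA EFinM lee_wpmul2l ?lee_fin.
have Bc0 : (0 <= B * c2^-1)%R by rewrite mulr_ge0// ltW.
have Bphi y : (EFin \o (fun y => B * ind 2 y)%R) y <= (B * c2^-1 * phi y)%:E.
  by rewrite lee_fin -mulrA ler_pM2l// ind_phi// ler_nat.
apply: (le_trans (green_le_excessive x nB t0' Bc0 Bphi)).
by rewrite lee_fin le_eqVlt; apply/orP; left; apply/eqP; ring.
Qed.

(** [T_t g <= exp (G t) T_r g] for every [r <= t], because [g] is excessive for the free semigroup;
    averaging over [r] brings in the potential of [g]. *)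
Let semigroup_profile_le : exists2 C : R, (0 <= C)%R & forall x, T t (EFin \o g) x <= (C * phi x)%:E.
Proof.
have [G G0 HG] := levy_profile_excessive pg; have t0' := ltW t0.
have [C C0 HC] := green_profile_le.
exists (t^-1 * (expR (G * t) * C))%R; first by rewrite !mulr_ge0 ?expR_ge0 ?invr_ge0.
move=> x; have eG0 : 0 <= (expR (G * t))%:E by rewrite lee_fin expR_ge0.
have le r : (0 <= r <= t)%R -> T t (EFin \o g) x <= (expR (G * t))%:E * T r (EFin \o g) x.
  move=> /andP[r0 rt]; have tr0 : (0 <= t - r)%R by rewrite subr_ge0.
  rewrite -{1}(subrKC r t) (fk_semigroup hX x pW p0 r0 tr0 ng).
  rewrite -(fkZ hX pW p0 r x ng eG0).
  have n1 : nnmeas (fun y => (expR (G * t))%:E * (g y)%:E) by apply: nnmeasM ng; exact: nnmeas_cst.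
  apply: (le_fk hX pW p0 r x (nnmeas_fk hX pW p0 (t - r)%R ng) n1) => y.
  apply: (le_trans (fk_mono_pot hX (t - r)%R y pW p0 p0 p0 pW.2 (fun _ => lexx _) ng)).
  apply: (le_trans (HG _ y tr0)); rewrite -EFinM lee_fin; apply: ler_wpM2r; first exact: pgg.2.
  by rewrite ler_expR ler_wpM2l// gerBl.
rewrite -mulrA EFinM lee_pdivlMl//.
have ti : t%:E * T t (EFin \o g) x <= (expR (G * t))%:E * green t (EFin \o g) x.
  have -> : t%:E * T t (EFin \o g) x = \int[lebesgue_measure]_(r in `[0%R, t]) T t (EFin \o g) x.
    by rewrite integral_cst//= lebesgue_measure_itv/= lte_fin t0 sube0 muleC.
  rewrite -(greenZ hX pW p0 t x ng (expR_ge0 _)); apply: ge0_le_integral => //.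
  - by move=> r _; apply: fk_ge0; exact: ng.2.
  - by apply: measurable_funTS; apply: measurable_fk_time => //; apply: nnmeasM ng; exact: nnmeas_cst.
  by move=> r; rewrite /= in_itv/= => rt; rewrite (fkZ hX pW p0 r x ng eG0); exact: le.
apply: (le_trans ti); rewrite -mulrA EFinM; exact: lee_wpmul2l.
Qed.

(** Jensen's inequality bounds [T_s 1] by a time average of the free semigroup applied to
    [exp (- s W) <= A g], and excessivity of [g] turns this into a multiple of [g]. The remaining
    time [t] takes [g] to [phi]. *)
Lemma killing_le_excessive (s A : R) : (0 < s)%R -> (0 <= A)%R ->
  (forall y, expR (- (s * W y)) <= A * g y)%R ->
  exists2 C : R, (0 <= C)%R & forall x, T (t + s)%R (cst 1) x <= (C * phi x)%:E.
Proof.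
move=> s0 A0 HA; have s0' := ltW s0; have t0' := ltW t0.
have [G G0 HG] := levy_profile_excessive pg.
have [C C0 HC] := semigroup_profile_le.
have pe : potential (fun y => expR (- (s * W y))).
  split; last by move=> y; exact: expR_ge0.
  apply: measurableT_comp; first exact: measurable_expR.
  by apply: measurableT_comp => //; apply: measurable_funM; [exact: measurable_cst|exact: pW.1].
pose D := (A * expR (G * s))%R; have D0 : (0 <= D)%R by rewrite mulr_ge0 ?expR_ge0.
have n1 := nnmeas1 R d.
have Ts y : T s (cst 1) y <= D%:E * (g y)%:E.
  apply: (@le_trans _ _ (s^-1%:E * green_pot P X zero zero s (EFin \o (fun y => expR (- (s * W y)))) y)).
    rewrite -(integral_weight_afun hX s y p0 p0 pe) -ge0_integralZl//; last 3 first.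
    - apply: (measurable_integral_interval 0%R (b := cst s)
        (f := fun z : O * measurableTypeR R => weight zero zero z.2 y (post_path X 0 z.1) *
           (expR (- (s * W (y + proc X z.2 z.1)%R)))%:E)).
      + exact: measurable_cst.
      + apply: (measurableT_comp (measurable_fk_integrand hX p0 p0 (nnmeas_EFin pe).1)
          (g := fun z : O * measurableTypeR R => (z.2, y, z.1))).
        by meas.
      + by move=> z; rewrite mule_ge0 ?weight_ge0// lee_fin expR_ge0.
    - by move=> w _; apply: integral_ge0 => r _; rewrite mule_ge0 ?weight_ge0// lee_fin expR_ge0.
    - by rewrite lee_fin invr_ge0.
    apply: ge0_le_integral.
    - exact: measurableT.
    - by move=> w _; rewrite mule_ge0 ?weight_ge0//= lee01.
    - exact: (measurable_fk_integrandx hX pW p0 s y n1.1).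
    - apply: emeasurable_funM; first exact: measurable_cst.
      apply: (measurable_integral_interval 0%R (b := cst s)
        (f := fun z : O * measurableTypeR R => weight zero zero z.2 y (post_path X 0 z.1) *
           (expR (- (s * W (y + proc X z.2 z.1)%R)))%:E)).
      + exact: measurable_cst.
      + apply: (measurableT_comp (measurable_fk_integrand hX p0 p0 (nnmeas_EFin pe).1)
          (g := fun z : O * measurableTypeR R => (z.2, y, z.1))).
        by meas.
      + by move=> z; rewrite mule_ge0 ?weight_ge0// lee_fin expR_ge0.
    move=> w _; rewrite mule1; apply: (le_trans (weight_le_mean y (post_path X 0 w) pW s0)).
    apply: lee_wpmul2l; first by rewrite lee_fin invr_ge0.
    rewrite le_eqVlt; apply/orP; left; apply/eqP; apply: eq_integral => r _.
    by rewrite weight0 mul1e.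
  have Dg0 : 0 <= D%:E * (g y)%:E by rewrite -EFinM lee_fin mulr_ge0// pgg.2.
  rewrite lee_pdivrMl//; apply: (green_le_cst hX p0 p0 (nnmeas_EFin pe) s0' Dg0).
  move=> r /andP[r0 rs]; have A0e : 0 <= A%:E by rewrite lee_fin.
  have na : nnmeas (fun y => A%:E * (g y)%:E) by apply: nnmeasM ng; exact: nnmeas_cst.
  apply: (@le_trans _ _ (fk P X zero zero r (fun y => A%:E * (g y)%:E) y)).
    by apply: (le_fk hX p0 p0 r y (nnmeas_EFin pe) na) => z; rewrite -EFinM lee_fin; exact: HA.
  rewrite (fkZ hX p0 p0 r y ng A0e) /D EFinM -muleA; apply: lee_wpmul2l => //.
  apply: (le_trans (HG r y r0)); rewrite -EFinM lee_fin; apply: ler_wpM2r; first exact: pgg.2.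
  by rewrite ler_expR ler_wpM2l.
exists (D * C)%R; first exact: mulr_ge0.
move=> x; rewrite (fk_semigroup hX x pW p0 t0' s0' n1).
have D0e : 0 <= D%:E by rewrite lee_fin.
have nD : nnmeas (fun y => D%:E * (g y)%:E) by apply: nnmeasM ng; exact: nnmeas_cst.
apply: (le_trans (le_fk hX pW p0 t x (nnmeas_fk hX pW p0 s n1) nD Ts)).
rewrite (fkZ hX pW p0 t x ng D0e) -(mulrA D C) (EFinM D).
by apply: (lee_wpmul2l D0e); exact: HC.
Qed.

End ground_state_domination.

(** * Decay of the ground state *)

Lemma measurable_continuous_rV (R : realType) d (f : 'rV[R]_d -> R) :
  continuous f -> measurable_fun setT f.
Proof.
move=> cf; apply: (measurability _ (RGenOInfty.measurableE R)).
move=> _ [_ [r ->] <-]; rewrite setTI; apply: sub_sigma_algebra => /=.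
by apply: (continuousP _).1 cf _ _; exact: interval_open.
Qed.

Section creation_bounds.
Local Open Scope ereal_scope.
Variables (R : realType) (d : nat) (dO : measure_display) (O : measurableType dO).
Variables (P : probability O R) (X : R -> O -> 'rV[R]_d).
Hypothesis hX : levy_process P X.
Local Notation zero := (cst 0%R : 'rV[R]_d -> R).

Lemma green_le_exp_moment U t x : potential U ->
  green_pot P X zero zero t (EFin \o U) x <= fk P X zero U t (cst 1) x.
Proof.
move=> pU; rewrite -(integral_afun hX t x pU) exp_momentE; apply: ge0_le_integral.
- exact: measurableT.
- by move=> w _; exact: afun_ge0.
- exact: (measurable_afun_w hX t x pU).
- by apply: measurableT_comp; [exact: measurable_expeR|exact: (measurable_afun_w hX t x pU)].
by move=> w _; apply: le_trans (expeR_ge1Dx _); rewrite leeDr.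
Qed.

(* A compactly supported creation potential costs at most a multiple of any function that
   is excessive for the killed semigroup and bounded below near the support. *)
Lemma creation_excessive_le V U (rho C : R) h beta :
  potential V -> kato_pot P X U -> (forall y, (rho <= enorm y)%R -> U y = 0%R) ->
  (forall s, (0 <= s)%R -> P [set w | (1 <= enorm (X s w))%R] <= (C * s)%:E) ->
  potential h -> (0 <= beta)%R ->
  (forall s x, (0 <= s)%R -> fk P X V zero s (EFin \o h) x <= (expR (beta * s))%:E * (h x)%:E) ->
  (exists2 c : R, (0 < c)%R & forall y, (enorm y <= rho + 1)%R -> (c <= h y)%R) ->
  exists K Gam : R, [/\ (0 <= K)%R, (0 <= Gam)%R & forall t x, (0 <= t)%R ->
    fk P X V U t (cst 1) x <= fk P X V zero t (cst 1) x + (K * (expR (Gam * t) * h x))%:E].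
Proof.
move=> pV kU supU tail ph beta0 exc [c c0 hc]; have pU := kU.1.
have p0 := potential0 R d; have n1 := nnmeas1 R d; have nU := nnmeas_EFin pU.
have [k [k0 Hk]] := khasminskii hX kU.
have ic : (0 <= c^-1)%R by rewrite invr_ge0 ltW.
(* One factor [2 exp (k t)] bounds the full semigroup in [creation_le], a second one the potential
   of [U] in [hitting_bound]; the latter also brings [c^-1] and the rate [beta]. *)
exists (4 * c^-1)%R, (2 * k + beta)%R; split.
- by rewrite mulr_ge0.
- by rewrite addr_ge0// mulr_ge0.
move=> t x t0.
have B0 : (0 <= 2 * expR (k * t))%R by rewrite mulr_ge0 ?expR_ge0.
have HB s y : (0 <= s <= t)%R -> fk P X V U s (cst 1) y <= (2 * expR (k * t))%:E.
  move=> /andP[s0 st].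
  apply: (le_trans (fk_mono_pot hX s y pV pU p0 pU pV.2 (fun _ => lexx _) n1)).
  apply: (le_trans (Hk s y s0)); rewrite lee_fin ler_pM2l// ler_expR.
  exact: ler_wpM2l.
apply: (le_trans (creation_le hX x pV kU t0 n1 B0 HB)); apply: leeD2l.
have greenB y : green_pot P X V zero t (EFin \o U) y <= (2 * expR (k * t))%:E.
  apply: (le_trans (green_mono_pot hX t y pV p0 p0 p0 pV.2 (fun _ => lexx _) nU)).
  exact: (le_trans (green_le_exp_moment t y pU) (Hk t y t0)).
have hB y : (enorm y < rho + 1)%R -> c%:E <= (h y)%:E.
  by move=> y1; rewrite lee_fin hc// ltW.
have exc' s y : (0 <= s <= t)%R -> fk P X V zero s (EFin \o h) y <= (expR (beta * s))%:E * (h y)%:E.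
  by move=> /andP[s0 _]; exact: exc.
have H := hitting_bound hX pV p0 pU supU tail (nnmeas_EFin ph) t0 beta0 c0 exc' hB B0 greenB x.
have B0e : 0 <= (2 * expR (k * t))%:E by rewrite lee_fin.
apply: (le_trans (lee_wpmul2l B0e H)); rewrite -!EFinM lee_fin le_eqVlt; apply/orP; left; apply/eqP.
rewrite (_ : ((2 * k + beta) * t = k * t + k * t + beta * t)%R); last by ring.
by rewrite !expRD; ring.
Qed.

End creation_bounds.

(** * Paths that stay in a small ball *)

Section small_ball.
Local Open Scope ereal_scope.
Variables (R : realType) (d : nat) (dO : measure_display) (O : measurableType dO).
Variables (P : probability O R) (X : R -> O -> 'rV[R]_d).
Hypothesis hX : levy_process P X.
Local Notation E := 'rV[R]_d.

(** Restricted to rational times so that the event is measurable; right continuity recovers the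
    other times. *)
Let stay (eps : R) (n : nat) : set O :=
  \bigcap_(q in [set: rat]) (if (0 <= ratr q :> R)%R && (ratr q <= n.+1%:R^-1 :> R)%R
    then [set w | (enorm (proc X (ratr q) w) <= eps)%R] else setT).

Let measurable_stay eps n : measurable (stay eps n).
Proof.
rewrite -[X in measurable X]setCK /stay setC_bigcap; apply: measurableC.
apply: countable_bigcupT_measurable => // q; apply: measurableC.
case: ifP => // _; rewrite (_ : [set w | _] = ~` [set w | (eps < enorm (proc X (ratr q) w))%R]).
  apply: measurableC; rewrite -[X in measurable X]setTI.
  have mp : measurable_fun setT (fun w => enorm (proc X (ratr q) w)).
    apply: measurable_enorm; apply: measurable_path_at_comp; last exact: measurable_cst.
    exact: (measurable_post_path hX (lexx 0%R)).
  have := mp measurableT `]eps, +oo[%classic (measurable_itv _).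
  by congr (measurable (_ `&` _)); apply/seteqP; split => w /=; rewrite in_itv/= andbT.
by apply/seteqP; split => w /=; rewrite leNgt => /negP.
Qed.

Let stayP eps n w : stay eps n w <-> forall q : rat,
  (0 <= ratr q :> R)%R -> (ratr q <= n.+1%:R^-1 :> R)%R -> (enorm (proc X (ratr q) w) <= eps)%R.
Proof.
split => [h q q0 q1|h q _]; first by have := h q I; rewrite q0 q1.
by case: ifP => // /andP[q0 q1]; exact: h.
Qed.

(** By right continuity at 0 the increasing events [stay (eps / 2) n] exhaust a set of full measure,
    so one of them has probability at least 1 / 2. *)
Lemma small_ball eps : (0 < eps)%R -> exists (t1 : R) (F : set O),
  [/\ (0 < t1)%R, measurable F, (2^-1)%:E <= P F & forall w, good X w -> F w ->
      forall s, (0 <= s <= t1)%R -> (enorm (proc X s w) < eps)%R].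
Proof.
move=> eps0; have e2 : (0 < eps / 2)%R by rewrite divr_gt0.
have e4 : (0 < eps / 4)%R by rewrite divr_gt0.
pose F := stay (eps / 2).
have ndF : nondecreasing_seq F.
  move=> m n mn; apply/subsetPset => w /stayP h; apply/stayP => q q0 q1; apply: h => //.
  by apply: (le_trans q1); rewrite lef_pV2 ?posrE ?ltr0n// ler_nat.
have mU : measurable (\bigcup_n F n) by apply: bigcup_measurable => n _; exact: measurable_stay.
have goodF w : good X w -> (\bigcup_n F n) w.
  move=> gw; have [X0 rc] := gw; have := rc 0%R (lexx _); rewrite X0 => c0.
  have [e /= e0 He] := cvg_enorm _ c0 e2.
  have [n _ Hn] := near_infty_natSinv_lt (PosNum e0).
  exists n => //; apply/stayP => q q0 q1; rewrite (procE gw q0).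
  have [->|qn0] := eqVneq (ratr q : R) 0%R; first by rewrite X0 enorm0 ltW.
  have qp : (0 < ratr q :> R)%R by rewrite lt_neqAle eq_sym qn0.
  apply: ltW; rewrite -[X in enorm X]subr0; apply: He => //=.
  by rewrite sub0r normrN gtr0_norm//; apply: (le_lt_trans q1); exact: Hn (leqnn n).
have PU : P (\bigcup_n F n) = 1.
  have [N [mN N0 HN]] := ae_good hX.
  have C0 : P (~` \bigcup_n F n) = 0.
    apply/eqP; rewrite eq_le measure_ge0 andbT -N0; apply: le_measure; rewrite ?inE//.
      exact: measurableC.
    by move=> w nF; apply: HN => gw; apply: nF; exact: goodF.
  by have := probability_setC P (measurableC mU); rewrite setCK C0 sube0.
have cv : (P \o F) n @[n --> \oo] --> P (\bigcup_n F n).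
  exact: nondecreasing_cvg_mu (measurable_stay (eps / 2)) mU ndF.
have [n Pn] : exists n, (2^-1)%:E <= P (F n).
  apply: contrapT => /forallNP H.
  have : limn (P \o F) <= (2^-1)%:E.
    apply: lime_le; first by apply/cvg_ex; eexists; exact: cv.
    by apply: nearW => n; apply: ltW; rewrite ltNge; apply/negP; exact: H.
  rewrite (cvg_lim _ cv)// [X in X <= _]PU lee_fin => h.
  by move: h; apply/negP; rewrite -ltNge invf_lt1// ltr1n.
(* [n + 2] in place of [n + 1] leaves room to the right of [s] for a rational time still inside the
   window. *)
exists (n.+2%:R^-1)%R, (F n); split => //; first exact: measurable_stay.
move=> w gw /stayP Fw s /andP[s0 s1]; rewrite (procE gw s0).
have [_ rc] := gw; have [e /= e0 He] := cvg_enorm _ (rc s s0) e4.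
have s1' : (s < n.+1%:R^-1)%R.
  by apply: (le_lt_trans s1); rewrite ltf_pV2 ?posrE ?ltr0n// ltr_nat.
have sm : (s < Num.min (s + e) n.+1%:R^-1)%R by rewrite lt_min ltrDl e0.
have [q] := rat_in_itvoo sm; rewrite in_itv/= lt_min => /andP[sq /andP[qe qn]].
have q0 : (0 <= ratr q :> R)%R := le_trans s0 (ltW sq).
have h1 := Fw q q0 (ltW qn); rewrite (procE gw q0) in h1.
have h2 : (enorm (X (ratr q) w - X s w) < eps / 4)%R.
  apply: He => //=; rewrite distrC gtr0_norm ?subr_gt0//; lra.
have := ler_enormB (X s w) (X (ratr q) w); rewrite enorm_sub; lra.
Qed.

(** On the event of [small_ball] the path stays in the ball around [x], where the killing integral
    is at most [t K]; creation can only increase the weight. *)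
Lemma killing_lower_bound (V1 V2 : E -> R) eps : potential V1 -> potential V2 -> (0 < eps)%R ->
  exists2 t1 : R, (0 < t1)%R & forall t x K, (0 < t)%R -> (t <= t1)%R -> (0 <= K)%R ->
    (forall y, eball x eps y -> (V1 y <= K)%R) ->
    (expR (- (t * K)) / 2)%:E <= fk P X V1 V2 t (cst 1) x.
Proof.
move=> p1 p2 eps0; have [t1 [F [t10 mF PF HF]]] := small_ball eps0.
exists t1 => // t x K t0 tt1 K0 HK.
have c0 : 0 <= (expR (- (t * K)))%:E by rewrite lee_fin expR_ge0.
apply: (@le_trans _ _ ((expR (- (t * K)))%:E * P F)).
  by rewrite EFinM; apply: lee_wpmul2l.
have mi : measurable_fun setT (fun w => (\1_F w : R)%:E) by apply/measurable_EFinP; exact: measurable_indic.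
have i0 w : [set: O] w -> 0 <= (\1_F w : R)%:E by rewrite lee_fin.
rewrite -[X in P X]setIT -integral_indic// -(ge0_integralZl P measurableT mi i0 c0).
apply: ae_ge0_le_integral => //.
- by apply: emeasurable_funM => //; exact: measurable_cst.
- by move=> w _; rewrite mule_ge0 ?weight_ge0//= lee01.
- exact: (measurable_fk_integrandx hX p1 p2 t x (nnmeas1 R d).1).
apply: filterS (ae_good hX) => w gw _; rewrite mule1 indicE.
case: (boolP (w \in F)) => [|_]; last by rewrite mule0; exact: weight_ge0.
rewrite inE mule1 => Fw; rewrite /weight -[(expR _)%:E]/(expeR (- (t * K))%:E) lee_expeR.
have A1 : additive_functional V1 t x (post_path X 0 w) <= (K * t)%:E.
  rewrite -(integral_itv_cst K (ltW t0)); apply: ge0_le_integral => //.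
  - by move=> s _; rewrite lee_fin; exact: p1.2.
  - by apply: measurable_funTS; exact: measurable_shifted_path.
  move=> s; rewrite /= in_itv/= => /andP[s0 st]; rewrite lee_fin; apply: HK.
  rewrite /eball/= addrC addKr; apply: (HF w gw Fw); rewrite s0/=.
  exact: le_trans tt1.
apply: (@le_trans _ _ (- additive_functional V1 t x (post_path X 0 w))).
  by rewrite EFinN leeN2 mulrC.
by rewrite leeDl//; exact: afun_ge0.
Qed.

End small_ball.

(** * The two implications *)

Section regular_process.
Local Open Scope ereal_scope.
Variables (R : realType) (d : nat) (hd : (0 < d)%N) (dO : measure_display)
  (O : measurableType dO) (P : probability O R) (X : R -> O -> 'rV[R]_d) (nu : 'rV[R]_d -> R)
  (hX : regular_jump_levy P X nu) (V : 'rV[R]_d -> R) (hV : confining_potential P X V)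
  (phi : nat -> 'rV[R]_d -> R) (lam : nat -> R) (hphi : feynman_kac_eigenbasis P X V phi lam).
Local Notation E := 'rV[R]_d.
Local Notation zero := (cst 0%R : E -> R).
Local Notation phi0 := (phi 0%N).
Local Notation Vp := (V^\+)%R.
Local Notation Vm := (V^\-)%R.

Let lX : levy_process P X. Proof. by case: hX. Qed.
Let a1 : regular_A1 P X nu. Proof. by case: hX. Qed.
Let sX : symmetric_process P X. Proof. exact: (A1_symmetric a1). Qed.
Let mV : measurable_fun setT V. Proof. by case: hV => -[]. Qed.
Let pp : potential Vp := potential_funrpos mV.
Let pn : potential Vm := potential_funrneg mV.
Let kV : kato_pot P X Vm.
Proof. by apply: (kato_potP lX); [exact: pn.2|case: hV => -[]]. Qed.
Let finV t x : (0 <= t)%R ->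
  {ae P, forall w, additive_functional Vp t x (post_path X 0 w) < +oo}.
Proof. by apply: ae_afun_fin_local => //; case: hV => -[]. Qed.
Let p0 := potential0 R d.

Let tail : exists2 C : R, (0 <= C)%R &
  forall t, (0 <= t)%R -> P [set w | (1 <= enorm (X t w))%R] <= (C * t)%:E.
Proof. exact: (levy_tail lX a1 ltr01). Qed.

Let cphi : continuous phi0. Proof. exact: (eigen_continuous hphi). Qed.
Let mphi : measurable_fun setT phi0. Proof. exact: measurable_continuous_rV. Qed.
Let phi_gt0 x : (0 < phi0 x)%R. Proof. exact: (ground_state_gt0 hphi). Qed.
Let phi_lower (rho : R) : exists2 c : R, (0 < c)%R &
  forall y, (enorm y <= rho)%R -> (c <= phi0 y)%R.
Proof. exact: ball_lower_bound. Qed.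
Let phi_bounded : exists2 M : R, (0 < M)%R & forall x, (phi0 x <= M)%R.
Proof.
have [M [_ HM]] := eigen_bounded hphi 0%N.
have h x : (phi0 x <= M + 1)%R.
  by apply: le_trans (HM (M + 1)%R _ x I); [exact: ler_norm|rewrite ltrDl].
by exists (M + 1)%R => //; exact: lt_le_trans (phi_gt0 0%R) (h 0%R).
Qed.

Let feynman_kac_fk t x : (0 <= t)%R ->
  feynman_kac P X V t (cst 1%R) x = fk P X Vp Vm t (cst 1) x.
Proof.
move=> t0; rewrite (feynman_kacE lX mV t0)//; exact: (ae_afun_fin lX x kV t0).
Qed.

Let tails (r : R) : (0 < r)%R -> exists2 C : R, (0 <= C)%R &
  forall t, (0 <= t)%R -> P [set w | (r <= enorm (X t w))%R] <= (C * t)%:E.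
Proof. by move=> r0; exact: (levy_tail lX a1 r0). Qed.

(** Leaving out creation only decreases the semigroup, and the absolute value provides the
    nonnegative rate required by [hitting_bound]. *)
Let killed_excessive t x : (0 <= t)%R ->
  fk P X Vp zero t (EFin \o phi0) x <= (expR (`|lam 0%N| * t))%:E * (phi0 x)%:E.
Proof.
move=> t0; have [_ _ [_ [p tp _]] _] := hX; have [M M0 HM] := phi_bounded.
have nphi : nnmeas (EFin \o phi0) by apply: nnmeas_EFin; split => // y; exact: ltW.
apply: (le_trans (fk_mono_pot lX t x pp p0 pp pn (fun _ => lexx _) pn.2 nphi)).
apply: (le_trans (eigen_excessive lX tp tails mV kV cphi (fun y => ltW (phi_gt0 y)) HM mphi (eigen_eq hphi 0%N) x t0)).
rewrite -EFinM lee_fin ler_pM2r// ler_expR -mulNr ler_wpM2r//.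
by rewrite -normrN ler_norm.
Qed.

Let V_large (K : R) : exists r : R, forall y, (r < enorm y)%R -> (K <= V y)%R.
Proof.
have [_ /cvgryPge] := hV => /(_ K) [r _ H]; exists r => y; exact: H.
Qed.

Lemma gsd_of_growth :
  (V x / `|ln (nu x)| @[x --> at_infinity R d] --> +oo)%R -> GSD P X V phi0.
Proof.
move=> growth t t0; have [g pg] := levy_profile_exists hd lX a1.
(* Half of [t] is spent on Jensen's inequality and half on the semigroup applied to [g]. The
   threshold [(t / 2)^-1] for the quotient then gives [exp (- (t / 2) V) <= nu] far away. *)
have s0 : (0 < t / 2)%R by rewrite divr_gt0.
have [r Hr] : exists r : R, forall y, (r < enorm y)%R -> ((t / 2)^-1 <= V y / `|ln (nu y)|)%R.
  by move/cvgryPge: growth => /(_ (t / 2)^-1%R) [r _ H]; exists r => y; exact: H.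
pose r1 := (Num.max r (1 / 2))%R.
have [L L0 HL] := levy_profile_harnack pg; have [C C0 HC] := levy_profile_ge pg.
have g0 := levy_profile_gt0 pg.
(* [C] serves far away, where [nu <= C g]; the second term serves on the ball of radius [r1], where
   the Harnack inequality bounds [g] below. *)
pose A := (C + expR (L * r1) / g 0)%R.
have A0 : (0 <= A)%R by rewrite addr_ge0 ?divr_ge0 ?expR_ge0// ltW.
have HA y : (expR (- (t / 2 * Vp y)) <= A * g y)%R.
  have [yr|yr] := leP (enorm y) r1.
    apply: (@le_trans _ _ 1%R).
      by rewrite expR_le1 oppr_le0 mulr_ge0 ?pp.2// ltW.
    apply: (@le_trans _ _ (expR (L * r1) / g 0 * g y)%R); last first.
      by rewrite ler_pM2r// lerDr ltW.
    rewrite mulrAC ler_pdivlMr// mul1r; have := HL y (- y)%R; rewrite subrr enormN => h.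
    by apply: (le_trans h); rewrite ler_pM2r// ler_expR ler_wpM2l.
  have [yr0 y2] : (r < enorm y)%R /\ (1 / 2 < enorm y)%R.
    by move: yr; rewrite /r1 gt_max => /andP.
  have y0 : y != 0%R.
    apply/eqP => y0; move: y2; rewrite y0 enorm0 => h.
    by have := lt_trans h (divr_gt0 (ltr01) (ltr0n R 2)) => /=; rewrite ltxx.
  have nu0 := A1_positive a1 y0.
  apply: (@le_trans _ _ (nu y)); last first.
    apply: (le_trans (HC y (ltW y2))); rewrite ler_pM2r// lerDl divr_ge0 ?expR_ge0//.
    exact: ltW.
  rewrite -[leRHS](lnK (_ : nu y \is Num.pos)%R) ?posrE// ler_expR.
  have h := Hr y yr0.
  (* As [0^-1 = 0], a vanishing logarithm would make the quotient 0, below the positive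
     threshold. *)
  have l0 : (0 < `|ln (nu y)|)%R.
    rewrite normr_gt0; apply/eqP => l0; move: h; rewrite l0 normr0 invr0 mulr0.
    by rewrite leNgt invr_gt0 s0.
  move: h; rewrite ler_pdivlMr// ler_pdivrMl// => h.
  have VVp : (V y <= Vp y)%R by rewrite /funrpos le_max lexx.
  have h1 : (`|ln (nu y)| <= t / 2 * Vp y)%R.
    by apply: (le_trans h); rewrite ler_pM2l.
  by rewrite lerNl; apply: le_trans h1; rewrite -normrN ler_norm.
have [Ct Ct0 HCt] := tail; have [Cm Cm0 HCm] := levy_second_moment lX a1.
have beta0 : (0 <= `|lam 0%N|)%R by [].
have [D D0 HD] := killing_le_excessive lX sX pg HCt HCm Ct0 Cm0 pp finV mphi phi_gt0 phi_lower
  beta0 killed_excessive s0 s0 A0 HA.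
have [rho Hrho] := V_large 0.
have supU y : (rho + 1 <= enorm y)%R -> Vm y = 0%R.
  move=> y1; have : (0 <= V y)%R by apply: Hrho; apply: lt_le_trans y1; rewrite ltrDl.
  by rewrite /funrneg => h; apply/max_idPr; rewrite oppr_le0.
have pphi : potential phi0 by split => // y; exact: ltW.
have [K [Gam [K0 Gam0 HK]]] := creation_excessive_le lX pp kV supU HCt pphi beta0
  killed_excessive (phi_lower (rho + 1 + 1)).
exists (D + K * expR (Gam * t) + 1)%R.
  by rewrite ltr_wpDl// addr_ge0// mulr_ge0 ?expR_ge0.
move=> x; have t0' := ltW t0; rewrite (feynman_kac_fk x t0'); apply: (le_trans (HK t x t0')).
have := HD x; rewrite -splitr => h; apply: (le_trans (leeD2r _ h)).
rewrite -EFinD lee_fin !mulrDl mul1r -(mulrA K) lerDl; exact: ltW.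
Qed.

Let ereal_exponent (a b u : \bar R) (c : R) : 0 <= a -> 0 <= b -> 0 <= u ->
  b + c%:E <= a + u -> - a + b <= - c%:E + u.
Proof.
case: a => [a| |] // a0; case: b => [b| |] // b0; case: u => [u| |] // u0;
  rewrite -?EFinN -?EFinD ?lee_fin ?leey ?leNye//= => h; lra.
Qed.

(* The ground state is compared with the free process killed at rate [lambda + 1] outside
   a ball; returning to that ball is controlled by the excessive profile [g]. *)
Let eigen_decay_ae g : levy_profile P X nu g -> exists K Gam : R, [/\ (0 <= K)%R, (0 <= Gam)%R &
  forall t, (0 < t)%R -> {ae lebesgue_rV R d, forall x,
    (phi0 x <= K * (expR (- t) + expR (Gam * t) * g x))%R}].
Proof.
move=> pg; have [_ _ [_ [p tp _]] _] := hX; have [M M0 HM] := phi_bounded.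
have nphi : nnmeas (EFin \o phi0) by apply: nnmeas_EFin; split => // y; exact: ltW.
have [Ct Ct0 HCt] := tail.
have g0 := levy_profile_gt0 pg; have [L L0 HL] := levy_profile_harnack pg.
have [G G0 HG] := levy_profile_excessive pg.
have pgg : potential g by split; [exact: (levy_profile_measurable pg)|move=> y; exact: ltW].
(* The excess of 1 over [|lam 0|] leaves the decay [exp (- t)] once the eigenvalue factor
   [exp (lam 0 * t)] has been absorbed. *)
pose c0 := (`|lam 0%N| + 1)%R; have c00 : (0 <= c0)%R by rewrite addr_ge0.
have [r Hr] := V_large c0.
pose B : set E := [set y | (enorm y <= r)%R].
have mB : measurable B.
  rewrite (_ : B = ~` [set y | (r < enorm y)%R]); last first.
    by apply/seteqP; split => y; rewrite /B/= leNgt => /negP.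
  apply: measurableC; rewrite -[X in measurable X]setTI.
  have := @measurable_enorm_id R d measurableT `]r, +oo[%classic (measurable_itv _).
  by congr (measurable (_ `&` _)); apply/seteqP; split => w /=; rewrite in_itv/= andbT.
(* Adding [c0] on the ball gives [Vm + c0 <= Vp + U] everywhere, so that killing at the constant
   rate [c0] can be taken out of the weight. *)
pose U y := (Vm y + c0 * \1_B y)%R.
have pcB : potential (fun y => c0 * \1_B y)%R.
  by apply: (potential_restrict (U := cst c0)) mB; split => // y; exact: c00.
have kcB : kato_pot P X (fun y => c0 * \1_B y)%R.
  apply: (kato_pot_le lX pcB _ (kato_pot_cst lX c00)) => y.
  by rewrite indicE; case: (_ \in _); rewrite ?mulr1// mulr0.
have kU : kato_pot P X U := kato_potD lX kV kcB.
have pU : potential U by case: kU.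
have supU y : (Num.max r 0 + 1 <= enorm y)%R -> U y = 0%R.
  move=> y1; have yr : (r < enorm y)%R.
    by apply: lt_le_trans y1; rewrite ltr_pwDr// le_max lexx.
  rewrite /U indicE memNset ?mulr0 ?addr0; last by rewrite /B/= leNgt yr.
  rewrite /funrneg; apply/max_idPr; rewrite oppr_le0; exact: (le_trans c00 (Hr y yr)).
have lowg : exists2 c : R, (0 < c)%R & forall y, (enorm y <= Num.max r 0 + 1 + 1)%R -> (c <= g y)%R.
  exists (g 0%R / expR (L * (Num.max r 0 + 1 + 1)))%R; first by rewrite divr_gt0// expR_gt0.
  move=> y yr; rewrite ler_pdivrMr ?expR_gt0//.
  have := HL y (- y)%R; rewrite subrr enormN => h; apply: (le_trans h).
  by rewrite mulrC ler_pM2l// ler_expR ler_wpM2l.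
have HG' s x : (0 <= s)%R -> fk P X zero zero s (EFin \o g) x <= (expR (G * s))%:E * (g x)%:E.
  by move=> s0; rewrite -EFinM; exact: HG.
have [K [Gam [K0 Gam0 HK]]] := creation_excessive_le lX p0 kU supU HCt pgg G0 HG' lowg.
exists (M * (1 + K))%R, Gam; split => //; first by rewrite mulr_ge0 ?addr_ge0// ltW.
move=> t t0; have t0' := ltW t0.
have ea := eigen_ae lX mV kV (fun y => ltW (phi_gt0 y)) (eigen_eq hphi 0%N) t0.
apply: filterS ea => x eig.
have pc : potential (cst c0 : E -> R) by split => //; exact: c00.
have n1 := nnmeas1 R d.
have le1 : fk P X Vp Vm t (EFin \o phi0) x <= (M * expR (- (c0 * t)))%:E * fk P X zero U t (cst 1) x.
  have k0 : 0 <= (M * expR (- (c0 * t)))%:E by rewrite lee_fin mulr_ge0 ?expR_ge0// ltW.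
  have mI := measurable_fk_integrandx lX p0 pU t x n1.1.
  have I0 w : [set: O] w -> 0 <= weight zero U t x (post_path X 0 w) * cst 1 (x + proc X t w)%R.
    by move=> _; rewrite mule_ge0 ?weight_ge0//= lee01.
  rewrite /fk -(ge0_integralZl P measurableT mI I0 k0); apply: ge0_le_integral.
  - exact: measurableT.
  - by move=> w _; rewrite mule_ge0 ?weight_ge0//; exact: nphi.2.
  - exact: (measurable_fk_integrandx lX pp pn t x nphi.1).
  - by apply: emeasurable_funM => //; exact: measurable_cst.
  move=> w _; rewrite mule1.
  apply: (@le_trans _ _ (weight Vp Vm t x (post_path X 0 w) * M%:E)).
    by apply: lee_wpmul2l; [exact: weight_ge0|rewrite lee_fin].
  rewrite muleC EFinM -muleA; apply: lee_wpmul2l; first by rewrite lee_fin ltW.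
  rewrite /weight -[(expR _)%:E]/(expeR (- (c0 * t))%:E) -expeRD lee_expeR.
  have -> : - additive_functional zero t x (post_path X 0 w) + additive_functional U t x (post_path X 0 w) =
      additive_functional U t x (post_path X 0 w).
    by rewrite [X in - X + _]/additive_functional /= integral0 oppe0 add0e.
  apply: ereal_exponent; rewrite ?afun_ge0//.
  rewrite -(afun_cstM c0 x (post_path X 0 w) t0') -!afunD//.
  apply: afun_mono; [exact: potentialD|exact: potentialD|move=> y].
  have Vy : (Vp y - Vm y = V y)%R by rewrite -[in RHS](funrposBneg V).
  rewrite /U /=; have [yr|yr] := leP (enorm y) r.
    have -> : \1_B y = 1%R :> R by rewrite indicE mem_set.
    by rewrite mulr1 [leRHS]addrC lerDl; exact: pp.2.
  rewrite indicE memNset ?mulr0 ?addr0; last by rewrite /B/= leNgt yr.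
  by rewrite addrC lerD2r; apply: (le_trans (Hr y yr)); rewrite -Vy gerBl; exact: pn.2.
have le2 := HK t x t0'; rewrite (fk_free x lX t0' n1) integral_cst// in le2.
rewrite [X in 1 * X]probability_setT mule1 -EFinD in le2.
have := le_trans le1 (lee_wpmul2l _ le2); rewrite eig -EFinM lee_fin => h.
have {}h : (expR (- (lam 0%N * t)) * phi0 x <= M * expR (- (c0 * t)) * (1 + K * (expR (Gam * t) * g x)))%R.
  by rewrite -lee_fin; apply: h; rewrite mulr_ge0 ?expR_ge0// ltW.
have e0 : (0 < expR (lam 0%N * t))%R := expR_gt0 _.
have h2 : (phi0 x <= M * expR (- t) * (1 + K * (expR (Gam * t) * g x)))%R.
  have phiE : phi0 x = (expR (lam 0%N * t) * (expR (- (lam 0%N * t)) * phi0 x))%R.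
    by rewrite mulrA -expRD subrr expR0 mul1r.
  rewrite phiE; apply: (le_trans (ler_wpM2l (ltW e0) h)).
  have q0 : (0 <= 1 + K * (expR (Gam * t) * g x))%R.
    by rewrite addr_ge0// mulr_ge0// mulr_ge0 ?expR_ge0// ltW.
  rewrite (mulrA (expR (lam 0%N * t))); apply: (ler_wpM2r q0).
  rewrite mulrCA -expRD.
  rewrite ler_pM2l// ler_expR /c0 mulrDl mul1r opprD addrA gerDr subr_le0 ler_pM2r//.
  exact: ler_norm.
apply: (le_trans h2); rewrite -!mulrA ler_pM2l//.
have e1 : (expR (- t) <= 1)%R by rewrite expR_le1 oppr_le0.
have q0 : (0 <= expR (Gam * t) * g x)%R by rewrite mulr_ge0 ?expR_ge0// ltW.
have e3 := expR_gt0 (- t)%R.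
move: (expR (- t)) (expR (Gam * t) * g x)%R e1 q0 e3 => e q e1 q0 e3.
have h4 : (e * (K * q) <= K * q)%R by rewrite ler_piMl// mulr_ge0.
have h5 : (0 <= K * e)%R by rewrite mulr_ge0// ltW.
rewrite mulrDr mulr1 mulrDl mul1r mulrDr; lra.
Qed.

Let eigen_decay : exists th C r : R, [/\ (0 < th)%R, (0 < C)%R & forall x, (r <= enorm x)%R ->
  (phi0 x <= C * expR (th * ln (nu x)))%R].
Proof.
have [g pg] := levy_profile_exists hd lX a1.
have [K [Gam [K0 Gam0 HK]]] := eigen_decay_ae pg.
have g0 := levy_profile_gt0 pg; have [L L0 HL] := levy_profile_harnack pg.
(* Points outside the null set are dense: the bound at a nearby [y] passes to [x] by continuity of
   the ground state, at the price of a factor [e ^ L] on [g]. *)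
have all t x : (0 < t)%R -> (phi0 x <= K * (expR (- t) + expR (Gam * t) * (expR L * g x)))%R.
  move=> t0; apply/ler_addgt0Pr => e e0.
  have cx : {for x, continuous phi0} by exact: cphi.
  have [r r0 cr] := continuous_enorm_near cx e0.
  have d1 : (0 < d%:R :> R)%R by rewrite ltr0n.
  pose q := (Num.min r 1 / 2 / d%:R)%R.
  have m0 : (0 < Num.min r 1)%R by rewrite lt_min r0 ltr01.
  have q0 : (0 < q)%R by rewrite !divr_gt0.
  have [y yx Hy] := ae_dense x (HK t t0) q0.
  have := cube_enorm (ltW q0) yx; rewrite /q mulrC divfK ?gt_eqF// => xy.
  have xy1 : (enorm (y - x) < Num.min r 1)%R by apply: (le_lt_trans xy); move: m0; lra.
  move: xy1; rewrite lt_min => /andP[yr y1].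
  have := cr y yr; rewrite ltr_distl => /andP[h1 _].
  have h2 : (g y <= expR L * g x)%R.
    rewrite -[X in g X](subrKC x y); apply: (le_trans (HL x (y - x)%R)).
    by rewrite ler_pM2r// ler_expR ler_piMr// ltW.
  have h3 : (K * (expR (- t) + expR (Gam * t) * g y) <= K * (expR (- t) + expR (Gam * t) * (expR L * g x)))%R.
    by rewrite ler_wpM2l// lerD2l ler_wpM2l// expR_ge0.
  move: (le_trans Hy h3) h1; lra.
have half : (0 < 1 / 2 :> R)%R by rewrite divr_gt0.
have [r Hr] := density_vanishes hd a1 half.
(* With [t = - th * ln (nu x)] both [exp (- t)] and [exp (Gam t) * nu x] equal [nu x ^ th]. *)
pose th := (Gam + 1)^-1%R; have G1 : (0 < Gam + 1)%R by rewrite ltr_wpDl.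
have th0 : (0 < th)%R by rewrite invr_gt0.
exists th, (K * (1 + expR L) + 1)%R, (Num.max r (1 / 2))%R; split => //.
  by rewrite ltr_wpDl// mulr_ge0// addr_ge0// expR_ge0.
move=> x; rewrite ge_max => /andP[xr x2].
have nu1 : (nu x <= 1 / 2)%R := Hr x xr.
have x0 : x != 0%R by apply/eqP => x0; move: x2; rewrite x0 enorm0; lra.
have nu0 := A1_positive a1 x0.
have gn : (g x <= expR (ln (nu x)))%R by rewrite lnK ?posrE//; exact: (levy_profile_le pg).
have l0 : (ln (nu x) < 0)%R by rewrite ln_lt0// nu0/=; apply: (le_lt_trans nu1); lra.
have t0 : (0 < - ln (nu x) * th)%R by rewrite mulr_gt0// oppr_gt0.
apply: (le_trans (all _ x t0)).
rewrite mulNr opprK (mulrC th).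
have h : (expR (Gam * (- (ln (nu x) * th))) * (expR L * g x) <= expR L * expR (ln (nu x) * th))%R.
  rewrite mulrCA; apply: ler_wpM2l; first exact: expR_ge0.
  apply: (@le_trans _ _ (expR (Gam * (- (ln (nu x) * th))) * expR (ln (nu x)))%R).
    by rewrite ler_wpM2l ?expR_ge0.
  rewrite -expRD ler_expR le_eqVlt; apply/orP; left; apply/eqP.
  by rewrite /th; field; rewrite gt_eqF.
have e0 := expR_gt0 (ln (nu x) * th).
have := ler_wpM2l K0 (lerD (lexx (expR (ln (nu x) * th))) h); move/le_trans; apply.
rewrite mulrDl mul1r -mulrA mulrDl mul1r lerDl; exact: ltW.
Qed.

Lemma growth_of_gsd : GSD P X V phi0 -> forall eps : R, (0 < eps <= 1)%R ->
  ereal_sup [set (V y)%:E | y in eball x eps] * (`|ln (nu x)|^-1)%:E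
    @[x --> at_infinity R d] --> +oo.
Proof.
move=> gsd eps /andP[eps0 _]; apply/cvgeyPge => A.
have [th [C [r [th0 C0 HC]]]] := eigen_decay.
pose A1 := (Num.max A 1)%R; have A10 : (0 < A1)%R by rewrite lt_max ltr01 orbT.
have [t1 t10 Ht1] := killing_lower_bound lX pp pn eps0.
(* [t * A1 <= th / 2] makes the lower bound of order [nu ^ (th / 2)], which decays more slowly than
   the upper bound [nu ^ th]. *)
pose t := (Num.min t1 (th / (2 * A1)))%R.
have A20 : (0 < 2 * A1)%R by rewrite mulr_gt0.
have t0 : (0 < t)%R by rewrite lt_min t10 divr_gt0.
have tt1 : (t <= t1)%R by rewrite ge_min lexx.
have tA : (t * A1 <= th / 2)%R.
  have : (t <= th / (2 * A1))%R by rewrite ge_min lexx orbT.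
  by rewrite ler_pdivlMr//; move: (t) (A1) => u a; lra.
have [D D0 HD] := gsd t t0.
(* Below this level [nu ^ (th / 2) <= 1 / (4 D C)], against [nu ^ (th / 2) / 2 <= D C nu ^ th] from
   the domination; the bound 1 / 2 keeps the logarithm negative. *)
pose e := Num.min (1 / 2)%R (expR (2 / th * ln (4 * (D * C))^-1))%R.
have e0 : (0 < e)%R by rewrite lt_min expR_gt0 divr_gt0.
have [r2 Hr2] := density_vanishes hd a1 e0.
exists (Num.max (Num.max r r2) 1)%R => // x /=; rewrite !gt_max => /andP[/andP[xr xr2] x1].
have nue := Hr2 x (ltW xr2).
have x0 : x != 0%R by apply/eqP => x0; move: x1; rewrite x0 enorm0; lra.
have nu0 := A1_positive a1 x0.
have nu1 : (nu x <= 1 / 2)%R by apply: (le_trans nue); rewrite ge_min lexx.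
have l0 : (ln (nu x) < 0)%R by rewrite ln_lt0// nu0/=; apply: (le_lt_trans nu1); lra.
have la : (`|ln (nu x)| = - ln (nu x))%R by rewrite ltr0_norm.
have nl0 : (0 < - ln (nu x))%R by rewrite oppr_gt0.
apply: (@le_trans _ _ A1%:E); first by rewrite lee_fin le_max lexx.
rewrite la lee_pdivlMr//; rewrite leNgt; apply/negP => small.
have HK y : eball x eps y -> (Vp y <= A1 * - ln (nu x))%R.
  move=> yx; rewrite ge_max mulr_ge0 ?(ltW A10) ?(ltW nl0)// andbT -lee_fin.
  apply: le_trans (ltW small); apply: ereal_sup_ubound; by exists y.
have K0 : (0 <= A1 * - ln (nu x))%R by rewrite mulr_ge0 ?(ltW A10) ?(ltW nl0).
have low := Ht1 t x _ t0 tt1 K0 HK.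
have up := HD x; rewrite (feynman_kac_fk x (ltW t0)) in up.
have := le_trans low up; rewrite lee_fin => h.
have h2 := ler_wpM2l (ltW D0) (HC x (ltW xr)).
have {h h2} h := le_trans h h2.
pose E2 := expR (th / 2 * ln (nu x)).
have E20 : (0 < E2)%R := expR_gt0 _.
have hE : (expR (th * ln (nu x)) = E2 * E2)%R by rewrite /E2 -expRD; congr expR; field.
have h3 : (E2 <= expR (- (t * (A1 * - ln (nu x)))))%R.
  by rewrite ler_expR mulrA mulrN opprK ler_wnM2r// ltW.
have h4 : (E2 <= (4 * (D * C))^-1)%R.
  have p : (0 < (4 * (D * C))^-1)%R by rewrite invr_gt0 !mulr_gt0.
  rewrite -[leRHS](lnK (_ : _ \is Num.pos)%R) ?posrE// ler_expR.
  have : (ln (nu x) <= 2 / th * ln (4 * (D * C))^-1)%R.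
    rewrite -[leRHS]expRK ler_ln ?posrE ?expR_gt0//.
    by apply: (le_trans nue); rewrite ge_min lexx orbT.
  rewrite -ler_pdivrMl ?divr_gt0// invf_div.
  by [].
have h5 : (4 * (D * C) * E2 <= 1)%R.
  by rewrite mulrC -ler_pdivlMr ?mul1r// !mulr_gt0.
have h6 : (E2 / 2 <= D * C * E2 * E2)%R.
  apply: (@le_trans _ _ (expR (- (t * (A1 * - ln (nu x)))) / 2)%R); first by rewrite ler_pM2r.
  by apply: (le_trans h); rewrite hE !mulrA.
have h7 : (4 * (D * C * E2 * E2) <= E2)%R.
  by rewrite !mulrA in h5 *; rewrite -[leRHS]mul1r ler_pM2r.
move: h6 h7 E20; lra.
Qed.

End regular_process.

Theorem theorem2p7 (R : realType) (d : nat) (hd : (0 < d)%N)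
    (dOmega : measure_display) (Omega : measurableType dOmega)
    (P : probability Omega R) (X : R -> Omega -> 'rV[R]_d)
    (nu : 'rV[R]_d -> R) (hX : regular_jump_levy P X nu)
    (V : 'rV[R]_d -> R) (hV : confining_potential P X V)
    (phi : nat -> 'rV[R]_d -> R) (lam : nat -> R)
    (hphi : feynman_kac_eigenbasis P X V phi lam) :
  (V x / `|ln (nu x)| @[x --> at_infinity R d] --> +oo ->
   GSD P X V (phi 0%N))
  /\
  (GSD P X V (phi 0%N) ->
   forall eps : R, 0 < eps <= 1 ->
     (ereal_sup [set (V y)%:E | y in eball x eps] * (`|ln (nu x)|^-1)%:E)%E
       @[x --> at_infinity R d] --> +oo%E).
Proof.
by split; [exact: (gsd_of_growth hd hX hV hphi)|exact: (growth_of_gsd hd hX hV hphi)].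
Qed.
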